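(* Let $\alpha\in(0,2)$, $m>0$ and let $\boldsymbol{Y}$ be the relativistic stable process in $\mathbb{R}^d$, i.e. the Lévy process with characteristic exponent $\psi(\xi)=(m^{2/\alpha}+|\xi|^2)^{\alpha/2}-m$. Then the density $p_\lambda(t,x,y)$ of the corresponding process $\boldsymbol{X}$ with resetting exists for all $\lambda>0$, $t>0$ and, for any $x\in\mathbb{R}^d$: 1. If $\lambda>m$ then $$p_\lambda(t,x,y)\sim\frac{\lambda\,\alpha\,m^{\frac{d+\alpha-1}{2\alpha}}}{2^{\frac{d-\alpha+1}{2}}\pi^{\frac{d-1}{2}}\Gamma(1-\frac{\alpha}{2})(\lambda-m)^2}\,\frac{e^{-m^{1/\alpha}|y|}}{|y|^{\frac{d+\alpha+1}{2}}}.$$ 2. If $\lambda=m$ then $$p_\lambda(t,x,y)\sim\frac{m^{\frac{d+\alpha-1}{2\alpha}}e^{-m^{1/\alpha}|y|}}{2^{\frac{d+\alpha-1}{2}}\pi^{\frac{d-1}{2}}|y|^{\frac{d-\alpha+1}{2}}}\int_0^{\frac{\sqrt{2^\alpha m}}{|y|^{\alpha/2}}t}\eta(s,1)\,ds.$$ 3. If $\lambda<m$ and $\frac{t}{|y|^{\alpha/2}}<M$ for some constant $M>0$ then $$p_\lambda(t,x,y)\sim\left(\lambda+e^{m^{1/\alpha}\langle\frac{y}{|y|},x\rangle}\,\frac{\eta\left(\frac{t}{|y-x|^{\alpha/2}}\sqrt{2^\alpha m},1\right)(m-\lambda)}{\eta\left(\frac{t}{|y|^{\alpha/2}}\sqrt{2^\alpha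 m},1\right)}\right)\frac{m^{\frac{d-\alpha-1}{2\alpha}}e^{-m^{1/\alpha}|y|}}{2^{\frac{d+\alpha-1}{2}}\pi^{\frac{d-1}{2}}|y|^{\frac{d-\alpha+1}{2}}}\int_0^{\frac{\sqrt{2^\alpha m}}{|y|^{\alpha/2}}t}e^{(m-\lambda)\frac{|y|^{\alpha/2}}{\sqrt{2^\alpha m}}s}\,\eta(s,1)\,ds.$$
   Context: Let $d\ge1$. The process $\boldsymbol{Y}$ satisfies $\mathbb{E}^0e^{i\langle\xi,Y_t\rangle}=e^{-t\psi(\xi)}$, and under $\mathbb{P}^x$ it starts from $x$. For $t>0$, $\eta(t,\cdot):(0,\infty)\to(0,\infty)$ is the (continuous) density of the $\alpha/2$-stable subordinator: $\int_0^\infty e^{-su}\eta(t,u)\,du=e^{-ts^{\alpha/2}}$, $s>0$. The transition density of $\boldsymbol{Y}$ is $$p(t,y)=e^{mt}\int_0^\infty(4\pi u)^{-d/2}e^{-\frac{|y|^2}{4u}}e^{-m^{2/\alpha}u}\eta(t,u)\,du,\quad t>0,\ y\in\mathbb{R}^d.$$ Let $\boldsymbol{N}$ be a Poisson process with intensity $\lambda>0$, independent of $\boldsymbol{Y}$, with arrival times $T_1<T_2<\dots$. The process with (total) resetting is $X_t=Y_t$ for $t<T_1$ and $X_t=Y_t-Y_{T_n}$ for $T_n\le t<T_{n+1}$, $n\ge1$. Its density under $\mathbb{P}^x$ is taken in the version $$p_\lambda(t,x,y)=e^{-\lambda t}p(t,y-x)+\int_0^t\lambda e^{-\lambda s}p(s,y)\,ds.$$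 Notation: $A(t,y)\sim B(t,y)$ means $\lim_{|y|\to\infty,\ t\to\infty}A(t,y)/B(t,y)=1$ (joint limit, with $x,\lambda,m,\alpha$ fixed); under a restriction such as $t/|y|^{\alpha/2}<M$ the limit is taken along $(t,y)$ satisfying that restriction, for any fixed $M>0$. *)

(* Defs.v *)
From mathcomp Require Export all_boot all_order all_algebra.
From mathcomp Require Export complex.
From mathcomp Require Export all_classical all_reals all_analysis measurable_realfun.

Set Implicit Arguments.
Unset Strict Implicit.
Unset Printing Implicit Defensive.

Export Order.TTheory GRing.Theory Num.Theory.
Export numFieldNormedType.Exports.

Local Open Scope classical_set_scope.
Local Open Scope ring_scope.

(* The norm `|v| that the library puts on 'rV[R]_d is the sup norm, hence the
   separate Euclidean norm. *)
Definition dotp (R : realType) (d : nat) (u v : 'rV[R]_d) : R :=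
  \sum_(i < d) u ord0 i * v ord0 i.

Definition enorm (R : realType) (d : nat) (v : 'rV[R]_d) : R :=
  Num.sqrt (dotp v v).

Notation borel_rV R d := (g_sigma_algebraType (@open 'rV[R]_d)).

(* Integral over R^d with respect to Lebesgue measure, written as an iterated
   one-dimensional integral; by Tonelli's theorem it is the usual integral for
   Borel functions f >= 0, and it is only used for such f. *)
Fixpoint integral_rV (R : realType) (d : nat) : ('rV[R]_d -> \bar R) -> \bar R :=
  match d return ('rV[R]_d -> \bar R) -> \bar R with
  | 0%N => fun f => f 0
  | n.+1 => fun f => (\int[lebesgue_measure]_u
      integral_rV (fun v : 'rV[R]_n => f (row_mx (u%:M : 'M[R]_1) v)))%E
  end.

Definition Gamma (R : realType) (a : R) : R :=
  \int[lebesgue_measure]_(u in `]0, +oo[) (u `^ (a - 1) * expR (- u)).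

Definition stable_subordinator_density (R : realType) (alpha : R)
    (eta : R -> R -> R) : Prop :=
  forall t : R, 0 < t ->
  [/\ forall u, 0 < u -> 0 < eta t u,
      {in `]0, +oo[, continuous (eta t)} &
      forall s, 0 < s ->
        (\int[lebesgue_measure]_(u in `]0%R, +oo[)
           (expR (- (s * u)) * eta t u)%:E
         = (expR (- (t * s `^ (alpha / 2))))%:E)%E].

(* Density p(t, y) of the relativistic stable process. It is \bar R-valued
   because the integral defining p_lambda below may be infinite at y = 0. *)
Definition rel_density (R : realType) (d : nat) (alpha m : R)
    (eta : R -> R -> R) (t : R) (y : 'rV[R]_d) : \bar R :=
  ((expR (m * t))%:E *
   \int[lebesgue_measure]_(u in `]0%R, +oo[)
     ((4 * pi * u) `^ (- (d%:R / 2)) * expR (- (enorm y ^+ 2 / (4 * u)))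
      * expR (- (m `^ (2 / alpha) * u)) * eta t u)%:E)%E.

Definition reset_density (R : realType) (d : nat) (alpha m : R)
    (eta : R -> R -> R) (lambda t : R) (x y : 'rV[R]_d) : \bar R :=
  ((expR (- (lambda * t)))%:E * rel_density alpha m eta t (y - x)
   + \int[lebesgue_measure]_(s in `]0%R, t[)
       ((lambda * expR (- (lambda * s)))%:E * rel_density alpha m eta s y))%E.

Section processes.
Context {R : realType} {disp : measure_display} {Omega : measurableType disp}.
Variable P : probability Omega R.

Definition indep_seq (dV : measure_display) (V : measurableType dV) (n : nat)
    (f : nat -> Omega -> V) : Prop :=
  forall A : nat -> set V, (forall i, measurable (A i)) ->
    P (\bigcap_(i in `I_n) (f i @^-1` A i)) = (\prod_(i < n) P (f i @^-1` A i))%E.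

Definition process_sigma (dV : measure_display) (V : measurableType dV)
    (Z : R -> Omega -> V) : set (set Omega) :=
  <<s [set B | exists t A, [/\ 0 <= t, measurable A & B = Z t @^-1` A]] >>.

Definition indep_processes (dV dW : measure_display) (V : measurableType dV)
    (W : measurableType dW) (Z : R -> Omega -> V) (Z' : R -> Omega -> W) : Prop :=
  forall B B', process_sigma Z B -> process_sigma Z' B' ->
    (P (B `&` B') = P B * P B')%E.

Definition char_fun (d : nat) (Z : Omega -> 'rV[R]_d) (xi : 'rV[R]_d) : R[i] :=
  (fine ('E_P[fun w => cos (dotp xi (Z w))])
   +i* fine ('E_P[fun w => sin (dotp xi (Z w))]))%C.

(* Y is, under P, a Levy process started from x; a realization with all paths
   right-continuous with left limits is taken. *)
Record levy_process (d : nat) (x : 'rV[R]_d) (Y : R -> Omega -> borel_rV R d)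
    : Prop := {
  levy_meas : forall t, 0 <= t -> measurable_fun [set: Omega] (Y t);
  levy_init : {ae P, forall w, Y 0 w = x};
  levy_indep : forall (n : nat) (t : nat -> R), 0 <= t 0%N ->
    {homo t : i j / (i <= j)%N >-> i <= j} ->
    indep_seq n (fun i w => (Y (t i.+1) w : 'rV[R]_d) - Y (t i) w : borel_rV R d);
  levy_stat : forall (s t : R) (A : set (borel_rV R d)), 0 <= s -> 0 <= t ->
    measurable A ->
    P [set w | A ((Y (s + t) w : 'rV[R]_d) - Y s w)] =
    P [set w | A ((Y t w : 'rV[R]_d) - Y 0 w)];
  levy_right_cont : forall w (t : R), 0 <= t ->
    (Y s w : 'rV[R]_d) @[s --> t^'+] --> (Y t w : 'rV[R]_d);
  levy_left_lim : forall w (t : R), 0 < t ->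
    exists l : 'rV[R]_d, (Y s w : 'rV[R]_d) @[s --> t^'-] --> l }.

(* The increment Y_t - x under P^x has the law of Y_t under P^0. *)
Definition has_char_exponent (d : nat) (x : 'rV[R]_d)
    (Y : R -> Omega -> borel_rV R d) (psi : 'rV[R]_d -> R) : Prop :=
  forall t xi, 0 <= t ->
    char_fun (fun w => (Y t w : 'rV[R]_d) - x) xi
    = (expR (- (t * psi xi)))%:C%C.

Definition rel_exponent (d : nat) (alpha m : R) (xi : 'rV[R]_d) : R :=
  (m `^ (2 / alpha) + enorm xi ^+ 2) `^ (alpha / 2) - m.

Definition rel_stable_process (d : nat) (alpha m : R) (x : 'rV[R]_d)
    (Y : R -> Omega -> borel_rV R d) : Prop :=
  levy_process x Y /\ has_char_exponent x Y (rel_exponent alpha m).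

(* poisson_pmf is only meaningful for a positive rate, hence s < t. *)
Record poisson_process (lambda : R) (N : R -> Omega -> nat) : Prop := {
  poisson_meas : forall t, 0 <= t -> measurable_fun [set: Omega] (N t);
  poisson_init : forall w, N 0 w = 0%N;
  poisson_homo : forall w (s t : R), 0 <= s -> s <= t -> (N s w <= N t w)%N;
  poisson_right_cont : forall w (t : R), 0 <= t ->
    \forall s \near t^'+, N s w = N t w;
  poisson_indep : forall (n : nat) (t : nat -> R), 0 <= t 0%N ->
    {homo t : i j / (i <= j)%N >-> i <= j} ->
    indep_seq n (fun i w => (N (t i.+1) w - N (t i) w)%N);
  poisson_incr : forall (s t : R) (k : nat), 0 <= s -> s < t ->
    P [set w | (N t w - N s w)%N = k]
    = (poisson_pmf (lambda * (t - s)) k)%:E }.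

Definition arrival (N : R -> Omega -> nat) (n : nat) (w : Omega) : \bar R :=
  ereal_inf [set s%:E | s in [set s : R | 0 <= s /\ (n <= N s w)%N]].

Definition resetting_process (d : nat) (Y : R -> Omega -> borel_rV R d)
    (N : R -> Omega -> nat) (X : R -> Omega -> borel_rV R d) : Prop :=
  forall w (t : R), 0 <= t ->
    ((t%:E < arrival N 1 w)%E -> X t w = Y t w) /\
    (forall n, (1 <= n)%N ->
      (arrival N n w <= t%:E)%E -> (t%:E < arrival N n.+1 w)%E ->
      X t w = ((Y t w : 'rV[R]_d) - Y (fine (arrival N n w)) w)).

Definition has_density (d : nat) (Z : Omega -> borel_rV R d)
    (f : borel_rV R d -> \bar R) : Prop :=
  [/\ measurable_fun [set: Omega] Z,
      measurable_fun [set: borel_rV R d] f,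
      forall y, (0 <= f y)%E &
      forall A : set (borel_rV R d), measurable A ->
        P (Z @^-1` A) = integral_rV (fun y => f y * (\1_A y)%:E)%E].

End processes.

Definition norm_infty (R : realType) (d : nat) : set_system 'rV[R]_d :=
  filter_from [set: R] (fun K => [set y | K < enorm y]).

(* A(t, y) / B(t, y) --> 1 as t --> +oo and |y| --> +oo jointly, along the
   pairs (t, y) in S. *)
Definition asymp_equiv_on (R : realType) (d : nat) (S : set (R * 'rV[R]_d))
    (A : R -> 'rV[R]_d -> \bar R) (B : R -> 'rV[R]_d -> R) : Prop :=
  (A ty.1 ty.2 * ((B ty.1 ty.2)^-1)%:E)%E
    @[ty --> within S (filter_prod (pinfty_nbhs R) (@norm_infty R d))]
  --> (1%E : \bar R).

(* Main.v *)
From HB Require Import structures.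
Require Import Defs.
From mathcomp Require Import ring lra.

Set Implicit Arguments.
Unset Strict Implicit.
Unset Printing Implicit Defensive.

Local Open Scope classical_set_scope.
Local Open Scope ring_scope.

(** The theorem has two independent halves, the existence of the density and its behaviour at
    infinity.

    Existence. Two finite measures on R^d that agree on all waves cos(<xi,y> + c) are equal
    ([cos_wave_eq_measure]), so it suffices to integrate the nonnegative functions 1 + cos(<xi,y> +
    c) against the law of X_t and against the proposed density. For the law, the last arrival before
    t is approximated from the right by points of a finite grid; Y and N are independent and the
    increments of Y are stationary, so the mean of the approximation is a geometric sum with an
    explicit limit ([resetting_mean]). For the density, p(s, .) is a mixture of heat kernels over a
    tempered stable subordinator, and Tonelli with the Fourier transform of the Gaussian gives the
    same closed form ([reset_density_fourier]).

    Asymptotics. Put kap = m^(1/alpha), beta = alpha/2, D = m - lambda, r = |y|, r' = |y - x|. Then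
    p(t,y) = e^(mt) Phi(r,t), where Phi(r,t) is the integral over u of (4 pi u)^(-d/2) exp(-r^2/(4u)
    - kap^2 u) eta(t,u), and p_lambda is e^(Dt) Phi(r',t) plus lambda times the integral of e^(Ds)
    Phi(r,s) over 0 < s < t. The exponent is maximal at u0 = r/(2 kap). Laplace's method and the
    self-similarity eta(t,u) = u^-1 eta(t u^-beta, 1) give Phi(r,t) ~ A(r) eta(t v0, 1) with v0 =
    u0^-beta, as long as t v0 is bounded and t is bounded below ([mixture_near],
    [mixture_first_term]). The three cases differ in how time is weighted.

    If lambda > m, the factor e^(Ds) confines s to bounded times, where eta(s v0, 1) ~ C s v0 with C
    = beta/Gamma(1 - beta); the result is lambda A v0 C / D^2 ([reset_subcritical]). If lambda = m,
    the integral dominates the first term: for bounded t v0 it grows at least like t^2 against t,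
    and for large t v0 it is of order A r^beta, while Phi(r,t) is at most of order A r^(beta/2)
    whatever t is ([mixture_uniform], [reset_critical]). If lambda < m and t v0 is bounded, the
    integral is carried by s near t, and D times the integral of e^(Ds) eta(s v0, 1) is close to
    e^(Dt) eta(t v0, 1). Both terms then have the same order; the bracket in the statement comes
    from A(r')/A(r) ~ e^(kap (r - r')) and r - r' = <y/|y|, x> + o(1) ([reset_supercritical]).

    Everything about eta is drawn from its Laplace transform, its continuity and its positivity.
    Uniqueness of Laplace transforms gives the scaling relation. Differentiating the transform gives
    the convolution equation u eta(t,u) = t C int_0^u (u - v)^-beta eta(t,v) dv ([eta_convolution]);
    a bootstrap on it yields eta(1,u) ~ C u^(-1-beta) ([eta_tail]), that is eta(z,1) ~ C z at 0, and
    the same equation is behind [mixture_uniform]. *)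

(** * Multipliers: functions that preserve agreement of two measures *)

Section multipliers.
Context d (T : measurableType d) (R : realType).
Variables mu nu : {measure set T -> \bar R}.
Hypotheses (mufin : (mu setT < +oo)%E) (nufin : (nu setT < +oo)%E).
Variable E : set (T -> R).

Definition bounded_measurable (f : T -> R) :=
  measurable_fun setT f /\ exists K : R, forall x, `|f x| <= K.

Hypothesis bE : forall e, E e -> bounded_measurable e.

Definition same_integrals (h : T -> R) := bounded_measurable h /\
  forall e, E e ->
    (\int[mu]_x (h x * e x)%:E = \int[nu]_x (h x * e x)%:E)%E.

(** Multipliers form an algebra closed under bounded pointwise limits even when [E] is not an
    algebra. They do the work of Stone-Weierstrass and of the monotone class theorem at once: a few
    explicit multipliers lead to the indicators of a generating family of sets. *)
Definition multiplier (f : T -> R) := bounded_measurable f /\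
  forall h, same_integrals h -> same_integrals (fun x => f x * h x).

Lemma bounded_measurable_cst c : bounded_measurable (fun=> c).
Proof. by split; [exact: measurable_cst | exists `|c|]. Qed.

Lemma bounded_measurableD f g : bounded_measurable f -> bounded_measurable g ->
  bounded_measurable (fun x => f x + g x).
Proof.
move=> [mf [K fK]] [mg [L gL]]; split; first exact: measurable_funD.
by exists (K + L) => x; rewrite (le_trans (ler_normD _ _))// lerD.
Qed.

Lemma bounded_measurableM f g : bounded_measurable f -> bounded_measurable g ->
  bounded_measurable (fun x => f x * g x).
Proof.
move=> [mf [K fK]] [mg [L gL]]; split; first exact: measurable_funM.
by exists (K * L) => x; rewrite normrM ler_pM.
Qed.

Lemma bounded_measurable_integrable (m : {measure set T -> \bar R}) f :
  (m setT < +oo)%E -> bounded_measurable f ->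
  m.-integrable setT (fun x => (f x)%:E).
Proof.
move=> mfin [mf [K fK]].
apply: measurable_bounded_integrable => //.
exists K; split; first exact: num_real.
by move=> x Kx y _ /=; rewrite (le_trans (fK y))// ltW.
Qed.

Lemma bounded_measurable_ext f g : f =1 g -> bounded_measurable f ->
  bounded_measurable g.
Proof. by move=> /funext ->. Qed.

Lemma integral_bounded_lim (m : {measure set T -> \bar R}) (K : R)
    (f_ : nat -> T -> R) (f : T -> R) :
  (m setT < +oo)%E -> (forall n, measurable_fun setT (f_ n)) ->
  measurable_fun setT f ->
  (forall n x, `|f_ n x| <= K) -> (forall x, f_ n x @[n --> \oo] --> f x) ->
  (\int[m]_x (f_ n x)%:E @[n --> \oo] --> \int[m]_x (f x)%:E)%E.
Proof.
move=> mfin mf_ mf fK f_f.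
have [] // := @dominated_convergence _ T R m setT measurableT
  (fun n x => (f_ n x)%:E) (fun x => (f x)%:E) (fun=> K%:E).
- by move=> n; apply/measurable_EFinP.
- by apply/measurable_EFinP.
- by apply/aeW => x _; apply: cvg_EFin; [apply: nearW | exact: f_f].
- apply: bounded_measurable_integrable => //.
  exact: bounded_measurable_cst.
- by apply/aeW => x n _; rewrite lee_fin.
Qed.

Lemma multiplier_cst c : multiplier (fun=> c).
Proof.
split; first exact: bounded_measurable_cst.
move=> h [bh hE]; split.
  by apply: bounded_measurableM => //; exact: bounded_measurable_cst.
move=> e Ee; under eq_integral do rewrite -mulrA EFinM.
under [RHS]eq_integral do rewrite -mulrA EFinM.
have bhe : bounded_measurable (fun x => h x * e x).
  by apply: bounded_measurableM => //; exact: bE.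
by rewrite !integralZl//= ?hE//; exact: bounded_measurable_integrable.
Qed.

Lemma multiplierD f g : multiplier f -> multiplier g ->
  multiplier (fun x => f x + g x).
Proof.
move=> [bf fH] [bg gH]; split; first exact: bounded_measurableD.
move=> h hh; have [bfh fh] := fH _ hh; have [bgh gh] := gH _ hh.
split.
  by apply: (bounded_measurable_ext _ (bounded_measurableD bfh bgh)) => x;
    rewrite mulrDl.
move=> e Ee; under eq_integral do rewrite !mulrDl EFinD.
under [RHS]eq_integral do rewrite !mulrDl EFinD.
have bfhe : bounded_measurable (fun x => f x * h x * e x).
  by apply: bounded_measurableM => //; exact: bE.
have bghe : bounded_measurable (fun x => g x * h x * e x).
  by apply: bounded_measurableM => //; exact: bE.
by rewrite !integralD//= ?fh ?gh//; exact: bounded_measurable_integrable.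
Qed.

Lemma multiplierM f g : multiplier f -> multiplier g ->
  multiplier (fun x => f x * g x).
Proof.
move=> [bf fH] [bg gH]; split; first exact: bounded_measurableM.
move=> h /gH/fH.
by under eq_fun do rewrite mulrA.
Qed.

Lemma multiplierX f n : multiplier f -> multiplier (fun x => f x ^+ n).
Proof.
move=> Mf; elim: n => [|n IH].
  by under eq_fun do rewrite expr0; exact: multiplier_cst.
by under eq_fun do rewrite exprS; exact: multiplierM.
Qed.

(** Dominated convergence under both measures; the uniform bound [K] and the finite masses make
    constants integrable dominators. *)
Lemma multiplier_lim (K : R) (f_ : nat -> T -> R) (f : T -> R) :
  (forall n, multiplier (f_ n)) -> (forall n x, `|f_ n x| <= K) ->
  (forall x, f_ n x @[n --> \oo] --> f x) -> multiplier f.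
Proof.
move=> Mf fK f_f.
have mf : measurable_fun setT f.
  apply: (measurable_fun_cvg (fun n => (Mf n).1.1)) => x _; exact: f_f.
have bf : bounded_measurable f.
  split => //; exists K => x.
  have /cvg_norm fx := f_f x.
  rewrite -(cvg_lim _ fx)//; apply: limr_le; first exact: cvgP fx.
  by apply: nearW => n; exact: fK.
split => // h hh; have [[mh [L hL]] hE] := hh; split.
  by apply: bounded_measurableM => //; split => //; exists L.
move=> e Ee; have [me [N eN]] := bE Ee.
have lim (m : {measure set T -> \bar R}) : (m setT < +oo)%E ->
  (\int[m]_x (f_ n x * h x * e x)%:E @[n --> \oo] -->
   \int[m]_x (f x * h x * e x)%:E)%E.
  move=> mfin; apply: (@integral_bounded_lim _ (K * L * N)) => //.
  - by move=> n; do 2![apply: measurable_funM => //]; exact: (Mf n).1.1.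
  - by do 2![apply: measurable_funM => //].
  - by move=> n x; rewrite !normrM !ler_pM ?mulr_ge0.
  - by move=> x; do 2![apply: cvgMr_tmp]; exact: f_f.
have l1 := lim _ mufin; have l2 := lim _ nufin.
have E12 : (fun n => \int[mu]_x (f_ n x * h x * e x)%:E)%E =
           (fun n => \int[nu]_x (f_ n x * h x * e x)%:E)%E.
  by apply/funext => n; apply: ((Mf n).2 _ hh).2.
rewrite E12 in l1.
exact: (cvg_unique _ l1 l2).
Qed.

End multipliers.

(** * Polynomials converging to a step function *)

Lemma bernoulli_ge (R : realDomainType) (y : R) n : 0 <= y <= 1 ->
  1 - n%:R * y <= (1 - y) ^+ n.
Proof.
move=> /andP[y0 y1]; elim: n => [|n IH]; first by rewrite mul0r subr0 expr0.
rewrite exprS -natr1; apply: (@le_trans _ _ ((1 - y) * (1 - n%:R * y))).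
  have : 0 <= n%:R * (y * y) by rewrite !mulr_ge0.
  nra.
by rewrite ler_wpM2l// subr_ge0.
Qed.

Lemma expR_ge_sqr (R : realType) (x : R) : 0 <= x -> x ^+ 2 / 4 <= expR x.
Proof.
move=> x0; have -> : expR x = expR (x / 2) ^+ 2.
  by rewrite -expRM_natr; congr expR; lra.
have -> : x ^+ 2 / 4 = (x / 2) ^+ 2 by field.
have := expR_ge1Dx (x / 2).
by move=> h; rewrite lerXn2r ?nnegrE ?expR_ge0 ?divr_ge0//; lra.
Qed.

(** With u = (1 - v)/2 and N = n + 1 this is (1 - u^N)^(N 2^N), as in elementary proofs of
    Stone-Weierstrass. On [-1, 1] the product N 2^N u^N = N (1 - v)^N tends to 0 for v > 0 and to
    infinity for v <= 0; the extra factor N settles the case v = 0. *)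
Definition step_poly (R : realType) (n : nat) (v : R) :=
  (1 - ((1 - v) / 2) ^+ n.+1) ^+ (n.+1 * 2 ^ n.+1).

Lemma step_poly_bound (R : realType) n (v : R) : `|v| <= 1 ->
  0 <= step_poly n v <= 1.
Proof.
rewrite ler_norml => /andP[v1 v2].
have u01 : 0 <= ((1 - v) / 2) ^+ n.+1 <= 1.
  by rewrite exprn_ge0/= ?exprn_ile1//; lra.
by rewrite exprn_ge0/= ?exprn_ile1//; lra.
Qed.

(** For v > 0, Bernoulli's inequality bounds the defect by N (1 - v)^N <= N e^(-N v) <= 4 / (N v^2).
    For v <= 0, 1 - x <= e^(-x) leaves exp(-N (1 - v)^N), which is at most 1 / N. *)
Lemma cvg_step_poly (R : realType) (v : R) : `|v| <= 1 ->
  step_poly n v @[n --> \oo] --> (((0 < v)%R : nat)%:R : R).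
Proof.
move=> v1; have vb := fun n => step_poly_bound n v1.
move: (v1); rewrite ler_norml => /andP[v2 v3].
have harm (c : R) : c * n.+1%:R^-1 @[n --> \oo] --> (0 : R).
  by rewrite -(mulr0 c); apply: cvgMl_tmp; exact: cvg_harmonic.
have u01 n : 0 <= ((1 - v) / 2) ^+ n.+1 <= 1.
  by rewrite exprn_ge0/= ?exprn_ile1//; lra.
case: ltP => v0 /=.
  apply: (@squeeze_cvgr _ _ _ _ (fun n => 1 - 4 / v ^+ 2 * n.+1%:R^-1)
    (fun=> 1)); last 2 first.
  - by rewrite -[X in _ --> X]subr0; apply: cvgB; [exact: cvg_cst | exact: harm].
  - exact: cvg_cst.
  apply: nearW => n; have /andP[_ ->] := vb n; rewrite andbT.
  apply: le_trans (bernoulli_ge _ (u01 n)).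
  rewrite lerD2l lerN2 natrM natrX -mulrA -exprMn mulrCA divff ?mulr1//.
  have e1 : (1 - v) ^+ n.+1 <= (expR (n.+1%:R * v))^-1.
    rewrite -expRN -mulrN mulrC expRM_natr.
    by rewrite lerXn2r ?nnegrE ?expR_ge0 ?expR_ge1Dx//; lra.
  have e2 : (n.+1%:R * v) ^+ 2 / 4 <= expR (n.+1%:R * v).
    by apply: expR_ge_sqr; rewrite mulr_ge0// ltW.
  have n0 : 0 < n.+1%:R :> R by [].
  have e3 : (expR (n.+1%:R * v))^-1 <= 4 / (n.+1%:R * v) ^+ 2.
    rewrite -[leRHS]invrK invf_div lef_pV2 ?posrE ?expR_gt0//.
    by rewrite divr_gt0// exprn_gt0// mulr_gt0.
  apply: (le_trans (ler_wpM2l (ltW n0) (le_trans e1 e3))).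
  rewrite le_eqVlt; apply/orP; left; apply/eqP; field.
  by rewrite nat1r !gt_eqF.
apply: (@squeeze_cvgr _ _ _ _ (fun=> 0) (fun n => 1 * n.+1%:R^-1)); last 2 first.
- exact: cvg_cst.
- exact: harm.
apply: nearW => n; have /andP[-> _] := vb n; rewrite /= mul1r.
have /andP[u0 u1] := u01 n.
apply: (@le_trans _ _ (expR (- ((1 - v) / 2) ^+ n.+1) ^+ (n.+1 * 2 ^ n.+1))).
  rewrite lerXn2r ?nnegrE ?expR_ge0 ?subr_ge0//.
  exact: expR_ge1Dx.
rewrite -expRM_natr natrM natrX mulNr expRN lef_pV2 ?posrE ?expR_gt0//.
rewrite mulrCA -exprMn divfK//.
apply: (@le_trans _ _ (1 + n.+1%:R * (1 - v) ^+ n.+1)); last exact: expR_ge1Dx.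
have : 1 <= (1 - v) ^+ n.+1 by rewrite exprn_ege1// ; lra.
have : 0 <= n.+1%:R :> R by [].
nra.
Qed.

(** * Equality of finite measures through multipliers *)

Section uniqueness.
Context d (T : measurableType d) (R : realType).
Variables mu nu : {measure set T -> \bar R}.
Hypotheses (mufin : (mu setT < +oo)%E) (nufin : (nu setT < +oo)%E).
Variable E : set (T -> R).
Hypothesis bE : forall e, E e -> bounded_measurable e.

Local Notation mult := (multiplier mu nu E).

Lemma multiplier_pos f : mult f -> (forall x, `|f x| <= 1) ->
  mult (\1_[set x | 0 < f x]).
Proof.
move=> Mf f1; apply: (multiplier_lim mufin nufin bE (K := 1)
    (f_ := fun n x => step_poly n (f x))).
- move=> n; apply: multiplierX => //.
  apply: multiplierD => //; first exact: multiplier_cst.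
  under eq_fun do rewrite -mulN1r.
  apply: multiplierM; first exact: multiplier_cst.
  apply: multiplierX => //; apply: multiplierM; last exact: multiplier_cst.
  apply: multiplierD => //; first exact: multiplier_cst.
  under eq_fun do rewrite -mulN1r.
  by apply: multiplierM => //; exact: multiplier_cst.
- move=> n x; have /andP[h0 h1] := step_poly_bound n (f1 x).
  by rewrite ger0_norm.
- move=> x; have := cvg_step_poly (f1 x).
  rewrite indicE; congr (_ --> _); congr (_ %:R).
  by case: ltP => h; [rewrite mem_set | rewrite memNset// => /=; lra].
Qed.

Lemma multiplier_pos_scaled c f : 0 < c -> mult f ->
  (forall x, `|f x| <= c) -> mult (\1_[set x | 0 < f x]).
Proof.
move=> c0 Mf fc.
rewrite (_ : [set x | 0 < f x] = [set x | 0 < c^-1 * f x]); last first.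
  by apply/seteqP; split => x /=; rewrite pmulr_rgt0// invr_gt0.
apply: multiplier_pos.
  by apply: multiplierM => //; exact: multiplier_cst.
by move=> x; rewrite normrM gtr0_norm ?invr_gt0// mulrC ler_pdivrMr// mul1r.
Qed.

(** The constant 1 has the same integrals, hence so has the indicator of every [B] whose indicator
    is a multiplier; testing it against the member 1 of [E] gives [mu B = nu B]. Such sets are
    stable under intersection because products of multipliers are multipliers, so the uniqueness
    theorem for measures on a pi-system applies. *)
Lemma eq_measure_multiplier :
  (forall e, E e -> (\int[mu]_x (e x)%:E = \int[nu]_x (e x)%:E)%E) ->
  E (fun=> 1) ->
  (forall A, measurable A -> <<s [set B | measurable B /\ mult \1_B] >> A) ->
  forall A, measurable A -> mu A = nu A.
Proof.
move=> Eeq E1 gen A /gen.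
set G := [set B | _].
have same1 : same_integrals mu nu E (fun=> 1).
  split; first exact: bounded_measurable_cst.
  move=> e Ee.
  under eq_integral do rewrite mul1r.
  by under [RHS]eq_integral do rewrite mul1r; exact: Eeq.
have GT : G setT.
  split => //; have := multiplier_cst mufin nufin bE 1.
  congr (multiplier _ _ _ _); apply/funext => x.
  by rewrite indicE in_setT.
apply: (g_sigma_algebra_measure_unique G _ (fun=> setT)) => //.
- by move=> B [].
- by rewrite bigcup_const//; exists 0%N.
- move=> B C [mB MB] [mC MC]; split; first exact: measurableI.
  by rewrite indicI; exact: multiplierM.
- move=> B [mB [_ MB]]; have [_ /(_ _ E1)] := MB _ same1.
  under eq_integral do rewrite !mulr1.
  under [RHS]eq_integral do rewrite !mulr1.
  by rewrite !integral_indic// !setIT.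
Qed.

End uniqueness.

(** * Densities, Tonelli on rectangles, images, affine substitutions *)

(** The proofs [mf] and [f0] are arguments so that the measure instance declared below can be
    recovered from the term itself. *)
Definition density_measure d (T : measurableType d) (R : realType)
  (mu : {measure set T -> \bar R}) (f : T -> \bar R)
  (mf : measurable_fun setT f) (f0 : forall x, (0 <= f x)%E) : set T -> \bar R :=
  fun A => (\int[mu]_(x in A) f x)%E.

Section density_measure.
Local Open Scope ereal_scope.
Context d (T : measurableType d) (R : realType).
Variables (mu : {measure set T -> \bar R}) (f : T -> \bar R).
Hypotheses (mf : measurable_fun setT f) (f0 : forall x, 0 <= f x).

Local Notation nu := (density_measure mu mf f0).

Let nu0 : nu set0 = 0.
Proof. exact: integral_set0. Qed.

Let nu_ge0 A : 0 <= nu A.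
Proof. by apply: integral_ge0 => x _; exact: f0. Qed.

Let nu_sigma_additive : semi_sigma_additive nu.
Proof.
move=> F mF tF mUF; rewrite /density_measure ge0_integral_bigcup//.
- by apply: is_cvg_nneseries => n _ _; exact: nu_ge0.
- exact: measurable_funTS.
Qed.

HB.instance Definition _ := isMeasure.Build _ _ _ nu nu0 nu_ge0 nu_sigma_additive.

Import HBNNSimple.

Lemma integral_density_measure g : measurable_fun setT g -> (forall x, 0 <= g x) ->
  \int[nu]_x g x = \int[mu]_x (g x * f x).
Proof.
move=> mg g0; pose g_ := nnsfun_approx measurableT mg.
have cg x : (g_ n x)%:E @[n --> \oo] --> g x.
  by apply: cvg_nnsfun_approx => // y _; exact: g0.
have L1 : \int[nu]_x g x = limn (fun n => \int[nu]_x (g_ n x)%:E).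
  rewrite -monotone_convergence//.
  - by apply: eq_integral => y _; apply/esym/cvg_lim => //; exact: cg.
  - by move=> n; exact/measurable_EFinP.
  - by move=> n y _; rewrite lee_fin.
  - by move=> y _ m n mn; rewrite lee_fin; exact/lefP/nd_nnsfun_approx.
have L2 : \int[mu]_x (g x * f x) = limn (fun n => \int[mu]_x ((g_ n x)%:E * f x)).
  rewrite -monotone_convergence//.
  - apply: eq_integral => y _; apply/esym/cvg_lim => //.
    (* The limit of a product requires that 0 times infinity be excluded. At a zero of [g] the
       approximations, which increase to it, vanish as well. *)
    have [->|fy0] := eqVneq (f y) 0.
      by rewrite mule0; apply: cvg_near_cst; apply: nearW => n; rewrite mule0.
    have [gy0|gy0] := eqVneq (g y) 0.
      rewrite gy0 mul0e; apply: cvg_near_cst; apply: nearW => n.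
      suff -> : (g_ n y)%:E = 0 by rewrite mul0e.
      apply/eqP; rewrite eq_le; apply/andP; split; last by rewrite lee_fin.
      rewrite -gy0.
      have ndg : {homo (fun n => (g_ n y)%:E) : n m / (n <= m)%N >-> n <= m}.
        by move=> a b ab; rewrite lee_fin; exact/lefP/nd_nnsfun_approx.
      rewrite -(cvg_lim _ (cg y))// (cvg_lim _ (ereal_nondecreasing_cvgn ndg))//.
      by apply: ereal_sup_ubound; exists n.
    apply: cvgeM (cg y) (cvg_cst _).
    by apply: neq0_mule_def; rewrite mule_eq0 negb_or gy0.
  - by move=> n; apply: emeasurable_funM => //; exact/measurable_EFinP.
  - by move=> n y _; rewrite mule_ge0// lee_fin.
  - move=> y _ m n mn; rewrite lee_wpmul2r// lee_fin.
    exact/lefP/nd_nnsfun_approx.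
rewrite L1 L2; congr (limn _); apply/funext => n.
transitivity (\int[nu]_x (\sum_(r \in range (g_ n))
    r%:E * (\1_(g_ n @^-1` [set r]) x)%:E)).
  by apply: eq_integral => x _; rewrite fimfunE -fsumEFin.
transitivity (\int[mu]_x (\sum_(r \in range (g_ n))
    (r%:E * (\1_(g_ n @^-1` [set r]) x)%:E) * f x)); last first.
  apply: eq_integral => x _; rewrite [in RHS]fimfunE -fsumEFin//.
  by rewrite -ge0_mule_fsuml// => r; exact: nnfun_muleindic_ge0.
have r0 x r : 0 <= r%:E * (\1_(g_ n @^-1` [set r]) x)%:E.
  exact: nnfun_muleindic_ge0.
have mr r : measurable_fun setT (fun x => r%:E * (\1_(g_ n @^-1` [set r]) x)%:E).
  by apply/measurable_EFinP; exact: measurable_funM.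
rewrite !ge0_integral_fsum//=.
- apply: eq_fsbigr => r /[!inE] -[x _ xr].
  have r00 : (0 <= r)%R by rewrite -xr.
  rewrite ge0_integralZl_EFin//=; last exact/measurable_EFinP.
  under [RHS]eq_integral do rewrite -muleA.
  rewrite ge0_integralZl_EFin//=; last 2 first.
    by move=> ? _; rewrite mule_ge0// lee_fin.
    by apply: emeasurable_funM => //; exact/measurable_EFinP.
  rewrite integral_indic// setIT.
  transitivity (r%:E * \int[mu]_(y in g_ n @^-1` [set r]) f y) => //.
  rewrite integral_mkcond; congr (_ * _); apply: eq_integral => y _.
  by rewrite patchE indicE; case: ifP => _; rewrite ?mul1e ?mul0e.
- by move=> r; apply: emeasurable_funM.
- by move=> r x _; rewrite mule_ge0.
Qed.

End density_measure.

Section tonelli_on.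
Local Open Scope ereal_scope.
Context d1 d2 (T1 : measurableType d1) (T2 : measurableType d2) (R : realType).
Variables (m1 : {sigma_finite_measure set T1 -> \bar R}).
Variables (m2 : {sigma_finite_measure set T2 -> \bar R}).
Variables (D1 : set T1) (D2 : set T2) (f : T1 * T2 -> \bar R).
Hypotheses (mD1 : measurable D1) (mD2 : measurable D2).
Hypotheses (mf : measurable_fun (D1 `*` D2) f).
Hypotheses (f0 : forall x y, D1 x -> D2 y -> 0 <= f (x, y)).

Let fD := f \_ (D1 `*` D2).

Let mfD : measurable_fun setT fD.
Proof. by apply/(measurable_restrictT _ _).1 => //; exact: measurableX. Qed.

Let fD0 z : 0 <= fD z.
Proof.
rewrite /fD patchE; case: ifP => // /set_mem; case: z => x y [] /=; exact: f0.
Qed.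

Let F1 x : ((fun x => \int[m2]_(y in D2) f (x, y)) \_ D1) x =
  \int[m2]_y fD (x, y).
Proof.
rewrite patchE; case: ifP => [/set_mem Dx|/negbT/negP Dx].
  rewrite integral_mkcond; apply: eq_integral => y _.
  rewrite /fD !patchE; case: ifP => [/set_mem Dy|/negbT/negP Dy].
    by rewrite mem_set.
  by rewrite memNset// => -[_ /mem_set].
rewrite integral0_eq// => y _.
by rewrite /fD patchE memNset// => -[/mem_set].
Qed.

Let F2 y : ((fun y => \int[m1]_(x in D1) f (x, y)) \_ D2) y =
  \int[m1]_x fD (x, y).
Proof.
rewrite patchE; case: ifP => [/set_mem Dy|/negbT/negP Dy].
  rewrite integral_mkcond; apply: eq_integral => x _.
  rewrite /fD !patchE; case: ifP => [/set_mem Dx|/negbT/negP Dx].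
    by rewrite mem_set.
  by rewrite memNset// => -[/mem_set].
rewrite integral0_eq// => x _.
by rewrite /fD patchE memNset// => -[_ /mem_set].
Qed.

Lemma tonelli_on : \int[m1]_(x in D1) \int[m2]_(y in D2) f (x, y) =
  \int[m2]_(y in D2) \int[m1]_(x in D1) f (x, y).
Proof.
rewrite integral_mkcond [RHS]integral_mkcond.
under eq_integral do rewrite F1.
under [RHS]eq_integral do rewrite F2.
exact: fubini_tonelli.
Qed.

Lemma measurable_tonelli_on :
  measurable_fun D1 (fun x => \int[m2]_(y in D2) f (x, y)).
Proof.
apply/(measurable_restrictT _ _).2 => //.
have -> : (fun x => \int[m2]_(y in D2) f (x, y)) \_ D1 =
    (fun x => \int[m2]_y fD (x, y)) by apply/funext => x; rewrite F1.
exact: measurable_fun_fubini_tonelli_F.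
Qed.

End tonelli_on.

Definition image_measure d1 d2 (T1 : measurableType d1) (T2 : measurableType d2)
    (R : realType) (m : {measure set T1 -> \bar R}) (f : T1 -> T2)
    (mf : measurable_fun setT f) : {measure set T2 -> \bar R} :=
  measure_function_pushforward__canonical__measure_function_Measure m mf.

Lemma ge0_integral_image d1 d2 (T1 : measurableType d1) (T2 : measurableType d2)
    (R : realType) (m : {measure set T1 -> \bar R}) (f : T1 -> T2)
    (mf : measurable_fun setT f) (D : set T2) (g : T2 -> \bar R) :
  measurable D -> measurable_fun D g -> (forall y, D y -> 0 <= g y)%E ->
  (\int[image_measure m mf]_(y in D) g y = \int[m]_(x in f @^-1` D) g (f x))%E.
Proof.
by move=> mD mg g0; rewrite ge0_integral_pushforward// => y /[!inE]; exact: g0.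
Qed.

Section affine_substitution.
Local Open Scope ereal_scope.
Context {R : realType}.
Local Notation mu := (@lebesgue_measure R).

Let aff (a b : R) (x : R) : measurableTypeR R := (a * x + b)%R.

Let maff a b : measurable_fun [set: measurableTypeR R] (aff a b).
Proof. by apply: measurable_funD => //; exact: measurable_funM. Qed.

Let lebesgue_measure_affine (a b : R) (A : set R) : (0 < a)%R -> measurable A ->
  mu A = a%:E * mu (aff a b @^-1` A).
Proof.
move=> a0 mA.
pose nu := mscale (NngNum (ltW a0)) (image_measure mu (maff a b)).
rewrite -[RHS]/(nu A).
apply: lebesgue_measure_unique => // _ [[x y]] /= _ <-.
rewrite /nu /mscale /= /image_measure /= /pushforward.
rewrite (_ : _ @^-1` _ = `](x - b) / a, (y - b) / a]%classic)%R; last first.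
  apply/seteqP; split => z /=; rewrite !in_itv/= /aff
    ler_pdivlMr// ltr_pdivrMr// => /andP[h1 h2]; apply/andP; split; lra.
rewrite !lebesgue_measure_itv/= !lte_fin ltr_pM2r ?invr_gt0// ltrD2r.
case: ifPn => _; last by rewrite mule0.
by rewrite -!EFinB -EFinM; congr EFin; field; rewrite gt_eqF.
Qed.

Lemma ge0_integral_affine (a b : R) (f : R -> \bar R) (D : set R) : (0 < a)%R ->
  measurable D -> measurable_fun D f -> (forall x, D x -> 0 <= f x) ->
  \int[mu]_(x in D) f x =
  a%:E * \int[mu]_(x in [set x | D (a * x + b)%R]) f (a * x + b)%R.
Proof.
move=> a0 mD mf f0.
have -> : \int[mu]_(x in D) f x =
    \int[mscale (NngNum (ltW a0)) (image_measure mu (maff a b))]_(x in D) f x.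
  by apply: eq_measure_integral => A mA _; exact: lebesgue_measure_affine.
rewrite ge0_integral_mscale//=; congr (_ * _).
exact: (ge0_integral_image _ (maff a b)).
Qed.

Lemma ge0_integral_reflect (b : R) (f : R -> \bar R) (D : set R) :
  measurable D -> measurable_fun D f -> (forall x, D x -> 0 <= f x) ->
  \int[mu]_(x in D) f x =
  \int[mu]_(x in [set x | D (b - x)%R]) f (b - x)%R.
Proof.
move=> mD mf f0.
pose s (x : R) : measurableTypeR R := (b - x)%R.
have ms : measurable_fun [set: measurableTypeR R] s by exact: measurable_funB.
have -> : \int[mu]_(x in D) f x = \int[image_measure mu ms]_(x in D) f x.
  apply: eq_measure_integral => A mA _.
  apply: lebesgue_measure_unique => // _ [[x y]] /= _ <-.
  rewrite /pushforward (_ : _ @^-1` _ = `[(b - y), (b - x)[%classic)%R; last first.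
    by apply/seteqP; split => z /=; rewrite !in_itv/= /s => /andP[h1 h2];
      apply/andP; split; lra.
  rewrite !lebesgue_measure_itv/= !lte_fin ltrD2l ltrN2.
  by case: ifPn => // _; rewrite -!EFinB; congr EFin; lra.
exact: (ge0_integral_image _ ms).
Qed.

End affine_substitution.

(** * Uniqueness of Laplace transforms *)

Notation posR := (`]0%R, +oo[%classic).

Lemma posRE (R : realType) (u : R) : posR u = (0 < u) :> Prop.
Proof. by rewrite /= in_itv/= andbT. Qed.

Lemma measurable_posR (R : realType) : measurable (posR : set R).
Proof. exact: measurable_itv. Qed.

Section laplace_unique.
Context (R : realType).
Local Notation leb := (@lebesgue_measure R).

(** Truncating at 0 keeps the exponential bounded on the whole line; it changes no integral here
    because the measures compared vanish off the positive half-line. *)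
Let e (s u : R) : R := expR (- (s * Num.max u 0)).

Let me_ s : measurable_fun setT (e s).
Proof.
apply: measurableT_comp => //; apply: measurable_funN.
apply: measurable_funM => //; exact: measurable_maxr.
Qed.

Let e_le1 s u : 0 <= s -> e s u <= 1.
Proof.
by move=> s0; rewrite /e -expR0 ler_expR oppr_le0 mulr_ge0// le_max lexx orbT.
Qed.

(** Multiplication by [e 1] turns [e s] into [e (1 + s)], so [e 1] is a multiplier. For b > 0 the
    ray []-oo, b[] is the set where [e 1] exceeds e^(-b), so its indicator is a multiplier; for b <=
    0 the ray is null for both measures. Rays generate the Borel sets. *)
Lemma laplace_unique_measure (mu nu : {measure set (measurableTypeR R) -> \bar R}) :
  (mu setT < +oo)%E -> (nu setT < +oo)%E ->
  mu (~` posR) = 0%E -> nu (~` posR) = 0%E ->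
  (forall s : R, (0 <= s)%R -> \int[mu]_(u in posR) (expR (- (s * u)))%:E =
                     \int[nu]_(u in posR) (expR (- (s * u)))%:E)%E ->
  forall A, measurable A -> mu A = nu A.
Proof.
move=> mufin nufin mu0 nu0 munu.
pose E : set (R -> R) := [set f | exists2 s, 0 <= s & f = e s].
have bE f : E f -> bounded_measurable (f : measurableTypeR R -> R).
  move=> [s s0 ->]; split; first exact: me_.
  by exists 1 => x; rewrite ger0_norm ?expR_ge0// e_le1.
have mC : measurable (~` posR : set (measurableTypeR R)).
  by apply: measurableC; exact: measurable_itv.
have splitC (m : {measure set (measurableTypeR R) -> \bar R})
    (f : measurableTypeR R -> R) :
    (m setT < +oo)%E -> m (~` posR) = 0%E -> bounded_measurable f ->
    (\int[m]_x (f x)%:E = \int[m]_(x in posR) (f x)%:E)%E.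
  move=> mfin m0 bf.
  rewrite -(setUv posR) integral_setU//=; first last.
  - by apply/disj_set2P; rewrite setICr.
  - by rewrite setUv; apply/measurable_EFinP; exact: bf.1.
  rewrite [X in (_ + X)%E](null_set_integral _ _ m0) ?adde0//.
  by apply/measurable_EFinP; apply: measurable_funTS; exact: bf.1.
apply: (eq_measure_multiplier mufin nufin bE).
- move=> f [s s0 ->].
  rewrite !splitC//; try by apply: bE; exists s.
  have Ee (m : {measure set (measurableTypeR R) -> \bar R}) :
      (\int[m]_(x in posR) (e s x)%:E =
       \int[m]_(x in posR) (expR (- (s * x)))%:E)%E.
    by apply: eq_integral => u; rewrite inE posRE => u0; rewrite /e max_l// ltW.
  by rewrite !Ee; exact: munu.
- by exists 0 => //; apply/funext => u; rewrite /e mul0r oppr0 expR0.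
have e1M : multiplier mu nu E (e 1).
  split; first by apply: bE; exists 1.
  move=> h [bh hE]; split.
    by apply: bounded_measurableM => //; apply: bE; exists 1.
  move=> _ [s s0 ->].
  have Es (m : {measure set (measurableTypeR R) -> \bar R}) :
      (\int[m]_x (e 1 x * h x * e s x)%:E = \int[m]_x (h x * e (1 + s) x)%:E)%E.
    by apply: eq_integral => u _; rewrite /e mulrDl opprD expRD mulrCA mulrA.
  by rewrite !Es; apply: hE; exists (1 + s) => //; rewrite addr_ge0.
have nullM (A : set (measurableTypeR R)) : measurable A -> A `<=` ~` posR ->
    multiplier mu nu E \1_A.
  move=> mA AN.
  have bA : bounded_measurable (\1_A : measurableTypeR R -> R).
    split; first exact: measurable_indic.
    by exists 1 => x; rewrite indicE ger0_norm// lern1 leq_b1.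
  split => // h [bh hE]; have bAh := bounded_measurableM bA bh.
  split => // f Ef; have bAhf := bounded_measurableM bAh (bE _ Ef).
  rewrite !splitC// !integral0_eq// => x xp; rewrite indicE memNset ?mul0r//;
    by move=> /AN; exact.
move=> A; rewrite [X in X A -> _](RGenInftyO.measurableE R).
apply: sub_sigma_algebra2 => _ [b ->] /=.
split; first exact: measurable_itv.
have [b0|b0] := ltP 0 b; last first.
  apply: nullM; first exact: measurable_itv.
  by move=> x /=; rewrite !in_itv/= andbT => xb; apply/negP; rewrite -leNgt; lra.
rewrite (_ : `]-oo, b[%classic = [set u | 0 < e 1 u + - expR (- b)]); last first.
  apply/seteqP; split => x /=; rewrite in_itv/= subr_gt0 /e ltr_expR mul1r ltrN2;
    by rewrite gt_max b0 andbT.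
apply: (multiplier_pos_scaled mufin nufin bE (c := 2)) => //.
  by apply: multiplierD => //; exact: multiplier_cst.
move=> x; rewrite (le_trans (ler_normD _ _))// normrN.
rewrite !ger0_norm ?expR_ge0// lerD ?e_le1//.
by rewrite -expR0 ler_expR; lra.
Qed.

(** The densities may have infinite mass, so both are first weighted by e^(-u), which shifts the
    transform variable by 1 and makes the measures finite. Their equality is then tested against
    h(u) e^u, which removes the weight. *)
Lemma laplace_unique (f g h : R -> \bar R) :
  measurable_fun (posR : set R) f -> measurable_fun (posR : set R) g ->
  (forall u, 0 < u -> (0 <= f u)%E) -> (forall u, 0 < u -> (0 <= g u)%E) ->
  (forall s : R, (0 < s)%R -> \int[leb]_(u in posR) ((expR (- (s * u)))%:E * f u) < +oo)%E ->
  (forall s : R, (0 < s)%R -> \int[leb]_(u in posR) ((expR (- (s * u)))%:E * f u) =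
                    \int[leb]_(u in posR) ((expR (- (s * u)))%:E * g u))%E ->
  measurable_fun (posR : set R) h -> (forall u, 0 < u -> (0 <= h u)%E) ->
  (\int[leb]_(u in posR) (h u * f u) = \int[leb]_(u in posR) (h u * g u))%E.
Proof.
move=> mf mg f0 g0 ffin fg mh h0.
have mexp s : measurable_fun setT (fun u : R => (expR (- (s * u)))%:E).
  apply/measurable_EFinP; apply: measurableT_comp => //.
  by apply: measurable_funN; exact: measurable_funM.
pose W (f : R -> \bar R) : measurableTypeR R -> \bar R :=
  (fun u => ((expR (- u))%:E * f u)%E) \_ posR.
have mW k : measurable_fun (posR : set R) k -> measurable_fun setT (W k).
  move=> mk; apply/(measurable_restrictT _ _).1; first exact: measurable_itv.
  apply: emeasurable_funM => //; apply: measurable_funTS.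
  by under eq_fun do rewrite -[X in (- X)%R]mul1r; exact: mexp.
have W0 k : (forall u, 0 < u -> (0 <= k u)%E) -> forall u, (0 <= W k u)%E.
  move=> k0 u; rewrite /W patchE; case: ifPn => //; rewrite inE posRE => u0.
  by rewrite mule_ge0 ?k0// lee_fin expR_ge0.
pose M k (mk : measurable_fun (posR : set R) k) (k0 : forall u, 0 < u -> (0 <= k u)%E) :
   {measure set (measurableTypeR R) -> \bar R} := density_measure leb (mW k mk) (W0 k k0).
have intM k mk k0 q : measurable_fun setT q -> (forall u, 0 <= q u)%E ->
    (\int[@M k mk k0]_u q u =
     \int[leb]_(u in posR) (q u * (expR (- u))%:E * k u))%E.
  move=> mq q0; rewrite integral_density_measure//.
  rewrite [RHS]integral_mkcond; apply: eq_integral => u _.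
  by rewrite /W !patchE; case: ifPn => _; rewrite ?muleA ?mule0.
have intMp k mk k0 s : 0 <= s ->
    (\int[@M k mk k0]_(u in posR) (expR (- (s * u)))%:E =
     \int[leb]_(u in posR) ((expR (- ((s + 1) * u)))%:E * k u))%E.
  move=> s0; rewrite integral_mkcond intM; last 2 first.
  - apply/(measurable_restrictT _ _).1; first exact: measurable_itv.
    by apply: measurable_funTS; exact: mexp.
  - by move=> u; rewrite patchE; case: ifPn => // _; rewrite lee_fin expR_ge0.
  apply: eq_integral => u up; rewrite patchE up; congr (_ * _)%E.
  by rewrite -EFinM -expRD; congr (expR _)%:E; ring.
have M0 k mk k0 : @M k mk k0 (~` posR) = 0%E.
  transitivity (\int[leb]_(u in ~` posR) W k u)%E => //.
  by apply: integral0_eq => u up; rewrite /W patchE memNset.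
have Mfin k mk k0 : (\int[leb]_(u in posR) ((expR (- (1 * u)))%:E * k u) < +oo)%E ->
    (@M k mk k0 setT < +oo)%E.
  apply: le_lt_trans; apply: (@le_trans _ _ (\int[leb]_u W k u)%E) => //.
  rewrite [leRHS]integral_mkcond le_eqVlt; apply/orP; left; apply/eqP.
  by apply: eq_integral => u _; rewrite /W !patchE mul1r.
have eqM : forall A, measurable A -> M f mf f0 A = M g mg g0 A.
  apply: laplace_unique_measure => //.
  - by apply: Mfin; exact: ffin.
  - by apply: Mfin; rewrite -fg//; exact: ffin.
  - by move=> s s0; rewrite !intMp// fg// ltr_wpDl.
pose q := (fun u => h u * (expR u)%:E)%E \_ posR.
have mq : measurable_fun setT q.
  apply/(measurable_restrictT _ _).1; first exact: measurable_itv.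
  by apply: emeasurable_funM => //; apply: measurable_funTS; exact/measurable_EFinP.
have q0 u : (0 <= q u)%E.
  rewrite /q patchE; case: ifPn => //; rewrite inE posRE => u0.
  by rewrite mule_ge0 ?h0// lee_fin expR_ge0.
have intq k mk k0 : (\int[@M k mk k0]_u q u = \int[leb]_(u in posR) (h u * k u))%E.
  rewrite intM//; apply: eq_integral => u up; rewrite /q patchE up.
  by rewrite -(muleA (h u)) -EFinM -expRD subrr expR0 mule1.
rewrite -(intq f mf f0) -(intq g mg g0).
by apply: eq_measure_integral => A mA _; exact: eqM.
Qed.

End laplace_unique.

(** * Measurability by structural decomposition *)

Lemma measurable_funV d (T : measurableType d) (R : realType) (D : set T)
    (f : T -> R) :
  measurable_fun D f -> measurable_fun D (fun x => (f x)^-1).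
Proof.
move=> mf.
(* This identity holds at 0 too, where the inverse is 0 by convention, so continuity of the inverse
   is not invoked. *)
have -> : (fun x => (f x)^-1) = (fun x => f x * (f x ^+ 2) `^ (-1)).
  apply/funext => x; rewrite powR_inv1 ?sqr_ge0//.
  have [->|fx0] := eqVneq (f x) 0; first by rewrite invr0 mul0r.
  by rewrite expr2 invfM mulrA divff// mul1r.
apply: measurable_funM => //.
apply: (measurableT_comp (measurable_powR (-1))).
exact: measurable_funX.
Qed.

Lemma measurable_fun_div d (T : measurableType d) (R : realType) (D : set T)
    (f g : T -> R) :
  measurable_fun D f -> measurable_fun D g -> measurable_fun D (fun x => f x / g x).
Proof. by move=> mf mg; apply: measurable_funM => //; exact: measurable_funV. Qed.

Lemma measurable_fun_powR d (T : measurableType d) (R : realType) (D : set T)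
    (f : T -> R) a :
  measurable_fun D f -> measurable_fun D (fun x => f x `^ a).
Proof. by move=> mf; apply: (measurableT_comp (measurable_powR a)). Qed.

Lemma measurable_fun_expR d (T : measurableType d) (R : realType) (D : set T)
    (f : T -> R) :
  measurable_fun D f -> measurable_fun D (fun x => expR (f x)).
Proof. by move=> mf; apply: measurableT_comp. Qed.

Ltac mfun_step :=
  lazymatch goal with
  | |- measurable_fun _ (fun _ => ?c) => exact: measurable_cst
  | |- measurable_fun _ (fun x => x) => exact: measurable_id
  | |- measurable_fun _ (fun x => EFin (@?f x)) => apply/(@measurable_EFinP _ _ _ _ f)
  | |- measurable_fun _ (EFin \o ?f) => apply/(@measurable_EFinP _ _ _ _ f)
  | |- measurable_fun _ (fun x => expR (@?f x)) => apply: (@measurable_fun_expR _ _ _ _ f)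
  | |- measurable_fun _ (fun x => powR (@?f x) ?a) => apply: (@measurable_fun_powR _ _ _ _ f a)
  | |- measurable_fun _ (fun x => (@?f x * @?g x)%R) => apply: (@measurable_funM _ _ _ _ f g)
  | |- measurable_fun _ (fun x => (@?f x + - @?g x)%R) => apply: (@measurable_funB _ _ _ _ f g)
  | |- measurable_fun _ (fun x => (@?f x + @?g x)%R) =>
      first [apply: (@measurable_funD _ _ _ _ f g) | apply: (@emeasurable_funD _ _ _ _ f g)]
  | |- measurable_fun _ (fun x => (- @?f x)%R) => apply: (@measurable_funN _ _ _ _ f)
  | |- measurable_fun _ (fun x => (@?f x ^+ ?n)%R) => apply: (@measurable_funX _ _ _ _ f n)
  | |- measurable_fun _ (fun x => (@?f x)^-1%R) => apply: (@measurable_funV _ _ _ _ f)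
  | |- measurable_fun _ (fun x => (@?f x * @?g x)%E) => apply: (@emeasurable_funM _ _ _ _ f g)
  | |- measurable_fun _ (fun x => fst x) => solve [exact: measurable_fst | apply: measurable_funTS; exact: measurable_fst]
  | |- measurable_fun _ (fun x => snd x) => solve [exact: measurable_snd | apply: measurable_funTS; exact: measurable_snd]
  | |- measurable_fun _ fst => solve [exact: measurable_fst | apply: measurable_funTS; exact: measurable_fst]
  | |- measurable_fun _ snd => solve [exact: measurable_snd | apply: measurable_funTS; exact: measurable_snd]
  | |- measurable_fun _ id => exact: measurable_id
  | |- measurable_fun _ (fun x => fst (@?f x)) => apply: (measurableT_comp measurable_fst)
  | |- measurable_fun _ (fun x => snd (@?f x)) => apply: (measurableT_comp measurable_snd)
  | |- measurable_fun _ _ => assumption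
  end.

Ltac mfun := repeat (mfun_step; cbv beta).

(** * From equal integrals to pointwise bounds on the continuous side *)

Section compare.
Context (R : realType).
Local Notation leb := (@lebesgue_measure R).
Variables (f : R -> R) (k : R -> \bar R).
Hypothesis cf : {in (posR : set R), continuous f}.
Hypothesis mk : measurable_fun (posR : set R) k.
Hypothesis f0 : forall u, 0 < u -> 0 <= f u.
Hypothesis k0 : forall u, 0 < u -> (0 <= k u)%E.
Hypothesis fk : forall h : R -> \bar R, measurable_fun (posR : set R) h ->
  (forall u, 0 < u -> (0 <= h u)%E) ->
  (\int[leb]_(u in posR) (h u * (f u)%:E) = \int[leb]_(u in posR) (h u * k u))%E.

Let mf : measurable_fun (posR : set R) f.
Proof. by apply: open_continuous_measurable_fun => //; exact: itv_open. Qed.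

Let fkI a b : 0 <= a -> a < b ->
  (\int[leb]_(u in `]a, b[) (f u)%:E = \int[leb]_(u in `]a, b[) k u)%E.
Proof.
move=> a0 ab.
have sub : `]a, b[ `<=` (posR : set R).
  by move=> u; rewrite /= !in_itv/= andbT => /andP[/(le_lt_trans a0)].
have E (q : R -> \bar R) : (\int[leb]_(u in `]a, b[) q u =
    \int[leb]_(u in posR) ((\1_(`]a, b[%classic) u)%:E * q u))%E.
  rewrite integral_mkcond [RHS]integral_mkcond; apply: eq_integral => u _.
  rewrite !patchE; case: ifPn => [uab|uab].
    by rewrite ifT ?indicE ?uab ?mul1e//; move: uab; rewrite !inE; exact: sub.
  by case: ifPn => // _; rewrite indicE (negbTE uab) mul0e.
rewrite !E; apply: fk; last by move=> u _; rewrite lee_fin.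
apply/measurable_EFinP; apply: measurable_funTS.
by apply: measurable_indic; exact: measurable_itv.
Qed.

Let subpos a b : 0 <= a -> `]a, b[ `<=` (posR : set R).
Proof.
by move=> a0 u; rewrite /= !in_itv/= andbT => /andP[/(le_lt_trans a0)].
Qed.

Let nbhd u0 (P : R -> Prop) a b : 0 <= a -> a < u0 <= b -> (\forall u \near f u0, P u) ->
  exists a' b', [/\ a <= a', a' < b', b' <= b & forall u, a' < u < b' -> P (f u)].
Proof.
move=> a0 /andP[au ub] Pf.
have : {for u0, continuous f} by apply: cf; rewrite inE posRE; lra.
move=> /(_ _ Pf) /nbhs_ballP[e /= e0 He].
exists (Num.max a (u0 - e)), (Num.min b (u0 + e)); split.
- by rewrite le_max lexx.
- by rewrite gt_max !lt_min; apply/andP; split; apply/andP; split; lra.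
- by rewrite ge_min lexx.
- move=> u; rewrite gt_max lt_min => /andP[/andP[_ h1] /andP[_ h2]].
  by apply: He; rewrite /ball /= ltr_norml; apply/andP; split; lra.
Qed.

Let integral_cst_itv a b c : a < b ->
  (\int[leb]_(u in `]a, b[) (c%:E) = (c * (b - a))%:E)%E.
Proof.
by move=> ab; rewrite integral_cst//= lebesgue_measure_itv/= lte_fin ab -EFinB.
Qed.

(** If [f] exceeded [K] at a point, continuity would keep it above (K + f u0)/2 on an open
    subinterval, and integrating over it contradicts the bound on [k]. The right end [b] is included
    in the conclusion; this allows a bound on [f u] from values of [k] strictly to the left of
    [u]. *)
Lemma le_of_integral_eq a b K : 0 <= a -> (forall u, a < u < b -> (k u <= K%:E)%E) ->
  forall u, a < u <= b -> f u <= K.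
Proof.
move=> a0 kK u0 uab; rewrite leNgt; apply/negP => Kf.
have [a' [b' [aa' ab' bb' H]]] := @nbhd u0 (fun v => (K + f u0) / 2 <= v) a b a0 uab
  (ltac:(by apply: lt_le_nbhsr; lra)).
have a'0 : 0 <= a' by lra.
have := fkI a'0 ab'.
have mI : measurable (`]a', b'[ : set R) by exact: measurable_itv.
have h1 : (((K + f u0) / 2 * (b' - a'))%:E <= \int[leb]_(u in `]a', b'[) (f u)%:E)%E.
  have Kp : 0 <= (K + f u0) / 2.
    have ku0 : (0 <= k ((a + u0) / 2))%E by apply: k0; lra.
    have := le_trans ku0 (kK _ (ltac:(lra) : a < (a + u0) / 2 < b)).
    by rewrite lee_fin; lra.
  rewrite -integral_cst_itv//; apply: ge0_le_integral => //.
  by apply/measurable_EFinP; apply: measurable_funS mf => //; exact: subpos.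
have h2 : (\int[leb]_(u in `]a', b'[) k u <= (K * (b' - a'))%:E)%E.
  rewrite -integral_cst_itv//; apply: ge0_le_integral => //.
  - by move=> u /(subpos a'0); rewrite posRE => /k0.
  - by apply: measurable_funS mk => //; exact: subpos.
  - by move=> u; rewrite /= in_itv/= => /andP[h3 h4]; apply: kK; lra.
move=> E; move: h2; rewrite -E => /(le_trans h1); rewrite lee_fin.
rewrite ler_pM2r ?subr_gt0//; lra.
Qed.

Lemma ge_of_integral_eq a b K : 0 <= a -> (forall u, a < u < b -> (K%:E <= k u)%E) ->
  forall u, a < u <= b -> K <= f u.
Proof.
move=> a0 kK u0 uab; rewrite leNgt; apply/negP => Kf.
have [a' [b' [aa' ab' bb' H]]] := @nbhd u0 (fun v => v <= (K + f u0) / 2) a b a0 uab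
  (ltac:(by apply: lt_le_nbhsl; lra)).
have a'0 : 0 <= a' by lra.
have := fkI a'0 ab'.
have mI : measurable (`]a', b'[ : set R) by exact: measurable_itv.
have Kp : 0 <= K by have := f0 (ltac:(lra) : 0 < u0); lra.
have h1 : (\int[leb]_(u in `]a', b'[) (f u)%:E <= ((K + f u0) / 2 * (b' - a'))%:E)%E.
  rewrite -integral_cst_itv//; apply: ge0_le_integral => //.
  - by move=> u /(subpos a'0); rewrite posRE lee_fin => /f0.
  - by apply/measurable_EFinP; apply: measurable_funS mf => //; exact: subpos.
have h2 : ((K * (b' - a'))%:E <= \int[leb]_(u in `]a', b'[) k u)%E.
  rewrite -integral_cst_itv//; apply: ge0_le_integral => //.
  - by apply: measurable_funS mk => //; exact: subpos.
  - by move=> u; rewrite /= in_itv/= => /andP[h3 h4]; apply: kK; lra.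
move=> E; move: h2; rewrite -E => /le_trans/(_ h1); rewrite lee_fin.
rewrite ler_pM2r ?subr_gt0//; lra.
Qed.

End compare.

(** * Scaling of the stable density *)

Section integrals_posR.
Context (R : realType).
Local Notation leb := (@lebesgue_measure R).

Lemma integral_posR_scale (a : R) (f : R -> \bar R) : 0 < a ->
  measurable_fun (posR : set R) f -> (forall u : R, 0 < u -> (0 <= f u)%E) ->
  (\int[leb]_(u in posR) f u = a%:E * \int[leb]_(u in posR) f (a * u)%R)%E.
Proof.
move=> a0 mf f0; rewrite (ge0_integral_affine 0 a0)//; last first.
  by move=> u; rewrite posRE => /f0.
congr (_ * _)%E.
rewrite (_ : [set x | posR (a * x + 0)%R] = posR).
  by apply: eq_integral => u _; rewrite addr0.
by apply/seteqP; split => u /=; rewrite !in_itv/= !andbT addr0 pmulr_rgt0.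
Qed.

Lemma integral_posR_shift (v : R) (f : R -> \bar R) :
  measurable_fun (`]v, +oo[ : set R) f -> (forall u : R, v < u -> (0 <= f u)%E) ->
  (\int[leb]_(u in `]v, +oo[) f u = \int[leb]_(u in posR) f (u + v)%R)%E.
Proof.
move=> mf f0; rewrite (ge0_integral_affine v ltr01)//; last first.
  by move=> u; rewrite /= in_itv/= andbT => /f0.
rewrite mul1e (_ : [set x | _] = posR).
  by apply: eq_integral => u _; rewrite mul1r.
by apply/seteqP; split => u /=; rewrite !in_itv/= !andbT mul1r; lra.
Qed.

End integrals_posR.

Section subordinator.
Context (R : realType) (alpha : R) (eta : R -> R -> R).
Local Notation leb := (@lebesgue_measure R).
Hypotheses (alpha_gt0 : 0 < alpha) (alpha_lt2 : alpha < 2).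
Hypothesis etaP : stable_subordinator_density alpha eta.
Local Notation beta := (alpha / 2).

Let beta_gt0 : 0 < beta. Proof. by rewrite divr_gt0. Qed.
Let beta_lt1 : beta < 1. Proof. by rewrite ltr_pdivrMr// mul1r. Qed.

Lemma eta_gt0 t u : 0 < t -> 0 < u -> 0 < eta t u.
Proof. by move=> /etaP[h _ _]; exact: h. Qed.

Lemma eta_ge0 t u : 0 < t -> 0 < u -> 0 <= eta t u.
Proof. by move=> t0 u0; exact/ltW/eta_gt0. Qed.

Lemma eta_continuous t : 0 < t -> {in (posR : set R), continuous (eta t)}.
Proof. by move=> /etaP[_ h _] u; rewrite inE => up; exact: h. Qed.

Lemma measurable_eta t : 0 < t -> measurable_fun (posR : set R) (eta t).
Proof.
move=> t0; apply: open_continuous_measurable_fun; first exact: interval_open.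
exact: eta_continuous.
Qed.

Lemma eta_laplace t s : 0 < t -> 0 < s ->
  (\int[leb]_(u in posR) ((expR (- (s * u)))%:E * (eta t u)%:E) =
   (expR (- (t * s `^ beta)))%:E)%E.
Proof.
move=> t0 s0; have [_ _ h] := etaP t0; rewrite -(h s s0).
by apply: eq_integral => u _; rewrite EFinM.
Qed.

(** Both sides have the Laplace transform e^(-t s^beta), hence equal integrals over intervals;
    continuity upgrades this to every point through the two comparison lemmas. *)
Lemma eta_scaling t u : 0 < t -> 0 < u ->
  eta t u = t `^ (- beta^-1) * eta 1 (t `^ (- beta^-1) * u).
Proof.
move=> t0 u0; set c := t `^ _.
have c0 : 0 < c by exact: powR_gt0.
pose k u := c * eta 1 (c * u).
have ck : {in (posR : set R), continuous k}.
  move=> v; rewrite inE posRE => v0; rewrite /k.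
  apply: cvgMl_tmp; apply: (@continuous_comp _ _ _ (fun u => c * u)).
    by apply: cvgMl_tmp; exact: cvg_id.
  by apply: (eta_continuous ltr01); rewrite inE posRE mulr_gt0.
have k0 (v : R) : 0 < v -> (0 <= (k v)%:E)%E.
  by move=> v0; rewrite lee_fin mulr_ge0 ?(ltW c0)// eta_ge0// mulr_gt0.
have mk : measurable_fun (posR : set R) (fun u => (k u)%:E).
  apply/measurable_EFinP; apply: open_continuous_measurable_fun; [exact: interval_open | exact: ck].
have lap s : 0 < s -> (\int[leb]_(u in posR) ((expR (- (s * u)))%:E * (k u)%:E) =
   (expR (- (t * s `^ beta)))%:E)%E.
  move=> s0; have sc0 : 0 < s / c by rewrite divr_gt0.
  have -> : t * s `^ beta = 1 * (s / c) `^ beta.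
    rewrite mul1r powRM ?ltW ?invr_gt0// mulrC; congr (_ * _).
    rewrite -powR_inv1 ?ltW// /c -!powRrM (_ : - _^-1 * (-1 * _) = 1).
      by rewrite powRr1 ?ltW.
    by field; rewrite gt_eqF.
  rewrite -(eta_laplace ltr01 sc0) [RHS](integral_posR_scale c0); last 2 first.
  - mfun; exact: (measurable_eta ltr01).
  - by move=> v v0; rewrite mule_ge0// lee_fin ?expR_ge0 ?eta_ge0.
  rewrite -ge0_integralZl_EFin ?(ltW c0)//.
  - apply: eq_integral => v _; rewrite -!EFinM /k mulrCA.
    by rewrite (_ : s / c * (c * v) = s * v)//; field; rewrite gt_eqF.
  - move=> v; rewrite posRE => v0; rewrite mule_ge0// lee_fin ?expR_ge0//.
    by rewrite eta_ge0// mulr_gt0.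
  - apply: emeasurable_funM; first by apply: measurable_funTS; mfun.
    have -> : (fun u => (eta 1 (c * u))%:E) = (fun u => c^-1%:E * (k u)%:E)%E.
      by apply/funext => v; rewrite -EFinM /k mulKf// gt_eqF.
    by apply: emeasurable_funM => //; exact: measurable_cst.
have fk (h : R -> \bar R) : measurable_fun (posR : set R) h ->
  (forall u : R, 0 < u -> (0 <= h u)%E) ->
  (\int[leb]_(u in posR) (h u * (eta t u)%:E) =
   \int[leb]_(u in posR) (h u * (k u)%:E))%E.
  apply: laplace_unique => //.
  - by apply/measurable_EFinP; exact: measurable_eta.
  - by move=> v v0; rewrite lee_fin eta_ge0.
  - by move=> s s0; rewrite eta_laplace// ltry.
  - by move=> s s0; rewrite eta_laplace// lap.
have cku : {for u, continuous k} by apply: ck; rewrite inE posRE.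
have etk := eta_continuous t0; have et0 := fun v => @eta_ge0 t v t0.
apply/eqP; rewrite -[X in _ == X]/(k u) eq_le; apply/andP; split; apply/ler_addgt0Pr => e e0.
- have [r /= r0 Hr] := (nbhs_ballP _ _).1 ((@cvgrPdist_lt _ _ _ _ _ _ _).1 cku _ e0).
  apply: (@le_of_integral_eq _ (eta t) (fun v => (k v)%:E) etk mk k0 fk
    (Num.max 0 (u - r)) (u + r)); first by rewrite le_max lexx.
    move=> v; rewrite gt_max => /andP[/andP[v0 v1] v2]; rewrite lee_fin.
    have : ball u r v by rewrite /ball /= ltr_norml; apply/andP; split; lra.
    by move=> /Hr /=; rewrite ltr_norml => /andP[]; lra.
  by rewrite gt_max u0/=; apply/andP; split; rewrite ?ltW; lra.
- have [r /= r0 Hr] := (nbhs_ballP _ _).1 ((@cvgrPdist_lt _ _ _ _ _ _ _).1 cku _ e0).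
  rewrite -lerBlDr.
  apply: (@ge_of_integral_eq _ (eta t) (fun v => (k v)%:E) etk mk et0 fk
    (Num.max 0 (u - r)) (u + r)); first by rewrite le_max lexx.
    move=> v; rewrite gt_max => /andP[/andP[v0 v1] v2]; rewrite lee_fin.
    have : ball u r v by rewrite /ball /= ltr_norml; apply/andP; split; lra.
    by move=> /Hr /=; rewrite ltr_norml => /andP[]; lra.
  by rewrite gt_max u0/=; apply/andP; split; rewrite ?ltW; lra.
Qed.

(** This reduces [eta] to the single function [eta z 1]; joint measurability in [measurable_eta2]
    and the variable [t * v0 r] used later both come from it. *)
Lemma eta_self_similar t u : 0 < t -> 0 < u ->
  eta t u = u^-1 * eta (t * u `^ (- beta)) 1.
Proof.
move=> t0 u0; rewrite eta_scaling// [in RHS]eta_scaling ?mulr_gt0 ?powR_gt0//.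
have -> : (t * u `^ (- beta)) `^ (- beta^-1) = t `^ (- beta^-1) * u.
  rewrite powRM ?powR_ge0 ?ltW// -powRrM mulrNN mulfV ?gt_eqF// powRr1//.
  exact: ltW.
rewrite mulr1; have [t1 u1] : t `^ (- beta^-1) != 0 /\ u != 0.
  by rewrite !gt_eqF ?powR_gt0.
by field.
Qed.

Lemma eta_one_continuous : {in (posR : set R), continuous (fun z => eta z 1)}.
Proof.
move=> z; rewrite inE posRE => z0.
have E : \forall w \near z, w `^ (- beta^-1) * eta 1 (w `^ (- beta^-1)) = eta w 1.
  near=> w; rewrite [RHS]eta_scaling// ?mulr1//.
  by near: w; exact: lt_nbhsr.
rewrite /continuous_at -(nbhs_singleton E).
apply: cvg_trans; first exact: near_eq_cvg E.
have cp : {for z, continuous (fun w : R => w `^ (- beta^-1))}.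
  apply: differentiable_continuous; apply/derivable1_diffP.
  by apply: derivable_powR; rewrite in_itv/= z0.
apply: cvgM => //; apply: (@continuous_comp _ _ _ (fun w : R => w `^ (- beta^-1)) (eta 1)) => //.
by apply: (eta_continuous ltr01); rewrite inE posRE powR_gt0.
Unshelve. all: end_near. Qed.

Lemma measurable_eta_one : measurable_fun (posR : set R) (fun z => eta z 1).
Proof.
apply: open_continuous_measurable_fun; first exact: interval_open.
exact: eta_one_continuous.
Qed.

Lemma measurable_eta2 :
  measurable_fun ((posR : set R) `*` (posR : set R)) (fun tu => eta tu.1 tu.2).
Proof.
apply: (eq_measurable_fun (fun tu : R * R => tu.2^-1 * eta (tu.1 * tu.2 `^ (- beta)) 1)).
  move=> [t u]; rewrite inE => -[]; rewrite !posRE /= => t0 u0.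
  by rewrite -eta_self_similar.
have mD : measurable ((posR : set R) `*` (posR : set R)) by apply: measurableX.
apply: measurable_funM; first by apply: measurable_funTS; mfun.
apply: (measurable_comp (F := (posR : set R)) (f := fun z => eta z 1)).
- exact: measurable_itv.
- move=> y [[t u] [/=]]; rewrite !in_itv/= !andbT => t0 u0 <-.
  by rewrite mulr_gt0// powR_gt0.
- exact: measurable_eta_one.
- by apply: measurable_funTS; mfun.
Qed.

Lemma measurable_eta1 u : 0 < u -> measurable_fun (posR : set R) (fun t => eta t u).
Proof.
move=> u0.
apply: (eq_measurable_fun (fun t : R => u^-1 * eta (t * u `^ (- beta)) 1)).
  by move=> t; rewrite inE posRE => t0; rewrite -eta_self_similar.
apply: measurable_funM; first exact: measurable_cst.
apply: (measurable_comp (F := (posR : set R)) (f := fun z => eta z 1)).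
- exact: measurable_itv.
- move=> y [t /=]; rewrite !in_itv/= !andbT => t0 <-.
  by rewrite mulr_gt0// powR_gt0.
- exact: measurable_eta_one.
- by apply: measurable_funTS; mfun.
Qed.

End subordinator.

(** * Total mass and potential density of the subordinator *)

Section subordinator2.
Context (R : realType) (alpha : R) (eta : R -> R -> R).
Local Notation leb := (@lebesgue_measure R).
Hypotheses (alpha_gt0 : 0 < alpha) (alpha_lt2 : alpha < 2).
Hypothesis etaP : stable_subordinator_density alpha eta.
Local Notation beta := (alpha / 2).

Let beta_gt0 : 0 < beta. Proof. by rewrite divr_gt0. Qed.
Let beta_lt1 : beta < 1. Proof. by rewrite ltr_pdivrMr// mul1r. Qed.

Local Notation eta_gt0 := (eta_gt0 etaP).
Local Notation eta_ge0 := (eta_ge0 etaP).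
Local Notation measurable_eta := (measurable_eta etaP).
Local Notation eta_laplace := (eta_laplace etaP).

(** Monotone convergence in the Laplace transform along s = 1 / (n + 1). *)
Lemma eta_mass t : 0 < t -> (\int[leb]_(u in posR) (eta t u)%:E = 1)%E.
Proof.
move=> t0.
pose g n u := ((expR (- (n.+1%:R^-1 * u)))%:E * (eta t u)%:E)%E.
have g0 n u : posR u -> (0 <= g n u)%E.
  by rewrite posRE => u0; rewrite mule_ge0// lee_fin ?expR_ge0// eta_ge0.
have mg n : measurable_fun (posR : set R) (g n).
  by rewrite /g; mfun; exact: measurable_eta.
have gnd u : posR u -> {homo g^~ u : n m / (n <= m)%N >-> (n <= m)%E}.
  rewrite posRE => u0 n k nk; rewrite /g -!EFinM lee_fin ler_pM2r ?eta_gt0//.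
  by rewrite ler_expR lerN2 ler_pM2r// lef_pV2 ?posrE// ler_nat.
have H := cvg_monotone_convergence (mu := leb) (@measurable_posR R) mg g0 gnd.
have Hl : (\int[leb]_(u in posR) limn (g^~ u) = \int[leb]_(u in posR) (eta t u)%:E)%E.
  apply: eq_integral => u _; apply/cvg_lim => //.
  rewrite -[X in _ --> X]mul1e; apply: cvgeM.
  - by [].
  - apply: cvg_EFin; first exact: nearW.
    have : expR (- (n.+1%:R^-1 * u)) @[n --> \oo] --> expR (- (0 * u)).
      apply: continuous_cvg; first exact: continuous_expR.
      by apply: cvgN; apply: cvgMr_tmp; exact: cvg_harmonic.
    by rewrite mul0r oppr0 expR0.
  - exact: cvg_cst.
rewrite Hl in H; have H2 : (\int[leb]_(u in posR) g n u)%E @[n --> \oo] --> (1 : \bar R)%E.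
  rewrite (_ : (fun n => _) = (fun n => (expR (- (t * n.+1%:R^-1 `^ beta)))%:E)); last first.
    by apply/funext => n; rewrite eta_laplace// invr_gt0.
  apply: cvg_EFin; first exact: nearW.
  have : expR (- (t * n.+1%:R^-1 `^ beta)) @[n --> \oo] --> expR (- (t * 0)).
    apply: continuous_cvg; first exact: continuous_expR.
    apply: cvgN; apply: cvgMl_tmp.
    have /cvg_at_rightP := powR_cvg0 beta_gt0; apply; split.
      by move=> n; rewrite invr_gt0.
    exact: cvg_harmonic.
  by rewrite mulr0 oppr0 expR0.
exact: (cvg_unique _ H H2).
Qed.

Lemma eta_potential u : 0 < u ->
  (\int[leb]_(s in posR) (eta s u)%:E =
   (u `^ (beta - 1))%:E * \int[leb]_(s in posR) (eta s 1)%:E)%E.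
Proof.
move=> u0; have ub0 : 0 < u `^ (- beta) by exact: powR_gt0.
rewrite (integral_posR_scale (a := u `^ beta)) ?powR_gt0//; last 2 first.
- by apply/measurable_EFinP; exact: (measurable_eta1 alpha_gt0).
- by move=> s s0; rewrite lee_fin eta_ge0.
have E s : posR s -> ((eta (u `^ beta * s) u)%:E = u^-1%:E * (eta s 1)%:E)%E.
  rewrite posRE => s0; rewrite (eta_self_similar alpha_gt0) ?mulr_gt0 ?powR_gt0//.
  rewrite -EFinM; congr (_ * eta _ _)%:E.
  rewrite mulrAC -powRD; last by rewrite (gt_eqF u0) implybT.
  by rewrite subrr powRr0 mul1r.
have -> : (\int[leb]_(s in posR) (eta (u `^ beta * s) u)%:E =
    \int[leb]_(s in posR) (u^-1%:E * (eta s 1)%:E))%E.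
  by apply: eq_integral => s /set_mem/E.
rewrite ge0_integralZl_EFin//; last 3 first.
- by move=> s; rewrite posRE => s0; rewrite lee_fin eta_ge0.
- by apply/measurable_EFinP; exact: (measurable_eta1 alpha_gt0).
- by rewrite invr_ge0 ltW.
rewrite muleA -EFinM powRB; last by rewrite (gt_eqF u0) implybT.
by rewrite powRr1// ltW.
Qed.

(** The double integral of e^(-u) eta(s,u) is computed in both orders: integrating in u first gives
    the integral of e^(-s), at most 1; integrating in s first gives [G] times the integral of e^(-u)
    u^(beta - 1), at least e^(-1) [G] by restricting to u < 1. *)
Lemma eta_potential_fin : (\int[leb]_(s in posR) (eta s 1)%:E < +oo)%E.
Proof.
set G := (\int[leb]_(s in posR) (eta s 1)%:E)%E.
have mD : measurable (posR : set R) by exact: measurable_posR.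
have E1 : (\int[leb]_(s in posR)
   \int[leb]_(u in posR) ((expR (- (1 * u)))%:E * (eta s u)%:E) =
   \int[leb]_(u in posR) ((expR (- (1 * u)) * u `^ (beta - 1))%:E * G))%E.
  pose F (su : R * R) := ((expR (- (1 * su.2)))%:E * (eta su.1 su.2)%:E)%E.
  have mF : measurable_fun ((posR : set R) `*` (posR : set R)) F.
    by rewrite /F; mfun; exact: (measurable_eta2 alpha_gt0 etaP).
  have F0 (s u : R) : posR s -> posR u -> (0 <= F (s, u))%E.
    rewrite !posRE => s0 u0.
    by rewrite mule_ge0// lee_fin ?expR_ge0// eta_ge0.
  rewrite (tonelli_on leb leb mD mD mF F0).
  apply: eq_integral => u /set_mem; rewrite posRE => u0 /=.
  rewrite /F/= ge0_integralZl_EFin ?expR_ge0//; last 2 first.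
  - by move=> s; rewrite posRE => s0; rewrite lee_fin eta_ge0.
  - by apply/measurable_EFinP; exact: (measurable_eta1 alpha_gt0).
  by rewrite eta_potential// muleA.
have E2 : (\int[leb]_(s in posR)
   \int[leb]_(u in posR) ((expR (- (1 * u)))%:E * (eta s u)%:E) =
   \int[leb]_(s in posR) (expR (- s))%:E)%E.
  apply: eq_integral => s /set_mem; rewrite posRE => s0.
  by rewrite eta_laplace// powR1 mulr1.
have G0 : (0 <= G)%E.
  by apply: integral_ge0 => s; rewrite posRE => s0; rewrite lee_fin eta_ge0.
have E3 : (\int[leb]_(s in posR) (expR (- s))%:E <= 1)%E.
  rewrite -(integral_exponential_pdf (ltr01 : 0 < 1 :> R)).
  have -> : (\int[leb]_(s in posR) (expR (- s))%:E =
      \int[leb]_(s in posR) (exponential_pdf 1 s)%:E)%E.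
    apply: eq_integral => s /set_mem; rewrite posRE => s0.
    by rewrite exponential_pdfE ?mul1r ?mulN1r// ltW.
  apply: ge0_subset_integral => //.
    by apply/measurable_EFinP; exact: measurable_exponential_pdf.
  by move=> s _; rewrite lee_fin exponential_pdf_ge0.
have E4 : ((expR (- 1))%:E * G <= 1)%E.
  apply: le_trans E3; rewrite -E2 E1.
  have -> : ((expR (-1))%:E * G = \int[leb]_(u in `]0%R, 1%R[) ((expR (-1))%:E * G))%E.
    by rewrite integral_cst//= lebesgue_measure_itv/= lte_fin ltr01 oppr0 adde0 mule1.
  have mk : measurable_fun (posR : set R) (fun u : R => ((expR (- (1 * u)) * u `^ (beta - 1))%:E * G)%E).
    by mfun.
  have sub : `]0%R, 1%R[ `<=` (posR : set R).
    by move=> u /=; rewrite !in_itv/= => /andP[->].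
  apply: (@le_trans _ _ (\int[leb]_(u in `]0%R, 1%R[)
      ((expR (- (1 * u)) * u `^ (beta - 1))%:E * G))%E).
    apply: ge0_le_integral => //.
    - by move=> u _; rewrite mule_ge0// lee_fin expR_ge0.
    - exact: (measurable_funS _ sub mk).
    - move=> u /=; rewrite in_itv/= => /andP[u0 u1]; rewrite lee_wpmul2r// lee_fin.
      rewrite -[leLHS]mulr1 ler_pM ?expR_ge0//; first by rewrite ler_expR; lra.
      rewrite -[leLHS](powRr0 u); apply: ger_powR.
        by rewrite u0 ltW.
      by rewrite subr_le0 ltW.
  apply: ge0_subset_integral => //.
  by move=> u _; rewrite mule_ge0// lee_fin mulr_ge0 ?expR_ge0 ?powR_ge0.
move: G0 E4; clear E1; case: G => [g| |] //.
  by move=> _ _; rewrite ltry.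
by rewrite gt0_muley// lte_fin expR_gt0.
Qed.

End subordinator2.

(** * Power singularities, the Gamma function and the fractional kernel *)

Lemma integral_restrict_support d (T : measurableType d) (R : realType)
    (mu : {measure set T -> \bar R}) (D D' : set T) (f : T -> \bar R) :
  D' `<=` D -> (forall x, D x -> ~ D' x -> f x = 0%E) ->
  (\int[mu]_(x in D) f x = \int[mu]_(x in D') f x)%E.
Proof.
move=> sub f0; rewrite integral_mkcond [RHS]integral_mkcond.
apply: eq_integral => x _; rewrite !patchE.
case: ifPn => [/set_mem Dx|/negP nDx]; case: ifPn => [/set_mem D'x|/negP nD'x] //.
  by apply: f0 => // D'x; apply: nD'x; rewrite inE.
by exfalso; apply: nDx; rewrite inE; exact: sub.
Qed.

Section power_integrals.
Context (R : realType) (b : R).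
Hypotheses (b_gt0 : 0 < b) (b_lt1 : b < 1).
Local Notation leb := (@lebesgue_measure R).

Let c := 1 - b.
Let c0 : 0 < c. Proof. by rewrite subr_gt0. Qed.

Lemma integral_powR_le x : 0 < x ->
  (\int[leb]_(y in `]0%R, x]) (y `^ (- b))%:E <= (x `^ (1 - b) / (1 - b))%:E)%E.
Proof.
move=> x0.
have cpow (p y : R) : 0 < y -> {for y, continuous (fun z : R => z `^ p)}.
  move=> y0; apply: differentiable_continuous; apply/derivable1_diffP.
  by apply: derivable_powR; rewrite in_itv/= y0.
have dF (y : R) : 0 < y -> is_derive y 1 (fun z : R => z `^ c / c) (y `^ (- b)).
  move=> y0; have H := is_derive1_powR c y0.
  have -> : y `^ (- b) = c^-1 *: (c * y `^ (c - 1)).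
    rewrite /GRing.scale/= mulrA mulVf ?gt_eqF// mul1r.
    by congr (_ `^ _); rewrite /c; lra.
  have -> : (fun z : R => z `^ c / c) = c^-1 \*: (fun z : R => z `^ c).
    by apply/funext => z /=; rewrite /GRing.scale/= mulrC.
  exact: is_deriveZ.
(* The integrand is singular at 0, so the primitive is used on segments that exhaust the
   interval. *)
pose F n := (`[x / n.+2%:R, x] : set R)%classic.
have an0 n : 0 < x / n.+2%:R by rewrite divr_gt0.
have anx n : x / n.+2%:R < x.
  by rewrite ltr_pdivrMr// ltr_pMr// ltr1n.
have UF : \bigcup_i F i = `]0%R, x]%classic.
  apply/seteqP; split => y.
    by move=> [n _]; rewrite /F /= !in_itv/= => /andP[h ->]; rewrite (lt_le_trans _ h).
  rewrite /= in_itv/= => /andP[y0 yx].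
  exists (Num.truncn (x / y)) => //; rewrite /F /= in_itv/= yx andbT.
  rewrite ler_pdivrMr// mulrC -ler_pdivrMr//.
  apply: ltW; apply: lt_le_trans (truncnS_gt _) _.
  by rewrite ler_nat.
have mp : measurable_fun setT (fun y : R => (y `^ (- b))%:E) by mfun.
have ndF : nondecreasing_seq F.
  move=> n k nk; apply/subsetPset => y; rewrite /F /= !in_itv/= => /andP[h ->].
  rewrite andbT (le_trans _ h)// ler_pM2l// lef_pV2 ?posrE// ler_nat.
  by rewrite !ltnS.
have H : (\int[leb]_(y in F n) (y `^ (- b))%:E @[n --> \oo] -->
    \int[leb]_(y in \bigcup_i F i) (y `^ (- b))%:E)%E.
  apply: ge0_nondecreasing_set_cvg_integral => //.
  - by move=> n; exact: measurable_itv.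
  - by move=> n; exact: measurable_funTS.
  - by move=> n y _; rewrite lee_fin powR_ge0.
rewrite -UF; rewrite -(cvg_lim _ H)//; apply: lime_le; first exact: cvgP H.
apply: nearW => n.
rewrite (continuous_FTC2 (F := fun z : R => z `^ c / c)) //.
- by rewrite -EFinB lee_fin lerBlDr lerDl divr_ge0 ?powR_ge0// ltW.
- apply: continuous_in_subspaceT => y; rewrite inE/= in_itv/= => /andP[h _].
  by apply: cpow; exact: lt_le_trans h.
- split.
  + move=> y; rewrite in_itv/= => /andP[h _].
    by have [] := dF y (lt_trans (an0 n) h).
  + apply: cvg_at_right_filter; apply: cvgMr_tmp; exact: cpow.
  + apply: cvg_at_left_filter; apply: cvgMr_tmp; exact: cpow.
- move=> y; rewrite in_itv/= => /andP[h _].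
  by rewrite derive1E; have [_ ->] := dF y (lt_trans (an0 n) h).
Qed.

Let G := (\int[leb]_(u in posR) (u `^ (- b) * expR (- u))%:E)%E.

Let mG : measurable_fun setT (fun u : R => (u `^ (- b) * expR (- u))%:E).
Proof. by mfun. Qed.

Let f0 (u : R) : (0 <= (u `^ (- b) * expR (- u))%:E)%E.
Proof. by rewrite lee_fin mulr_ge0 ?powR_ge0 ?expR_ge0. Qed.

Lemma integral_expRN : (\int[leb]_(s in posR) (expR (- s))%:E = 1)%E.
Proof.
rewrite -(integral_exponential_pdf (ltr01 : 0 < 1 :> R)).
have -> : (\int[leb]_(s in posR) (expR (- s))%:E =
      \int[leb]_(s in posR) (exponential_pdf 1 s)%:E)%E.
  apply: eq_integral => s /set_mem; rewrite posRE => s0.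
  by rewrite exponential_pdfE ?mul1r ?mulN1r// ltW.
rewrite [RHS](integral_restrict_support _ (D' := (`[0%R, +oo[%classic : set (measurableTypeR R))))//.
  rewrite integral_itv_obnd_cbnd//; apply/measurable_EFinP.
  by apply: measurable_funTS; exact: measurable_exponential_pdf.
move=> s _ /=; rewrite in_itv/= andbT => /negP; rewrite -ltNge => s0.
by rewrite lt0_exponential_pdf.
Qed.

(** [Gamma] is a real-valued integral, which would be 0 if the extended one were infinite.
    Finiteness is therefore proved first, with the dominator u^(-b) up to 1 and e^(-u) beyond. *)
Lemma Gamma_integral : ((Gamma (1 - b))%:E = G)%E /\ 0 < Gamma (1 - b).
Proof.
have Gfin : (G < +oo)%E.
  have -> : G = (\int[leb]_(u in `]0%R, 1%R] `|` `]1%R, +oo[) (u `^ (- b) * expR (- u))%:E)%E.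
    congr (integral _ _ _); apply/seteqP; split => u /=; rewrite !in_itv/= !andbT.
      by case: (leP u 1) => h u0; [left; rewrite u0 | right].
    by move=> [/andP[]//|]; lra.
  rewrite ge0_integral_setU//=; first last.
  - apply/disj_set2P; apply/seteqP; split => // u /=.
    by rewrite !in_itv/= andbT => -[/andP[_ h1] h2]; lra.
  - by apply: measurable_funTS.
  apply: lte_add_pinfty.
    apply: le_lt_trans (_ : (_ <= (1 `^ (1 - b) / (1 - b))%:E)%E) (ltry _).
    apply: le_trans (integral_powR_le ltr01).
    apply: ge0_le_integral => //=.
    - exact: measurable_funTS.
    - by apply: measurable_funTS; mfun.
    - move=> u; rewrite in_itv/= => /andP[u0 _]; rewrite lee_fin.
      by rewrite ler_piMr ?powR_ge0// -expR0 ler_expR; lra.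
  apply: le_lt_trans (_ : (_ <= 1%:E)%E) (ltry _); rewrite -integral_expRN.
  apply: (@le_trans _ _ (\int[leb]_(u in `]1%R, +oo[) (expR (- u))%:E)%E).
    apply: ge0_le_integral => //=.
    - exact: measurable_funTS.
    - by apply: measurable_funTS; mfun.
    - move=> u; rewrite in_itv/= andbT => u1; rewrite lee_fin.
      rewrite ler_piMl ?expR_ge0// -(powRr0 u); apply: ler_powR; first exact: ltW.
      by rewrite oppr_le0 ltW.
  apply: ge0_subset_integral => //=.
  - by apply: measurable_funTS; mfun.
  - by move=> u /=; rewrite !in_itv/= !andbT; lra.
have E : ((Gamma (1 - b))%:E = G)%E.
  rewrite /Gamma /Rintegral (_ : \int[leb]_(x in posR) _ = G)%E; last first.
    by apply: eq_integral => u _; rewrite (_ : 1 - b - 1 = - b)//; lra.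
  rewrite fineK// ge0_fin_numE//.
  by apply: integral_ge0 => u _.
split => //; rewrite -lte_fin E.
apply: (@lt_le_trans _ _ (\int[leb]_(u in `]0%R, 1%R[) (expR (-1))%:E)%E).
  by rewrite integral_cst//= lebesgue_measure_itv/= lte_fin ltr01 oppr0 adde0 mule1
    lte_fin expR_gt0.
apply: (@le_trans _ _ (\int[leb]_(u in `]0%R, 1%R[) (u `^ (- b) * expR (- u))%:E)%E).
  apply: ge0_le_integral => //=.
  - exact: measurable_funTS.
  - move=> u /=; rewrite in_itv/= => /andP[u0 u1]; rewrite lee_fin.
    rewrite -[leLHS]mul1r ler_pM ?expR_ge0//; last by rewrite ler_expR; lra.
    rewrite -[leLHS](powRr0 u); apply: ger_powR; first by rewrite u0 ltW.
    by rewrite oppr_le0 ltW.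
apply: ge0_subset_integral => //=.
- exact: measurable_funTS.
- by move=> u /=; rewrite !in_itv/= => /andP[->].
Qed.

(* The truncation [Num.max (u - v) 0] works because 0 `^ (- b) = 0. *)
Definition frac_kernel (u v : R) := Num.max (u - v) 0 `^ (- b).

Lemma frac_kernel_ge0 u v : 0 <= frac_kernel u v.
Proof. exact: powR_ge0. Qed.

Lemma frac_kernelE u v : v < u -> frac_kernel u v = (u - v) `^ (- b).
Proof. by move=> vu; rewrite /frac_kernel max_l// subr_ge0 ltW. Qed.

Lemma frac_kernel_eq0 u v : u <= v -> frac_kernel u v = 0.
Proof.
by move=> uv; rewrite /frac_kernel max_r ?subr_le0// powR0// oppr_eq0 gt_eqF.
Qed.

Lemma measurable_frac_kernel d (T : measurableType d) (D : set T) (f g : T -> R) :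
  measurable_fun D f -> measurable_fun D g ->
  measurable_fun D (fun x => frac_kernel (f x) (g x)).
Proof.
move=> mf mg; apply: measurable_fun_powR.
by apply: measurable_maxr; [exact: measurable_funB | exact: measurable_cst].
Qed.

(** Translating by [v] and scaling by 1/s reduces this to the Gamma integral: s^(b - 1) Gamma(1 - b)
    is the transform of u^(-b). *)
Lemma integral_frac_kernel_laplace s v : 0 < s -> 0 < v ->
  (\int[leb]_(u in posR) ((expR (- (s * u)))%:E * (frac_kernel u v)%:E) =
   (expR (- (s * v)) * (s `^ (b - 1) * Gamma (1 - b)))%:E)%E.
Proof.
move=> s0 v0.
have mk : measurable_fun setT (fun u => (expR (- (s * u)))%:E * (frac_kernel u v)%:E)%E.
  mfun; by apply: measurable_frac_kernel; [exact: measurable_id|exact: measurable_cst].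
rewrite (integral_restrict_support _ (D' := (`]v, +oo[%classic : set (measurableTypeR R)))); last 2 first.
- by move=> u /=; rewrite !in_itv/= !andbT; lra.
- move=> u _ /=; rewrite in_itv/= andbT => /negP; rewrite -leNgt => uv.
  by rewrite frac_kernel_eq0// mule0.
rewrite integral_posR_shift; last 2 first.
- exact: measurable_funTS.
- by move=> u _; rewrite mule_ge0// lee_fin ?expR_ge0 ?frac_kernel_ge0.
have -> : (\int[leb]_(u in posR)
     ((expR (- (s * (u + v))))%:E * (frac_kernel (u + v) v)%:E) =
   \int[leb]_(u in posR) ((expR (- (s * v)))%:E * (expR (- (s * u)) * u `^ (- b))%:E))%E.
  apply: eq_integral => u /set_mem; rewrite posRE => u0.
  rewrite frac_kernelE ?ltrDr// addrK -!EFinM mulrA -expRD; congr (expR _ * _)%:E.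
  by ring.
have mk2 : measurable_fun setT (fun u => (expR (- (s * u)) * u `^ (- b))%:E) by mfun.
rewrite ge0_integralZl_EFin ?expR_ge0//; last 2 first.
- by move=> u _; rewrite lee_fin mulr_ge0 ?expR_ge0 ?powR_ge0.
- exact: measurable_funTS.
rewrite [RHS]EFinM; congr (_ * _)%E.
have si0 : 0 < s^-1 by rewrite invr_gt0.
rewrite (integral_posR_scale si0); last 2 first.
- exact: measurable_funTS.
- by move=> u _; rewrite lee_fin mulr_ge0 ?expR_ge0 ?powR_ge0.
have -> : (\int[leb]_(u in posR) (expR (- (s * (s^-1 * u))) * (s^-1 * u) `^ (- b))%:E =
  \int[leb]_(u in posR) ((s `^ b)%:E * (u `^ (- b) * expR (- u))%:E))%E.
  apply: eq_integral => u /set_mem; rewrite posRE => u0.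
  rewrite mulVKf ?gt_eqF// powRM ?ltW// -EFinM mulrC -mulrA; congr (_ * _)%:E.
  by rewrite -powR_inv1 ?ltW// -powRrM mulN1r opprK.
rewrite ge0_integralZl_EFin ?powR_ge0//; last exact: measurable_funTS.
have [GE _] := Gamma_integral; rewrite -/G -GE.
rewrite -!EFinM mulrA; congr (_ * _)%:E.
by rewrite powRB ?(gt_eqF s0) ?implybT// powRr1 ?(ltW s0)// mulrC.
Qed.

End power_integrals.

(** * Derivative of the Laplace transform *)

Section subordinator3.
Context (R : realType) (alpha : R) (eta : R -> R -> R).
Local Notation leb := (@lebesgue_measure R).
Hypotheses (alpha_gt0 : 0 < alpha) (alpha_lt2 : alpha < 2).
Hypothesis etaP : stable_subordinator_density alpha eta.
Local Notation beta := (alpha / 2).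

Let beta_gt0 : 0 < beta. Proof. by rewrite divr_gt0. Qed.
Let beta_lt1 : beta < 1. Proof. by rewrite ltr_pdivrMr// mul1r. Qed.

Local Notation eta_gt0 := (eta_gt0 etaP).
Local Notation eta_ge0 := (eta_ge0 etaP).
Local Notation measurable_eta := (measurable_eta etaP).
Local Notation eta_laplace := (eta_laplace etaP).

(** Minus the derivative in [s] of the Laplace transform, taken under the integral sign on the one
    hand and from the closed form on the other. *)
Lemma eta_laplace_mean t s : 0 < t -> 0 < s ->
  (\int[leb]_(u in posR) ((expR (- (s * u)))%:E * (u * eta t u)%:E) =
   (t * beta * s `^ (beta - 1) * expR (- (t * s `^ beta)))%:E)%E.
Proof.
move=> t0 s0.
pose f (x y : R) := expR (- (x * y)) * eta t y.
(* Dominates y e^(-xy) eta(t,y) for all x > s/2, because y <= (4/s) e^(sy/4). *)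
pose G (y : R) : R := `|4 / s * (expR (- (s / 4 * y)) * eta t y)|.
have intexp (x : R) : 0 < x -> leb.-integrable posR (EFin \o f x).
  move=> x0; apply/integrableP; split.
    by rewrite /f; mfun; exact: measurable_eta.
  rewrite (_ : \int[leb]_(y in posR) _ = (expR (- (t * x `^ beta)))%:E)%E ?ltry//.
  rewrite -eta_laplace//; apply: eq_integral => y /set_mem; rewrite posRE => y0 /=.
  by rewrite ger0_norm ?EFinM// mulr_ge0 ?expR_ge0 ?eta_ge0.
have intG : leb.-integrable posR (EFin \o G).
  have h : leb.-integrable posR (fun y => ((4 / s)%R)%:E * (EFin \o f (s / 4)%R) y)%E.
    by apply: integrableZl => //; apply: intexp; rewrite divr_gt0.
  move: h => /integrable_abse; apply: eq_integrable => //.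
have G_ge0 y : 0 <= G y by exact: normr_ge0.
have df (x y : R) : is_derive x 1 (f ^~ y) (- y * f x y).
  rewrite /f.
  have h1 : is_derive x 1 (fun x => - (x * y)) (- y).
    rewrite (_ : (fun x => - (x * y)) = (- y) \*: id).
      by rewrite -[X in is_derive _ _ _ X]mulr1; exact: is_deriveZ.
    by apply/funext => z /=; rewrite /GRing.scale/= mulrC mulNr.
  have h2 : is_derive x 1 (fun x => expR (- (x * y))) (expR (- (x * y)) * - y).
    have := @is_derive1_comp _ expR (fun x => - (x * y)) x _ _ (is_derive_expR _) h1.
    by [].
  rewrite (_ : (fun x => expR (- (x * y)) * eta t y) =
     (eta t y \*: (fun x => expR (- (x * y))))); last first.
    by apply/funext => z /=; rewrite /GRing.scale/= mulrC.
  rewrite (_ : - y * _ = eta t y *: (expR (- (x * y)) * - y)).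
    exact: is_deriveZ.
  by rewrite /GRing.scale/=; ring.
have Ia : `](s / 2), (s * 2)[%classic s by rewrite /= in_itv/=; apply/andP; split; lra.
have pE x y : partial1of2 f x y = - y * f x y.
  by rewrite partial1of2E; have [_ ->] := df x y.
have ye y : 0 < y -> y <= 4 / s * expR (s / 4 * y).
  move=> y0; have := expR_ge1Dx (s / 4 * y) => h.
  apply: (@le_trans _ _ (4 / s * (s / 4 * y))); last first.
    by rewrite ler_pM2l ?divr_gt0//; lra.
  by rewrite le_eqVlt; apply/orP; left; apply/eqP; field; rewrite gt_eqF.
have Gub x y : `](s / 2), (s * 2)[%classic x -> posR y -> `|partial1of2 f x y| <= G y.
  rewrite /= !in_itv/= andbT => /andP[sx _] y0.
  rewrite pE /G normrM normrN (gtr0_norm y0) ger0_norm; last first.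
    by rewrite mulr_ge0 ?expR_ge0 ?eta_ge0.
  rewrite ger0_norm; last by rewrite !mulr_ge0 ?invr_ge0 ?expR_ge0 ?eta_ge0 ?(ltW s0).
  rewrite /f !mulrA ler_pM2r ?eta_gt0//.
  apply: (@le_trans _ _ (y * expR (- (s / 2 * y)))).
    by rewrite ler_pM2l// ler_expR lerN2 ler_pM2r// ltW.
  apply: (le_trans (ler_wpM2r (expR_ge0 _) (ye _ y0))).
  by rewrite -(mulrA (4 / s)) -expRD ler_pM2l ?divr_gt0// ler_expR; nra.
have H := @differentiation_under_integral R _ _ leb f posR (@measurable_posR R) s
  (s / 2) (s * 2) Ia (fun x hx => intexp x (ltac:(move: hx; rewrite /= in_itv/= => /andP[]; lra)))
  (fun x y _ _ => @ex_derive _ _ _ _ _ _ _ (df x y)) G G_ge0 intG Gub.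
have dL : is_derive s 1 (fun x => expR (- (t * x `^ beta)))
    (- (t * beta * s `^ (beta - 1) * expR (- (t * s `^ beta)))).
  have h1 : is_derive s 1 (fun x => - (t * x `^ beta)) (- (t * (beta * s `^ (beta - 1)))).
    have h := is_derive1_powR beta s0.
    rewrite (_ : (fun x : R => - (t * x `^ beta)) = (- t) \*: (fun x : R => x `^ beta)).
      by rewrite -mulNr; exact: is_deriveZ.
    by apply/funext => z /=; rewrite /GRing.scale/= mulNr.
  have h2 := @is_derive1_comp _ expR (fun x => - (t * x `^ beta)) s _ _ (is_derive_expR _) h1.
  rewrite (_ : - _ = expR (- (t * s `^ beta)) * - (t * (beta * s `^ (beta - 1)))) //.
  by ring.
have LE : \forall x \near s, expR (- (t * x `^ beta)) = \int[leb]_(y in posR) f x y.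
  near=> x; have x0 : 0 < x by near: x; exact: lt_nbhsr.
  rewrite /Rintegral; transitivity (fine (expR (- (t * x `^ beta)))%:E) => //.
  by rewrite -eta_laplace//; congr fine; apply: eq_integral => y _; rewrite EFinM.
move: H; rewrite derive1E -(near_eq_derive _ LE) //.
have [_ ->] := dL.
rewrite /Rintegral => H.
have intp : leb.-integrable posR (fun y => (partial1of2 f s y)%:E).
  apply: le_integrable intG => //.
    apply/measurable_EFinP; rewrite (_ : partial1of2 f s = (fun y => - y * f s y)).
      by rewrite /f; mfun; exact: measurable_eta.
    by apply/funext => y; exact: pE.
  move=> y yp; rewrite lee_fin /=; apply: (le_trans (Gub _ _ Ia yp)).
  by rewrite ger0_norm.
have H2 : (\int[leb]_(y in posR) (partial1of2 f s y)%:E =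
   (- (t * beta * s `^ (beta - 1) * expR (- (t * s `^ beta))))%:E)%E.
  by rewrite H fineK//; exact: integrable_fin_num.
have -> : (\int[leb]_(u in posR) ((expR (- (s * u)))%:E * (u * eta t u)%:E) =
   \int[leb]_(u in posR) - (partial1of2 f s u)%:E)%E.
  by apply: eq_integral => u _; rewrite pE /f -EFinN -EFinM; congr EFin; ring.
rewrite integralN ?H2 ?EFinN ?oppeK//; exact: (integrable_add_def _ intp).
Unshelve. all: end_near. Qed.

End subordinator3.

(** * Convolution equation of the stable density *)

Lemma powR_onem_le4 (R : realType) (b eps : R) : 0 <= b -> b <= 1 ->
  0 <= eps -> eps <= 1 / 2 -> (1 - eps) `^ (- (1 + b)) <= 4.
Proof.
move=> b0 b1 eps0 eps1.
rewrite powRN -[leRHS]invrK lef_pV2 ?posrE ?powR_gt0//; last by lra.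
have -> : 4^-1 = (2^-1 : R) `^ 2.
  by rewrite powR_mulrn// expr2 -invfM; congr (_^-1); lra.
apply: (@le_trans _ _ ((1 - eps) `^ 2)).
  by apply: ge0_ler_powR; rewrite ?nnegrE; lra.
by apply: ger_powR; [apply/andP; split; lra | lra].
Qed.

Section subordinator4.
Context (R : realType) (alpha : R) (eta : R -> R -> R).
Local Notation leb := (@lebesgue_measure R).
Hypotheses (alpha_gt0 : 0 < alpha) (alpha_lt2 : alpha < 2).
Hypothesis etaP : stable_subordinator_density alpha eta.
Local Notation beta := (alpha / 2).

Let beta_gt0 : 0 < beta. Proof. by rewrite divr_gt0. Qed.
Let beta_lt1 : beta < 1. Proof. by rewrite ltr_pdivrMr// mul1r. Qed.

Local Notation eta_gt0 := (eta_gt0 etaP).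
Local Notation eta_ge0 := (eta_ge0 etaP).
Local Notation measurable_eta := (measurable_eta etaP).
Local Notation eta_laplace := (eta_laplace etaP).
Local Notation gam := (Gamma (1 - beta)).

Let gam_gt0 : 0 < gam. Proof. by have [] := Gamma_integral beta_gt0 beta_lt1. Qed.

(** Up to the factor Gamma(1 - beta), the Riemann-Liouville fractional integral of order 1 - beta of
    [eta t]. *)
Definition eta_frac t u : \bar R :=
  (\int[leb]_(v in posR) (frac_kernel beta u v * eta t v)%:E)%E.

Let mD : measurable (posR : set R). Proof. exact: measurable_posR. Qed.

Let mKer t : 0 < t -> measurable_fun ((posR : set R) `*` (posR : set R))
    (fun uv => frac_kernel beta uv.1 uv.2 * eta t uv.2).
Proof.
move=> t0; apply: measurable_funM.
  by apply: measurable_frac_kernel; mfun.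
apply: (measurable_comp (F := (posR : set R)) (f := eta t)) => //.
- by move=> y [[u v] [/= _]]; move=> v0 <-.
- exact: measurable_eta.
- by mfun.
Qed.

Let mKer1 t u : 0 < t -> measurable_fun (posR : set R)
    (fun v => frac_kernel beta u v * eta t v).
Proof.
move=> t0; apply: measurable_funM; last exact: measurable_eta.
by apply: measurable_frac_kernel; mfun.
Qed.

Let Ker0 t u v : 0 < t -> 0 < v -> 0 <= frac_kernel beta u v * eta t v.
Proof. by move=> t0 v0; rewrite mulr_ge0 ?frac_kernel_ge0 ?eta_ge0. Qed.

Lemma eta_frac_ge0 t u : 0 < t -> (0 <= eta_frac t u)%E.
Proof.
by move=> t0; apply: integral_ge0 => v; rewrite posRE => v0; rewrite lee_fin Ker0.
Qed.

Lemma measurable_eta_frac t : 0 < t -> measurable_fun (posR : set R) (eta_frac t).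
Proof.
move=> t0; pose F (uv : R * R) := (frac_kernel beta uv.1 uv.2 * eta t uv.2)%:E.
have mF : measurable_fun ((posR : set R) `*` (posR : set R)) F.
  by apply/measurable_EFinP; exact: mKer.
have F0 (u v : R) : posR u -> posR v -> (0 <= F (u, v))%E.
  by rewrite !posRE => u0 v0; rewrite lee_fin Ker0.
exact: (measurable_tonelli_on leb mD mD mF F0).
Qed.

(** The equation u eta(t,u) = t (beta/Gamma(1 - beta)) int (u - v)^(-beta) eta(t,v) dv in integrated
    form: both sides have the transform t beta s^(beta - 1) e^(-t s^beta). It expresses that the
    Levy density of the subordinator is beta/Gamma(1 - beta) u^(-1-beta). *)
Lemma eta_convolution t (h : R -> \bar R) : 0 < t ->
  measurable_fun (posR : set R) h -> (forall u : R, 0 < u -> (0 <= h u)%E) ->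
  (\int[leb]_(u in posR) (h u * (u * eta t u)%:E) =
   \int[leb]_(u in posR) (h u * ((t * beta / gam)%:E * eta_frac t u)))%E.
Proof.
move=> t0 mh h0.
have C0 : 0 <= t * beta / gam by rewrite ltW// divr_gt0// mulr_gt0.
have lapr s : 0 < s -> (\int[leb]_(u in posR) ((expR (- (s * u)))%:E * ((t * beta / gam)%:E * eta_frac t u)) =
   (t * beta * s `^ (beta - 1) * expR (- (t * s `^ beta)))%:E)%E.
  move=> s0.
  pose F (uv : R * R) := ((expR (- (s * uv.1)) * (frac_kernel beta uv.1 uv.2 * eta t uv.2))%:E).
  have mF : measurable_fun ((posR : set R) `*` (posR : set R)) F.
    apply/measurable_EFinP; apply: measurable_funM; last exact: mKer.
    by mfun.
  have F0 (u v : R) : posR u -> posR v -> (0 <= F (u, v))%E.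
    by rewrite !posRE => u0 v0; rewrite lee_fin mulr_ge0 ?expR_ge0 ?Ker0.
  have E1 : (\int[leb]_(u in posR) ((expR (- (s * u)))%:E * ((t * beta / gam)%:E * eta_frac t u)) =
     (t * beta / gam)%:E * \int[leb]_(u in posR) \int[leb]_(v in posR) F (u, v))%E.
    rewrite -ge0_integralZl_EFin//; last 2 first.
    - by move=> u up; apply: integral_ge0 => v vp; exact: F0.
    - exact: (measurable_tonelli_on leb mD mD mF F0).
    apply: eq_integral => u up; rewrite muleCA; congr (_ * _)%E.
    rewrite /eta_frac -ge0_integralZl_EFin ?expR_ge0//.
    - by move=> v; rewrite posRE => v0; rewrite lee_fin Ker0.
    - by apply/measurable_EFinP; exact: mKer1.
  rewrite E1 (tonelli_on leb leb mD mD mF F0).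
  have E2 : (\int[leb]_(v in posR) \int[leb]_(u in posR) F (u, v) =
     \int[leb]_(v in posR) ((s `^ (beta - 1) * gam)%:E * ((expR (- (s * v)))%:E * (eta t v)%:E)))%E.
    apply: eq_integral => v; rewrite inE posRE => v0.
    transitivity (\int[leb]_(u in posR) ((eta t v)%:E * ((expR (- (s * u)))%:E * (frac_kernel beta u v)%:E)))%E.
      by apply: eq_integral => u _; rewrite /F/= -!EFinM; congr EFin; ring.
    rewrite ge0_integralZl_EFin ?eta_ge0//; last 2 first.
    - by move=> u up; rewrite mule_ge0// lee_fin ?expR_ge0 ?frac_kernel_ge0.
    - apply/measurable_EFinP; apply: measurable_funM; first by mfun.
      by apply: measurable_frac_kernel; mfun.
    rewrite (integral_frac_kernel_laplace beta_gt0 beta_lt1 s0 v0) -!EFinM.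
    by congr EFin; ring.
  rewrite E2 ge0_integralZl_EFin ?mulr_ge0 ?powR_ge0 ?(ltW gam_gt0)//; last 2 first.
  - by move=> u; rewrite posRE => u0; rewrite mule_ge0// lee_fin ?expR_ge0 ?eta_ge0.
  - by mfun; exact: measurable_eta.
  rewrite eta_laplace// -!EFinM; congr EFin; move: gam_gt0; set g := gam => g0.
  by field; rewrite gt_eqF.
apply: laplace_unique => //.
- by mfun; exact: measurable_eta.
- by apply: emeasurable_funM; [exact: measurable_cst | exact: measurable_eta_frac].
- by move=> u u0; rewrite lee_fin mulr_ge0 ?eta_ge0// ltW.
- by move=> u u0; rewrite mule_ge0// eta_frac_ge0.
- by move=> s s0; rewrite (eta_laplace_mean etaP)// ltry.
- by move=> s s0; rewrite (eta_laplace_mean etaP)// lapr.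
Qed.

(** The total mass is 1, and 1 - e^(-x) <= x at x = a^beta. Since 1 - e^(-av) >= 1/2 for v >= 1/a,
    this serves as a bound on the mass beyond 1/a. *)
Lemma eta_tail_laplace (a : R) : 0 < a ->
  (\int[leb]_(v in posR) ((1 - expR (- (a * v))) * eta 1 v)%:E <= (a `^ beta)%:E)%E.
Proof.
move=> a0.
have e1 v : 0 < v -> 0 <= 1 - expR (- (a * v)).
  by move=> v0; rewrite subr_ge0 -expR0 ler_expR oppr_le0 mulr_ge0 ?ltW.
have me := measurable_eta (ltr01 : 0 < 1 :> R).
have E : (\int[leb]_(v in posR) ((1 - expR (- (a * v))) * eta 1 v)%:E +
  \int[leb]_(v in posR) ((expR (- (a * v)))%:E * (eta 1 v)%:E) = 1)%E.
  rewrite -ge0_integralD//.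
  - rewrite -(eta_mass alpha_gt0 etaP ltr01); apply: eq_integral => v _.
    by rewrite -EFinM -EFinD; congr EFin; ring.
  - by move=> v; rewrite posRE => v0; rewrite lee_fin mulr_ge0 ?e1 ?eta_ge0.
  - by mfun.
  - by move=> v; rewrite posRE => v0; rewrite mule_ge0// lee_fin ?expR_ge0 ?eta_ge0.
  - by mfun.
rewrite eta_laplace// in E; rewrite mul1r in E.
have := expR_ge1Dx (- (a `^ beta)).
move: E; case: integral => [x| |]//; rewrite -EFinD => -[E] h.
by rewrite lee_fin; lra.
Qed.

(** For v < u the kernel is at least u^(-beta), and the mass beyond [u] is at most 2 u^(-beta) by
    [eta_tail_laplace] with a = 1/u. *)
Lemma eta_frac_lower (u : R) : 0 < u ->
  ((u `^ (- beta) * (1 - 2 * u `^ (- beta)))%:E <= eta_frac 1 u)%E.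
Proof.
move=> u0; have me := measurable_eta (ltr01 : 0 < 1 :> R).
have i0 : 0 < u^-1 by rewrite invr_gt0.
have T := eta_tail_laplace i0.
set X := (\int[leb]_(v in posR) _)%E in T.
have iub : u^-1 `^ beta = u `^ (- beta).
  by rewrite -powR_inv1 ?ltW// -powRrM mulN1r.
rewrite iub in T.
have X0 v : 0 < v -> 0 <= (1 - expR (- (u^-1 * v))) * eta 1 v.
  move=> v0; rewrite mulr_ge0 ?eta_ge0// subr_ge0 -expR0 ler_expR oppr_le0.
  by rewrite mulr_ge0// ltW.
have E : ((u `^ (- beta))%:E <= eta_frac 1 u + (2 * u `^ (- beta))%:E * X)%E.
  rewrite /X -ge0_integralZl_EFin ?mulr_ge0 ?powR_ge0//; last 2 first.
  - by move=> v; rewrite posRE => v0; rewrite lee_fin X0.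
  - by mfun.
  rewrite /eta_frac -ge0_integralD//; last 4 first.
  - by move=> v; rewrite posRE => v0; rewrite lee_fin Ker0.
  - by apply/measurable_EFinP; exact: mKer1.
  - by move=> v; rewrite posRE => v0; rewrite mule_ge0// lee_fin; [rewrite mulr_ge0 ?powR_ge0 | exact: X0].
  - by mfun.
  have -> : ((u `^ (- beta))%:E = \int[leb]_(v in posR) ((u `^ (- beta))%:E * (eta 1 v)%:E))%E.
    rewrite ge0_integralZl_EFin ?powR_ge0//.
    - by rewrite (eta_mass alpha_gt0 etaP ltr01) mule1.
    - by move=> v; rewrite posRE => v0; rewrite lee_fin eta_ge0.
    - by mfun.
  apply: ge0_le_integral => //.
  - by move=> v; rewrite posRE => v0; rewrite mule_ge0// lee_fin ?powR_ge0 ?eta_ge0.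
  - by mfun.
  - mfun; by apply: measurable_frac_kernel; mfun.
  move=> v; rewrite posRE => v0; rewrite -!EFinM -EFinD lee_fin.
  rewrite [X in _ + X]mulrA -mulrDl ler_pM2r ?eta_gt0//.
  case: (ltP v u) => vu.
    rewrite -[leLHS]addr0 lerD//; last first.
      by rewrite !mulr_ge0 ?powR_ge0// subr_ge0 -expR0 ler_expR oppr_le0 mulr_ge0 ?ltW.
    rewrite frac_kernelE// !powRN lef_pV2 ?posrE ?powR_gt0 ?subr_gt0//.
    apply: ge0_ler_powR; rewrite ?(ltW beta_gt0) ?nnegrE//; lra.
  rewrite -[leLHS]add0r lerD ?frac_kernel_ge0// mulrAC -[leLHS]mul1r ler_wpM2r ?powR_ge0//.
  have e2 : expR (- (u^-1 * v)) <= 2^-1.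
    apply: (@le_trans _ _ (expR (-1))).
      by rewrite ler_expR lerN2 mulrC ler_pdivlMr// mul1r.
    rewrite expRN lef_pV2 ?posrE ?expR_gt0//.
    by have := expR_ge1Dx (1 : R); lra.
  by lra.
have X1 : X \is a fin_num.
  rewrite ge0_fin_numE; first by rewrite (le_lt_trans T)// ltry.
  by apply: integral_ge0 => v; rewrite posRE => v0; rewrite lee_fin X0.
move: E; rewrite -(fineK X1) -EFinM -leeBlDr// -EFinB; apply: le_trans.
rewrite -(fineK X1) lee_fin in T; rewrite lee_fin.
have := powR_ge0 u (- beta); nra.
Qed.

(* Split at [delta u] and [(1 - eps) u]: the mass below [delta u] is at most 1, the
   mass above it is controlled by [eta_tail_laplace], and near [u] the pointwise
   bound [v `^ (- (1 + beta)) * S] is integrated against the singular kernel. *)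
Lemma eta_frac_upper (u eps delta S : R) : 0 < u -> 0 < eps <= 1 / 2 ->
  0 < delta <= 1 / 2 ->
  (forall v, (1 - eps) * u <= v < u -> v `^ (1 + beta) * eta 1 v <= S) ->
  ((u `^ beta)%:E * eta_frac 1 u <= ((1 - delta) `^ (- beta)
    + 2 * (eps * delta) `^ (- beta) * u `^ (- beta)
    + 4 * S * eps `^ (1 - beta) / (1 - beta) * u `^ (- beta))%:E)%E.
Proof.
move=> u0 /andP[eps0 eps1] /andP[del0 del1] HS.
have me := measurable_eta (ltr01 : 0 < 1 :> R).
have eu0 : 0 < eps * u by rewrite mulr_gt0.
have du0 : 0 < delta * u by rewrite mulr_gt0.
have w0 : 0 < (1 - eps) * u by rewrite mulr_gt0//; lra.
have wu : (1 - eps) * u < u by nra.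
have S0 : 0 <= S.
  have /HS : (1 - eps) * u <= (1 - eps) * u < u by rewrite lexx.
  by apply: le_trans; rewrite mulr_ge0 ?powR_ge0 ?eta_ge0.
(* [a1] bounds the kernel below delta u, [a2] is twice its bound from there to (1 - eps) u, and [E]
   bounds [eta 1] on the remaining window; [W] is at least half of [eta 1] beyond delta u. *)
pose a1 := ((1 - delta) * u) `^ (- beta).
pose a2 := 2 * (eps * u) `^ (- beta).
pose W v := (1 - expR (- ((delta * u)^-1 * v))) * eta 1 v.
pose E := S / ((1 - eps) * u) `^ (1 + beta).
pose I : set R := `[(1 - eps) * u, u[%classic.
pose kr := (fun v => frac_kernel beta u v) \_ I.
have E0 : 0 <= E by rewrite divr_ge0 ?powR_ge0.
have W0 v : 0 < v -> 0 <= W v.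
  move=> v0; rewrite mulr_ge0 ?eta_ge0// subr_ge0 -expR0 ler_expR oppr_le0.
  by rewrite mulr_ge0// ?invr_ge0 ltW.
have a10 : 0 <= a1 by exact: powR_ge0.
have a20 : 0 <= a2 by rewrite mulr_ge0 ?powR_ge0.
have kr0 v : 0 <= kr v by rewrite /kr patchE; case: ifP => _ //; exact: frac_kernel_ge0.
have mI : measurable I by exact: measurable_itv.
have mker : measurable_fun setT (fun v => frac_kernel beta u v).
  by apply: measurable_frac_kernel; mfun.
have mkr : measurable_fun setT kr.
  by apply/(measurable_restrictT _ _).1 => //; exact: measurable_funTS.
have ptw v : 0 < v ->
    frac_kernel beta u v * eta 1 v <= a1 * eta 1 v + (a2 * W v + E * kr v).
  move=> v0; have ev := eta_gt0 ltr01 v0; have ev' := ltW ev.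
  have h1 : 0 <= a1 * eta 1 v by rewrite mulr_ge0.
  have h2 : 0 <= a2 * W v by rewrite mulr_ge0 ?W0.
  have h3 : 0 <= E * kr v by rewrite mulr_ge0.
  case: (leP u v) => uv; first by rewrite frac_kernel_eq0// mul0r !addr_ge0.
  case: (leP ((1 - eps) * u) v) => wv.
    have -> : kr v = frac_kernel beta u v.
      by rewrite /kr patchE ifT// inE /I/= in_itv/= wv.
    have : eta 1 v <= E.
      rewrite /E ler_pdivlMr ?powR_gt0// mulrC.
      apply: le_trans (HS v _); last by rewrite wv.
      rewrite ler_pM2r//; apply: ge0_ler_powR; rewrite ?nnegrE ?(ltW v0) ?(ltW w0)//.
      by rewrite addr_ge0 ?ltW.
    move=> /(ler_wpM2l (frac_kernel_ge0 beta u v)).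
    by rewrite [X in _ <= X -> _]mulrC; lra.
  rewrite frac_kernelE//.
  case: (ltP v (delta * u)) => dv.
    have : (u - v) `^ (- beta) <= a1.
      rewrite /a1 !powRN lef_pV2 ?posrE ?powR_gt0 ?subr_gt0//; last by rewrite mulr_gt0//; lra.
      apply: ge0_ler_powR; rewrite ?(ltW beta_gt0) ?nnegrE ?mulr_ge0//; nra.
    by move=> /(ler_wpM2r ev'); lra.
  have hW : 2^-1 * eta 1 v <= W v.
    rewrite /W ler_pM2r//.
    have : expR (- ((delta * u)^-1 * v)) <= 2^-1.
      apply: (@le_trans _ _ (expR (-1))).
        by rewrite ler_expR lerN2 mulrC ler_pdivlMr// mul1r.
      rewrite expRN lef_pV2 ?posrE ?expR_gt0//.
      by have := expR_ge1Dx (1 : R); lra.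
    by lra.
  have : (u - v) `^ (- beta) <= (eps * u) `^ (- beta).
    rewrite !powRN lef_pV2 ?posrE ?powR_gt0 ?subr_gt0//.
    apply: ge0_ler_powR; rewrite ?(ltW beta_gt0) ?nnegrE ?(ltW eu0) ?subr_ge0 ?(ltW uv)//; nra.
  move=> /(ler_wpM2r ev') h4.
  have : a2 * (2^-1 * eta 1 v) <= a2 * W v by rewrite ler_wpM2l.
  have -> : a2 * (2^-1 * eta 1 v) = (eps * u) `^ (- beta) * eta 1 v.
    by rewrite /a2; field.
  by lra.
have T : (\int[leb]_(v in posR) (W v)%:E <= ((delta * u) `^ (- beta))%:E)%E.
  have -> : (delta * u) `^ (- beta) = (delta * u)^-1 `^ beta.
    by rewrite -[in RHS]powR_inv1 ?(ltW du0)// -powRrM mulN1r.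
  by apply: eta_tail_laplace; rewrite invr_gt0.
have Tk : (\int[leb]_(v in posR) (kr v)%:E <= ((eps * u) `^ (1 - beta) / (1 - beta))%:E)%E.
  rewrite (integral_restrict_support _ (D' := (I : set (measurableTypeR R)))); last 2 first.
  - by move=> v; rewrite /I /= !in_itv/= andbT => /andP[+ _]; exact: lt_le_trans.
  - by move=> v _ nI; rewrite /kr patchE memNset.
  rewrite (ge0_integral_reflect u) //; last first.
  - by move=> v _; rewrite lee_fin.
  - by apply/measurable_EFinP; exact: measurable_funTS.
  rewrite (_ : [set x | _] = `]0%R, eps * u]%classic); last first.
    by apply/seteqP; split => v; rewrite /I /= !in_itv/= => /andP[? ?]; apply/andP; split; lra.
  apply: le_trans (integral_powR_le beta_lt1 eu0).
  rewrite le_eqVlt; apply/orP; left; apply/eqP; apply: eq_integral => v.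
  rewrite inE /= in_itv/= => /andP[v0 v1].
  rewrite /kr patchE ifT; last by rewrite inE /I/= in_itv/=; apply/andP; split; lra.
  by rewrite frac_kernelE; [congr ((_ `^ _)%:E); lra | lra].
have K1 : (eta_frac 1 u <= a1%:E + (a2%:E * ((delta * u) `^ (- beta))%:E +
    E%:E * ((eps * u) `^ (1 - beta) / (1 - beta))%:E))%E.
  apply: (@le_trans _ _ (\int[leb]_(v in posR) (a1%:E * (eta 1 v)%:E +
      (a2%:E * (W v)%:E + E%:E * (kr v)%:E)))%E).
    apply: ge0_le_integral => //.
    - by move=> v; rewrite posRE => v0; rewrite lee_fin Ker0.
    - by apply/measurable_EFinP; exact: mKer1.
    - by rewrite /W; mfun; exact: (measurable_funTS mkr).
    - by move=> v; rewrite posRE => v0; rewrite -!EFinM -!EFinD lee_fin ptw.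
  rewrite ge0_integralD//; last 4 first.
  - by move=> v; rewrite posRE => v0; rewrite mule_ge0// lee_fin eta_ge0.
  - by mfun.
  - by move=> v; rewrite posRE => v0; rewrite adde_ge0// mule_ge0// lee_fin ?W0.
  - by rewrite /W; mfun; exact: (measurable_funTS mkr).
  rewrite ge0_integralD//; last 4 first.
  - by move=> v; rewrite posRE => v0; rewrite mule_ge0// lee_fin W0.
  - by rewrite /W; mfun.
  - by move=> v _; rewrite mule_ge0// lee_fin.
  - by mfun; exact: (measurable_funTS mkr).
  have Zl (c : R) (f : R -> R) : 0 <= c -> measurable_fun (posR : set R) f ->
      (forall v, 0 < v -> 0 <= f v) ->
      (\int[leb]_(v in posR) (c%:E * (f v)%:E) = c%:E * \int[leb]_(v in posR) (f v)%:E)%E.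
    move=> c0 mf f0; rewrite ge0_integralZl_EFin//; last exact/measurable_EFinP.
    by move=> v; rewrite posRE => v0; rewrite lee_fin f0.
  have mW : measurable_fun (posR : set R) W by rewrite /W; mfun.
  have mkr' : measurable_fun (posR : set R) kr by exact: measurable_funTS.
  rewrite (Zl _ _ a10 me (fun v => @eta_ge0 1 v ltr01)) (Zl _ _ a20 mW W0).
  rewrite (Zl _ _ E0 mkr' (fun v _ => kr0 v)).
  rewrite (eta_mass alpha_gt0 etaP ltr01) mule1 leeD2l// leeD// lee_wpmul2l//.
have ub0 := powR_gt0 beta u0.
have K2 : ((u `^ beta)%:E * eta_frac 1 u <= (u `^ beta * (a1 +
    (a2 * (delta * u) `^ (- beta) +
     E * ((eps * u) `^ (1 - beta) / (1 - beta)))))%:E)%E.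
  by rewrite EFinM lee_wpmul2l// lee_fin powR_ge0.
apply: (le_trans K2).
rewrite lee_fin !mulrDr addrA.
have uNb : u `^ beta * u `^ (- beta) = 1.
  by rewrite powRN divff// gt_eqF.
rewrite lerD//; first rewrite le_eqVlt; first (apply/orP; left; apply/eqP).
  rewrite /a1 /a2 !powRM ?(ltW u0) ?(ltW eps0) ?(ltW del0)//; last by lra.
  transitivity (u `^ beta * u `^ (- beta) * ((1 - delta) `^ (- beta) +
    2 * (eps `^ (- beta) * delta `^ (- beta)) * u `^ (- beta))); first by ring.
  by rewrite uNb mul1r.
have -> : u `^ beta * (E * ((eps * u) `^ (1 - beta) / (1 - beta))) =
  S * eps `^ (1 - beta) / (1 - beta) * u `^ (- beta) * (1 - eps) `^ (- (1 + beta)).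
  rewrite /E -powRN !powRM ?(ltW u0) ?(ltW eps0)//; last by lra.
  have -> : u `^ (- beta) = u `^ beta * u `^ (- (1 + beta)) * u `^ (1 - beta).
    by rewrite -!powRD ?(gt_eqF u0) ?implybT//; congr (_ `^ _); lra.
  by ring.
have -> : 4 * S * eps `^ (1 - beta) / (1 - beta) * u `^ (- beta) =
  S * eps `^ (1 - beta) / (1 - beta) * u `^ (- beta) * 4 by ring.
apply: ler_wpM2l.
  by rewrite !mulr_ge0 ?powR_ge0 ?invr_ge0 ?subr_ge0 ?(ltW beta_lt1).
exact: powR_onem_le4 (ltW beta_gt0) (ltW beta_lt1) (ltW eps0) eps1.
Qed.

End subordinator4.

(** * Tail of the stable density *)

Lemma powR_small (R : realType) (p e : R) : 0 < p -> 0 < e ->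
  exists2 x : R, 0 < x & forall y, 0 < y <= x -> y `^ p <= e.
Proof.
move=> p0 e0; exists (e `^ p^-1); first exact: powR_gt0.
move=> y /andP[y0 yx]; apply: (@le_trans _ _ ((e `^ p^-1) `^ p)).
  by apply: ge0_ler_powR; rewrite ?nnegrE ?powR_ge0 ?(ltW p0) ?(ltW y0).
by rewrite -powRrM mulVf ?gt_eqF// powRr1// ltW.
Qed.

Lemma powRN_small (R : realType) (p e : R) : 0 < p -> 0 < e ->
  exists2 U : R, 1 <= U & forall u, U <= u -> u `^ (- p) <= e.
Proof.
move=> p0 e0; have [x x0 H] := powR_small p0 e0.
exists (Num.max 1 x^-1); first by rewrite le_max lexx.
move=> u; rewrite ge_max => /andP[u1 ux]; have u0 : 0 < u by lra.
have -> : u `^ (- p) = (u^-1) `^ p.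
  by rewrite -[in RHS]powR_inv1 ?(ltW u0)// -powRrM mulN1r.
apply: H; rewrite invr_gt0 u0/=; rewrite -[x]invrK lef_pV2 ?posrE ?invr_gt0//.
Qed.

Lemma powRN_le1 (R : realType) (p u : R) : 0 <= p -> 1 <= u -> u `^ (- p) <= 1.
Proof.
by move=> p0 u1; rewrite -[leRHS](powRr0 u); apply: ler_powR; rewrite ?oppr_le0.
Qed.

Lemma continuous_powR_at (R : realType) (p y : R) : 0 < y ->
  {for y, continuous (fun z : R => z `^ p)}.
Proof.
move=> y0; apply: differentiable_continuous; apply/derivable1_diffP.
by apply: derivable_powR; rewrite in_itv/= y0.
Qed.

Section subordinator5.
Context (R : realType) (alpha : R) (eta : R -> R -> R).
Local Notation leb := (@lebesgue_measure R).
Hypotheses (alpha_gt0 : 0 < alpha) (alpha_lt2 : alpha < 2).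
Hypothesis etaP : stable_subordinator_density alpha eta.
Local Notation beta := (alpha / 2).
Local Notation gam := (Gamma (1 - beta)).

Let b0 : 0 < beta. Proof. by rewrite divr_gt0. Qed.
Let b1 : beta < 1. Proof. by rewrite ltr_pdivrMr// mul1r. Qed.
Variable C : R.
Hypothesis CE : C = beta / gam.
Let C0 : 0 < C.
Proof. by rewrite CE divr_gt0//; have [] := Gamma_integral b0 b1. Qed.

Local Notation F := (fun u : R => u `^ (1 + beta) * eta 1 u).
Let k (u : R) : \bar R := ((u `^ beta)%:E * (C%:E * eta_frac alpha eta 1 u))%E.

Let cF : {in (posR : set R), continuous F}.
Proof.
move=> u; rewrite inE posRE => u0; apply: cvgM; first exact: continuous_powR_at.
by apply: (eta_continuous etaP ltr01); rewrite inE posRE.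
Qed.

Let mk : measurable_fun (posR : set R) k.
Proof.
rewrite /k; apply: emeasurable_funM; first by mfun.
apply: emeasurable_funM; first by mfun.
exact: (measurable_eta_frac etaP ltr01).
Qed.

Let F0 (u : R) : 0 < u -> 0 <= F u.
Proof. by move=> u0; rewrite mulr_ge0 ?powR_ge0 ?(eta_ge0 etaP). Qed.

Let k0 (u : R) : 0 < u -> (0 <= k u)%E.
Proof.
move=> u0; rewrite mule_ge0 ?lee_fin ?powR_ge0// mule_ge0 ?lee_fin ?(ltW C0)//.
exact: (eta_frac_ge0 etaP).
Qed.

Let Fk (h : R -> \bar R) : measurable_fun (posR : set R) h ->
  (forall u : R, 0 < u -> (0 <= h u)%E) ->
  (\int[leb]_(u in posR) (h u * (F u)%:E) = \int[leb]_(u in posR) (h u * k u))%E.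
Proof.
move=> mh h0.
have := @eta_convolution _ _ _ alpha_gt0 alpha_lt2 etaP 1
  (fun u => (h u * (u `^ beta)%:E)%E) ltr01.
rewrite mul1r -CE => H.
transitivity (\int[leb]_(u in posR) (h u * (u `^ beta)%:E * (u * eta 1 u)%:E))%E.
  apply: eq_integral => u /set_mem; rewrite posRE => u0; rewrite -muleA -EFinM.
  rewrite addrC powRD ?(gt_eqF u0) ?implybT// powRr1 ?(ltW u0)//.
  by congr (_ * _%:E)%E; ring.
rewrite H.
- by apply: eq_integral => u _; rewrite -muleA.
- by apply: emeasurable_funM => //; mfun.
- by move=> u u0; rewrite mule_ge0 ?h0// lee_fin powR_ge0.
Qed.

Let k_upper (u eps delta S : R) : 0 < u -> 0 < eps <= 1 / 2 ->
  0 < delta <= 1 / 2 ->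
  (forall v, (1 - eps) * u <= v < u -> F v <= S) ->
  (k u <= (C * ((1 - delta) `^ (- beta)
    + 2 * (eps * delta) `^ (- beta) * u `^ (- beta)
    + 4 * S * eps `^ (1 - beta) / (1 - beta) * u `^ (- beta)))%:E)%E.
Proof.
move=> u0 he hd HS; have := eta_frac_upper alpha_gt0 alpha_lt2 etaP u0 he hd HS.
rewrite /k muleCA => H; rewrite [leRHS]EFinM; apply: lee_wpmul2l => //.
by rewrite lee_fin ltW.
Qed.

(** A bootstrap. Let c maximize u^(1+beta) eta(1,u) on [1/2, U]. If c > 1, the convolution equation
    with [S = F c] in the window gives F c <= A + F c / 2, since [eps] is chosen to make the
    coefficient of [S] at most 1/2. The resulting bound does not depend on U. The starting point 1/2
    ensures that (1 - eps) v stays in the segment for v > 1. *)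
Lemma eta_tail_bound : exists2 S : R, 0 < S & forall u, 1 / 2 <= u -> F u <= S.
Proof.
have b1' : 0 < 1 - beta by rewrite subr_gt0.
have c0 : 0 < (1 - beta) / (8 * C) by apply: divr_gt0 => //; exact: mulr_gt0.
have [x x0 Hx] := powR_small b1' c0.
pose eps := Num.min (1 / 2) x.
have eps0 : 0 < eps by rewrite lt_min x0 divr_gt0.
have eps1 : eps <= 1 / 2 by rewrite ge_min lexx.
have Heps : 4 * eps `^ (1 - beta) / (1 - beta) * C <= 1 / 2.
  have := Hx eps; rewrite eps0 ge_min lexx orbT => /(_ isT).
  rewrite ler_pdivlMr ?mulr_gt0// => h.
  rewrite mulrAC ler_pdivrMr ?subr_gt0//; lra.
have within (a b : R) : 0 < a -> {within `[a, b], continuous F}.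
  move=> a0; apply: continuous_in_subspaceT => y; rewrite inE/= in_itv/= => /andP[h _].
  by apply: cF; rewrite inE posRE; exact: lt_le_trans h.
have [c1 _ Hc1] := EVT_max (ltac:(lra) : 1 / 2 <= 1 :> R) (within (1 / 2) 1 (ltac:(lra))).
pose A := C * ((1 - 1 / 2) `^ (- beta) + 2 * (eps * (1 / 2)) `^ (- beta)).
have A0 : 0 <= A by rewrite mulr_ge0 ?(ltW C0)// addr_ge0 ?mulr_ge0 ?powR_ge0.
exists (1 + F c1 + 2 * A).
  have : 0 <= F c1 by apply: le_trans (Hc1 1 _); rewrite ?in_itv/= ?lexx ?andbT; [exact: F0 | lra].
  by lra.
move=> u u2.
pose U := Num.max 1 u.
have U1 : 1 <= U by rewrite le_max lexx.
have uU : u <= U by rewrite le_max lexx orbT.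
have [c cU Hc] := EVT_max (ltac:(lra) : 1 / 2 <= U) (within (1 / 2) U (ltac:(lra))).
apply: le_trans (Hc u _) _; first by rewrite in_itv/= u2.
move: cU; rewrite in_itv/= => /andP[c2 cU].
have Fc0 : 0 <= F c by apply: F0; lra.
have Fc10 : 0 <= F c1.
  by apply: le_trans (Hc1 1 _); rewrite ?in_itv/= ?lexx ?andbT; [exact: F0 | lra].
have [c_le1|c_gt1] := leP c 1.
  by have := Hc1 c; rewrite in_itv/= c2 c_le1 => /(_ isT); lra.
have : F c <= A + F c / 2.
  apply: (le_of_integral_eq cF mk k0 Fk (a := 1) (b := U)); [lra | | by rewrite c_gt1].
  move=> v /andP[v1 vU].
  have v0 : 0 < v by lra.
  apply: (le_trans (k_upper (u := v) (eps := eps) (delta := 1 / 2) (S := F c) v0 _ _ _)).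
  - by rewrite eps0.
  - by apply/andP; split; lra.
  - move=> w /andP[w1 w2]; apply: Hc; rewrite in_itv/=; apply/andP; split; last by lra.
    by nra.
  have vb := powRN_le1 (ltW b0) (ltW v1); have vb0 := powR_ge0 v (- beta).
  rewrite lee_fin; set X := 4 * F c * _ / _.
  have X0 : 0 <= X.
    apply: divr_ge0; last exact: ltW.
    by apply: mulr_ge0; [exact: mulr_ge0 | exact: powR_ge0].
  have CX : C * X <= F c / 2.
    have -> : C * X = 4 * eps `^ (1 - beta) / (1 - beta) * C * F c by rewrite /X; ring.
    by apply: (le_trans (ler_wpM2r Fc0 Heps)); rewrite mulrC; lra.
  apply: (@le_trans _ _ (C * ((1 - 1 / 2) `^ (- beta) + 2 * (eps * (1 / 2)) `^ (- beta) + X))).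
    rewrite ler_pM2l// !lerD// ler_piMr// mulr_ge0 ?powR_ge0//.
  by rewrite mulrDr lerD.
by lra.
Qed.

(** Once the function is bounded, every term of the upper bound carrying u^(-beta) vanishes at
    infinity, and only C (1 - delta)^(-beta) with small delta remains; the lower bound is
    [eta_frac_lower]. *)
Lemma eta_tail theta : 0 < theta ->
  exists2 U : R, 1 <= U & forall u, U < u -> `|F u - C| <= theta.
Proof.
move=> th0; have [S S0 HS] := eta_tail_bound.
pose t := theta / (3 * C); have t0 : 0 < t by rewrite divr_gt0 ?mulr_gt0.
pose delta := Num.min (1 / 2) (t / 2).
have d0 : 0 < delta by rewrite lt_min; apply/andP; split; apply: divr_gt0.
have d1 : delta <= 1 / 2 by rewrite ge_min lexx.
have d2 : delta <= t / 2 by rewrite ge_min lexx orbT.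
have Hd : (1 - delta) `^ (- beta) <= 1 + t.
  apply: (@le_trans _ _ ((1 - delta) `^ (- 1))).
    by apply: ger_powR; [apply/andP; split; lra | rewrite lerN2 ltW].
  rewrite powR_inv1 ?subr_ge0; last by lra.
  rewrite -div1r ler_pdivrMr; last by lra.
  have : 0 <= (t / 2 - delta) * 1 by lra.
  have : 0 <= (1 / 2 - delta) * t by rewrite mulr_ge0//; lra.
  by lra.
(* Collects the coefficients of u^(-beta) in the upper bound taken at eps = 1/2; the last 2 serves
   the lower bound. *)
pose K1 := 2 * ((1 / 2) * delta) `^ (- beta) + 4 * S * (1 / 2) `^ (1 - beta) / (1 - beta) + 2.
have K10 : 0 < K1.
  rewrite ltr_wpDl// addr_ge0 ?mulr_ge0 ?powR_ge0 ?invr_ge0 ?subr_ge0 ?(ltW b1) ?(ltW S0)//.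
have [U U1 HU] := powRN_small b0 (ltac:(by rewrite divr_gt0) : 0 < t / K1).
exists U => // u uU.
have small v : U < v -> v `^ (- beta) * K1 <= t.
  by move=> Uv; rewrite -ler_pdivlMr// HU// ltW.
have up : F u <= C * (1 + 2 * t).
  apply: (le_of_integral_eq cF mk k0 Fk (a := U) (b := u)); [lra | | by rewrite uU lexx].
  move=> v /andP[v1 vU]; have v0 : 0 < v by lra.
  apply: (le_trans (k_upper (u := v) (eps := 1 / 2) (delta := delta) (S := S) v0 _ _ _)).
  - by apply/andP; split; lra.
  - by rewrite d0.
  - by move=> w /andP[w1 w2]; apply: HS; lra.
  rewrite lee_fin ler_pM2l//.
  have := small v v1; rewrite /K1 => h; have := powR_ge0 v (- beta) => hv.
  by lra.
have lo : C * (1 - t) <= F u.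
  apply: (ge_of_integral_eq cF mk F0 Fk (a := U) (b := u)); [lra | | by rewrite uU lexx].
  move=> v /andP[v1 vU]; have v0 : 0 < v by lra.
  rewrite /k muleCA [leLHS]EFinM; apply: lee_wpmul2l; first by rewrite lee_fin ltW.
  have vv : v `^ beta * v `^ (- beta) = 1 by rewrite powRN divff// gt_eqF// powR_gt0.
  apply: (@le_trans _ _ ((v `^ beta)%:E * (v `^ (- beta) * (1 - 2 * v `^ (- beta)))%:E)%E).
    rewrite -EFinM lee_fin mulrA vv mul1r lerD2l lerN2.
    have : v `^ (- beta) * 2 <= v `^ (- beta) * K1.
      rewrite ler_wpM2l ?powR_ge0// /K1 lerDr.
      by rewrite addr_ge0 ?mulr_ge0 ?powR_ge0 ?invr_ge0 ?subr_ge0 ?(ltW b1) ?(ltW S0).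
    by have := small v v1; lra.
  rewrite lee_wpmul2l ?lee_fin ?powR_ge0//.
  exact: (eta_frac_lower alpha_gt0 etaP).
have Ct : C * t = theta / 3 by rewrite /t; field; rewrite gt_eqF.
by rewrite ler_norml; apply/andP; split; lra.
Qed.

End subordinator5.

(** * Relative continuity of the map from z to eta(z,1), down to z = 0 *)

Lemma segment_ratio_unif_continuous (R : realType) (g : R -> R) (a b theta : R) :
  0 < a -> {in (posR : set R), continuous g} -> (forall z, 0 < z -> 0 < g z) ->
  0 < theta ->
  exists2 delta : R, 0 < delta & forall z, a <= z <= b ->
    forall w, `|w - 1| <= delta -> `|g (w * z) - g z| <= theta * g z.
Proof.
move=> a0 cg g0 th0.
have /compact_near_coveringP := @segment_compact R a b.
move=> /(_ _ (0^'+) (fun delta z => forall w, `|w - 1| <= delta ->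
  `|g (w * z) - g z| <= theta * g z) _) H.
have : \forall delta \near 0^'+, `[a, b] `<=` (fun z => forall w, `|w - 1| <= delta ->
  `|g (w * z) - g z| <= theta * g z).
  apply: H => x; rewrite /= in_itv/= => /andP[ax _].
  have x0 : 0 < x by exact: lt_le_trans ax.
  have gx0 := g0 _ x0.
  pose e := Num.min (g x / 2) (theta * g x / 4).
  have e0 : 0 < e.
    by rewrite lt_min; apply/andP; split; apply: divr_gt0 => //; exact: mulr_gt0.
  have e1 : e <= g x / 2 by rewrite ge_min lexx.
  have e2 : e <= theta * g x / 4 by rewrite ge_min lexx orbT.
  have : {for x, continuous g} by apply: cg; rewrite inE posRE.
  move=> /cvgrPdist_lt/(_ _ e0)/nbhs_ballP[r /= r0 Hr].
  exists (ball x (Num.min (r / 2) (x / 2)),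
    [set delta | 0 < delta /\ delta < r / (4 * x)]) => /=.
    split.
      by apply: nbhsx_ballx; rewrite lt_min; apply/andP; split; apply: divr_gt0.
    near=> d; split; first by near: d; exact: nbhs_right_gt.
    by near: d; apply: nbhs_right_lt; apply: divr_gt0 => //; exact: mulr_gt0.
  move=> [z d] [/= xz [d0 dr]] w wd.
  move: xz; rewrite /ball/= lt_min !ltr_norml => /andP[/andP[z1 z2] /andP[z3 z4]].
  have Hb (y : R) : x - r < y -> y < x + r -> g x - e < g y /\ g y < g x + e.
    move=> y1 y2; have /Hr : ball x r y by rewrite /ball/= ltr_norml; apply/andP; split; lra.
    by rewrite /= ltr_norml => /andP[h1 h2]; split; lra.
  have [h1 h2] : g x - e < g z /\ g z < g x + e by apply: Hb; lra.
  have dx : d * (4 * x) < r by rewrite -ltr_pdivlMr ?mulr_gt0.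
  move: wd; rewrite ler_norml => /andP[w1 w2].
  have [h3 h4] : g x - e < g (w * z) /\ g (w * z) < g x + e.
    have k1 : 0 <= (d - (w - 1)) * z by apply: mulr_ge0; lra.
    have k2 : 0 <= (d + (w - 1)) * z by apply: mulr_ge0; lra.
    have k3 : 0 <= d * (2 * x - z) by apply: mulr_ge0; lra.
    by apply: Hb; nra.
  have k4 : 0 <= theta * (g z - g x / 2) by apply: mulr_ge0; lra.
  by rewrite ler_norml; apply/andP; split; nra.
move=> Hd; have : \forall delta \near 0^'+, 0 < delta :> R by exact: nbhs_right_gt.
move=> /(filterI Hd)/filter_ex[d [/= H1 d0]].
exists d => // z zab; apply: H1; by rewrite /= in_itv.
Unshelve. all: end_near. Qed.

Section subordinator6.
Context (R : realType) (alpha : R) (eta : R -> R -> R).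
Local Notation leb := (@lebesgue_measure R).
Hypotheses (alpha_gt0 : 0 < alpha) (alpha_lt2 : alpha < 2).
Hypothesis etaP : stable_subordinator_density alpha eta.
Local Notation beta := (alpha / 2).
Local Notation gam := (Gamma (1 - beta)).
Variable C : R.
Hypothesis CE : C = beta / gam.

Let b0 : 0 < beta. Proof. by rewrite divr_gt0. Qed.
Let b1 : beta < 1. Proof. by rewrite ltr_pdivrMr// mul1r. Qed.
Let C0 : 0 < C.
Proof. by rewrite CE divr_gt0//; have [] := Gamma_integral b0 b1. Qed.
Let g0 z : 0 < z -> 0 < eta z 1.
Proof. by move=> z0; exact: (eta_gt0 etaP). Qed.

Lemma eta_one_tail z : 0 < z ->
  eta z 1 = z * ((z `^ (- beta^-1)) `^ (1 + beta) * eta 1 (z `^ (- beta^-1))).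
Proof.
move=> z0; rewrite (eta_scaling alpha_gt0 etaP z0 ltr01) mulr1.
set u := z `^ _; have u0 : 0 < u by exact: powR_gt0.
have zE : z = u `^ (- beta).
  by rewrite /u -powRrM mulrNN mulVf ?gt_eqF// powRr1// ltW.
rewrite [X in _ = X * _]zE mulrA -powRD ?(gt_eqF u0) ?implybT//.
by rewrite addrCA addNr addr0 powRr1// ltW.
Qed.

(** By scaling, z near 0 corresponds to u = z^(-1/beta) near infinity in [eta_tail]. *)
Lemma eta_one_at0 theta : 0 < theta ->
  exists2 z0 : R, 0 < z0 & forall z, 0 < z < z0 -> `|eta z 1 - C * z| <= theta * z.
Proof.
move=> th0; have [U U1 HU] := eta_tail alpha_gt0 alpha_lt2 etaP CE th0.
have U0 : 0 < U by lra.
exists (U `^ (- beta)); first exact: powR_gt0.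
move=> z /andP[z0 zU]; rewrite eta_one_tail// (mulrC C) -mulrBr normrM gtr0_norm//.
rewrite [leRHS]mulrC ler_pM2l//; apply: HU.
have -> : U = (U `^ (- beta)) `^ (- beta^-1).
  by rewrite -powRrM mulrNN mulfV ?gt_eqF// powRr1// ltW.
rewrite !powRN ltf_pV2 ?posrE ?powR_gt0//.
apply: gt0_ltr_powR.
- by rewrite invr_gt0.
- by rewrite nnegrE ltW.
- by rewrite nnegrE invr_ge0 powR_ge0.
- by rewrite -powRN.
by rewrite invr_gt0 powR_gt0.
Qed.

Lemma eta_one_bounds Z : 0 < Z ->
  exists c1 c2 : R, [/\ 0 < c1, 0 < c2 &
    forall z, 0 < z <= Z -> c1 * z <= eta z 1 <= c2 * z].
Proof.
move=> Z0; have C2 : 0 < C / 2 by rewrite divr_gt0.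
have [z0 z00 Hz] := eta_one_at0 C2.
pose a := Num.min (z0 / 2) Z.
have a0 : 0 < a by rewrite lt_min Z0 andbT divr_gt0.
have az : a <= z0 / 2 by rewrite ge_min lexx.
have aZ : a <= Z by rewrite ge_min lexx orbT.
pose q z := eta z 1 / z.
have cq : {within `[a, Z], continuous q}.
  apply: continuous_in_subspaceT => y; rewrite inE/= in_itv/= => /andP[h _].
  have y0 : 0 < y by exact: lt_le_trans h.
  apply: cvgM; first by apply: (eta_one_continuous alpha_gt0 etaP); rewrite inE posRE.
  by apply: cvgV; [rewrite gt_eqF | exact: cvg_id].
have [M MI HM] := EVT_max aZ cq; have [m mI Hm] := EVT_min aZ cq.
have q0 z : 0 < z -> 0 < q z by move=> z1; rewrite divr_gt0// g0.
have pos z : z \in `[a, Z] -> 0 < z.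
  by rewrite in_itv/= => /andP[h _]; exact: lt_le_trans h.
have qm := q0 _ (pos _ mI); have qM := q0 _ (pos _ MI).
exists (Num.min (C / 2) (q m)), (Num.max (2 * C) (q M)); split.
- by rewrite lt_min qm andbT.
- by rewrite lt_max qM orbT.
move=> z /andP[z1 zZ].
suff /andP[h1 h2] : Num.min (C / 2) (q m) <= q z <= Num.max (2 * C) (q M).
  by rewrite -ler_pdivlMr// h1/= -[X in X <= _](divfK (lt0r_neq0 z1)) ler_pM2r.
have [za|za] := ltP z a.
  have := Hz z; rewrite z1 => /(_ (ltac:(lra))).
  rewrite ler_norml => /andP[h1 h2].
  have h3 : C / 2 <= q z by rewrite /q ler_pdivlMr//; lra.
  have h4 : q z <= 2 * C by rewrite /q ler_pdivrMr//; nra.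
  by rewrite ge_min le_max h3 h4.
have zI : z \in `[a, Z] by rewrite in_itv/= za.
by rewrite ge_min le_max Hm// HM// !orbT.
Qed.

(** The relative modulus of continuity is uniform up to z = 0: there the function is close to the
    linear map C z, whose relative variation is that of [w]; away from 0 compactness applies. *)
Lemma eta_one_ratio Z theta : 0 < Z -> 0 < theta ->
  exists2 delta : R, 0 < delta <= 1 / 2 & forall z, 0 < z <= Z ->
    forall w, `|w - 1| <= delta -> `|eta (w * z) 1 - eta z 1| <= theta * eta z 1.
Proof.
move=> Z0 th0; have [c1 [c2 [c10 c20 Hc]]] := eta_one_bounds Z0.
pose th := theta * c1 / 6; have th1 : 0 < th by rewrite divr_gt0 ?mulr_gt0.
have [z0 z00 Hz] := eta_one_at0 th1.
have [d d0 Hd] := @segment_ratio_unif_continuous _ (fun z => eta z 1) (z0 / 2) Z theta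
  (ltac:(by rewrite divr_gt0)) (eta_one_continuous alpha_gt0 etaP) g0 th0.
pose e := theta * c1 / (2 * C); have e0 : 0 < e by rewrite divr_gt0 ?mulr_gt0.
exists (Num.min (1 / 2) (Num.min d e)).
  by rewrite !lt_min d0 e0 ge_min lexx !andbT divr_gt0.
move=> z /andP[z1 zZ] w; rewrite !le_min => /andP[w1 /andP[w2 w3]].
have [zz|zz] := ltP z (z0 / 2); last by apply: Hd => //; rewrite zz.
move: w1; rewrite ler_norml => /andP[w4 w5].
have wz0 : 0 < w * z by apply: mulr_gt0; lra.
have wzz : w * z < z0 by nra.
have h1 := Hz z (ltac:(by rewrite z1/=; lra)).
have h2 := Hz (w * z) (ltac:(by rewrite wz0)).
have h3 : `|C * (w * z) - C * z| <= theta * c1 / 2 * z.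
  have -> : C * (w * z) - C * z = C * z * (w - 1) by ring.
  rewrite normrM gtr0_norm ?mulr_gt0//.
  apply: (le_trans (ler_wpM2l (ltW (mulr_gt0 C0 z1)) w3)).
  by rewrite le_eqVlt; apply/orP; left; apply/eqP; rewrite /e; field; rewrite gt_eqF.
have /andP[h4 _] := Hc z (ltac:(by rewrite z1)).
have h5 : theta * (c1 * z) <= theta * eta z 1 by rewrite ler_pM2l.
have h6 : th * (w * z) <= th * (3 / 2 * z) by rewrite ler_pM2l//; nra.
apply: le_trans h5.
have -> : eta (w * z) 1 - eta z 1 = (eta (w * z) 1 - C * (w * z)) +
   ((C * (w * z) - C * z) + (C * z - eta z 1)) by ring.
apply: (le_trans (ler_normD _ _)); apply: (le_trans (lerD h2 (ler_normD _ _))).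
rewrite (distrC (C * z)); apply: (le_trans (lerD (lexx _) (lerD h3 h1))).
have P0 : 0 <= theta * c1 * z by rewrite !mulr_ge0 ?ltW.
have E6 : th * (3 / 2 * z) = theta * c1 * z / 4 by rewrite /th; field.
have E7 : th * z = theta * c1 * z / 6 by rewrite /th; field.
by rewrite E6 in h6; rewrite E7; lra.
Qed.

End subordinator6.

(** * Laplace's method for a normalized kernel *)

Lemma ge0_le_integral_EFin d (T : measurableType d) (R : realType)
    (mu : {measure set T -> \bar R}) (D : set T) (f g : T -> R) :
  measurable D -> measurable_fun D f -> measurable_fun D g ->
  (forall x, D x -> 0 <= f x) -> (forall x, D x -> f x <= g x) ->
  (\int[mu]_(x in D) (f x)%:E <= \int[mu]_(x in D) (g x)%:E)%E.
Proof.
move=> mD mf mg f0 fg; apply: ge0_le_integral => //.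
- exact/measurable_EFinP.
- exact/measurable_EFinP.
Qed.

Lemma powR_le_expR (R : realType) (p x : R) : 0 < p -> 0 <= x ->
  x `^ p <= p `^ p * expR x.
Proof.
move=> p0 x0; have -> : x = p * (x / p) by field; rewrite gt_eqF.
have xp : 0 <= x / p by rewrite divr_ge0// ltW.
rewrite powRM ?(ltW p0)// ler_wpM2l ?powR_ge0//.
apply: (@le_trans _ _ (expR (x / p) `^ p)).
  apply: ge0_ler_powR; rewrite ?nnegrE ?(ltW p0) ?expR_ge0//.
  by have := expR_ge1Dx (x / p); lra.
by rewrite -expRM (mulrC p).
Qed.

Lemma expRN_powR_small (R : realType) (p c e : R) : 0 <= p -> 0 < c -> 0 < e ->
  exists2 x0 : R, 1 <= x0 & forall x, x0 <= x -> expR (- (c * x)) * x `^ p <= e.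
Proof.
move=> p0 c0 e0; have p1 : 0 < p + 1 by lra.
pose K := ((p + 1) / c) `^ (p + 1).
have K0 : 0 < K by rewrite powR_gt0// divr_gt0.
exists (Num.max 1 (K / e)); first by rewrite le_max lexx.
move=> x; rewrite ge_max => /andP[x1 xK]; have x0 : 0 < x by lra.
have h : x `^ (p + 1) <= K * expR (c * x).
  have := powR_le_expR p1 (ltW (mulr_gt0 c0 x0)).
  rewrite powRM ?(ltW c0) ?(ltW x0)// -ler_pdivlMl ?powR_gt0//.
  move=> /le_trans; apply; rewrite /K powRM ?(ltW p1) ?invr_ge0 ?(ltW c0)//.
  rewrite -[in leRHS](powR_inv1 (ltW c0)) -[in leRHS]powRrM mulN1r powRN.
  by rewrite le_eqVlt; apply/orP; left; apply/eqP; ring.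
rewrite expRN mulrC ler_pdivrMr ?expR_gt0//.
have : x `^ p * x <= e * expR (c * x) * x.
  rewrite -[X in _ * X <= _](powRr1 (ltW x0)) -powRD ?(gt_eqF x0) ?implybT//.
  apply: (le_trans h); rewrite mulrAC ler_wpM2r ?expR_ge0//.
  by move: xK; rewrite ler_pdivrMr// mulrC.
by rewrite ler_pM2r.
Qed.

Lemma powR_near1 (R : realType) (p e : R) : 0 < e ->
  exists2 d : R, 0 < d <= 1 / 2 & forall w, `|w - 1| <= d -> `|w `^ p - 1| <= e.
Proof.
move=> e0; have := @continuous_powR_at R p 1 ltr01.
move=> /cvgrPdist_lt/(_ _ e0)/nbhs_ballP[r /= r0 Hr].
exists (Num.min (1 / 2) (r / 2)).
  by rewrite ge_min lexx andbT lt_min; apply/andP; split; apply: divr_gt0.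
move=> w; rewrite le_min => /andP[_ wr].
have /Hr : ball (1 : R) r w by rewrite /ball/= distrC; apply: le_lt_trans wr _; lra.
by rewrite /= powR1 distrC => /ltW.
Qed.

Section laplace_kernel.
Context (R : realType).
Local Notation leb := (@lebesgue_measure R).

(** With X = kap r, this is the exponential factor of [gauss_weight r] at the point w times the
    saddle point, divided by its value at w = 1. *)
Definition laplace_kernel (X w : R) := expR (- (X / 2 * (w + w^-1 - 2))).
Local Notation kk := laplace_kernel.

Lemma laplace_kernel_ge0 X w : 0 <= kk X w. Proof. exact: expR_ge0. Qed.

Lemma laplace_kernelE X w : 0 < w -> kk X w = expR (- (X * (w - 1) ^+ 2 / (2 * w))).
Proof. by move=> w0; congr expR; field; rewrite gt_eqF. Qed.

Lemma measurable_laplace_kernel X (D : set R) : measurable_fun D (kk X).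
Proof. by apply: measurable_funTS; rewrite /laplace_kernel; mfun. Qed.

Lemma gauss_integral1 (v : R) : 0 < v ->
  (\int[leb]_w (expR (- ((w - 1) ^+ 2 / (2 * v))))%:E = (Num.sqrt (2 * pi * v))%:E)%E.
Proof.
move=> v0; pose s := Num.sqrt v; have s0 : 0 < s by rewrite sqrtr_gt0.
have s2 : s ^+ 2 = v by rewrite sqr_sqrtr// ltW.
have := integral_normal_pdf 1 s.
have E (w : R) : (normal_pdf 1 s w)%:E =
   ((normal_peak s)%:E * (expR (- ((w - 1) ^+ 2 / (2 * v))))%:E)%E.
  rewrite normal_pdfE ?gt_eqF// -EFinM; congr (_ * expR _)%:E.
  by rewrite s2 -mulr_natl mulNr.
under eq_integral do rewrite E.
have p0 : 0 < normal_peak s by rewrite normal_peak_gt0 ?gt_eqF.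
have mg : measurable_fun setT (fun w : R => (expR (- ((w - 1) ^+ 2 / (2 * v))))%:E) by mfun.
have -> : (\int[leb]_w ((normal_peak s)%:E * (expR (- ((w - 1) ^+ 2 / (2 * v))))%:E) =
    (normal_peak s)%:E * \int[leb]_w (expR (- ((w - 1) ^+ 2 / (2 * v))))%:E)%E.
  by apply: ge0_integralZl_EFin => //; exact: ltW.
have -> : Num.sqrt (2 * pi * v) = (normal_peak s)^-1.
  by rewrite /normal_peak invrK s2; congr Num.sqrt; rewrite -mulr_natl; ring.
move=> H; have p1 : (normal_peak s)%:E != 0%E by rewrite eqe gt_eqF.
move: H; case: integral => [x| |].
- by rewrite -EFinM => -[H]; congr EFin; rewrite -[RHS]mulr1 -H mulKf// gt_eqF.
- by rewrite gt0_muley ?lte_fin.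
- by rewrite gt0_muleNy ?lte_fin.
Qed.

Let near (eps : R) : set R := `]1 - eps, 1 + eps[%classic.

(** On the window 2w <= 2(1 + eps), so the kernel lies below a Gaussian of variance (1 + eps)/X;
    extend it to the line and use sqrt(1 + eps) <= 1 + eps. *)
Lemma laplace_kernel_near_upper (eps X : R) : 0 < eps <= 1 / 2 -> 0 < X ->
  (\int[leb]_(w in near eps) (kk X w)%:E <=
   ((1 + eps) * Num.sqrt (2 * pi / X))%:E)%E.
Proof.
move=> /andP[e0 e1] X0; have v0 : 0 < (1 + eps) / X by rewrite divr_gt0//; lra.
apply: (@le_trans _ _ (Num.sqrt (2 * pi * ((1 + eps) / X)))%:E).
  rewrite -gauss_integral1//.
  have mg : measurable_fun setT (fun w : R => (expR (- ((w - 1) ^+ 2 / (2 * ((1 + eps) / X)))))%:E) by mfun.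
  apply: (@le_trans _ _ (\int[leb]_(w in near eps) (expR (- ((w - 1) ^+ 2 / (2 * ((1 + eps) / X)))))%:E)%E).
    apply: ge0_le_integral_EFin.
    - exact: measurable_itv.
    - exact: measurable_laplace_kernel.
    - by mfun.
    - by move=> w _; exact: laplace_kernel_ge0.
    - move=> w; rewrite /near /= in_itv/= => /andP[w1 w2].
      have w0 : 0 < w by lra.
      rewrite laplace_kernelE// ler_expR lerN2.
      have -> : (w - 1) ^+ 2 / (2 * ((1 + eps) / X)) = X * (w - 1) ^+ 2 / (2 * (1 + eps)).
        by field; rewrite !gt_eqF//; lra.
      apply: ler_wpM2l; first by apply: mulr_ge0; [exact: ltW | exact: sqr_ge0].
      by rewrite lef_pV2 ?posrE; lra.
  by apply: ge0_subset_integral => //; exact: measurable_itv.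
have sle : Num.sqrt (1 + eps) <= 1 + eps.
  rewrite -[leRHS](@ger0_norm _ (1 + eps)) -?sqrtr_sqr; last by lra.
  by rewrite ler_wsqrtr// expr2; nra.
have -> : 2 * pi * ((1 + eps) / X) = (1 + eps) * (2 * pi / X) by field; rewrite gt_eqF.
rewrite lee_fin sqrtrM; last by lra.
by rewrite ler_wpM2r// sqrtr_ge0.
Qed.

(* The missing mass of the lower Gaussian bound is controlled by
   [exp (- x) <= exp (- x / 2) exp (- X eps ^ 2 / 4)] off the window. *)
Lemma laplace_kernel_near_lower (eps theta : R) : 0 < eps <= 1 / 2 -> 0 < theta ->
  exists2 X0 : R, 0 < X0 & forall X, X0 <= X ->
  (((1 - eps - theta) * Num.sqrt (2 * pi / X))%:E <=
    \int[leb]_(w in near eps) (kk X w)%:E)%E.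
Proof.
move=> /andP[e0 e1] th0.
have c0 : 0 < eps ^+ 2 / 4 by rewrite divr_gt0// exprn_gt0.
have th2 : 0 < theta / 2 by rewrite divr_gt0.
have [X0 X01 HX] := expRN_powR_small (lexx (0 : R)) c0 th2.
exists X0; first by lra.
move=> X XX; have X1 : 0 < X by lra.
have := HX X XX; rewrite powRr0 mulr1 => tail.
have v0 : 0 < (1 - eps) / X by rewrite divr_gt0//; lra.
have v20 : 0 < (2 * (1 - eps)) / X by rewrite divr_gt0//; lra.
pose gf (w : R) := expR (- ((w - 1) ^+ 2 / (2 * ((1 - eps) / X)))).
pose gf2 (w : R) := expR (- ((w - 1) ^+ 2 / (2 * ((2 * (1 - eps)) / X)))).
have mg : measurable_fun setT gf by rewrite /gf; mfun.
have mg2 : measurable_fun setT gf2 by rewrite /gf2; mfun.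
have mk : measurable_fun setT (kk X) by exact: measurable_laplace_kernel.
pose kn := (kk X) \_ (near eps).
have mkn : measurable_fun setT kn.
  by apply/(measurable_restrictT _ _).1; [exact: measurable_itv | exact: measurable_funTS].
have kn0 w : 0 <= kn w by rewrite /kn patchE; case: ifP => // _; exact: laplace_kernel_ge0.
have ptw w : gf w <= kn w + theta / 2 * gf2 w.
  rewrite /kn patchE; case: ifPn => [|].
    rewrite inE /near/= in_itv/= => /andP[w1 w2]; have w0 : 0 < w by lra.
    rewrite -[leLHS]addr0 lerD//; last by rewrite mulr_ge0 ?expR_ge0 ?(ltW th2).
    rewrite /gf laplace_kernelE// ler_expR lerN2.
    have -> : (w - 1) ^+ 2 / (2 * ((1 - eps) / X)) = X * (w - 1) ^+ 2 / (2 * (1 - eps)).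
      by field; rewrite !gt_eqF//; lra.
    apply: ler_wpM2l; first by apply: mulr_ge0; [exact: ltW | exact: sqr_ge0].
    by rewrite lef_pV2 ?posrE; lra.
  rewrite notin_setE /near/= in_itv/= => /negP; rewrite negb_and -!leNgt => nw.
  have w2 : eps ^+ 2 <= (w - 1) ^+ 2.
    by case/orP: nw => h; rewrite !expr2; nra.
  rewrite add0r; apply: (@le_trans _ _ (expR (- (eps ^+ 2 / 4 * X)) * gf2 w)); last first.
    by rewrite ler_wpM2r// expR_ge0.
  rewrite /gf /gf2 -expRD ler_expR.
  have -> : (w - 1) ^+ 2 / (2 * ((1 - eps) / X)) =
      (w - 1) ^+ 2 / (2 * (2 * (1 - eps) / X)) + X * (w - 1) ^+ 2 / (4 * (1 - eps)).
    by field; rewrite !gt_eqF//; lra.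
  have : eps ^+ 2 / 4 * X <= X * (w - 1) ^+ 2 / (4 * (1 - eps)).
    have X2 := ler_wpM2l (ltW X1) w2.
    apply: (@le_trans _ _ (X * (w - 1) ^+ 2 / 4)); first by lra.
    apply: ler_wpM2l; first by apply: mulr_ge0; [exact: ltW | exact: sqr_ge0].
    by rewrite lef_pV2 ?posrE; lra.
  by lra.
have H : ((Num.sqrt (2 * pi * ((1 - eps) / X)))%:E <=
    \int[leb]_(w in near eps) (kk X w)%:E +
    (theta / 2 * Num.sqrt (2 * pi * (2 * (1 - eps) / X)))%:E)%E.
  rewrite -gauss_integral1// EFinM -gauss_integral1//.
  rewrite -ge0_integralZl_EFin ?(ltW th2)//; last exact/measurable_EFinP.
  have -> : (\int[leb]_(w in near eps) (kk X w)%:E = \int[leb]_w (kn w)%:E)%E.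
    rewrite integral_mkcond; apply: eq_integral => w _.
    by rewrite /kn !patchE; case: ifP.
  rewrite -ge0_integralD//; last 4 first.
  - by move=> w _; rewrite lee_fin.
  - exact/measurable_EFinP.
  - by move=> w _; rewrite mule_ge0// lee_fin ?(ltW th2) ?expR_ge0.
  - by rewrite -/(gf2 _); mfun.
  apply: ge0_le_integral => //.
  - exact/measurable_EFinP.
  - by mfun.
  - by move=> w _; rewrite -EFinM -EFinD lee_fin ptw.
have sge : 1 - eps <= Num.sqrt (1 - eps).
  rewrite -[leLHS](@ger0_norm _ (1 - eps)) -?sqrtr_sqr; last by lra.
  by rewrite ler_wsqrtr// expr2; nra.
have sle : Num.sqrt (2 * (1 - eps)) <= 2.
  rewrite -[leRHS](@ger0_norm _ 2)// -sqrtr_sqr ler_wsqrtr// expr2; lra.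
have E1 : 2 * pi * ((1 - eps) / X) = (1 - eps) * (2 * pi / X) by field; rewrite gt_eqF.
have E2 : 2 * pi * (2 * (1 - eps) / X) = (2 * (1 - eps)) * (2 * pi / X).
  by field; rewrite gt_eqF.
move: H; rewrite E1 E2 (sqrtrM (2 * pi / X) (_ : 0 <= 1 - eps)); last by lra.
rewrite (sqrtrM (2 * pi / X) (_ : 0 <= 2 * (1 - eps))); last by lra.
set I := integral _ _ _; set sX := Num.sqrt (2 * pi / X) => H.
have sX0 : 0 <= sX by exact: sqrtr_ge0.
have : (((1 - eps - theta) * sX)%:E + (theta * sX)%:E <= I + (theta * sX)%:E)%E.
  rewrite -EFinD -mulrDl subrK; apply: (@le_trans _ _ (Num.sqrt (1 - eps) * sX)%:E).
    by rewrite lee_fin ler_wpM2r.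
  apply: (le_trans H); rewrite leeD2l// lee_fin mulrA ler_wpM2r//.
  have := ler_wpM2l (ltW th2) sle; lra.
by rewrite leeD2rE.
Qed.

Lemma laplace_kernel_far (kap p eps : R) : 0 < kap -> 0 < p -> 0 < eps <= 1 / 2 ->
  exists K c X0 : R, [/\ 0 < K, 0 < c, 0 < X0 &
    forall X w, X0 <= X -> 0 < w ->
      w `^ (- p) * expR (w / kap) * kk X w <= K /\
      (eps <= `|w - 1| ->
       w `^ (- p) * expR (w / kap) * kk X w <= K * expR (- (c * X)))].
Proof.
move=> k0 p0 /andP[e0 e1].
(* With this value the exponent w/kap - (X0/2)(w + 1/w - 2) becomes X0 - w - X0/(2w), and X0/2 >= 1
   leaves e^(-1/w) to beat w^(-p) near 0. *)
have [X0 X0E] : exists X0 : R, X0 = 2 / kap + 2 by exists (2 / kap + 2).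
have kap2 : 0 < 2 / kap by rewrite divr_gt0.
have X00 : 0 < X0 by rewrite X0E addr_gt0.
pose c := eps ^+ 2 / 4; have c0 : 0 < c by rewrite divr_gt0// exprn_gt0.
pose K0 := (1 + p `^ p) * expR X0.
have K00 : 0 < K0 by rewrite mulr_gt0 ?expR_gt0// addr_gt0// powR_gt0.
have base w : 0 < w -> w `^ (- p) * expR (w / kap) * kk X0 w <= K0.
  move=> w0; have i0 : 0 < w^-1 by rewrite invr_gt0.
  rewrite -mulrA -expRD.
  have -> : w / kap - X0 / 2 * (w + w^-1 - 2) = X0 + (- w - X0 / 2 * w^-1).
    by rewrite X0E; field; rewrite !gt_eqF.
  rewrite expRD mulrCA /K0 [leRHS]mulrC; apply: ler_wpM2l; first exact: expR_ge0.
  have X2 : 1 <= X0 / 2 by rewrite X0E; lra.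
  have [w1|w1] := leP 1 w.
    have h1 : w `^ (- p) <= 1 by apply: powRN_le1 => //; exact: ltW.
    have h2 : expR (- w - X0 / 2 * w^-1) <= 1.
      rewrite -[leRHS]expR0 ler_expR; have : 0 <= X0 / 2 * w^-1 by apply: mulr_ge0; lra.
      by lra.
    apply: (@le_trans _ _ (1 * 1)); first by rewrite ler_pM ?powR_ge0 ?expR_ge0.
    by rewrite mulr1 lerDl powR_ge0.
  have h1 : w `^ (- p) <= p `^ p * expR w^-1.
    have -> : w `^ (- p) = w^-1 `^ p by rewrite -[in RHS](powR_inv1 (ltW w0)) -powRrM mulN1r.
    exact: powR_le_expR (ltW i0).
  apply: (le_trans (ler_wpM2r (expR_ge0 _) h1)).
  rewrite -(mulrA (p `^ p)) -expRD; apply: (@le_trans _ _ (p `^ p * 1)).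
    rewrite ler_wpM2l ?powR_ge0// -[leRHS]expR0 ler_expR.
    have : 0 <= (X0 / 2 - 1) * w^-1 by apply: mulr_ge0; lra.
    by lra.
  by rewrite mulr1 lerDr.
have split X w : kk X w = kk X0 w * kk (X - X0) w.
  by rewrite -expRD; congr expR; ring.
exists (K0 * expR (c * X0)), c, X0; split => //; first by rewrite mulr_gt0 ?expR_gt0.
move=> X w XX w0; rewrite split mulrA.
have b := base w w0.
split.
  apply: (@le_trans _ _ (K0 * 1)).
    rewrite ler_pM ?mulr_ge0 ?powR_ge0 ?expR_ge0//.
    rewrite laplace_kernelE// -[leRHS]expR0 ler_expR oppr_le0.
    apply: divr_ge0; apply: mulr_ge0 => //; [by rewrite subr_ge0 | exact: sqr_ge0 | exact: ltW].
  rewrite ler_wpM2l ?(ltW K00)// -[leLHS]expR0 ler_expR; apply: mulr_ge0; exact: ltW.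
move=> we; rewrite -[leRHS]mulrA -[in leRHS]expRD ler_pM ?mulr_ge0 ?powR_ge0 ?expR_ge0//.
rewrite laplace_kernelE// ler_expR.
have -> : c * X0 - c * X = - (c * (X - X0)) by ring.
rewrite lerN2 -[leRHS]mulrA [leLHS]mulrC; apply: ler_wpM2l; first by rewrite subr_ge0.
rewrite ler_pdivlMr ?mulr_gt0// /c.
have h : eps ^+ 2 * w <= 2 * (w - 1) ^+ 2.
  move: we; case: (ger0P (w - 1)) => hw we; rewrite !expr2.
    have k1 : 0 <= (w - 1 - eps) * eps by apply: mulr_ge0; lra.
    have k2 : 0 <= (w - 1 - eps) * (w - 1) by apply: mulr_ge0; lra.
    have k3 : 0 <= (1 / 2 - eps) * (eps * (w - 1)).
      by apply: mulr_ge0; [lra | apply: mulr_ge0; lra].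
    have k4 := sqr_ge0 (w - 1); rewrite expr2 in k4.
    by lra.
  have k1 : 0 <= eps * eps * (1 - w) by apply: mulr_ge0; [apply: mulr_ge0; lra | lra].
  have k2 : 0 <= (- (w - 1) - eps) * (1 - w + eps) by apply: mulr_ge0; lra.
  have k3 := sqr_ge0 (w - 1); rewrite expr2 in k3.
  by lra.
by rewrite (_ : eps ^+ 2 / 4 * (2 * w) = eps ^+ 2 * w / 2); [lra | field].
Qed.

End laplace_kernel.

(** * The Gaussian weight around its saddle point *)

Section integral_EFin.
Context d (T : measurableType d) (R : realType).
Variables (mu : {measure set T -> \bar R}) (D : set T).
Hypothesis mD : measurable D.

Lemma ge0_integralZl_fun (c : R) (f : T -> R) : 0 <= c -> measurable_fun D f ->
  (forall x, D x -> 0 <= f x) ->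
  (\int[mu]_(x in D) (c * f x)%:E = c%:E * \int[mu]_(x in D) (f x)%:E)%E.
Proof.
move=> c0 mf f0; under eq_integral do rewrite EFinM.
by rewrite ge0_integralZl_EFin//; exact/measurable_EFinP.
Qed.

Lemma ge0_integralD_fun (f g : T -> R) : measurable_fun D f -> measurable_fun D g ->
  (forall x, D x -> 0 <= f x) -> (forall x, D x -> 0 <= g x) ->
  (\int[mu]_(x in D) (f x + g x)%:E =
   \int[mu]_(x in D) (f x)%:E + \int[mu]_(x in D) (g x)%:E)%E.
Proof.
move=> mf mg f0 g0; under eq_integral do rewrite EFinD.
by rewrite ge0_integralD//; exact/measurable_EFinP.
Qed.

End integral_EFin.

Section window.
Context (R : realType) (a kap : R).
Local Notation leb := (@lebesgue_measure R).
Hypotheses (a_gt0 : 0 < a) (kap_gt0 : 0 < kap).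

Definition gauss_weight (r u : R) :=
  (4 * pi * u) `^ (- a) * expR (- (r ^+ 2 / (4 * u))) * expR (- (kap ^+ 2 * u)).
Local Notation q := gauss_weight.

(* The saddle point of the exponent of [gauss_weight r]. *)
Definition saddle (r : R) := r / (2 * kap).
Local Notation u0 := saddle.

Definition saddle_value (r : R) := (4 * pi * u0 r) `^ (- a) * expR (- (kap * r)).
Local Notation B := saddle_value.

Lemma saddle_gt0 r : 0 < r -> 0 < u0 r.
Proof. by move=> r0; rewrite divr_gt0// mulr_gt0. Qed.

Lemma saddle_value_gt0 r : 0 < r -> 0 < B r.
Proof.
move=> r0; rewrite mulr_gt0 ?expR_gt0// powR_gt0// mulr_gt0 ?saddle_gt0//.
by rewrite mulr_gt0// pi_gt0.
Qed.

Lemma gauss_weight_ge0 r u : 0 <= q r u.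
Proof. by rewrite !mulr_ge0 ?powR_ge0 ?expR_ge0. Qed.

Lemma measurable_gauss_weight r (D : set R) : measurable_fun D (q r).
Proof. by apply: measurable_funTS; rewrite /gauss_weight; mfun. Qed.

Lemma gauss_weightE r w : 0 < r -> 0 < w ->
  q r (u0 r * w) = B r * (w `^ (- a) * laplace_kernel (kap * r) w).
Proof.
move=> r0 w0; rewrite /gauss_weight /saddle_value /laplace_kernel.
have u00 := saddle_gt0 r0.
have p0 : 0 <= 4 * pi * u0 r :> R.
  by apply: mulr_ge0; [apply: mulr_ge0 => //; exact: pi_ge0 | exact: ltW].
rewrite (mulrA (4 * pi)) (powRM _ p0 (ltW w0)) -mulrA -expRD.
rewrite [RHS]mulrACA -expRD; congr (_ * expR _).
by rewrite /saddle; field; rewrite !gt_eqF.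
Qed.

Let near (eps : R) : set R := `]1 - eps, 1 + eps[%classic.

Let scaleE r (f : R -> R) : 0 < r -> measurable_fun (posR : set R) f ->
  (forall u, 0 < u -> 0 <= f u) ->
  (\int[leb]_(u in posR) (f u)%:E =
   \int[leb]_(w in posR) (u0 r * f (u0 r * w))%:E)%E.
Proof.
move=> r0 mf f0; have u00 := saddle_gt0 r0.
rewrite (integral_posR_scale u00); last 2 first.
- exact/measurable_EFinP.
- by move=> u u1; rewrite lee_fin f0.
rewrite -ge0_integralZl_fun//; first exact: ltW.
- apply: (measurable_comp (F := (posR : set R)) (f := f) (g := fun w : R => u0 r * w)) => //.
    by move=> y [w /=]; rewrite !in_itv/= !andbT => w0 <-; rewrite mulr_gt0.
  by mfun.
- by move=> w; rewrite posRE => w0; apply: f0; rewrite mulr_gt0.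
Qed.

Let msc r (f : R -> R) : 0 < r -> measurable_fun (posR : set R) f ->
  measurable_fun (posR : set R) (fun w => f (u0 r * w)).
Proof.
move=> r0 mf; apply: (measurable_comp (F := (posR : set R)) (f := f) (g := fun w : R => u0 r * w)) => //.
  move=> y [w /=]; rewrite !in_itv/= !andbT => w0 <-.
  by rewrite mulr_gt0 ?saddle_gt0.
by mfun.
Qed.

Let mqs r : measurable_fun (posR : set R) (fun w => q r (u0 r * w)).
Proof.
apply: (measurableT_comp (f := q r)); last by mfun.
exact: measurable_gauss_weight.
Qed.

(** The window contributes the Gaussian area times the bound [hi]; the rest is exponentially small
    times the Laplace transform of [f] at 2/r, because e^(-w/kap) equals e^(-(2/r) u) at u = u0 w.
    The function [f] stays general: it will be [eta t], the potential density, and e^(u/r). *)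
Lemma gauss_weight_upper eps : 0 < eps <= 1 / 2 ->
  exists K c X0 : R, [/\ 0 < K, 0 < c, 0 < X0 &
    forall r (f : R -> R) hi, 0 < r -> X0 <= kap * r ->
    measurable_fun (posR : set R) f -> (forall u, 0 < u -> 0 <= f u) -> 0 <= hi ->
    (forall w, `|w - 1| < eps -> w `^ (- a) * (u0 r * f (u0 r * w)) <= hi) ->
    (\int[leb]_(u in posR) (q r u * f u)%:E <=
     (B r * ((1 + eps) * Num.sqrt (2 * pi / (kap * r)) * hi))%:E +
     (B r * (K * expR (- (c * (kap * r)))))%:E *
       \int[leb]_(u in posR) (expR (- (2 / r * u)) * f u)%:E)%E].
Proof.
move=> he; have [K [c [X0 [K0 c0 X00 Hfar]]]] := laplace_kernel_far kap_gt0 a_gt0 he.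
exists K, c, X0; split => // r f hi r0 Xr mf f0 hi0 Hhi.
have u00 := saddle_gt0 r0; have B0 := saddle_value_gt0 r0.
have X1 : 0 < kap * r by exact: mulr_gt0.
have mq : measurable_fun (posR : set R) (q r) by exact: measurable_gauss_weight.
rewrite (scaleE r0); last 2 first.
- exact: measurable_funM.
- by move=> u u1; rewrite mulr_ge0 ?gauss_weight_ge0 ?f0.
rewrite [X in (_ <= _ + _ * X)%E](scaleE r0); last 2 first.
- by apply: measurable_funM => //; mfun.
- by move=> u u1; rewrite mulr_ge0 ?expR_ge0 ?f0.
pose kn := laplace_kernel (kap * r) \_ (near eps).
have kn0 w : 0 <= kn w by rewrite /kn patchE; case: ifP => // _; exact: laplace_kernel_ge0.
have mkn : measurable_fun setT kn.
  apply/(measurable_restrictT _ _).1; first exact: measurable_itv.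
  exact: measurable_laplace_kernel.
pose ef w := u0 r * (expR (- (2 / r * (u0 r * w))) * f (u0 r * w)).
have ef0 w : 0 < w -> 0 <= ef w.
  by move=> w0; rewrite mulr_ge0 ?(ltW u00)// mulr_ge0 ?expR_ge0// f0// mulr_gt0.
have mef : measurable_fun (posR : set R) ef.
  by rewrite /ef; mfun; exact: msc.
have BK0 : 0 <= B r * (K * expR (- (c * (kap * r)))).
  by apply: mulr_ge0; [exact: ltW | apply: mulr_ge0; [exact: ltW | exact: expR_ge0]].
have ptw w : 0 < w -> u0 r * (q r (u0 r * w) * f (u0 r * w)) <=
    (B r * hi) * kn w + (B r * (K * expR (- (c * (kap * r))))) * ef w.
  move=> w0; rewrite gauss_weightE//.
  have f1 : 0 <= f (u0 r * w) by rewrite f0// mulr_gt0.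
  have phi0 : 0 <= u0 r * f (u0 r * w) by rewrite mulr_ge0// ltW.
  have t0 : 0 <= B r * (K * expR (- (c * (kap * r)))) * ef w.
    by apply: mulr_ge0 => //; exact: ef0.
  have -> : u0 r * (B r * (w `^ (- a) * laplace_kernel (kap * r) w) * f (u0 r * w)) =
     B r * (w `^ (- a) * (u0 r * f (u0 r * w)) * laplace_kernel (kap * r) w) by ring.
  rewrite /kn patchE; case: ifPn => [|].
    rewrite inE /near/= in_itv/= => /andP[w1 w2].
    rewrite -[leLHS]addr0 lerD// -[leRHS]mulrA; apply: ler_wpM2l; first exact: ltW.
    rewrite ler_wpM2r ?laplace_kernel_ge0//; apply: Hhi.
    by rewrite ltr_norml; apply/andP; split; lra.
  rewrite notin_setE /near/= in_itv/= => /negP; rewrite negb_and -!leNgt => nw.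
  have we : eps <= `|w - 1|.
    by rewrite ler_normr; case/orP: nw => h; apply/orP; [right|left]; lra.
  have [_ /(_ we) Hf] := Hfar _ _ Xr w0.
  rewrite mulr0 add0r -[leRHS]mulrA; apply: ler_wpM2l; first exact: ltW.
  have -> : w `^ (- a) * (u0 r * f (u0 r * w)) * laplace_kernel (kap * r) w =
     (w `^ (- a) * expR (w / kap) * laplace_kernel (kap * r) w) *
     (expR (- (w / kap)) * (u0 r * f (u0 r * w))).
    rewrite expRN -[RHS]mulrA; have := expR_gt0 (w / kap).
    by set e := expR _ => e0; field; rewrite gt_eqF.
  have -> : ef w = expR (- (w / kap)) * (u0 r * f (u0 r * w)).
    rewrite /ef (_ : 2 / r * (u0 r * w) = w / kap); first by ring.
    by rewrite /saddle; field; rewrite !gt_eqF.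
  by rewrite ler_wpM2r// mulr_ge0// expR_ge0.
apply: (@le_trans _ _ (\int[leb]_(w in posR) ((B r * hi) * kn w +
    (B r * (K * expR (- (c * (kap * r))))) * ef w)%:E)%E).
  apply: ge0_le_integral_EFin; first exact: measurable_itv.
  - by mfun; [exact: mqs | exact: msc].
  - by have mkn' := measurable_funTS (D := posR : set R) mkn; mfun.
  - move=> w; rewrite posRE => w0; rewrite mulr_ge0 ?(ltW u00)//.
    by rewrite mulr_ge0 ?gauss_weight_ge0// f0// mulr_gt0.
  - by move=> w; rewrite posRE; exact: ptw.
rewrite ge0_integralD_fun; first last.
- move=> w; rewrite posRE => w0; by apply: mulr_ge0 => //; exact: ef0.
- by move=> w _; rewrite mulr_ge0// mulr_ge0// ltW.
- by mfun.
- by have mkn' := measurable_funTS (D := posR : set R) mkn; mfun.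
- exact: measurable_itv.
rewrite ge0_integralZl_fun; first last.
- by move=> w _; exact: kn0.
- exact: measurable_funTS.
- by rewrite mulr_ge0// ltW.
- exact: measurable_itv.
rewrite ge0_integralZl_fun; first last.
- by move=> w; rewrite posRE; exact: ef0.
- by [].
- by [].
- exact: measurable_itv.
rewrite leeD2r//.
have -> : B r * ((1 + eps) * Num.sqrt (2 * pi / (kap * r)) * hi) =
   B r * hi * ((1 + eps) * Num.sqrt (2 * pi / (kap * r))) by ring.
rewrite [leRHS]EFinM; apply: lee_wpmul2l.
  by rewrite lee_fin; apply: mulr_ge0 => //; exact: ltW.
apply: le_trans (laplace_kernel_near_upper he X1).
rewrite (integral_restrict_support _ (D' := (near eps : set (measurableTypeR R)))); last 2 first.
- by move=> w; rewrite /near /= !in_itv/= andbT => /andP[w1 _]; have /andP[? ?] := he; lra.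
- by move=> w _ nw; rewrite /kn patchE memNset.
rewrite le_eqVlt; apply/orP; left; apply/eqP; apply: eq_integral => w wn.
by rewrite /kn patchE wn.
Qed.

(** Only the window is kept, the integrand being nonnegative. *)
Lemma gauss_weight_lower eps theta : 0 < eps <= 1 / 2 -> 0 < theta ->
  exists2 X0 : R, 0 < X0 &
    forall r (f : R -> R) lo, 0 < r -> X0 <= kap * r ->
    measurable_fun (posR : set R) f -> (forall u, 0 < u -> 0 <= f u) -> 0 <= lo ->
    (forall w, `|w - 1| < eps -> lo <= w `^ (- a) * (u0 r * f (u0 r * w))) ->
    ((B r * ((1 - eps - theta) * Num.sqrt (2 * pi / (kap * r)) * lo))%:E <=
     \int[leb]_(u in posR) (q r u * f u)%:E)%E.
Proof.
move=> he th0; have [X0 X00 HX] := laplace_kernel_near_lower he th0.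
exists X0 => // r f lo r0 Xr mf f0 lo0 Hlo.
have u00 := saddle_gt0 r0; have B0 := saddle_value_gt0 r0.
have mq : measurable_fun (posR : set R) (q r) by exact: measurable_gauss_weight.
rewrite (scaleE r0); last 2 first.
- exact: measurable_funM.
- by move=> u u1; rewrite mulr_ge0 ?gauss_weight_ge0 ?f0.
have sub : near eps `<=` (posR : set R).
  by move=> w; rewrite /near /= !in_itv/= andbT => /andP[w1 _]; have /andP[? ?] := he; lra.
have mI : measurable (near eps) by exact: measurable_itv.
have mint : measurable_fun (posR : set R) (fun w => u0 r * (q r (u0 r * w) * f (u0 r * w))).
  by mfun; [exact: mqs | exact: msc].
have int0 w : posR w -> 0 <= u0 r * (q r (u0 r * w) * f (u0 r * w)).
  rewrite posRE => w0; rewrite mulr_ge0 ?(ltW u00)//.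
  by rewrite mulr_ge0 ?gauss_weight_ge0// f0// mulr_gt0.
apply: (@le_trans _ _ (\int[leb]_(w in near eps) (u0 r * (q r (u0 r * w) * f (u0 r * w)))%:E)%E); last first.
  apply: ge0_subset_integral => //.
  exact/measurable_EFinP.
apply: (@le_trans _ _ (\int[leb]_(w in near eps) ((B r * lo) * laplace_kernel (kap * r) w)%:E)%E).
  rewrite ge0_integralZl_fun; first last.
  - by move=> w _; exact: laplace_kernel_ge0.
  - exact: measurable_laplace_kernel.
  - by rewrite mulr_ge0// ltW.
  - exact: measurable_itv.
  have -> : B r * ((1 - eps - theta) * Num.sqrt (2 * pi / (kap * r)) * lo) =
     B r * lo * ((1 - eps - theta) * Num.sqrt (2 * pi / (kap * r))) by ring.
  rewrite [leLHS]EFinM; apply: lee_wpmul2l; last exact: HX.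
  by rewrite lee_fin; apply: mulr_ge0 => //; exact: ltW.
apply: ge0_le_integral_EFin; first exact: measurable_itv.
- by mfun; exact: measurable_laplace_kernel.
- exact: measurable_funS sub mint.
- by move=> w _; rewrite mulr_ge0 ?laplace_kernel_ge0// mulr_ge0// ltW.
move=> w wI; have := sub _ wI; rewrite posRE => w0.
rewrite gauss_weightE//.
have -> : u0 r * (B r * (w `^ (- a) * laplace_kernel (kap * r) w) * f (u0 r * w)) =
   B r * (w `^ (- a) * (u0 r * f (u0 r * w)) * laplace_kernel (kap * r) w) by ring.
rewrite -[leLHS]mulrA; apply: ler_wpM2l; first exact: ltW.
apply: ler_wpM2r; first exact: laplace_kernel_ge0.
apply: Hlo; move: wI; rewrite /near/= in_itv/= => /andP[w1 w2].
by rewrite ltr_norml; apply/andP; split; lra.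
Qed.

Lemma gauss_weight_sup : exists K X0 : R, [/\ 0 < K, 0 < X0 &
  forall r u, 0 < r -> X0 <= kap * r -> 0 < u ->
    q r u <= K * B r * expR (- (2 / r * u))].
Proof.
have h2 : 0 < (1 / 2 : R) <= 1 / 2 by apply/andP; split => //; lra.
have [K [c [X0 [K0 c0 X00 Hfar]]]] := laplace_kernel_far kap_gt0 a_gt0 h2.
exists K, X0; split => // r u r0 Xr u1.
have u00 := saddle_gt0 r0; have B0 := saddle_value_gt0 r0.
have uE : u = u0 r * (u / u0 r) by rewrite mulrC divfK// gt_eqF.
have w0 : 0 < u / u0 r by rewrite divr_gt0.
have [Hf _] := Hfar _ _ Xr w0.
have -> : 2 / r * u = (u / u0 r) / kap.
  by rewrite /saddle; field; rewrite !gt_eqF.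
rewrite {1}uE gauss_weightE//; move: (u / u0 r) w0 Hf => w w0 Hf.
rewrite (mulrC K) -[leRHS]mulrA; apply: ler_wpM2l; first exact: ltW.
by rewrite expRN ler_pdivlMr ?expR_gt0// mulrAC.
Qed.

End window.

(** * The mixture at a fixed time *)

Section perturbation.
Variable R : realDomainType.
Implicit Types e g W G : R.

Lemma perturb_mul e g W G : 0 <= e <= 1 -> 0 <= g -> `|W - 1| <= e ->
  `|G - g| <= e * g ->
  (1 - e) * ((1 - e) * g) <= W * G <= (1 + e) * ((1 + e) * g).
Proof.
rewrite !ler_norml => /andP[e0 e1] g0 /andP[w1 w2] /andP[g1 g2].
have f1 : 0 <= (1 - e) * g by apply: mulr_ge0 => //; lra.
by apply/andP; split; apply: ler_pM; lra.
Qed.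

End perturbation.

Lemma perturb_const (R : realFieldType) (eps e th : R) :
  0 < eps -> eps <= e -> e = th / 8 -> th <= 1 ->
  1 - th <= (1 - eps - e) * (1 - e) * (1 - e) /\ (1 + eps) * (1 + e) * (1 + e) <= 1 + th.
Proof.
move=> e0 ee eE t1.
have h : 1 - 2 * e <= (1 - e) * (1 - e) <= 1 by apply/andP; split; nra.
have h' : 1 <= (1 + e) * (1 + e) <= 1 + 3 * e by apply/andP; split; nra.
rewrite -!mulrA; move: h h'.
move: ((1 - e) * (1 - e)) ((1 + e) * (1 + e)) => x y /andP[x1 x2] /andP[y1 y2].
by split; nra.
Qed.

Section mixture.
Context (R : realType) (alpha a kap : R) (eta : R -> R -> R).
Local Notation leb := (@lebesgue_measure R).
Hypotheses (alpha_gt0 : 0 < alpha) (alpha_lt2 : alpha < 2).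
Hypothesis etaP : stable_subordinator_density alpha eta.
Hypotheses (a_gt0 : 0 < a) (kap_gt0 : 0 < kap).
Local Notation beta := (alpha / 2).
Local Notation q := (gauss_weight a kap).
Local Notation u0 := (saddle kap).
Local Notation B := (saddle_value a kap).

Let beta_gt0 : 0 < beta. Proof. by rewrite divr_gt0. Qed.

(** For a = d/2 and kap = m^(1/alpha), the density of the relativistic stable process at y is e^(mt)
    times this value at r = |y|. *)
Definition mixture (r t : R) := (\int[leb]_(u in posR) (q r u * eta t u)%:E)%E.
Local Notation Phi := mixture.

(* Laplace's method: the integral of [q r] concentrates near [u0 r], where
   the exponent has second derivative [kap * r / u0 r ^+ 2]. *)
Definition saddle_area (r : R) := B r * Num.sqrt (2 * pi / (kap * r)).
Local Notation A := saddle_area.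

(** By self-similarity eta(t, u0) = eta(t v0, 1) / u0, so t v0 is the rescaled time on which the
    mixture depends. *)
Definition time_scale (r : R) := u0 r `^ (- beta).
Local Notation v0 := time_scale.

Lemma saddle_area_gt0 r : 0 < r -> 0 < A r.
Proof.
move=> r0; rewrite mulr_gt0 ?saddle_value_gt0// sqrtr_gt0 divr_gt0 ?mulr_gt0//.
exact: pi_gt0.
Qed.

Lemma time_scale_gt0 r : 0 < r -> 0 < v0 r.
Proof. by move=> r0; rewrite powR_gt0// saddle_gt0. Qed.

Lemma mixture_ge0 r t : 0 < t -> (0 <= Phi r t)%E.
Proof.
move=> t0; apply: integral_ge0 => u; rewrite posRE => u1.
by rewrite lee_fin mulr_ge0 ?gauss_weight_ge0 ?(eta_ge0 etaP).
Qed.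

Lemma measurable_mixture r : measurable_fun (posR : set R) (Phi r).
Proof.
pose F (tu : R * R) := (q r tu.2 * eta tu.1 tu.2)%:E.
have mD : measurable (posR : set R) by exact: measurable_itv.
have mF : measurable_fun ((posR : set R) `*` (posR : set R)) F.
  apply/measurable_EFinP/measurable_funM; last exact: measurable_eta2 alpha_gt0 etaP.
  by apply: (measurableT_comp (f := q r)); [exact: measurable_gauss_weight | mfun].
have F0 (t u : R) : posR t -> posR u -> (0 <= F (t, u))%E.
  rewrite !posRE => t0 u1.
  by rewrite lee_fin mulr_ge0 ?gauss_weight_ge0 ?(eta_ge0 etaP).
exact: (measurable_tonelli_on leb mD mD mF F0).
Qed.

Lemma mixture_sup : exists K X0 : R, [/\ 0 < K, 0 < X0 &
  forall r t, 0 < r -> X0 <= kap * r -> 0 < t -> (Phi r t <= (K * B r)%:E)%E].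
Proof.
have [K [X0 [K0 X00 H]]] := gauss_weight_sup a_gt0 kap_gt0.
exists K, X0; split => // r t r0 Xr t0.
have KB : 0 <= K * B r by rewrite mulr_ge0 ?ltW ?saddle_value_gt0.
have me := measurable_eta etaP t0.
rewrite -[leRHS]mule1 -(eta_mass alpha_gt0 etaP t0).
rewrite -ge0_integralZl_fun//; last by move=> u; rewrite posRE => u1; exact: (eta_ge0 etaP).
apply: ge0_le_integral_EFin.
- exact: measurable_itv.
- by apply: measurable_funM => //; exact: measurable_gauss_weight.
- by mfun.
- by move=> u; rewrite posRE => u1; rewrite mulr_ge0 ?gauss_weight_ge0 ?(eta_ge0 etaP).
- move=> u; rewrite posRE => u1; apply: ler_wpM2r; first exact: (eta_ge0 etaP).
  apply: (le_trans (H r u r0 Xr u1)); rewrite -[leRHS]mulr1; apply: ler_wpM2l => //.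
  rewrite -[leRHS]expR0 ler_expR oppr_le0 mulr_ge0 ?(ltW u1)//.
  by rewrite divr_ge0// ltW.
Qed.

(** Against the peak value [B r], the product A v0 decays at most like a power of [r], so errors
    that are exponentially small relative to [B r] are negligible at the scale A v0. *)
Lemma saddle_area_lower r : 0 < r -> 1 <= kap * r -> 2 * kap ^+ 2 <= kap * r ->
  B r * (2 * kap ^+ 2 / (kap * r) ^+ 2) <= A r * v0 r.
Proof.
move=> r0 X1 X2; have B0 := saddle_value_gt0 a kap_gt0 r0.
have X0 : 0 < kap * r by exact: mulr_gt0.
rewrite /saddle_area -[leRHS]mulrA; apply: ler_wpM2l; first exact: ltW.
have -> : 2 * kap ^+ 2 / (kap * r) ^+ 2 = (kap * r)^-1 * (2 * kap ^+ 2 / (kap * r)).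
  by field; rewrite !gt_eqF.
apply: ler_pM.
- by rewrite invr_ge0 ltW.
- by rewrite divr_ge0// ?ltW// mulr_gt0// exprn_gt0.
- have i0 : 0 < (kap * r)^-1 by rewrite invr_gt0.
  have i1 : (kap * r)^-1 <= 1 by rewrite invf_le1.
  have p2 := pi_ge2 R.
  have h : (kap * r)^-1 ^+ 2 <= 2 * pi / (kap * r).
    by rewrite expr2; apply: ler_wpM2r; [exact: ltW | lra].
  rewrite -[leLHS]gtr0_norm// -sqrtr_sqr; exact: ler_wsqrtr.
- have -> : 2 * kap ^+ 2 / (kap * r) = (u0 r)^-1 by rewrite /saddle; field; rewrite !gt_eqF.
  have u1 : 1 <= u0 r.
    rewrite /saddle ler_pdivlMr ?mulr_gt0// mul1r.
    by rewrite -(ler_pM2l kap_gt0); move: X2; rewrite expr2; lra.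
  rewrite /time_scale powRN lef_pV2 ?posrE ?powR_gt0 ?saddle_gt0//.
  rewrite -[leRHS]powRr1; last by rewrite (le_trans _ u1).
  by rewrite ler_powR// ler_pdivrMr// mul1r ltW.
Qed.

Lemma exp_negligible K c th : 0 < K -> 0 < c -> 0 < th ->
  exists2 X0 : R, 0 < X0 & forall r, 0 < r -> X0 <= kap * r ->
    B r * (K * expR (- (c * (kap * r)))) <= th * (A r * v0 r).
Proof.
move=> K0 c0 th0.
have e0 : 0 < th * (2 * kap ^+ 2) / K.
  by apply: divr_gt0 => //; apply: mulr_gt0 => //; rewrite mulr_gt0// exprn_gt0.
have [X0 X01 HX] := expRN_powR_small (ler0n R 2) c0 e0.
exists (Num.max X0 (2 * kap ^+ 2)); first by rewrite lt_max (lt_le_trans ltr01 X01).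
move=> r r0; rewrite ge_max => /andP[X1 X2].
have B0 := saddle_value_gt0 a kap_gt0 r0.
have X3 : 1 <= kap * r by exact: le_trans X1.
have X4 : 0 < kap * r by exact: lt_le_trans X3.
have h := HX _ X1; rewrite powR_mulrn ?(ltW X4)// in h.
apply: (@le_trans _ _ (th * (B r * (2 * kap ^+ 2 / (kap * r) ^+ 2)))); last first.
  by apply: ler_wpM2l; [exact: ltW | exact: saddle_area_lower].
rewrite (mulrCA th); apply: ler_wpM2l; first exact: ltW.
rewrite [leRHS]mulrA ler_pdivlMr ?exprn_gt0//.
move: h; rewrite ler_pdivlMr// => h.
suff -> : K * expR (- (c * (kap * r))) * (kap * r) ^+ 2 =
  expR (- (c * (kap * r))) * (kap * r) ^+ 2 * K by [].
by ring.
Qed.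

(** For u = u0 w one has u0 eta(t,u) = w^-1 eta(w^(-beta) t v0, 1), close to eta(t v0, 1) on the
    window, uniformly for t v0 <= Z by [eta_one_ratio]. The additive error th A v0 is the far part;
    it is harmless once [t] is bounded below, since eta(t v0, 1) is at least of order t v0. *)
Lemma mixture_near Z th : 0 < Z -> 0 < th <= 1 ->
  exists2 X0 : R, 0 < X0 & forall r t, 0 < r -> X0 <= kap * r -> 0 < t ->
    t * v0 r <= Z ->
    (((1 - th) * (A r * eta (t * v0 r) 1))%:E <= Phi r t)%E /\
    (Phi r t <= ((1 + th) * (A r * eta (t * v0 r) 1) + th * (A r * v0 r))%:E)%E.
Proof.
move=> Z0 /andP[th0 th1].
(* The eighth is shared by the window width, the powers of [w], the variation of [eta] and the
   Gaussian remainder; see [perturb_const]. *)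
have [e eE] : exists e : R, e = th / 8 by exists (th / 8).
have e0 : 0 < e by rewrite eE divr_gt0.
have e01 : 0 <= e <= 1 by apply/andP; split; lra.
have f1 : 0 <= 1 - e by lra.
have f2 : 0 <= 1 + e by lra.
have [dl /andP[dl0 _] Hdl] := eta_one_ratio alpha_gt0 alpha_lt2 etaP erefl Z0 e0.
have [d1 /andP[d10 d11] Hd1] := powR_near1 (- beta) dl0.
have [d2 /andP[d20 d21] Hd2] := powR_near1 (- (a + 1)) e0.
have [eps [ep0 ep1 epd1 epd2 epe]] : exists eps : R,
    [/\ 0 < eps, eps <= 1 / 2, eps <= d1, eps <= d2 & eps <= e].
  exists (Num.min e (Num.min d1 d2)); split.
  - by rewrite !lt_min e0 d10.
  - by rewrite !ge_min d11 orbT.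
  - by rewrite !ge_min lexx orbT.
  - by rewrite !ge_min lexx !orbT.
  - by rewrite ge_min lexx.
have he : 0 < eps <= 1 / 2 by rewrite ep0.
have ep2 : eps <= 1 by lra.
have [K [c [X1 [K0 c0 X10 Hup]]]] := gauss_weight_upper a_gt0 kap_gt0 he.
have [X2 X20 Hlo] := gauss_weight_lower a kap_gt0 he e0.
have [X3 X30 Hneg] := exp_negligible K0 c0 th0.
exists (Num.max X1 (Num.max X2 X3)); first by rewrite lt_max X10.
move=> r t r0; rewrite !ge_max => /and3P[Xr1 Xr2 Xr3] t0 tZ.
have v0r := time_scale_gt0 r0; have A0 := saddle_area_gt0 r0.
have B0 := saddle_value_gt0 a kap_gt0 r0; have u00 := saddle_gt0 kap_gt0 r0.
have z0 : 0 < t * v0 r by exact: mulr_gt0.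
have g0 : 0 < eta (t * v0 r) 1 by exact: (eta_gt0 etaP).
have wE w : `|w - 1| < eps -> 0 < w /\ w `^ (- a) * (u0 r * eta t (u0 r * w)) =
    w `^ (- (a + 1)) * eta (w `^ (- beta) * (t * v0 r)) 1.
  move=> /ltr_distlCBl w1; have w0 : 0 < w by apply: le_lt_trans w1; rewrite subr_ge0.
  split=> //; rewrite (eta_self_similar alpha_gt0 etaP t0 (mulr_gt0 u00 w0)).
  rewrite (powRM _ (ltW u00) (ltW w0)) invfM.
  rewrite opprD powRD; last by rewrite (gt_eqF w0) implybT.
  rewrite powRN powR_inv1 ?(ltW w0)// -powRN.
  have -> : t * (u0 r `^ (- beta) * w `^ (- beta)) = w `^ (- beta) * (t * v0 r).
    by rewrite /time_scale; ring.
  set G := eta _ _; set W := w `^ _.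
  by field; rewrite !gt_eqF.
have near w : `|w - 1| < eps ->
    (1 - e) * ((1 - e) * eta (t * v0 r) 1) <= w `^ (- a) * (u0 r * eta t (u0 r * w))
    <= (1 + e) * ((1 + e) * eta (t * v0 r) 1).
  move=> we; have [w0 ->] := wE _ we.
  have h1 := Hd1 w (le_trans (ltW we) epd1).
  have h2 := Hd2 w (le_trans (ltW we) epd2).
  have hz : 0 < t * v0 r <= Z by rewrite z0.
  have h3 := Hdl _ hz _ h1.
  exact: perturb_mul (ltW g0) h2 h3.
have [cst1 cst2] := perturb_const ep0 epe eE th1.
have me := measurable_eta etaP t0.
have e0' u : 0 < u -> 0 <= eta t u by exact: (eta_ge0 etaP).
split.
  have lo0 : 0 <= (1 - e) * ((1 - e) * eta (t * v0 r) 1).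
    by rewrite !mulr_ge0// ltW.
  apply: le_trans (Hlo r (eta t) _ r0 Xr2 me e0' lo0 _); last first.
    by move=> w /near/andP[].
  rewrite lee_fin.
  have -> : B r * ((1 - eps - e) * Num.sqrt (2 * pi / (kap * r)) *
      ((1 - e) * ((1 - e) * eta (t * v0 r) 1))) =
      ((1 - eps - e) * (1 - e) * (1 - e)) * (A r * eta (t * v0 r) 1).
    by rewrite /saddle_area; ring.
  by apply: ler_wpM2r => //; rewrite mulr_ge0 ?ltW.
have hi0 : 0 <= (1 + e) * ((1 + e) * eta (t * v0 r) 1).
  by rewrite !mulr_ge0// ltW.
apply: (le_trans (Hup r (eta t) _ r0 Xr1 me e0' hi0 _)); first by move=> w /near/andP[].
rewrite [leRHS]EFinD; apply: leeD.
  rewrite lee_fin.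
  have -> : B r * ((1 + eps) * Num.sqrt (2 * pi / (kap * r)) *
      ((1 + e) * ((1 + e) * eta (t * v0 r) 1))) =
      ((1 + eps) * (1 + e) * (1 + e)) * (A r * eta (t * v0 r) 1).
    by rewrite /saddle_area; ring.
  by apply: ler_wpM2r => //; rewrite mulr_ge0 ?ltW.
have E : (\int[leb]_(u in posR) (expR (- (2 / r * u)) * eta t u)%:E <= 1)%E.
  under eq_integral do rewrite EFinM.
  rewrite (eta_laplace etaP) ?divr_gt0// lee_fin -[leRHS]expR0 ler_expR oppr_le0.
  by rewrite mulr_ge0 ?(ltW t0)// powR_ge0.
apply: (@le_trans _ _ (B r * (K * expR (- (c * (kap * r)))))%:E); last first.
  by rewrite lee_fin; exact: Hneg.
rewrite -[leRHS]mule1; apply: lee_wpmul2l => //.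
by rewrite lee_fin mulr_ge0 ?(ltW B0)// mulr_ge0 ?(ltW K0)// expR_ge0.
Qed.

End mixture.

(** * The mixture under exponential damping and integrated over all times *)

Section mixture_bounds.
Context (R : realType) (alpha a kap : R) (eta : R -> R -> R).
Local Notation leb := (@lebesgue_measure R).
Hypotheses (alpha_gt0 : 0 < alpha) (alpha_lt2 : alpha < 2).
Hypothesis etaP : stable_subordinator_density alpha eta.
Hypotheses (a_gt0 : 0 < a) (kap_gt0 : 0 < kap).
Local Notation beta := (alpha / 2).
Local Notation q := (gauss_weight a kap).
Local Notation u0 := (saddle kap).
Local Notation B := (saddle_value a kap).
Local Notation Phi := (mixture a kap eta).
Local Notation A := (saddle_area a kap).
Local Notation v0 := (time_scale alpha kap).
Local Notation gam := (Gamma (1 - beta)).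
Variable C : R.
Hypothesis CE : C = beta / gam.

Let beta_gt0 : 0 < beta. Proof. by rewrite divr_gt0. Qed.
Let beta_lt1 : beta < 1. Proof. by rewrite ltr_pdivrMr// mul1r. Qed.

Lemma tail_constant_gt0 : 0 < C.
Proof. by have [_ G0] := Gamma_integral beta_gt0 beta_lt1; rewrite CE divr_gt0. Qed.

(** Since 1/v0 = u0^beta, this factor is a stretched exponential in [r], which still beats every
    power. *)
Lemma exp_negligible_scale K c th : 0 < K -> 0 < c -> 0 < th ->
  exists2 X0 : R, 0 < X0 & forall r, 0 < r -> X0 <= kap * r ->
    B r * (K * expR (- (c / v0 r))) <= th * (A r * v0 r).
Proof.
move=> K0 c0 th0.
have k2 : 0 < 2 * kap ^+ 2 by rewrite mulr_gt0// exprn_gt0.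
have e0 : 0 < th / (2 * kap ^+ 2) / K by rewrite !divr_gt0.
have p0 : 0 <= 2 / beta by rewrite divr_ge0// ltW.
have [Y0 Y01 HY] := expRN_powR_small p0 c0 e0.
exists (Num.max 1 (2 * kap ^+ 2 * Y0 `^ beta^-1)); first by rewrite lt_max ltr01.
move=> r r0; rewrite ge_max => /andP[X1 X2].
have B0 := saddle_value_gt0 a kap_gt0 r0.
have X4 : 0 < kap * r by exact: mulr_gt0.
have Y00 : 0 < Y0 by exact: lt_le_trans Y01.
have uE : kap * r = 2 * kap ^+ 2 * u0 r by rewrite /saddle; field; rewrite gt_eqF.
have uY : Y0 `^ beta^-1 <= u0 r by rewrite -(ler_pM2l k2) -uE.
have u00 := saddle_gt0 kap_gt0 r0.
have Yb : 1 <= Y0 `^ beta^-1.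
  by rewrite -[leLHS](powRr0 Y0) ler_powR// invr_ge0 ltW.
have Yle : Y0 <= u0 r `^ beta.
  have -> : Y0 = (Y0 `^ beta^-1) `^ beta.
    by rewrite -powRrM mulVf ?powRr1 ?gt_eqF// ltW.
  by apply: ge0_ler_powR; rewrite ?nnegrE ?powR_ge0 ?(ltW beta_gt0) ?(ltW u00).
have h := HY _ Yle; rewrite -powRrM in h.
have bE : beta * (2 / beta) = 2%:R by field; rewrite gt_eqF.
rewrite bE powR_mulrn ?(ltW u00)// in h.
have X2k : 2 * kap ^+ 2 <= kap * r.
  by rewrite uE -[leLHS]mulr1 ler_pM2l//; apply: le_trans uY.
apply: (@le_trans _ _ (th * (B r * (2 * kap ^+ 2 / (kap * r) ^+ 2)))); last first.
  by apply: ler_wpM2l; [exact: ltW | exact: saddle_area_lower].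
rewrite (mulrCA th); apply: ler_wpM2l; first exact: ltW.
have -> : c / v0 r = c * u0 r `^ beta by rewrite /time_scale powRN invrK.
rewrite uE; move: h k2; set E := expR _; set k := kap ^+ 2; set u := u0 r => h k2.
have -> : th * (2 * k / (2 * k * u) ^+ 2) = th / (2 * k) / K * (u ^+ 2)^-1 * K.
  field; rewrite !gt_eqF//; move: k2; rewrite pmulr_rgt0//.
rewrite mulrC; apply: ler_wpM2r; first exact: ltW.
by rewrite ler_pdivlMr// exprn_gt0.
Qed.

(** An integrable majorant in [s], uniform in [r]. While s v0 is small, [mixture_near] and eta(z,1)
    <= (C + e) z apply; beyond, half of the damping is at most e^(-c/v0) and makes the crude bound K
    B negligible. *)
Lemma mixture_damped D th : 0 < D -> 0 < th <= 1 ->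
  exists2 X0 : R, 0 < X0 & forall r s, 0 < r -> X0 <= kap * r -> 0 < s ->
  ((expR (- (D * s)))%:E * Phi r s <=
    (A r * v0 r * (((C + th) * s + th) * expR (- (D * s)) + th * expR (- (D / 2 * s))))%:E)%E.
Proof.
move=> D0 /andP[th0 th1]; have C0 := tail_constant_gt0.
have [e eE] : exists e, e = th / (C + 2) by exists (th / (C + 2)).
have C2 : 0 < C + 2 by rewrite addr_gt0.
have e0 : 0 < e by rewrite eE divr_gt0.
have e1 : e <= 1 by rewrite eE ler_pdivrMr// mul1r; lra.
have eC : e * (C + 2) = th by rewrite eE divfK// gt_eqF.
have e01 : 0 < e <= 1 by rewrite e0.
have Cth : (1 + e) * (C + e) <= C + th by rewrite -eC; nra.
have eth : e <= th by rewrite -eC; nra.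
have [z0 z00 Hz] := eta_one_at0 alpha_gt0 alpha_lt2 etaP CE e0.
have Z0 : 0 < z0 / 2 by rewrite divr_gt0.
have Zz : z0 / 2 < z0 by lra.
have [X1 X10 H1] := mixture_near alpha_gt0 alpha_lt2 etaP a_gt0 kap_gt0 Z0 e01.
have [K [X2 [K0 X20 H2]]] := mixture_sup alpha_gt0 etaP a_gt0 kap_gt0.
have c0 : 0 < D / 2 * (z0 / 2) by rewrite mulr_gt0// divr_gt0.
have [X3 X30 H3] := exp_negligible_scale K0 c0 th0.
exists (Num.max X1 (Num.max X2 X3)); first by rewrite lt_max X10.
move=> r s r0; rewrite !ge_max => /and3P[Xr1 Xr2 Xr3] s0.
have v0r := time_scale_gt0 alpha kap_gt0 r0; have A0 := saddle_area_gt0 a kap_gt0 r0.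
have B0 := saddle_value_gt0 a kap_gt0 r0.
have sv : 0 < s * v0 r by exact: mulr_gt0.
have Av : 0 < A r * v0 r by exact: mulr_gt0.
have E0 := expR_gt0 (- (D * s)); have E1 := expR_gt0 (- (D / 2 * s)).
have [sZ|Zs] := leP (s * v0 r) (z0 / 2).
  have [_ Hu] := H1 r s r0 Xr1 s0 sZ.
  have g1 : eta (s * v0 r) 1 <= (C + e) * (s * v0 r).
    have /Hz : 0 < s * v0 r < z0 by rewrite sv; exact: le_lt_trans Zz.
    by rewrite ler_norml => /andP[_]; rewrite lerBlDl -mulrDl.
  apply: (@le_trans _ _ ((expR (- (D * s)))%:E * (A r * v0 r * ((C + th) * s + th))%:E)%E).
    apply: lee_wpmul2l; first by rewrite lee_fin ltW.
    apply: (le_trans Hu); rewrite lee_fin mulrDr; apply: lerD; last first.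
      by rewrite mulrC ler_pM2l.
    apply: (@le_trans _ _ ((1 + e) * (A r * ((C + e) * (s * v0 r))))).
      by rewrite ler_pM2l ?addr_gt0// ler_pM2l.
    have -> : (1 + e) * (A r * ((C + e) * (s * v0 r))) =
       A r * v0 r * ((1 + e) * (C + e) * s) by ring.
    by rewrite ler_pM2l// ler_pM2r.
  rewrite -EFinM lee_fin mulrCA ler_pM2l// mulrC lerDl.
  by rewrite mulr_ge0 ?ltW.
apply: (@le_trans _ _ ((expR (- (D * s)))%:E * (K * B r)%:E)%E).
  by apply: lee_wpmul2l; [rewrite lee_fin ltW | exact: H2].
rewrite -EFinM lee_fin.
have -> : expR (- (D * s)) = expR (- (D / 2 * s)) * expR (- (D / 2 * s)).
  by rewrite -expRD; congr expR; field.
apply: (@le_trans _ _ (A r * v0 r * (th * expR (- (D / 2 * s))))); last first.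
  rewrite ler_pM2l// lerDr !mulr_ge0 ?ltW//.
  by rewrite addr_gt0// mulr_gt0// addr_gt0.
have -> : A r * v0 r * (th * expR (- (D / 2 * s))) =
  expR (- (D / 2 * s)) * (th * (A r * v0 r)) by ring.
rewrite -(mulrA (expR _)) ler_pM2l//; apply: le_trans (H3 r r0 Xr3).
have -> : expR (- (D / 2 * s)) * (K * B r) = B r * (K * expR (- (D / 2 * s))) by ring.
rewrite ler_pM2l// ler_pM2l// ler_expR lerN2 -mulrA ler_pM2l ?divr_gt0//.
by rewrite ler_pdivrMr// ltW.
Qed.

(** Tonelli: the transform of [eta t] at [s] is e^(-t s^beta), whose integral over t is
    s^(-beta). *)
Lemma eta_potential_laplace G s : G%:E = (\int[leb]_(t in posR) (eta t 1)%:E)%E -> 0 < s ->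
  (\int[leb]_(u in posR) (expR (- (s * u)) * (u `^ (beta - 1) * G))%:E =
   (s `^ (- beta))%:E)%E.
Proof.
move=> GE s0; have c0 : 0 < s `^ beta by exact: powR_gt0.
pose F (tu : R * R) := (expR (- (s * tu.2)) * eta tu.1 tu.2)%:E.
have mD : measurable (posR : set R) by exact: measurable_itv.
have mF : measurable_fun ((posR : set R) `*` (posR : set R)) F.
  apply/measurable_EFinP/measurable_funM; last exact: measurable_eta2 alpha_gt0 etaP.
  by mfun.
have F0 (t u : R) : posR t -> posR u -> (0 <= F (t, u))%E.
  by rewrite !posRE => t0 u1; rewrite lee_fin mulr_ge0 ?expR_ge0 ?(eta_ge0 etaP).
transitivity (\int[leb]_(u in posR) \int[leb]_(t in posR) F (t, u))%E.
  apply: eq_integral => u /set_mem; rewrite posRE => u1.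
  rewrite /F /= ge0_integralZl_fun ?expR_ge0//; first last.
  - by move=> t; rewrite posRE => t0; exact: (eta_ge0 etaP).
  - exact: (measurable_eta1 alpha_gt0 etaP u1).
  by rewrite (eta_potential alpha_gt0 etaP u1) -GE.
rewrite -(tonelli_on leb leb mD mD mF F0).
transitivity (\int[leb]_(t in posR) (expR (- (s `^ beta * t)))%:E)%E.
  apply: eq_integral => t /set_mem; rewrite posRE => t0; rewrite /F /=.
  by under eq_integral do rewrite EFinM; rewrite (eta_laplace etaP)// mulrC.
have ci0 : 0 < (s `^ beta)^-1 by rewrite invr_gt0.
rewrite (integral_posR_scale ci0); last 2 first.
- by mfun.
- by move=> u _; rewrite lee_fin expR_ge0.
have -> : (\int[leb]_(u in posR) (expR (- (s `^ beta * ((s `^ beta)^-1 * u))))%:E =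
   \int[leb]_(u in posR) (expR (- u))%:E)%E.
  by apply: eq_integral => u _; rewrite mulrA mulfV ?mul1r// gt_eqF.
by rewrite integral_expRN mule1 powRN.
Qed.

(** Integrating over time first replaces [eta] by its potential density u^(beta - 1) G, to which
    Laplace's method applies. *)
Lemma mixture_potential G th : G%:E = (\int[leb]_(t in posR) (eta t 1)%:E)%E ->
  0 < th <= 1 -> exists2 X0 : R, 0 < X0 & forall r, 0 < r -> X0 <= kap * r ->
  (\int[leb]_(s in posR) Phi r s <=
   ((1 + th) * (A r * (u0 r `^ beta * G)) + th * (A r * u0 r `^ beta))%:E)%E.
Proof.
move=> GE /andP[th0 th1].
have G0 : 0 <= G.
  rewrite -lee_fin GE; apply: integral_ge0 => t; rewrite posRE => t0.
  by rewrite lee_fin (eta_ge0 etaP).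
have e0 : 0 < th / 8 by rewrite divr_gt0.
have [d1 /andP[d10 d11] Hd] := powR_near1 (beta - 1 - a) e0.
have [eps [ep0 ep1 epd epe]] : exists eps : R,
    [/\ 0 < eps, eps <= 1 / 2, eps <= d1 & eps <= th / 8].
  exists (Num.min (th / 8) d1); split.
  - by rewrite lt_min e0 d10.
  - by rewrite ge_min d11 orbT.
  - by rewrite ge_min lexx orbT.
  - by rewrite ge_min lexx.
have he : 0 < eps <= 1 / 2 by rewrite ep0.
have [K [c [X1 [K0 c0 X10 Hup]]]] := gauss_weight_upper a_gt0 kap_gt0 he.
have K20 : 0 < K * kap `^ beta by rewrite mulr_gt0// powR_gt0.
have [X2 X20 Hneg] := @exp_negligible _ alpha a kap alpha_lt2 kap_gt0 _ _ _ K20 c0 th0.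
exists (Num.max X1 (Num.max X2 (2 * kap ^+ 2))); first by rewrite lt_max X10.
move=> r r0; rewrite !ge_max => /and3P[Xr1 Xr2 Xr3].
have v0r := time_scale_gt0 alpha kap_gt0 r0; have A0 := saddle_area_gt0 a kap_gt0 r0.
have B0 := saddle_value_gt0 a kap_gt0 r0; have u00 := saddle_gt0 kap_gt0 r0.
pose f u := u `^ (beta - 1) * G.
have f0 u : 0 < u -> 0 <= f u by move=> _; rewrite mulr_ge0 ?powR_ge0.
have mf : measurable_fun (posR : set R) f by rewrite /f; mfun.
have -> : (\int[leb]_(s in posR) Phi r s = \int[leb]_(u in posR) (q r u * f u)%:E)%E.
  pose F (tu : R * R) := (q r tu.2 * eta tu.1 tu.2)%:E.
  have mD : measurable (posR : set R) by exact: measurable_itv.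
  have mF : measurable_fun ((posR : set R) `*` (posR : set R)) F.
    apply/measurable_EFinP/measurable_funM; last exact: measurable_eta2 alpha_gt0 etaP.
    by apply: (measurableT_comp (f := q r)); [exact: measurable_gauss_weight | mfun].
  have F0 (t u : R) : posR t -> posR u -> (0 <= F (t, u))%E.
    by rewrite !posRE => t0 u1; rewrite lee_fin mulr_ge0 ?gauss_weight_ge0 ?(eta_ge0 etaP).
  rewrite (tonelli_on leb leb mD mD mF F0).
  apply: eq_integral => u /set_mem; rewrite posRE => u1.
  rewrite /F /= ge0_integralZl_fun ?gauss_weight_ge0//; first last.
  - by move=> t; rewrite posRE => t0; exact: (eta_ge0 etaP).
  - exact: (measurable_eta1 alpha_gt0 etaP u1).
  by rewrite (eta_potential alpha_gt0 etaP u1) -GE.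
have hi0 : 0 <= (1 + th / 8) * (u0 r `^ beta * G).
  by rewrite !mulr_ge0 ?powR_ge0// addr_ge0// ltW.
apply: (le_trans (Hup r f _ r0 Xr1 mf f0 hi0 _)).
  move=> w we; have w0 : 0 < w.
    by move: we => /ltr_distlCBl; apply: le_lt_trans; lra.
  rewrite /f (powRM _ (ltW u00) (ltW w0)).
  have -> : u0 r `^ (beta - 1) = u0 r `^ beta / u0 r.
    rewrite powRD; last by rewrite (gt_eqF u00) implybT.
    by rewrite powR_inv1// ltW.
  have -> : w `^ (- a) * (u0 r * (u0 r `^ beta / u0 r * w `^ (beta - 1) * G)) =
      w `^ (beta - 1 - a) * (u0 r `^ beta * G).
    rewrite [in RHS]powRD; last by rewrite (gt_eqF w0) implybT.
    by field; rewrite gt_eqF.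
  apply: ler_wpM2r; first by rewrite mulr_ge0// powR_ge0.
  have := Hd w (le_trans (ltW we) epd).
  by rewrite ler_norml => /andP[_]; lra.
rewrite (@eta_potential_laplace G (2 / r)) ?divr_gt0//.
rewrite [leRHS]EFinD; apply: leeD.
  rewrite lee_fin.
  have -> : B r * ((1 + eps) * Num.sqrt (2 * pi / (kap * r)) *
      ((1 + th / 8) * (u0 r `^ beta * G))) =
      ((1 + eps) * (1 + th / 8)) * (A r * (u0 r `^ beta * G)).
    by rewrite /saddle_area; ring.
  apply: ler_wpM2r; first by rewrite mulr_ge0 ?(ltW A0)// mulr_ge0 ?powR_ge0.
  by nra.
have h := Hneg r r0 Xr2; rewrite -EFinM lee_fin.
have u1 : 1 <= u0 r.
  rewrite /saddle ler_pdivlMr ?mulr_gt0// mul1r.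
  by rewrite -(ler_pM2l kap_gt0); move: Xr3; rewrite expr2; lra.
have ub0 : 0 < u0 r `^ beta by exact: powR_gt0.
have v1 : v0 r <= 1 by exact: powRN_le1 (ltW beta_gt0) u1.
have -> : (2 / r) `^ (- beta) = kap `^ beta * u0 r `^ beta.
  rewrite -powRM ?(ltW kap_gt0) ?(ltW u00)//.
  have -> : 2 / r = (kap * u0 r)^-1 by rewrite /saddle; field; rewrite !gt_eqF.
  by rewrite -(@powR_inv1 _ (kap * u0 r)) ?(mulr_ge0 (ltW kap_gt0) (ltW u00))// -powRrM mulN1r opprK.
have -> : B r * (K * expR (- (c * (kap * r)))) * (kap `^ beta * u0 r `^ beta) =
  B r * (K * kap `^ beta * expR (- (c * (kap * r)))) * u0 r `^ beta by ring.
rewrite [leRHS]mulrA ler_pM2r//; apply: (le_trans h).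
by rewrite ler_pM2l// -[leRHS]mulr1 ler_pM2l.
Qed.

End mixture_bounds.

(** * A bound on the mixture uniform in time *)

Section mixture_uniform.
Context (R : realType) (alpha a kap : R) (eta : R -> R -> R).
Local Notation leb := (@lebesgue_measure R).
Hypotheses (alpha_gt0 : 0 < alpha) (alpha_lt2 : alpha < 2).
Hypothesis etaP : stable_subordinator_density alpha eta.
Hypotheses (a_gt0 : 0 < a) (kap_gt0 : 0 < kap).
Local Notation beta := (alpha / 2).
Local Notation q := (gauss_weight a kap).
Local Notation u0 := (saddle kap).
Local Notation B := (saddle_value a kap).
Local Notation Phi := (mixture a kap eta).
Local Notation A := (saddle_area a kap).
Local Notation v0 := (time_scale alpha kap).
Local Notation gam := (Gamma (1 - beta)).
Variable C : R.
Hypothesis CE : C = beta / gam.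

Let beta_gt0 : 0 < beta. Proof. by rewrite divr_gt0. Qed.
Let beta_lt1 : beta < 1. Proof. by rewrite ltr_pdivrMr// mul1r. Qed.

(** Split at distance [rho] from the singularity: beyond it the kernel is at most rho^(-beta),
    within it [h] is at most [S]. *)
Let frac_shift (h : R -> R) (v rho I S : R) : measurable_fun (posR : set R) h ->
  (forall u, 0 < u -> 0 <= h u <= S) -> 0 < v -> 0 < rho ->
  (\int[leb]_(u in posR) (h u)%:E <= I%:E)%E ->
  (\int[leb]_(u in posR) (h u * frac_kernel beta u v)%:E <=
   (rho `^ (- beta) * I + S * (rho `^ (1 - beta) / (1 - beta)))%:E)%E.
Proof.
move=> mh h0 v1 rho0 hI.
have b1 : 0 < 1 - beta by rewrite subr_gt0.
have S0 : 0 <= S by have /andP[h1 h2] := h0 _ ltr01; exact: le_trans h2.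
have rb0 : 0 <= rho `^ (- beta) by exact: powR_ge0.
pose k (u : R) := ((fun y : R => y `^ (- beta)) \_ (`]0%R, rho]%classic)) (u - v).
have k0 u : 0 <= k u by rewrite /k patchE; case: ifP => // _; exact: powR_ge0.
have mk0 : measurable_fun setT ((fun y : R => y `^ (- beta)) \_ (`]0%R, rho]%classic)).
  by apply/(measurable_restrictT _ _).1; [exact: measurable_itv | mfun].
have mk : measurable_fun (posR : set R) k.
  apply: measurable_funTS; apply: (measurableT_comp (f := (fun y : R => y `^ (- beta)) \_ (`]0%R, rho]%classic))) => //.
  by mfun.
have mfk : measurable_fun (posR : set R) (fun u => frac_kernel beta u v).
  by apply: measurable_frac_kernel; mfun.
have Ik : (\int[leb]_(u in posR) (k u)%:E <= (rho `^ (1 - beta) / (1 - beta))%:E)%E.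
  apply: le_trans (integral_powR_le beta_lt1 rho0).
  rewrite (integral_restrict_support _ (D' := (`]v, +oo[%classic : set (measurableTypeR R)))); last 2 first.
  - by move=> u; rewrite /= !in_itv/= !andbT; exact: lt_trans.
  - move=> u _; rewrite /= in_itv/= andbT => /negP; rewrite -leNgt => uv.
    by rewrite /k patchE memNset//= in_itv/= => /andP[]; lra.
  rewrite integral_posR_shift; last 2 first.
  - apply/measurable_EFinP; apply: measurable_funTS.
    apply: (measurableT_comp (f := (fun y : R => y `^ (- beta)) \_ (`]0%R, rho]%classic))) => //.
    by mfun.
  - by move=> u _; rewrite lee_fin.
  rewrite (integral_restrict_support _ (D' := (`]0%R, rho]%classic : set (measurableTypeR R)))); last 2 first.
  - by move=> u; rewrite /= !in_itv/= andbT => /andP[].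
  - by move=> u _ nu; rewrite /k addrK patchE memNset.
  rewrite le_eqVlt; apply/orP; left; apply/eqP; apply: eq_integral => u un.
  by rewrite /k addrK patchE un.
apply: (@le_trans _ _ (\int[leb]_(u in posR) (rho `^ (- beta) * h u + S * k u)%:E)%E).
  apply: ge0_le_integral_EFin; first exact: measurable_itv.
  - by mfun.
  - by mfun.
  - move=> u; rewrite posRE => u1; rewrite mulr_ge0 ?frac_kernel_ge0//.
    by have /andP[] := h0 u u1.
  - move=> u; rewrite posRE => u1; have /andP[hu0 huS] := h0 u u1.
    have [uv|vu] := leP u v.
      by rewrite (frac_kernel_eq0 beta_gt0 uv) mulr0 addr_ge0// mulr_ge0.
    rewrite frac_kernelE//; have [ur|ru] := leP (u - v) rho.
      rewrite -[leLHS]add0r; apply: lerD; first by rewrite mulr_ge0.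
      rewrite /k patchE mem_set; last by rewrite /= in_itv/= ur subr_gt0 vu.
      by apply: ler_wpM2r => //; exact: powR_ge0.
    rewrite -[leLHS]addr0; apply: lerD; last by rewrite mulr_ge0.
    rewrite mulrC; apply: ler_wpM2r => //.
    rewrite !powRN lef_pV2 ?posrE ?powR_gt0 ?subr_gt0//.
    apply: ge0_ler_powR; rewrite ?nnegrE ?(ltW beta_gt0) ?(ltW rho0)// ?(ltW ru)//.
    by rewrite subr_ge0 ltW.
rewrite ge0_integralD_fun; first last.
- by move=> u _; rewrite mulr_ge0.
- by move=> u; rewrite posRE => /h0/andP[? _]; rewrite mulr_ge0.
- by mfun.
- by mfun.
- exact: measurable_itv.
rewrite EFinD; apply: leeD.
  rewrite ge0_integralZl_fun//; last by move=> u; rewrite posRE => /h0/andP[].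
  by rewrite EFinM; apply: lee_wpmul2l.
rewrite ge0_integralZl_fun//.
by rewrite EFinM; apply: lee_wpmul2l.
Qed.

(** Insert the convolution equation and integrate in [u] first. Since u > v on the support of the
    kernel, the weight e^(u/r) in the hypothesis leaves e^(-v/r), whose integral against [eta t] is
    e^(-x) with x = t r^(-beta). Then t e^(-x) = r^beta x e^(-x) <= r^beta, which removes the
    dependence on [t]. *)
Let mix_frac (h : R -> R) (r t J : R) : 0 < r -> 0 < t -> 0 <= J ->
  measurable_fun (posR : set R) h -> (forall u, 0 < u -> 0 <= h u) ->
  (forall v, 0 < v -> (\int[leb]_(u in posR) (h u * expR (u / r) * frac_kernel beta u v)%:E <= J%:E)%E) ->
  (\int[leb]_(u in posR) ((h u)%:E * (u * eta t u)%:E) <= (C * J * r `^ beta)%:E)%E.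
Proof.
move=> r0 t0 J0 mh h0 HJ; have C0 := tail_constant_gt0 alpha_gt0 alpha_lt2 CE.
have mD : measurable (posR : set R) by exact: measurable_itv.
rewrite (eta_convolution alpha_gt0 alpha_lt2 etaP t0); last 2 first.
- exact/measurable_EFinP.
- by move=> u u1; rewrite lee_fin h0.
pose F (uv : R * R) := (h uv.1 * (frac_kernel beta uv.1 uv.2 * eta t uv.2))%:E.
have mF : measurable_fun ((posR : set R) `*` (posR : set R)) F.
  apply/measurable_EFinP; apply: measurable_funM.
    apply: (measurable_comp (F := (posR : set R)) (f := h)) => //; last by mfun.
    by move=> y [[u v] [/= u1 _]] <-.
  apply: measurable_funM; first by apply: measurable_frac_kernel; mfun.
  apply: (measurable_comp (F := (posR : set R)) (f := eta t)) => //; last by mfun.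
    by move=> y [[u v] [/= _]]; move=> v1 <-.
  exact: (measurable_eta etaP t0).
have F0 (u v : R) : posR u -> posR v -> (0 <= F (u, v))%E.
  rewrite !posRE => u1 v1.
  by rewrite lee_fin mulr_ge0 ?h0// mulr_ge0 ?frac_kernel_ge0 ?(eta_ge0 etaP).
have tC0 : 0 <= t * beta / gam by rewrite -mulrA -CE mulr_ge0// ltW.
have mfe u : measurable_fun (posR : set R) (fun v => frac_kernel beta u v * eta t v).
  apply: measurable_funM; last exact: (measurable_eta etaP t0).
  by apply: measurable_frac_kernel; mfun.
have -> : (\int[leb]_(u in posR) ((h u)%:E * ((t * beta / gam)%:E * eta_frac alpha eta t u)) =
    (t * beta / gam)%:E * \int[leb]_(u in posR) \int[leb]_(v in posR) F (u, v))%E.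
  rewrite -ge0_integralZl_EFin//; last 2 first.
  - by move=> u up; apply: integral_ge0 => v vp; exact: F0.
  - exact: (measurable_tonelli_on leb mD mD mF F0).
  apply: eq_integral => u /set_mem; rewrite posRE => u1; rewrite muleCA; congr (_ * _)%E.
  rewrite /eta_frac /F /= ge0_integralZl_fun ?h0//; last 2 first.
  - exact: (mfe u).
  - by move=> v; rewrite posRE => v1; rewrite mulr_ge0 ?frac_kernel_ge0 ?(eta_ge0 etaP).
rewrite (tonelli_on leb leb mD mD mF F0).
have step : (\int[leb]_(v in posR) \int[leb]_(u in posR) F (u, v) <=
    \int[leb]_(v in posR) (J * (expR (- (r^-1 * v)) * eta t v))%:E)%E.
  apply: ge0_le_integral => //.
  - by move=> v vp; apply: integral_ge0 => u up; exact: F0.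
  - apply: (measurable_tonelli_on (f := fun vu => F (vu.2, vu.1)) leb mD mD); last first.
      by move=> v u vp up; exact: F0.
    apply: (measurable_comp (F := (posR : set R) `*` (posR : set R)) (f := F)) => //.
    + by apply: measurableX.
    + by move=> y [[v u] [/= v1 u1]] <-; split.
    + by apply: measurable_funTS; apply/measurable_fun_pairP; split; [exact: measurable_snd | exact: measurable_fst].
  - have me := measurable_eta etaP t0; by mfun.
  move=> v; rewrite posRE => v1.
  apply: (@le_trans _ _ ((expR (- (r^-1 * v)) * eta t v)%:E *
     \int[leb]_(u in posR) (h u * expR (u / r) * frac_kernel beta u v)%:E)%E).
    have e0 : 0 <= expR (- (r^-1 * v)) * eta t v by rewrite mulr_ge0 ?expR_ge0 ?(eta_ge0 etaP).
    have mfk : measurable_fun (posR : set R) (fun u => frac_kernel beta u v).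
      by apply: measurable_frac_kernel; mfun.
    rewrite -ge0_integralZl_fun//; last 2 first.
    - by mfun.
    - by move=> u; rewrite posRE => u1; rewrite !mulr_ge0 ?expR_ge0 ?frac_kernel_ge0 ?h0.
    have m1 : measurable_fun (posR : set R) (fun u => h u * (frac_kernel beta u v * eta t v)).
      by mfun.
    have m2 : measurable_fun (posR : set R) (fun u => expR (- (r^-1 * v)) * eta t v *
        (h u * expR (u / r) * frac_kernel beta u v)) by mfun.
    apply: ge0_le_integral_EFin => //.
    - move=> u; rewrite posRE /= => u1.
      by rewrite mulr_ge0 ?h0// mulr_ge0 ?frac_kernel_ge0 ?(eta_ge0 etaP).
    move=> u; rewrite posRE => u1; have hu0 := h0 u u1.
    have [uv|vu] := leP u v; first by rewrite (frac_kernel_eq0 beta_gt0 uv) !(mul0r, mulr0).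
    have -> : expR (- (r^-1 * v)) * eta t v * (h u * expR (u / r) * frac_kernel beta u v) =
      expR ((u - v) / r) * (h u * (frac_kernel beta u v * eta t v)).
      by rewrite mulrBl expRD [r^-1 * v]mulrC; ring.
    rewrite -[leLHS]mul1r; apply: ler_wpM2r.
      by rewrite !mulr_ge0 ?frac_kernel_ge0 ?(eta_ge0 etaP).
    rewrite -[leLHS]expR0 ler_expR divr_ge0 ?subr_ge0 ?(ltW vu)// ltW//.
  rewrite (mulrC J) [X in (_ <= X)%E]EFinM; apply: lee_wpmul2l; last exact: HJ.
  by rewrite lee_fin mulr_ge0 ?expR_ge0 ?(eta_ge0 etaP).
apply: (@le_trans _ _ ((t * beta / gam)%:E * (J * expR (- (t * r^-1 `^ beta)))%:E)%E).
  apply: lee_wpmul2l => //; apply: (le_trans step).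
  have me := measurable_eta etaP t0.
  rewrite ge0_integralZl_fun//; last 2 first.
  - by mfun.
  - by move=> v; rewrite posRE => v1; rewrite mulr_ge0 ?expR_ge0 ?(eta_ge0 etaP).
  by under eq_integral do rewrite EFinM; rewrite (eta_laplace etaP)// ?invr_gt0.
have ri0 : 0 < r^-1 `^ beta by rewrite powR_gt0// invr_gt0.
have rE : r `^ beta = (r^-1 `^ beta)^-1.
  by rewrite -(@powR_inv1 _ r) ?(ltW r0)// -powRrM mulN1r powRN invrK.
rewrite -EFinM lee_fin -(mulrA t) -CE rE ler_pdivlMr//.
have -> : t * C * (J * expR (- (t * r^-1 `^ beta))) * r^-1 `^ beta =
  C * J * (t * r^-1 `^ beta * expR (- (t * r^-1 `^ beta))) by ring.
rewrite -[leRHS]mulr1; apply: ler_wpM2l; first by rewrite mulr_ge0// ltW.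
move: (t * _) => x; rewrite expRN ler_pdivrMr ?expR_gt0// mul1r.
by apply: le_trans (expR_ge1Dx x); rewrite lerDr.
Qed.

Let half_window (w : R) : `|w - 1| < 1 / 2 -> [/\ 1 / 2 < w, 0 < w & w < 2].
Proof. by rewrite ltr_norml => /andP[w1 w2]; split; lra. Qed.

(** Needed at lambda = m for times with t v0 large, where [mixture_near] says nothing: the order A
    r^(beta/2) is below the order A r^beta of the full time integral. The factor u of the
    convolution equation is produced by raising the exponent [a] to [a + 1], and the cut [rho] =
    sqrt r, the width of the Gaussian window in [u], balances the two terms of [frac_shift]. *)
Lemma mixture_uniform : exists K X0 : R, [/\ 0 < K, 0 < X0 &
  forall r t, 0 < r -> X0 <= kap * r -> 0 < t ->
    (Phi r t <= (K * (A r * r `^ (beta / 2)))%:E)%E].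
Proof.
have C0 := tail_constant_gt0 alpha_gt0 alpha_lt2 CE.
have a1 : 0 < a + 1 by rewrite addr_gt0.
have h2 : 0 < (1 / 2 : R) <= 1 / 2 by apply/andP; split => //; lra.
have [K1 [X1 [K10 X10 Hsup]]] := gauss_weight_sup a1 kap_gt0.
have [K2 [c [X2 [K20 c0 X20 Hup]]]] := gauss_weight_upper a1 kap_gt0 h2.
have K2k : 0 < K2 * (2 * kap) by rewrite mulr_gt0// mulr_gt0.
have [X3 X30 Hneg] := @exp_negligible _ alpha a kap alpha_lt2 kap_gt0 _ _ _ K2k c0 ltr01.
have [W WE] : exists W, W = (1 / 2 : R) `^ (- (a + 1)) * expR (2 / (2 * kap)).
  by exists ((1 / 2 : R) `^ (- (a + 1)) * expR (2 / (2 * kap))).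
have W0 : 0 < W by rewrite WE mulr_gt0 ?expR_gt0// powR_gt0// divr_gt0.
have b1 : 0 < 1 - beta by rewrite subr_gt0.
have [I IE] : exists I, I = 2 * W + 1 by exists (2 * W + 1).
have I0 : 0 < I by rewrite IE addr_gt0// mulr_gt0.
have [S SE] : exists S, S = K1 * 2 * kap * (1 + kap) / (1 - beta) by exists (K1 * 2 * kap * (1 + kap) / (1 - beta)).
have S0 : 0 < S by rewrite SE divr_gt0// !mulr_gt0// addr_gt0.
exists (C * (I + S)), (Num.max X1 (Num.max X2 (Num.max X3 (Num.max (2 * kap ^+ 2) kap)))).
split; [by rewrite mulr_gt0// addr_gt0 | by rewrite lt_max X10 |].
move=> r t r0; rewrite !ge_max => /and5P[Xr1 Xr2 Xr3 Xr4 Xr5] t0.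
have r1 : 1 <= r by rewrite -(ler_pM2l kap_gt0) mulr1.
have X0 : 0 < kap * r by exact: mulr_gt0.
have A0 := saddle_area_gt0 a kap_gt0 r0.
have B0 := saddle_value_gt0 a kap_gt0 r0; have u00 := saddle_gt0 kap_gt0 r0.
have u1 : 1 <= u0 r.
  rewrite /saddle ler_pdivlMr ?mulr_gt0// mul1r.
  by rewrite -(ler_pM2l kap_gt0); move: Xr4; rewrite expr2; lra.
have v1 : v0 r <= 1 by exact: powRN_le1 (ltW beta_gt0) u1.
have pi0 : 0 < pi :> R by exact: pi_gt0.
pose h u := 4 * pi * gauss_weight (a + 1) kap r u.
have h0 u : 0 < u -> 0 <= h u.
  by move=> _; rewrite /h mulr_ge0 ?gauss_weight_ge0// mulr_ge0// ltW.
have mq1 : measurable_fun (posR : set R) (gauss_weight (a + 1) kap r) by exact: measurable_gauss_weight.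
have mh : measurable_fun (posR : set R) h by rewrite /h; mfun.
have decr (x : R) : 0 < x -> (4 * pi * x) `^ (- (a + 1)) = (4 * pi * x) `^ (- a) / (4 * pi * x).
  move=> x0; have p0 : 0 < 4 * pi * x by rewrite !mulr_gt0.
  rewrite opprD powRD; last by rewrite (gt_eqF p0) implybT.
  by rewrite powR_inv1// ltW.
have -> : Phi r t = (\int[leb]_(u in posR) ((h u)%:E * (u * eta t u)%:E))%E.
  apply: eq_integral => u /set_mem; rewrite posRE => u2; rewrite -EFinM; congr EFin.
  rewrite /h /gauss_weight (decr u u2); set E := (4 * pi * u) `^ _.
  by move: pi0; generalize (pi : R) => p p0; field; rewrite !gt_eqF.
have BE : saddle_value (a + 1) kap r = B r / (4 * pi * u0 r).
  by rewrite /saddle_value (decr _ u00) mulrAC.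
have rho0 : 0 < Num.sqrt r by rewrite sqrtr_gt0.
have sq2 : Num.sqrt r * Num.sqrt r = r by rewrite -expr2 sqr_sqrtr// ltW.
have Bu : 0 <= B r / u0 r by exact: divr_ge0 (ltW B0) (ltW u00).
have Sh u : 0 < u -> 0 <= h u * expR (u / r) <= K1 * (B r / u0 r).
  move=> u2; rewrite mulr_ge0 ?h0 ?expR_ge0//=.
  have := Hsup r u r0 Xr1 u2; rewrite BE => hs.
  apply: (@le_trans _ _ (4 * pi * (K1 * (B r / (4 * pi * u0 r)) * expR (- (2 / r * u))) * expR (u / r))).
    apply: ler_wpM2r; first exact: expR_ge0.
    by apply: ler_wpM2l => //; rewrite mulr_ge0 ?(ltW pi0).
  have -> : 4 * pi * (K1 * (B r / (4 * pi * u0 r)) * expR (- (2 / r * u))) * expR (u / r) =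
    K1 * (B r / u0 r) * (expR (- (2 / r * u)) * expR (u / r)).
    move: B0 u00 pi0; move: (B r) (u0 r) => b w b0 w0.
    by generalize (pi : R) => p p0; field; rewrite !gt_eqF.
  rewrite -[leRHS]mulr1; apply: ler_wpM2l; first by rewrite (mulr_ge0 (ltW K10) Bu).
  rewrite -expRD -[leRHS]expR0 ler_expR (_ : _ + _ = - (u / r)); last by field; rewrite gt_eqF.
  by rewrite oppr_le0 divr_ge0 ?ltW.
have mhe : measurable_fun (posR : set R) (fun u => h u * expR (u / r)) by mfun.
have Ih : (\int[leb]_(u in posR) (h u * expR (u / r))%:E <= (I * A r)%:E)%E.
  have p4 : 0 <= 4 * pi :> R by rewrite mulr_ge0 ?(ltW pi0).
  have -> : (\int[leb]_(u in posR) (h u * expR (u / r))%:E =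
     (4 * pi)%:E * \int[leb]_(u in posR) (gauss_weight (a + 1) kap r u * expR (u / r))%:E)%E.
    rewrite -ge0_integralZl_fun//.
    - by apply: eq_integral => u _; rewrite /h mulrA.
    - by mfun.
    - by move=> u _; rewrite mulr_ge0 ?gauss_weight_ge0 ?expR_ge0.
  have hi0 : 0 <= W * u0 r by rewrite mulr_ge0 ?ltW.
  have f0 u : 0 < u -> 0 <= expR (u / r) by rewrite expR_ge0.
  have mf : measurable_fun (posR : set R) (fun u => expR (u / r)) by mfun.
  apply: le_trans (lee_wpmul2l _ (Hup r (fun u => expR (u / r)) _ r0 Xr2 mf f0 hi0 _)) _ => //.
    move=> w /half_window[w0 w3 w4].
    rewrite mulrCA mulrC WE; apply: ler_wpM2r; first exact: ltW.
    apply: ler_pM; rewrite ?powR_ge0 ?expR_ge0//.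
      rewrite !powRN lef_pV2 ?posrE ?powR_gt0//.
      by apply: ge0_ler_powR; rewrite ?nnegrE ?(ltW a1) ?(ltW w3)// ltW.
    rewrite ler_expR (_ : u0 r * w / r = w / (2 * kap)).
      by rewrite ler_pM2r ?invr_gt0 ?mulr_gt0// ltW.
    by rewrite /saddle; field; rewrite !gt_eqF.
  have -> : (\int[leb]_(u in posR) (expR (- (2 / r * u)) * expR (u / r))%:E = r%:E)%E.
    rewrite (integral_posR_scale r0); last 2 first.
    - by mfun.
    - by move=> u _; rewrite lee_fin mulr_ge0 ?expR_ge0.
    have -> : (\int[leb]_(u in posR) (expR (- (2 / r * (r * u))) * expR (r * u / r))%:E =
       \int[leb]_(u in posR) (expR (- u))%:E)%E.
      by apply: eq_integral => u _; rewrite -expRD; congr (expR _)%:E; field; rewrite gt_eqF.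
    by rewrite integral_expRN mule1.
  rewrite BE -!EFinM lee_fin.
  have -> : 4 * pi * (B r / (4 * pi * u0 r) *
     ((1 + 1 / 2) * Num.sqrt (2 * pi / (kap * r)) * (W * u0 r)) +
     B r / (4 * pi * u0 r) * (K2 * expR (- (c * (kap * r)))) * r) =
     3 / 2 * W * A r + B r * (K2 * (2 * kap) * expR (- (c * (kap * r)))).
    rewrite /saddle_area; move: (Num.sqrt _) (expR _) (B r) => Q E b.
    by rewrite /saddle; move: pi0; generalize (pi : R) => p p0; field; rewrite !gt_eqF.
  rewrite IE (_ : (2 * W + 1) * A r = 2 * W * A r + A r); last by ring.
  apply: lerD.
    by rewrite ler_pM2r// ler_pM2r//; lra.
  apply: (le_trans (Hneg r r0 Xr3)); rewrite mul1r -[leRHS]mulr1.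
  by rewrite ler_pM2l.
pose rho := Num.sqrt r.
have J0 : 0 <= rho `^ (- beta) * (I * A r) + K1 * (B r / u0 r) * (rho `^ (1 - beta) / (1 - beta)).
  apply: addr_ge0; apply: mulr_ge0; rewrite ?powR_ge0//.
  - by rewrite mulr_ge0// ltW.
  - by rewrite (mulr_ge0 (ltW K10) Bu).
  - by rewrite divr_ge0 ?powR_ge0// ltW.
have HJ v : 0 < v -> (\int[leb]_(u in posR) (h u * expR (u / r) * frac_kernel beta u v)%:E <=
    (rho `^ (- beta) * (I * A r) + K1 * (B r / u0 r) * (rho `^ (1 - beta) / (1 - beta)))%:E)%E.
  by move=> v2; apply: frac_shift.
apply: (le_trans (mix_frac r0 t0 J0 mh h0 HJ)).
have rhoE : rho `^ (- beta) * r `^ beta = r `^ (beta / 2).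
  rewrite /rho -powR12_sqrt ?(ltW r0)// -powRrM -powRD; last by rewrite (gt_eqF r0) implybT.
  by congr (_ `^ _); field.
have rho1 : rho `^ (1 - beta) = rho * rho `^ (- beta).
  rewrite powRD; last by rewrite (gt_eqF rho0) implybT.
  by rewrite powRr1// ltW.
rewrite lee_fin rho1 -mulrA mulrDl -(mulrA C) ler_pM2l//.
have -> : rho `^ (- beta) * (I * A r) * r `^ beta +
   K1 * (B r / u0 r) * (rho * rho `^ (- beta) / (1 - beta)) * r `^ beta =
   (I * A r + K1 * (B r / u0 r) * rho / (1 - beta)) * r `^ (beta / 2).
  rewrite -rhoE; move: (B r) (rho `^ _) (r `^ _) (A r) u00 => b x y z; move: (u0 r) => v v2.
  by move: b1; move: (1 - beta) => bb b1; field; rewrite !gt_eqF.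
rewrite [leRHS]mulrA; apply: ler_wpM2r; first exact: powR_ge0.
rewrite mulrDl lerD2l SE.
have BA : B r <= (1 + kap) * rho * A r.
  rewrite /saddle_area mulrCA -[leLHS]mulr1 ler_pM2l//.
  have s0 : 0 < Num.sqrt (2 * pi / (kap * r)) by rewrite sqrtr_gt0 divr_gt0// mulr_gt0.
  rewrite -(@ler_pXn2r _ 2) ?nnegrE ?mulr_ge0 ?ltW ?addr_gt0//.
  rewrite expr1n !exprMn !sqr_sqrtr ?(ltW r0)// ?divr_ge0 ?mulr_ge0 ?ltW//.
  have -> : (1 + kap) ^+ 2 * r * (2 * pi / (kap * r)) = ((1 + kap) ^+ 2 / kap) * (2 * pi).
    by generalize (pi : R) => p; field; rewrite !gt_eqF.
  have p2 := pi_ge2 R.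
  have k1 : 1 <= (1 + kap) ^+ 2 / kap by rewrite ler_pdivlMr// mul1r; nra.
  by nra.
have uE : (u0 r)^-1 = 2 * kap / r by rewrite /saddle; field; rewrite !gt_eqF.
rewrite uE.
have -> : K1 * (B r * (2 * kap / r)) * rho / (1 - beta) =
  K1 * 2 * kap / (1 - beta) / r * rho * B r.
  by move: (B r) => b; move: b1; move: (1 - beta) => bb b1; field; rewrite !gt_eqF.
have -> : K1 * 2 * kap * (1 + kap) / (1 - beta) * A r =
  K1 * 2 * kap / (1 - beta) / r * rho * ((1 + kap) * rho * A r).
  have -> : K1 * 2 * kap / (1 - beta) / r * rho * ((1 + kap) * rho * A r) =
    K1 * 2 * kap / (1 - beta) / r * (rho * rho) * ((1 + kap) * A r) by ring.
  by rewrite /rho sq2; move: (A r) => w; move: b1; move: (1 - beta) => bb b1; field; rewrite !gt_eqF.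
by rewrite ler_pM2l// !mulr_gt0 ?divr_gt0 ?mulr_gt0 ?invr_gt0.
Qed.

End mixture_uniform.

(** * Elementary exponential integrals *)

Section elementary_integrals.
Context (R : realType).
Local Notation leb := (@lebesgue_measure R).
Implicit Types D t : R.

Lemma integral_expRN_scale D : 0 < D ->
  (\int[leb]_(s in posR) (expR (- (D * s)))%:E = (D^-1)%:E)%E.
Proof.
move=> D0; have Di : 0 < D^-1 by rewrite invr_gt0.
rewrite (integral_posR_scale Di); last 2 first.
- by mfun.
- by move=> u _; rewrite lee_fin expR_ge0.
have -> : (\int[leb]_(u in posR) (expR (- (D * (D^-1 * u))))%:E =
   \int[leb]_(u in posR) (expR (- u))%:E)%E.
  by apply: eq_integral => u _; rewrite mulrA mulfV ?mul1r// gt_eqF.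
by rewrite integral_expRN mule1.
Qed.

Lemma integral_id_expRN D : 0 < D ->
  (\int[leb]_(s in posR) (s * expR (- (D * s)))%:E = (D ^- 2)%:E)%E.
Proof.
move=> D0.
pose k (s : R) := s * expR (- (D * s)).
pose K (s : R) := - (s / D + D ^- 2) * expR (- (D * s)).
have dK (x : R) : is_derive x 1 K (k x).
  rewrite /K /k; apply: is_derive_eq.
  by rewrite /GRing.scale /=; field; rewrite gt_eqF.
have ck : continuous k.
  by move=> x; apply: cvgM; [exact: cvg_id | apply: continuous_comp; [apply: cvgN; apply: cvgM; [exact: cvg_cst | exact: cvg_id] | exact: continuous_expR]].
have cK : continuous K.
  by move=> x; apply: differentiable_continuous; apply/derivable1_diffP; case: (dK x).
transitivity (\int[leb]_(s in `[0%R, +oo[) (k s)%:E)%E.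
  rewrite -integral_itv_obnd_cbnd//.
  by apply/measurable_EFinP; rewrite /k; mfun.
rewrite (@ge0_continuous_FTC2y _ k K 0 0).
- have -> : K 0 = - D ^- 2 by rewrite /K mul0r add0r mulr0 oppr0 expR0 mulr1.
  transitivity ((0 - - D ^- 2)%:E); first by [].
  by rewrite sub0r opprK.
- by move=> x x0; rewrite mulr_ge0 ?expR_ge0.
- exact: continuous_subspaceT.
- apply/cvgrPdist_le => e e0.
  have c0 : 0 < e / (D^-1 + D ^- 2) by rewrite divr_gt0// addr_gt0 ?invr_gt0 ?exprn_gt0.
  have [X0 X01 HX] := expRN_powR_small ler01 D0 c0.
  near=> x; have xX : X0 <= x by near: x; apply: nbhs_pinfty_ge; rewrite num_real.
  have x1 : 1 <= x by exact: le_trans X01 xX.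
  have xp : 0 < x by exact: lt_le_trans x1.
  have Di : 0 < D^-1 by rewrite invr_gt0.
  have D2 : 0 < D ^- 2 by rewrite invr_gt0 exprn_gt0.
  have xD0 : 0 < x / D by rewrite divr_gt0.
  rewrite sub0r normrN /K normrM normrN (gtr0_norm (addr_gt0 xD0 D2)).
  rewrite gtr0_norm ?expR_gt0//.
  apply: (@le_trans _ _ ((D^-1 + D ^- 2) * (expR (- (D * x)) * x))).
    rewrite [leRHS](_ : _ = (x * D^-1 + x * D ^- 2) * expR (- (D * x))); last by ring.
    apply: ler_wpM2r; first exact: expR_ge0.
    by rewrite lerD2l -[leLHS]mul1r; apply: ler_wpM2r => //; exact: ltW.
  have := HX x xX; rewrite powRr1 ?(ltW xp)// => h.
  by rewrite mulrC -ler_pdivlMr// addr_gt0.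
- by move=> x _; case: (dK x).
- by apply: cvg_at_right_filter; exact: cK.
- by move=> x _; rewrite derive1E; apply: derive_val.
Unshelve. all: by end_near. Qed.

Lemma integral_expR_itv D t : 0 < D -> 0 < t ->
  (\int[leb]_(s in `]0%R, t[) (expR (D * s))%:E = ((expR (D * t) - 1) / D)%:E)%E.
Proof.
move=> D0 t0; pose K (s : R) := expR (D * s) / D.
have dK (x : R) : is_derive x 1 K (expR (D * x)).
  rewrite /K; apply: is_derive_eq.
  by rewrite /GRing.scale /=; field; rewrite gt_eqF.
have cK : continuous K.
  by move=> x; apply: differentiable_continuous; apply/derivable1_diffP; case: (dK x).
have ck : continuous (fun s : R => expR (D * s)).
  by move=> x; apply: continuous_comp; [apply: cvgM; [exact: cvg_cst | exact: cvg_id] | exact: continuous_expR].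
transitivity (\int[leb]_(s in `[0%R, t]) (expR (D * s))%:E)%E.
  rewrite -integral_itv_obnd_cbnd; last by mfun.
  by rewrite -[RHS]integral_itv_bndo_bndc//; mfun.
rewrite (continuous_FTC2 (F := K) t0); last 3 first.
- exact: continuous_subspaceT.
- split; first by move=> x _; case: (dK x).
  + by apply: cvg_at_right_filter; exact: cK.
  + by apply: cvg_at_left_filter; exact: cK.
- by move=> x _; rewrite derive1E; apply: derive_val.
by rewrite /K mulr0 expR0 -EFinB -mulrBl.
Qed.

End elementary_integrals.

(** * Time integrals of the mixture *)

Section time_integrals.
Context (R : realType) (alpha a kap : R) (eta : R -> R -> R).
Local Notation leb := (@lebesgue_measure R).
Hypotheses (alpha_gt0 : 0 < alpha) (alpha_lt2 : alpha < 2).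
Hypothesis etaP : stable_subordinator_density alpha eta.
Hypotheses (a_gt0 : 0 < a) (kap_gt0 : 0 < kap).
Local Notation beta := (alpha / 2).
Local Notation q := (gauss_weight a kap).
Local Notation u0 := (saddle kap).
Local Notation B := (saddle_value a kap).
Local Notation Phi := (mixture a kap eta).
Local Notation A := (saddle_area a kap).
Local Notation v0 := (time_scale alpha kap).
Local Notation gam := (Gamma (1 - beta)).
Variable C : R.
Hypothesis CE : C = beta / gam.

Let beta_gt0 : 0 < beta. Proof. by rewrite divr_gt0. Qed.
Let beta_lt1 : beta < 1. Proof. by rewrite ltr_pdivrMr// mul1r. Qed.

(* With [s = u0 r `^ beta * s'], this is the integral of the statement up to
   the factor [u0 r `^ beta]. *)
Definition time_integral (D r t : R) : R :=
  (\int[leb]_(s in `]0%R, t[) (expR (D * s) * eta (s * v0 r) 1))%R.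
Local Notation H := time_integral.

Local Notation It t := (`]0%R, t[%classic : set R).
Let mIt t : measurable (It t). Proof. exact: measurable_itv. Qed.
Let subIt t : It t `<=` (posR : set R).
Proof. by move=> s; rewrite /= !in_itv/= andbT => /andP[]. Qed.
Let ItE t s : It t s = (0 < s < t). Proof. by rewrite /= in_itv. Qed.

Let mg r : 0 < r -> measurable_fun (posR : set R) (fun s => eta (s * v0 r) 1).
Proof.
move=> r0; have v0r := time_scale_gt0 alpha kap_gt0 r0.
apply: (measurable_comp (F := (posR : set R)) (f := fun z => eta z 1) (g := fun s : R => s * v0 r)) => //.
- by move=> y [s /=]; rewrite !in_itv/= !andbT => s0 <-; rewrite mulr_gt0.
- exact: (measurable_eta_one alpha_gt0 etaP).
- by mfun.
Qed.

Let mgI r t : 0 < r -> measurable_fun (It t) (fun s => eta (s * v0 r) 1).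
Proof. by move=> r0; apply: measurable_funS (mg r0) => //; exact: subIt. Qed.

Let geta r s : 0 < r -> 0 < s -> 0 < eta (s * v0 r) 1.
Proof. by move=> r0 s0; apply: (eta_gt0 etaP) => //; rewrite mulr_gt0// time_scale_gt0. Qed.

Let integral_cst_It t c : 0 < t -> (\int[leb]_(s in It t) c%:E = (c * t)%:E)%E.
Proof. move=> t0; transitivity (c%:E * leb (It t))%E; first exact: integral_cst.
by rewrite lebesgue_measure_itv/= lte_fin t0 sube0. Qed.

Lemma time_integralE D r t : 0 < r -> 0 < t ->
  ((H D r t)%:E = \int[leb]_(s in `]0%R, t[) (expR (D * s) * eta (s * v0 r) 1)%:E)%E.
Proof.
move=> r0 t0; have v0r := time_scale_gt0 alpha kap_gt0 r0.
rewrite /time_integral /Rintegral fineK// ge0_fin_numE; last first.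
  apply: integral_ge0 => s; rewrite ItE => /andP[s0 _].
  by rewrite lee_fin mulr_ge0 ?expR_ge0// ltW// geta.
have Z0 : 0 < t * v0 r by rewrite mulr_gt0.
have [c1 [c2 [c10 c20 Hb]]] := eta_one_bounds alpha_gt0 alpha_lt2 etaP CE Z0.
apply: (@le_lt_trans _ _ (\int[leb]_(s in It t) (expR (`|D| * t) * (c2 * (t * v0 r)))%:E)%E).
  apply: ge0_le_integral_EFin => //.
  - by have h := @mgI r t r0; mfun.
  - by move=> s; rewrite ItE => /andP[s0 _]; rewrite mulr_ge0 ?expR_ge0// ltW// geta.
  move=> s; rewrite ItE => /andP[s0 st].
  have sv : s * v0 r <= t * v0 r by rewrite ler_pM2r// ltW.
  apply: ler_pM; rewrite ?expR_ge0//.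
  - by rewrite ltW// geta.
  - rewrite ler_expR (le_trans (ler_norm _))// normrM (gtr0_norm s0).
    by rewrite ler_wpM2l// ltW.
  - have /Hb/andP[_ h] : 0 < s * v0 r <= t * v0 r by rewrite sv mulr_gt0.
    by apply: (le_trans h); rewrite ler_pM2l.
by rewrite integral_cst_It// ltry.
Qed.

(** Keep only s > t/2, where eta(s v0, 1) >= c1 v0 t/2. The growth in [t] is what later absorbs
    errors of size v0 and of size t v0. *)
Lemma time_integral_lower Z : 0 < Z -> exists2 c1 : R, 0 < c1 &
  forall D r t, 0 <= D -> 0 < r -> 0 < t -> t * v0 r <= Z ->
    c1 * (v0 r * (t ^+ 2 / 4)) <= H D r t.
Proof.
move=> Z0; have [c1 [c2 [c10 c20 Hb]]] := eta_one_bounds alpha_gt0 alpha_lt2 etaP CE Z0.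
exists c1 => // D r t D0 r0 t0 tZ; have v0r := time_scale_gt0 alpha kap_gt0 r0.
have t2 : 0 < t / 2 by rewrite divr_gt0.
have tt : t / 2 < t by rewrite ltr_pdivrMr// ltr_pMr// ltr1n.
rewrite -lee_fin time_integralE//.
have sub : (`](t / 2)%R, t[ : set R) `<=` It t.
  by move=> s; rewrite ItE /= in_itv/= => /andP[s1 ->]; rewrite (lt_trans _ s1).
apply: (@le_trans _ _ (\int[leb]_(s in `](t / 2)%R, t[) (expR (D * s) * eta (s * v0 r) 1)%:E)%E); last first.
  apply: ge0_subset_integral => //.
  - by apply/measurable_EFinP; have h := @mgI r t r0; mfun.
  - move=> s; rewrite ItE => /andP[s0 _].
    by rewrite lee_fin mulr_ge0 ?expR_ge0// ltW// geta.
apply: (@le_trans _ _ (\int[leb]_(s in `](t / 2)%R, t[) (c1 * (v0 r * (t / 2)))%:E)%E).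
  rewrite (_ : (\int[leb]_(s in `](t / 2)%R, t[) (c1 * (v0 r * (t / 2)))%:E =
      (c1 * (v0 r * (t / 2)))%:E * leb (`](t / 2)%R, t[ : set R))%E).
    rewrite lebesgue_measure_itv/= lte_fin tt -EFinB -EFinM lee_fin.
    by rewrite le_eqVlt; apply/orP; left; apply/eqP; field.
  exact: integral_cst.
apply: ge0_le_integral_EFin => //.
- have h := measurable_funS (mIt t) sub (@mgI r t r0); by mfun.
- by move=> s _; rewrite mulr_ge0 ?(ltW c10)// mulr_ge0 ?ltW.
move=> s; rewrite /= in_itv/= => /andP[s1 st]; have s0 : 0 < s by exact: lt_trans s1.
have /Hb/andP[h _] : 0 < s * v0 r <= Z.
  by rewrite mulr_gt0//=; apply: le_trans tZ; rewrite ler_pM2r// ltW.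
rewrite -[leLHS]mul1r; apply: ler_pM => //.
- by rewrite mulr_ge0 ?(ltW c10)// mulr_ge0 ?ltW.
- by rewrite -[leLHS]expR0 ler_expR mulr_ge0// ltW.
- by apply: le_trans h; rewrite ler_pM2l// mulrC ler_pM2r// ltW.
Qed.

(** [mixture_near] is integrated in [s]. Its additive error e A v0 is relative for s >= 1, because
    v0 <= eta(s v0, 1) / k1 there; for s < 1 it contributes at most e A v0 e^D, which the lower
    bound on [H] outgrows as [t] increases. *)
Lemma mixture_time_integral D Z th : 0 <= D -> 0 < Z -> 0 < th <= 1 ->
  exists2 X0 : R, 0 < X0 & forall r t, 0 < r -> X0 <= kap * r -> X0 <= t ->
    t * v0 r <= Z ->
    (((1 - th) * (A r * H D r t))%:E <=
      \int[leb]_(s in `]0%R, t[) ((expR (D * s))%:E * Phi r s))%E /\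
    (\int[leb]_(s in `]0%R, t[) ((expR (D * s))%:E * Phi r s) <=
      ((1 + th) * (A r * H D r t))%:E)%E.
Proof.
move=> D0 Z0 /andP[th0 th1].
have [c1 c10 Hlow] := time_integral_lower Z0.
have [k1 [k2 [k10 k20 Hb]]] := eta_one_bounds alpha_gt0 alpha_lt2 etaP CE Z0.
have [e [e0 e1 ek]] : exists e, [/\ 0 < e, e <= th / 2 & e + e / k1 <= th / 2].
  have k3 : 0 < 1 + k1^-1 by rewrite addr_gt0// invr_gt0.
  exists (th / 2 / (1 + k1^-1)); split; first by rewrite !divr_gt0.
    by rewrite ler_pdivrMr// ler_peMr ?divr_ge0 ?(ltW th0)// lerDl invr_ge0 ltW.
  have -> : forall x, x + x / k1 = x * (1 + k1^-1) by move=> x; ring.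
  by rewrite divfK// gt_eqF.
have e01 : 0 < e <= 1 by rewrite e0; apply: (le_trans e1); lra.
have [X1 X10 Hn] := mixture_near alpha_gt0 alpha_lt2 etaP a_gt0 kap_gt0 Z0 e01.
(* Solves (th/2) c1 L = e e^D; it is used through t^2/4 >= t - 1 >= L. *)
have [L LE] : exists L, L = 2 * (e * expR D) / (c1 * th) by exists (2 * (e * expR D) / (c1 * th)).
have L0 : 0 < L by rewrite LE divr_gt0 ?mulr_gt0 ?expR_gt0.
exists (Num.max X1 (2 + L)); first by rewrite lt_max X10.
move=> r t r0; rewrite !ge_max => /andP[Xr1 _] /andP[_ tL] tZ.
have v0r := time_scale_gt0 alpha kap_gt0 r0; have A0 := saddle_area_gt0 a kap_gt0 r0.
have t1 : 1 < t by lra.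
have tL1 : L <= t - 1 by lra.
have t0 : 0 < t by exact: lt_trans t1.
have HH := time_integralE D r0 t0.
have mgt := @mgI r t r0.
have HnI s : It t s -> (((1 - e) * (A r * eta (s * v0 r) 1))%:E <= Phi r s)%E /\
    (Phi r s <= ((1 + e) * (A r * eta (s * v0 r) 1) + e * (A r * v0 r))%:E)%E.
  rewrite ItE => /andP[s0 st]; apply: Hn => //.
  by apply: le_trans tZ; rewrite ler_pM2r// ltW.
have mPhi : measurable_fun (It t) (fun s => (expR (D * s))%:E * Phi r s)%E.
  have h := measurable_funS (measurable_itv _) (@subIt t) (measurable_mixture a kap alpha_gt0 etaP r).
  by mfun.
have Hge0 : 0 <= H D r t.
  by rewrite -lee_fin HH; apply: integral_ge0 => s; rewrite ItE => /andP[s0 _];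
    rewrite lee_fin mulr_ge0 ?expR_ge0// ltW// geta.
split.
  apply: (@le_trans _ _ (((1 - e) * A r)%:E * (H D r t)%:E)%E).
    rewrite -EFinM lee_fin mulrA; apply: ler_wpM2r => //.
    by rewrite ler_pM2r//; lra.
  have e2 : 0 <= (1 - e) * A r by rewrite mulr_ge0 ?(ltW A0)//; lra.
  rewrite HH -ge0_integralZl_fun//; last 2 first.
  - by mfun.
  - by move=> s; rewrite ItE => /andP[s0 _]; rewrite mulr_ge0 ?expR_ge0// ltW// geta.
  apply: ge0_le_integral => //.
  - move=> s; rewrite ItE => /andP[s0 _].
    by rewrite lee_fin mulr_ge0// mulr_ge0 ?expR_ge0// ltW// geta.
  - by apply/measurable_EFinP; mfun.
  move=> s sI; have [h _] := HnI s sI.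
  rewrite (_ : _ * A r * _ = expR (D * s) * ((1 - e) * (A r * eta (s * v0 r) 1))); last by ring.
  by rewrite EFinM; apply: lee_wpmul2l => //; rewrite lee_fin expR_ge0.
(* The additive error on s < 1, the only range where it is not dominated by eta(s v0, 1). *)
pose c3 := e * (A r * v0 r) * expR D.
have Av0 : 0 <= A r * v0 r by rewrite mulr_ge0 ?ltW.
have eAv0 : 0 <= e * (A r * v0 r) by rewrite mulr_ge0 ?(ltW e0).
have c30 : 0 <= c3 by rewrite mulr_ge0 ?expR_ge0.
pose ind (s : R) : R := \1_(It 1) s.
have mind : measurable_fun (It t) ind by apply: measurable_funTS; exact: measurable_indic.
have th2 : 0 <= (1 + th / 2) * A r by rewrite mulr_ge0 ?(ltW A0)// addr_ge0// divr_ge0// ltW.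
apply: (@le_trans _ _ (\int[leb]_(s in It t) ((1 + th / 2) * A r *
   (expR (D * s) * eta (s * v0 r) 1) + c3 * ind s)%:E)%E).
  apply: ge0_le_integral => //.
  - move=> s; rewrite ItE => /andP[s0 _].
    by rewrite mule_ge0 ?lee_fin ?expR_ge0// (mixture_ge0 _ _ etaP).
  - by apply/measurable_EFinP; mfun.
  move=> s sI; have [_ h] := HnI s sI; move: sI; rewrite ItE => /andP[s0 st].
  apply: (@le_trans _ _ ((expR (D * s))%:E * ((1 + e) * (A r * eta (s * v0 r) 1) + e * (A r * v0 r))%:E)%E).
    by apply: lee_wpmul2l => //; rewrite lee_fin expR_ge0.
  rewrite -EFinM lee_fin; have E0 := expR_gt0 (D * s); have g0 := geta r0 s0.
  have eth : 1 + e <= 1 + th / 2 by rewrite lerD2l.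
  have [s1|s1] := ltP s 1.
    rewrite /ind indicE mem_set ?ItE ?s0// mulr1 mulrDr; apply: lerD.
      have -> : expR (D * s) * ((1 + e) * (A r * eta (s * v0 r) 1)) =
        (1 + e) * (A r * (expR (D * s) * eta (s * v0 r) 1)) by ring.
      rewrite -[leRHS]mulrA; apply: ler_wpM2r => //.
      by rewrite mulr_ge0 ?(ltW A0)// mulr_ge0 ?(ltW E0) ?(ltW g0).
    rewrite mulrC /c3; apply: ler_wpM2l => //.
    by rewrite ler_expR ler_piMr// ltW.
  rewrite /ind indicE memNset; last by rewrite ItE => /andP[_]; rewrite ltNge s1.
  rewrite mulr0 addr0.
  have /Hb/andP[hk _] : 0 < s * v0 r <= Z.
    by rewrite mulr_gt0//=; apply: le_trans tZ; rewrite ler_pM2r// ltW.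
  have vk : v0 r <= eta (s * v0 r) 1 / k1.
    rewrite ler_pdivlMr// mulrC; apply: le_trans hk.
    by rewrite ler_pM2l// ler_peMl// ltW.
  have -> : (1 + th / 2) * A r * (expR (D * s) * eta (s * v0 r) 1) =
    expR (D * s) * ((1 + th / 2) * (A r * eta (s * v0 r) 1)) by ring.
  rewrite ler_pM2l//; apply: (@le_trans _ _ ((1 + (e + e / k1)) * (A r * eta (s * v0 r) 1))).
    rewrite (_ : (1 + (e + e / k1)) * (A r * eta (s * v0 r) 1) =
      (1 + e) * (A r * eta (s * v0 r) 1) + e * (A r * (eta (s * v0 r) 1 / k1))); last by ring.
    by rewrite lerD2l ler_pM2l// ler_pM2l.
  apply: ler_wpM2r; first by rewrite mulr_ge0 ?ltW.
  by rewrite lerD2l.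
rewrite ge0_integralD_fun//; first last.
- by move=> s _; rewrite mulr_ge0// /ind indicE.
- move=> s; rewrite ItE => /andP[s0 _].
  by rewrite mulr_ge0// mulr_ge0 ?expR_ge0// ltW// geta.
- by mfun.
- by mfun.
rewrite ge0_integralZl_fun//; first last.
- by move=> s; rewrite ItE => /andP[s0 _]; rewrite mulr_ge0 ?expR_ge0// ltW// geta.
- by mfun.
rewrite [X in (X * _ + _)%E]EFinM -HH -EFinM.
rewrite ge0_integralZl_fun//.
rewrite integral_indic//.
apply: (@le_trans _ _ (((1 + th / 2) * A r * H D r t)%:E + c3%:E * 1)%E).
  rewrite -EFinM leeD2l//; apply: lee_wpmul2l => //.
  apply: (@le_trans _ _ (leb (It 1))); last by rewrite lebesgue_measure_itv/= lte_fin ltr01 sube0.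
  by apply: le_measure; rewrite ?inE//; exact: measurableI.
rewrite mule1 -EFinD lee_fin.
have -> : (1 + th) * (A r * H D r t) = (1 + th / 2) * A r * H D r t + th / 2 * (A r * H D r t) by field.
rewrite lerD2l /c3.
have h := Hlow D r t D0 r0 t0 tZ.
apply: (@le_trans _ _ (th / 2 * (A r * (c1 * (v0 r * L))))); last first.
  rewrite ler_pM2l ?divr_gt0// ler_pM2l//; apply: le_trans h.
  rewrite ler_pM2l// ler_pM2l//; apply: (le_trans tL1).
  have -> : t ^+ 2 / 4 = t - 1 + (t / 2 - 1) ^+ 2 by field.
  by rewrite lerDl sqr_ge0.
rewrite LE le_eqVlt; apply/orP; left; apply/eqP.
by move: (expR D) => E; field; rewrite !gt_eqF.
Qed.

(** The growing weight e^(Ds) concentrates the integral near s = t, where eta(s v0, 1) is close to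
    eta(t v0, 1) in relative terms; the ratio s/t is all that [eta_one_ratio] needs, so the estimate
    is uniform in [r]. *)
Lemma time_integral_exp D Z th : 0 < D -> 0 < Z -> 0 < th <= 1 ->
  exists2 X0 : R, 0 < X0 & forall r t, 0 < r -> X0 <= t -> t * v0 r <= Z ->
    (1 - th) * (expR (D * t) * eta (t * v0 r) 1) <= D * H D r t <=
    (1 + th) * (expR (D * t) * eta (t * v0 r) 1).
Proof.
move=> D0 Z0 /andP[th0 th1].
have [k1 [k2 [k10 k20 Hb]]] := eta_one_bounds alpha_gt0 alpha_lt2 etaP CE Z0.
have th3 : 0 < th / 3 by rewrite divr_gt0.
have [dl /andP[dl0 dl1] Hd] := eta_one_ratio alpha_gt0 alpha_lt2 etaP erefl Z0 th3.
have [w wE] : exists w, w = D * (1 + k2 / k1) by exists (D * (1 + k2 / k1)).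
have kk0 : 0 < k2 / k1 by rewrite divr_gt0.
have w0 : 0 < w by rewrite wE mulr_gt0// addr_gt0.
have [X1 X11 HX] := expRN_powR_small ler01 (mulr_gt0 D0 dl0) (divr_gt0 th3 w0).
have thw : 0 < th / 3 by [].
have [X2 X21 HX2] := expRN_powR_small (lexx 0) D0 th3.
exists (Num.max X1 X2); first by rewrite lt_max (lt_le_trans ltr01).
move=> r t r0; rewrite ge_max => /andP[tX1 tX2] tZ.
have t1 : 1 <= t by exact: le_trans X11 tX1.
have t0 : 0 < t by exact: lt_le_trans t1.
have v0r := time_scale_gt0 alpha kap_gt0 r0.
have [g gE] : exists g, g = eta (t * v0 r) 1 by exists (eta (t * v0 r) 1).
have g0 : 0 < g by rewrite gE geta.
have E0 := expR_gt0 (D * t).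
(* Times before [b] contribute, up to a constant times eta(t v0, 1), at most t e^(Db), exponentially
   less than e^(Dt). *)
have [b bE] : exists b, b = (1 - dl) * t by exists ((1 - dl) * t).
have tb : t * expR (D * b) <= th / 3 / w * expR (D * t).
  have := HX t tX1; rewrite powRr1 ?(ltW t0)// => h.
  have -> : expR (D * b) = expR (- (D * dl * t)) * expR (D * t).
    by rewrite -expRD bE; congr expR; ring.
  by rewrite mulrA (mulrC t) ler_pM2r.
have one : 1 <= th / 3 * expR (D * t).
  have := HX2 t tX2; rewrite powRr0 mulr1 expRN.
  by rewrite -[X in X <= _]mul1r ler_pdivrMr.
have mgt := @mgI r t r0.
have HH := time_integralE D r0 t0.
have HI := integral_expR_itv D0 t0.
have near s : 0 < s < t -> b <= s -> (1 - th / 3) * g <= eta (s * v0 r) 1 <= (1 + th / 3) * g.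
  move=> /andP[s0 st] bs; have hz : 0 < t * v0 r <= Z by rewrite mulr_gt0.
  have : `|s / t - 1| <= dl.
    rewrite distrC ger0_norm ?subr_ge0 ?ler_pdivrMr ?mul1r ?(ltW st)//.
    by rewrite lerBlDr -lerBlDl ler_pdivlMr// -bE.
  move=> /(Hd _ hz); have -> : s / t * (t * v0 r) = s * v0 r by field; rewrite gt_eqF.
  by rewrite -gE ler_norml => /andP[h1 h2]; apply/andP; split; lra.
have far s : 0 < s < t -> eta (s * v0 r) 1 <= k2 / k1 * g.
  move=> /andP[s0 st]; have sv : s * v0 r <= t * v0 r by rewrite ler_pM2r// ltW.
  have /Hb/andP[_ h] : 0 < s * v0 r <= Z by rewrite mulr_gt0//= (le_trans sv).
  have /Hb/andP[h' _] : 0 < t * v0 r <= Z by rewrite mulr_gt0.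
  apply: (le_trans h); apply: (@le_trans _ _ (k2 * (t * v0 r))); first by rewrite ler_pM2l.
  rewrite (_ : k2 / k1 * g = k2 * (g / k1)); last by ring.
  rewrite ler_pM2l// ler_pdivlMr// gE mulrC.
  exact: h'.
have Dw : D * (k2 / k1) <= w by rewrite wE ler_pM2l// lerDr.
have Dw1 : D <= w by rewrite wE ler_peMr ?(ltW D0)// lerDl ltW.
have tbw : w * (t * expR (D * b)) <= th / 3 * expR (D * t).
  move: tb; rewrite -(ler_pM2l w0); set lhs := w * _ => h; apply: (le_trans h).
  by rewrite le_eqVlt; apply/orP; left; apply/eqP; field; rewrite gt_eqF.
have tb0 : 0 <= t * expR (D * b) by rewrite mulr_ge0 ?expR_ge0// ltW.
have p1 : 0 <= (1 + th / 3) * g by rewrite mulr_ge0 ?(ltW g0)// addr_ge0// ltW.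
have p2 : 0 <= (1 - th / 3) * g by rewrite mulr_ge0 ?(ltW g0)//; lra.
have p3 : 0 <= k2 / k1 * g * expR (D * b) by rewrite mulr_ge0 ?expR_ge0// mulr_ge0 ?ltW.
have p4 : 0 <= (1 - th / 3) * g * expR (D * b) by rewrite mulr_ge0 ?expR_ge0.
have me : measurable_fun (It t) (fun s => expR (D * s)) by mfun.
have bound x : 0 <= x <= w * (t * expR (D * b)) -> x <= th / 3 * expR (D * t).
  by move=> /andP[_ h]; exact: le_trans h tbw.
apply/andP; split.
  have h : (1 - th / 3) * g * ((expR (D * t) - 1) / D) <= H D r t + (1 - th / 3) * g * expR (D * b) * t.
    rewrite -lee_fin EFinM -HI EFinD HH -(integral_cst_It _ t0).
    rewrite -ge0_integralZl_fun// -?ge0_integralD_fun//.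
    - apply: ge0_le_integral_EFin => //.
      + by mfun.
      + by mfun.
      + by move=> s _; rewrite mulr_ge0 ?expR_ge0.
      move=> s; rewrite ItE => sI; have /andP[s0 st] := sI.
      have eg : 0 <= expR (D * s) * eta (s * v0 r) 1 by rewrite mulr_ge0 ?expR_ge0// ltW// geta.
      have [bs|sb] := leP b s.
        have /andP[h _] := near s sI bs; rewrite -[leLHS]addr0; apply: lerD => //.
        by rewrite mulrC; apply: ler_wpM2l => //; exact: expR_ge0.
      rewrite -[leLHS]add0r; apply: lerD => //; apply: ler_wpM2l => //.
      by rewrite ler_expR ler_pM2l// ltW.
    - by mfun.
    - by move=> s; rewrite ItE => /andP[s0 _]; rewrite mulr_ge0 ?expR_ge0// ltW// geta.
  have h2 : D * ((1 - th / 3) * g * expR (D * b) * t) <= g * (th / 3 * expR (D * t)).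
    have -> : D * ((1 - th / 3) * g * expR (D * b) * t) = g * ((1 - th / 3) * (D * (t * expR (D * b)))) by ring.
    rewrite ler_pM2l//; apply: le_trans tbw; apply: (@le_trans _ _ (D * (t * expR (D * b)))).
      by rewrite ler_piMl ?mulr_ge0 ?(ltW D0)//; lra.
    exact: ler_wpM2r.
  have h3 : (1 - th / 3) * g * (expR (D * t) - 1) <= D * H D r t + D * ((1 - th / 3) * g * expR (D * b) * t).
    have -> : (1 - th / 3) * g * (expR (D * t) - 1) = D * ((1 - th / 3) * g * ((expR (D * t) - 1) / D)).
      by move: (expR _) => x; field; rewrite gt_eqF.
    by rewrite -mulrDr ler_pM2l.
  rewrite -gE; move: h2 h3 one; move: (D * H D r t) (D * _) (expR (D * t)) E0 => x y E E0 h2 h3 one.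
  have : (1 - th / 3) * g * (E - th / 3 * E) <= (1 - th / 3) * g * (E - 1).
    by apply: ler_wpM2l => //; lra.
  move=> h4; have h5 : 0 <= g * E by rewrite mulr_ge0 ?ltW.
  have h6 : (1 - th / 3) * g * (E - th / 3 * E) = (1 - th / 3) ^+ 2 * (g * E) by ring.
  have h7 : (1 - th) * (g * E) <= ((1 - th / 3) ^+ 2 - th / 3) * (g * E).
    by apply: ler_wpM2r => //; have := sqr_ge0 th; rewrite !expr2; lra.
  by rewrite (mulrC E); lra.
have h : H D r t <= (1 + th / 3) * g * ((expR (D * t) - 1) / D) + k2 / k1 * g * expR (D * b) * t.
  rewrite -lee_fin EFinD EFinM -HI HH -(integral_cst_It _ t0).
  rewrite -ge0_integralZl_fun// -?ge0_integralD_fun//.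
  - apply: ge0_le_integral_EFin => //.
    + by mfun.
    + by mfun.
    + by move=> s; rewrite ItE => /andP[s0 _]; rewrite mulr_ge0 ?expR_ge0// ltW// geta.
    move=> s; rewrite ItE => sI; have /andP[s0 st] := sI.
    have [bs|sb] := leP b s.
      have /andP[_ h] := near s sI bs; rewrite -[leLHS]addr0; apply: lerD => //.
      by rewrite [leRHS]mulrC; apply: ler_wpM2l => //; exact: expR_ge0.
    rewrite -[leLHS]add0r; apply: lerD; first by rewrite mulr_ge0 ?expR_ge0.
    rewrite mulrC; apply: ler_pM; rewrite ?expR_ge0//.
    + by rewrite ltW// geta.
    + exact: far.
    + by rewrite ler_expR ler_pM2l// ltW.
  - by mfun.
  - by move=> s _; rewrite mulr_ge0 ?expR_ge0.
have h2 : D * (k2 / k1 * g * expR (D * b) * t) <= g * (th / 3 * expR (D * t)).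
  have -> : D * (k2 / k1 * g * expR (D * b) * t) = g * (D * (k2 / k1) * (t * expR (D * b))) by ring.
  by rewrite ler_pM2l//; apply: le_trans tbw; exact: ler_wpM2r.
have h3 : D * H D r t <= (1 + th / 3) * g * (expR (D * t) - 1) + D * (k2 / k1 * g * expR (D * b) * t).
  have -> : (1 + th / 3) * g * (expR (D * t) - 1) = D * ((1 + th / 3) * g * ((expR (D * t) - 1) / D)).
    by move: (expR _) => x; field; rewrite gt_eqF.
  by rewrite -mulrDr ler_pM2l.
rewrite -gE; move: h2 h3 one; move: (D * H D r t) (D * _) (expR (D * t)) E0 => x y E E0 h2 h3 one.
have h5 : 0 <= g * E by rewrite mulr_ge0 ?ltW.
have h7 : 0 <= th / 3 * (g * E) by rewrite mulr_ge0 ?(ltW th3).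
by rewrite (mulrC E); lra.
Qed.

End time_integrals.

(** * Calculus of relative errors *)

Section relative_closeness.
Variable R : realFieldType.
Implicit Types e c P Q S : R.

Definition close e P Q := (1 - e) * Q <= P <= (1 + e) * Q.

Lemma close_le e e' P Q : e <= e' -> 0 <= Q -> close e P Q -> close e' P Q.
Proof.
move=> ee Q0 /andP[h1 h2]; apply/andP; split.
  by apply: le_trans h1; apply: ler_wpM2r => //; rewrite lerD2l lerN2.
by apply: (le_trans h2); apply: ler_wpM2r => //; rewrite lerD2l.
Qed.

Lemma close_trans e P Q S : 0 <= e <= 1 -> 0 <= S -> close e P Q -> close e Q S ->
  close (3 * e) P S.
Proof.
move=> /andP[e0 e1] S0 /andP[p1 p2] /andP[q1 q2]; apply/andP; split.
  apply: le_trans p1; apply: (@le_trans _ _ ((1 - e) * ((1 - e) * S))).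
    by rewrite mulrA; apply: ler_wpM2r => //; nra.
  by apply: ler_wpM2l => //; rewrite subr_ge0.
apply: (le_trans p2); apply: (@le_trans _ _ ((1 + e) * ((1 + e) * S))).
  by apply: ler_wpM2l => //; rewrite addr_ge0.
by rewrite mulrA; apply: ler_wpM2r => //; nra.
Qed.

Lemma close_sym e P Q : 0 <= e <= 1 / 2 -> 0 <= Q -> close e P Q -> close (2 * e) Q P.
Proof.
move=> /andP[e0 e1] Q0 /andP[p1 p2]; apply/andP; split.
  apply: (@le_trans _ _ ((1 - 2 * e) * ((1 + e) * Q))).
    by apply: ler_wpM2l => //; lra.
  by rewrite mulrA -[leRHS]mul1r; apply: ler_wpM2r => //; nra.
apply: (@le_trans _ _ ((1 + 2 * e) * ((1 - e) * Q))).
  by rewrite mulrA -[leLHS]mul1r; apply: ler_wpM2r => //; nra.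
by apply: ler_wpM2l => //; lra.
Qed.

Lemma closeZ e c P Q : 0 <= c -> close e P Q -> close e (c * P) (c * Q).
Proof.
by move=> c0 /andP[h1 h2]; apply/andP; split; rewrite mulrCA; apply: ler_wpM2l.
Qed.

Lemma closeD e P Q P' Q' : close e P Q -> close e P' Q' -> close e (P + P') (Q + Q').
Proof. by move=> /andP[? ?] /andP[? ?]; apply/andP; split; rewrite mulrDr lerD. Qed.

Lemma close_norm e w : `|w - 1| <= e -> close e w 1.
Proof. by rewrite ler_norml => /andP[? ?]; apply/andP; split; lra. Qed.

Lemma close_refl e Q : 0 <= e -> 0 <= Q -> close e Q Q.
Proof.
by move=> e0 Q0; apply/andP; split; [rewrite ler_piMl//; lra | rewrite ler_peMl//; lra].
Qed.

Lemma closeM e P Q P' Q' : 0 <= e <= 1 -> 0 <= Q -> 0 <= Q' -> 0 <= P' -> close e P Q -> close e P' Q' ->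
  close (3 * e) (P * P') (Q * Q').
Proof.
move=> he Q0 Q0' P0' h h'; apply: (@close_trans _ _ (Q * P')) => //.
- by rewrite mulr_ge0.
- by rewrite mulrC (mulrC Q); exact: closeZ.
- exact: closeZ.
Qed.

End relative_closeness.

(** * Changing the centre from y to y - x, and the case lambda < m *)

Section regimes.
Context (R : realType) (alpha a kap : R) (eta : R -> R -> R).
Local Notation leb := (@lebesgue_measure R).
Hypotheses (alpha_gt0 : 0 < alpha) (alpha_lt2 : alpha < 2).
Hypothesis etaP : stable_subordinator_density alpha eta.
Hypotheses (a_gt0 : 0 < a) (kap_gt0 : 0 < kap).
Local Notation beta := (alpha / 2).
Local Notation q := (gauss_weight a kap).
Local Notation u0 := (saddle kap).
Local Notation B := (saddle_value a kap).
Local Notation Phi := (mixture a kap eta).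
Local Notation A := (saddle_area a kap).
Local Notation v0 := (time_scale alpha kap).
Local Notation gam := (Gamma (1 - beta)).
Variable C : R.
Hypothesis CE : C = beta / gam.

Let beta_gt0 : 0 < beta. Proof. by rewrite divr_gt0. Qed.
Let beta_lt1 : beta < 1. Proof. by rewrite ltr_pdivrMr// mul1r. Qed.

Local Notation H := (time_integral alpha kap eta).

Lemma time_scale_ratio r r' : 0 < r -> 0 < r' -> v0 r' = (r' / r) `^ (- beta) * v0 r.
Proof.
move=> r0 r0'; have hu := ltW (saddle_gt0 kap_gt0 r0); have hw : 0 <= r' / r by rewrite divr_ge0 ?ltW.
rewrite /time_scale -(powRM _ hw hu).
by congr (_ `^ _); rewrite /saddle; field; rewrite !gt_eqF.
Qed.

(** When r' - r stays bounded the power tends to 1 by [ratio_close], and only the exponential of kap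
    (r - r') survives; it is the source of the directional factor in the third case. *)
Lemma saddle_area_ratio r r' : 0 < r -> 0 < r' ->
  A r' = (r' / r) `^ (- (a + 1 / 2)) * (expR (kap * (r - r')) * A r).
Proof.
move=> r0 r0'; have w0 : 0 < r' / r by rewrite divr_gt0.
have pu : 0 < 4 * pi * u0 r by rewrite mulr_gt0 ?saddle_gt0// mulr_gt0// pi_gt0.
rewrite /saddle_area /saddle_value.
have -> : 4 * pi * u0 r' = r' / r * (4 * pi * u0 r).
  by rewrite /saddle; generalize (pi : R) => p; field; rewrite !gt_eqF.
rewrite (powRM _ (ltW w0) (ltW pu)).
have -> : Num.sqrt (2 * pi / (kap * r')) = (r' / r) `^ (- (1 / 2)) * Num.sqrt (2 * pi / (kap * r)).
  have -> : 2 * pi / (kap * r') = (r' / r)^-1 * (2 * pi / (kap * r)).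
    by generalize (pi : R) => p; field; rewrite !gt_eqF.
  rewrite sqrtrM ?invr_ge0 ?(ltW w0)//; congr (_ * _).
  rewrite -powR12_sqrt ?invr_ge0 ?(ltW w0)// -(@powR_inv1 _ (r' / r)) ?(ltW w0)// -powRrM.
  by congr (_ `^ _); field.
have -> : expR (- (kap * r')) = expR (kap * (r - r')) * expR (- (kap * r)).
  by rewrite -expRD; congr expR; ring.
rewrite opprD [in RHS]powRD; last by rewrite (gt_eqF w0) implybT.
by ring.
Qed.

Lemma ratio_close L p th : 0 < L -> 0 < th -> exists2 X0 : R, 0 < X0 &
  forall r r', X0 <= r -> `|r' - r| <= L -> 0 < r' /\ `|(r' / r) `^ p - 1| <= th.
Proof.
move=> L0 th0; have [e /andP[e0 e1] He] := powR_near1 p th0.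
exists (L / e); first by rewrite divr_gt0.
move=> r r' rL hL; have r0 : 0 < r by apply: lt_le_trans rL; rewrite divr_gt0.
have w1 : `|r' / r - 1| <= e.
  have -> : r' / r - 1 = (r' - r) / r by field; rewrite gt_eqF.
  rewrite normrM normfV (gtr0_norm r0) ler_pdivrMr//; apply: (le_trans hL).
  by rewrite mulrC -ler_pdivrMr.
split; last exact: He.
have : 0 < r' / r by move: w1; rewrite ler_norml => /andP[h _]; lra.
by rewrite pmulr_lgt0// invr_gt0.
Qed.

Lemma time_integral_ge0 D r t : 0 < r -> 0 < t -> 0 <= H D r t.
Proof.
move=> r0 t0; apply: Rintegral_ge0 => s /=; rewrite in_itv/= => /andP[s0 _].
by rewrite mulr_ge0 ?expR_ge0// (eta_ge0 etaP)// mulr_gt0// time_scale_gt0.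
Qed.

(** For t >= 1 the additive error of [mixture_near] becomes relative, because eta(t v0, 1) >= c1 t
    v0 >= c1 v0. *)
Lemma mixture_first_term Z th : 0 < Z -> 0 < th <= 1 -> exists2 X0 : R, 0 < X0 &
  forall r t, 0 < r -> X0 <= kap * r -> X0 <= t -> t * v0 r <= Z ->
    exists2 phi, Phi r t = phi%:E & close th phi (A r * eta (t * v0 r) 1).
Proof.
move=> Z0 /andP[th0 th1].
have [c1 [c2 [c10 c20 Hb]]] := eta_one_bounds alpha_gt0 alpha_lt2 etaP CE Z0.
have k3 : 0 < 1 + c1^-1 by rewrite addr_gt0// invr_gt0.
have [e eE] : exists e, e = th / (1 + c1^-1) by exists (th / (1 + c1^-1)).
have e0 : 0 < e by rewrite eE divr_gt0.
have eth : e + e / c1 = th by rewrite -[e in e + _]mulr1 -mulrDr eE divfK// gt_eqF.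
have e1 : e <= th by rewrite -eth lerDl divr_ge0// ltW.
have e01 : 0 < e <= 1 by rewrite e0 (le_trans e1).
have [X1 X10 Hn] := mixture_near alpha_gt0 alpha_lt2 etaP a_gt0 kap_gt0 Z0 e01.
exists (Num.max X1 1); first by rewrite lt_max X10.
move=> r t r0; rewrite !ge_max => /andP[Xr _] /andP[_ t1] tZ.
have t0 : 0 < t by exact: lt_le_trans t1.
have v0r := time_scale_gt0 alpha kap_gt0 r0; have A0 := saddle_area_gt0 a kap_gt0 r0.
have z0 : 0 < t * v0 r by rewrite mulr_gt0.
have g0 := eta_gt0 etaP z0 ltr01.
have [h1 h2] := Hn r t r0 Xr t0 tZ.
have fin : Phi r t \is a fin_num.
  rewrite ge0_fin_numE; last exact: (mixture_ge0 _ _ etaP).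
  by apply: le_lt_trans h2 _; rewrite ltry.
have Ag : 0 <= A r * eta (t * v0 r) 1 by rewrite mulr_ge0 ?ltW.
exists (fine (Phi r t)); first by rewrite fineK.
apply/andP; split; rewrite -lee_fin fineK//.
  apply: le_trans h1; rewrite lee_fin; apply: ler_wpM2r => //.
  by rewrite lerD2l lerN2.
apply: (le_trans h2); rewrite lee_fin -eth addrA [leRHS]mulrDl lerD2l.
have /Hb/andP[hk _] : 0 < t * v0 r <= Z by rewrite z0.
rewrite (_ : e / c1 * (A r * eta (t * v0 r) 1) = e * (A r * (eta (t * v0 r) 1 / c1))); last by ring.
rewrite ler_pM2l// ler_pM2l// ler_pdivlMr// mulrC.
by apply: le_trans hk; rewrite ler_pM2l// ler_peMl// ltW.
Qed.

Let sumE (x y : \bar R) p q : x = p%:E -> y = q%:E -> (x + y = (p + q)%:E)%E.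
Proof. by move=> -> ->. Qed.

Let time_fin D Z th : 0 <= D -> 0 < Z -> 0 < th <= 1 -> exists2 X0 : R, 0 < X0 &
  forall r t, 0 < r -> X0 <= kap * r -> X0 <= t -> t * v0 r <= Z ->
  exists2 S, (\int[leb]_(s in `]0%R, t[) ((expR (D * s))%:E * Phi r s) = S%:E)%E &
    close th S (A r * H D r t).
Proof.
move=> D0 Z0 th1; have [X0 X00 HX] := mixture_time_integral alpha_gt0 alpha_lt2 etaP a_gt0 kap_gt0 CE D0 Z0 th1.
exists X0 => // r t r0 Xr Xt tZ; have [h1 h2] := HX r t r0 Xr Xt tZ.
set I := (\int[leb]_(s in _) _)%E in h1 h2 *.
have fin : I \is a fin_num.
  rewrite ge0_fin_numE; first by apply: le_lt_trans h2 _; rewrite ltry.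
  apply: integral_ge0 => s /=; rewrite in_itv/= => /andP[s0 _].
  by rewrite mule_ge0 ?lee_fin ?expR_ge0// (mixture_ge0 _ _ etaP).
exists (fine I); first by rewrite fineK.
by apply/andP; split; rewrite -lee_fin fineK.
Qed.

Variables (lam L : R).
Hypotheses (lam_gt0 : 0 < lam) (L_gt0 : 0 < L).

(* The density of the process with resetting, as a function of [r = |y|] and
   [r' = |y - x|], with [D] standing for [m - lambda]. *)
Definition reset_mixture (D r r' t : R) :=
  ((expR (D * t))%:E * Phi r' t +
   lam%:E * \int[leb]_(s in `]0%R, t[) ((expR (D * s))%:E * Phi r s))%E.
Local Notation p := reset_mixture.

(** The first term is close to e^(Dt) A(r') eta(t v0(r'), 1). Replacing A(r') by e^(kap om) A(r),
    with [om] approximating r - r', and e^(Dt) eta(t v0(r), 1) by D H through [time_integral_exp],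
    puts A H in factor of both terms. *)
Lemma reset_supercritical D Z th : 0 < D -> 0 < Z -> 0 < th <= 1 ->
  exists2 X0 : R, 0 < X0 & forall r r' t om, X0 <= r -> X0 <= t ->
    `|r' - r| <= L -> `|expR (kap * (r - r' - om)) - 1| <= th / 100 -> t * v0 r <= Z ->
  exists2 P, p D r r' t = P%:E & close th P
    ((lam + expR (kap * om) * (eta (t * v0 r') 1 * D / eta (t * v0 r) 1)) *
     (A r * H D r t)).
Proof.
move=> D0 Z0 /andP[th0 th1].
have Z2 : 0 < 2 * Z by rewrite mulr_gt0.
(* One [closeM] and two [close_trans] each triple the error, and 27/100 is below 1. *)
have [e eE] : exists e, e = th / 100 by exists (th / 100).
have e0 : 0 < e by rewrite eE divr_gt0.
have e1 : e <= 1 / 100 by rewrite eE; lra.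
have e01 : 0 < e <= 1 by rewrite e0; lra.
have he : 0 <= e <= 1 by rewrite ltW//=; lra.
have he3 : 0 <= 3 * e <= 1 by apply/andP; split; lra.
have he9 : 0 <= 3 * (3 * e) <= 1 by apply/andP; split; lra.
have hee : 0 <= e <= 1 / 2 by apply/andP; split; lra.
have eth : e <= th by rewrite eE; lra.
have eth27 : 3 * (3 * (3 * e)) <= th by rewrite eE; lra.
have e33 : e <= 3 * e by lra.
have e29 : 2 * e <= 3 * (3 * e) by lra.
have [X1 X10 H1] := time_fin (ltW D0) Z0 e01.
have [X2 X20 H2] := mixture_first_term Z2 e01.
have [X3 X30 H3] := time_integral_exp alpha_gt0 alpha_lt2 etaP kap_gt0 CE D0 Z0 e01.
have [X4 X40 H4] := ratio_close (- beta) L_gt0 e0.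
have [X5 X50 H5] := ratio_close (- (a + 1 / 2)) L_gt0 e0.
have m0 : 0 < Num.max X1 (Num.max X2 X3) by rewrite lt_max X10.
exists (Num.max (Num.max X1 (Num.max X2 X3)) (Num.max (X1 / kap) (Num.max (X2 / kap + L) (Num.max X4 X5)))).
  by rewrite lt_max m0.
move=> r r' t om; rewrite !ge_max => /andP[_ /and4P[r1 r2 r4 r5]] /andP[/and3P[t1 t2 t3] _] hL hom tZ.
rewrite -eE in hom.
have r0 : 0 < r by exact: lt_le_trans X40 r4.
have t0 : 0 < t by exact: lt_le_trans X10 t1.
have [r0' Hv] := H4 r r' r4 hL; have [_ Ha] := H5 r r' r5 hL.
have X1r : X1 <= kap * r by rewrite mulrC -ler_pdivrMr.
have X2r : X2 <= kap * r'.
  rewrite mulrC -ler_pdivrMr//.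
  by move: hL; rewrite distrC ler_norml => /andP[_ hl]; lra.
have v0r := time_scale_gt0 alpha kap_gt0 r0; have v0r' := time_scale_gt0 alpha kap_gt0 r0'.
have A0 := saddle_area_gt0 a kap_gt0 r0; have A0' := saddle_area_gt0 a kap_gt0 r0'.
have tZ' : t * v0 r' <= 2 * Z.
  rewrite (time_scale_ratio r0 r0') mulrCA; apply: ler_pM => //; first exact: powR_ge0.
  - by rewrite mulr_ge0 ?ltW.
  - by move: Hv; rewrite ler_norml => /andP[_ h]; lra.
have [S SE clS] := H1 r t r0 X1r t1 tZ.
have [phi phiE clphi] := H2 r' t r0' X2r t2 tZ'.
have clH := H3 r t r0 t3 tZ.
have [g gE] : exists g, g = eta (t * v0 r) 1 by exists (eta (t * v0 r) 1).
have [g' gE'] : exists g', g' = eta (t * v0 r') 1 by exists (eta (t * v0 r') 1).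
have g0 : 0 < g by rewrite gE; apply: (eta_gt0 etaP) => //; rewrite mulr_gt0.
have g0' : 0 < g' by rewrite gE'; apply: (eta_gt0 etaP) => //; rewrite mulr_gt0.
have H0 := time_integral_ge0 D r0 t0.
exists (expR (D * t) * phi + lam * S).
  by rewrite /reset_mixture SE phiE.
rewrite -gE -gE' in clphi clH *.
have E0 := expR_gt0 (D * t); have Eo := expR_gt0 (kap * om).
rewrite (_ : (lam + expR (kap * om) * (g' * D / g)) * (A r * H D r t) =
   expR (kap * om) * A r * g' / g * (D * H D r t) + lam * (A r * H D r t)); last first.
  by move: (expR _) (A r) (H D r t) => x y z; field; rewrite gt_eqF.
have AH : 0 <= A r * H D r t by rewrite mulr_ge0 ?(ltW A0).
apply: closeD; last first.
  apply: closeZ; first exact: ltW.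
  exact: close_le clS.
have clA : close (3 * e) (A r') (expR (kap * om) * A r).
  have AE : A r' = expR (kap * om) * A r *
      ((r' / r) `^ (- (a + 1 / 2)) * expR (kap * (r - r' - om))).
    rewrite (saddle_area_ratio r0 r0').
    have -> : expR (kap * (r - r')) = expR (kap * (r - r' - om)) * expR (kap * om).
      by rewrite -expRD; congr expR; ring.
    by ring.
  rewrite AE -[X in close _ _ X]mulr1; apply: closeZ; first by rewrite mulr_ge0 ?(ltW A0) ?ltW.
  rewrite -[X in close _ _ X]mulr1.
  by apply: closeM => //; exact: close_norm.
have cl1 : close (3 * e) (expR (D * t) * phi) (expR (D * t) * (A r' * g')).
  by apply: closeZ; [exact: ltW | apply: close_le clphi => //; rewrite mulr_ge0 ?ltW].
have EA : 0 <= expR (kap * om) * A r by rewrite mulr_ge0 ?ltW.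
have cl2 : close (3 * e) (expR (D * t) * (A r' * g')) (expR (D * t) * g' * (expR (kap * om) * A r)).
  rewrite (_ : expR (D * t) * (A r' * g') = expR (D * t) * g' * A r'); last by ring.
  by apply: closeZ => //; rewrite mulr_ge0 ?ltW.
have cl3 : close (3 * (3 * e)) (expR (D * t) * phi) (expR (D * t) * g' * (expR (kap * om) * A r)).
  by apply: close_trans cl1 cl2 => //; rewrite mulr_ge0// mulr_ge0 ?ltW.
have cl4 : close (3 * (3 * e)) (expR (D * t) * g' * (expR (kap * om) * A r))
   (expR (kap * om) * A r * g' / g * (D * H D r t)).
  rewrite (_ : expR (D * t) * g' * (expR (kap * om) * A r) =
     expR (kap * om) * A r * g' / g * (expR (D * t) * g)); last first.
    by move: (expR _) (expR _) (A r) => x y z; field; rewrite gt_eqF.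
  apply: closeZ; first by rewrite mulr_ge0 ?invr_ge0 ?(ltW g0)// mulr_ge0 ?(ltW g0').
  apply: (@close_le _ (2 * e)) => //; first by rewrite mulr_ge0 ?(ltW D0).
  by apply: close_sym => //; rewrite mulr_ge0 ?ltW.
have T0 : 0 <= expR (kap * om) * A r * g' / g * (D * H D r t).
  rewrite mulr_ge0//; last by rewrite mulr_ge0// ltW.
  by rewrite mulr_ge0 ?invr_ge0 ?(ltW g0)// mulr_ge0 ?(ltW g0').
apply: (@close_le _ (3 * (3 * (3 * e)))) => //.
exact: close_trans cl3 cl4.
Qed.

End regimes.

(** * The cases lambda > m and lambda = m *)

Lemma lower_const (R : realFieldType) (e C y : R) : 0 < e -> e <= 1 -> e < C -> 0 < y ->
  C - e * (2 * C + 1 + C * y) <= (1 - e) * ((C - e) * (1 - e * y)).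
Proof.
move=> e0 e1 eC y0; have C0 : 0 < C by exact: lt_trans eC.
have w1 : C - e - e * C <= (1 - e) * (C - e) by have := sqr_ge0 e; rewrite expr2; lra.
have w2 : (1 - e) * (C - e) <= C by nra.
have ec : 0 <= e * C by rewrite mulr_ge0 ?ltW.
rewrite mulrA; move: w1 w2; move: ((1 - e) * (C - e)) => W w1 w2.
have : e * y * W <= e * y * C by rewrite ler_wpM2l// mulr_ge0 ?ltW.
lra.
Qed.

Section critical_regimes.
Context (R : realType) (alpha a kap : R) (eta : R -> R -> R).
Local Notation leb := (@lebesgue_measure R).
Hypotheses (alpha_gt0 : 0 < alpha) (alpha_lt2 : alpha < 2).
Hypothesis etaP : stable_subordinator_density alpha eta.
Hypotheses (a_gt0 : 0 < a) (kap_gt0 : 0 < kap).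
Local Notation beta := (alpha / 2).
Local Notation q := (gauss_weight a kap).
Local Notation u0 := (saddle kap).
Local Notation B := (saddle_value a kap).
Local Notation Phi := (mixture a kap eta).
Local Notation A := (saddle_area a kap).
Local Notation v0 := (time_scale alpha kap).
Local Notation gam := (Gamma (1 - beta)).
Variable C : R.
Hypothesis CE : C = beta / gam.

Let beta_gt0 : 0 < beta. Proof. by rewrite divr_gt0. Qed.
Let beta_lt1 : beta < 1. Proof. by rewrite ltr_pdivrMr// mul1r. Qed.

Local Notation H := (time_integral alpha kap eta).
Local Notation It t := (`]0%R, t[%classic : set R).
Variables (lam L : R).
Hypotheses (lam_gt0 : 0 < lam) (L_gt0 : 0 < L).
Local Notation p := (reset_mixture a kap eta lam).

(** The substitution that identifies v0 H with the integral in the statement of the theorem. *)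
Lemma time_integral_scaleE D r t : 0 < r -> 0 < t ->
  ((v0 r * H D r t)%:E =
   \int[leb]_(s in `]0%R, (t * v0 r)%R[) (expR (D / v0 r * s) * eta s 1)%:E)%E.
Proof.
move=> r0 t0; have v0r := time_scale_gt0 alpha kap_gt0 r0.
rewrite EFinM (time_integralE alpha_gt0 alpha_lt2 etaP kap_gt0 CE)//.
have sub : (It (t * v0 r)) `<=` (posR : set R).
  by move=> s; rewrite /= !in_itv/= andbT => /andP[].
rewrite [RHS](ge0_integral_affine 0 v0r); last 3 first.
- exact: measurable_itv.
- have h := measurable_funS (measurable_itv _) sub (measurable_eta_one alpha_gt0 etaP).
  by mfun.
- move=> s /sub; rewrite posRE => s0.
  by rewrite lee_fin mulr_ge0 ?expR_ge0// (eta_ge0 etaP).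
congr (_ * _)%E; rewrite [in RHS](_ : [set x | _] = It t); last first.
  apply/seteqP; split => s /=; rewrite !in_itv/= addr0 mulrC pmulr_lgt0// ltr_pM2r//.
apply: eq_integral => s _; rewrite addr0 (mulrC s); congr (expR _ * _)%:E.
by field; rewrite gt_eqF.
Qed.

(** If no finite horizon captured the fraction 1 - e, the limit of the integrals over ]0, n + 1[
    would stay below (1 - e) G. *)
Lemma eta_potential_head G e : G%:E = (\int[leb]_(t in posR) (eta t 1)%:E)%E ->
  0 < G -> 0 < e -> exists2 Z : R, 0 < Z &
    (((1 - e) * G)%:E <= \int[leb]_(s in `]0%R, Z[) (eta s 1)%:E)%E.
Proof.
move=> GE G0 e0; apply: contrapT => nZ.
have mg := measurable_eta_one alpha_gt0 etaP.
pose F n := (`]0%R, n.+1%:R[ : set R)%classic.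
have UF : \bigcup_i F i = (posR : set R).
  apply/seteqP; split => y; first by move=> [n _]; rewrite /F /= !in_itv/= andbT => /andP[].
  rewrite /= in_itv/= andbT => y0; exists (Num.truncn y) => //.
  by rewrite /F /= in_itv/= y0 truncnS_gt.
have sub n : F n `<=` (posR : set R) by move=> y Fy; rewrite -UF; exists n.
have ndF : nondecreasing_seq F.
  move=> n k nk; apply/subsetPset => y; rewrite /F /= !in_itv/= => /andP[->] h.
  by rewrite (lt_le_trans h)// ler_nat.
have Hc : (\int[leb]_(y in F n) (eta y 1)%:E @[n --> \oo] -->
    \int[leb]_(y in \bigcup_i F i) (eta y 1)%:E)%E.
  apply: ge0_nondecreasing_set_cvg_integral => //.
  - by move=> n; exact: measurable_itv.
  - by move=> n; apply/measurable_EFinP; exact: measurable_funS (sub n) mg.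
  - by move=> n y /sub; rewrite posRE => y0; rewrite lee_fin (eta_ge0 etaP).
have : (G%:E <= ((1 - e) * G)%:E)%E.
  rewrite GE -UF -(cvg_lim _ Hc)//; apply: lime_le; first exact: cvgP Hc.
  apply: nearW => n; rewrite leNgt; apply/negP => hlt; apply: nZ.
  by exists n.+1%:R => //; exact: ltW.
by rewrite lee_fin leNgt; rewrite gtr_pMl// ltrBlDr ltrDl e0.
Qed.

Lemma integral_id_expRN_head D e : 0 < D -> 0 < e -> exists2 T : R, 0 < T &
  ((D ^- 2 - e)%:E <= \int[leb]_(s in `]0%R, T[) (s * expR (- (D * s)))%:E)%E.
Proof.
move=> D0 e0; have D2 : 0 < D / 2 by rewrite divr_gt0.
have e2 : 0 < e * (D / 2) by rewrite mulr_gt0.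
have [T T1 HT] := expRN_powR_small ler01 D2 e2.
have T0 : 0 < T by exact: lt_le_trans T1.
exists T => //.
pose k (s : R) := s * expR (- (D * s)).
pose kT := k \_ (It T).
have k0 s : 0 < s -> 0 <= k s by move=> s0; rewrite mulr_ge0 ?expR_ge0// ltW.
have kT0 s : 0 <= kT s.
  by rewrite /kT patchE; case: ifP => //; rewrite inE /= in_itv/= => /andP[s0 _]; exact: k0.
have mkT : measurable_fun setT kT.
  by apply/(measurable_restrictT _ _).1; [exact: measurable_itv | rewrite /k; mfun].
have h : ((D ^- 2)%:E <= \int[leb]_(s in It T) (k s)%:E + e%:E)%E.
  rewrite -(integral_id_expRN D0).
  apply: (@le_trans _ _ (\int[leb]_(s in posR) (kT s + e * (D / 2) * expR (- (D / 2 * s)))%:E)%E).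
    apply: ge0_le_integral_EFin; first exact: measurable_itv.
    - by mfun.
    - by have h := measurable_funTS (D := posR : set R) mkT; mfun.
    - by move=> s; rewrite posRE; exact: k0.
    move=> s; rewrite posRE => s0; have [sT|Ts] := ltP s T.
      rewrite /kT patchE mem_set; last by rewrite /= in_itv/= s0.
      by rewrite /k lerDl mulr_ge0 ?expR_ge0// ltW.
    rewrite -[leLHS]add0r; apply: lerD => //.
    have := HT s Ts; rewrite powRr1 ?(ltW s0)// => hs.
    have -> : s * expR (- (D * s)) = expR (- (D / 2 * s)) * s * expR (- (D / 2 * s)).
      have -> : expR (- (D * s)) = expR (- (D / 2 * s)) * expR (- (D / 2 * s)).
        by rewrite -expRD; congr expR; field.
      by ring.
    by apply: ler_wpM2r => //; exact: expR_ge0.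
  rewrite ge0_integralD_fun; first last.
  - by move=> s _; rewrite mulr_ge0 ?expR_ge0// ltW.
  - by move=> s _.
  - by mfun.
  - exact: measurable_funTS.
  - exact: measurable_itv.
  apply: leeD.
    rewrite (integral_restrict_support _ (D' := (It T : set (measurableTypeR R)))); last 2 first.
    - by move=> s; rewrite /= !in_itv/= andbT => /andP[].
    - by move=> s _ ns; rewrite /kT patchE memNset.
    rewrite le_eqVlt; apply/orP; left; apply/eqP; apply: eq_integral => s sT.
    by rewrite /kT patchE sT.
  rewrite ge0_integralZl_fun; first last.
  - by move=> s _; exact: expR_ge0.
  - by mfun.
  - exact: ltW.
  - exact: measurable_itv.
  rewrite integral_expRN_scale// -EFinM lee_fin -mulrA mulfV ?gt_eqF// mulr1//.
by rewrite EFinB leeBlDr.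
Qed.

Let near_consts : exists2 X0 : R, 0 < X0 &
  forall r r' : R, X0 <= r -> `|r' - r| <= L ->
   [/\ 0 < r', A r' <= 2 * expR (kap * L) * A r, v0 r' <= 2 * v0 r,
      r' `^ (beta / 2) <= 2 * r `^ (beta / 2) & kap * r - kap * L <= kap * r'].
Proof.
have [X1 X10 H1] := ratio_close (- (a + 1 / 2)) L_gt0 ltr01.
have [X2 X20 H2] := ratio_close (- beta) L_gt0 ltr01.
have [X3 X30 H3] := ratio_close (beta / 2) L_gt0 ltr01.
exists (Num.max X1 (Num.max X2 X3)); first by rewrite lt_max X10.
move=> r r'; rewrite !ge_max => /and3P[r1 r2 r3] hL.
have [r0' h1] := H1 r r' r1 hL; have [_ h2] := H2 r r' r2 hL; have [_ h3] := H3 r r' r3 hL.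
have r0 : 0 < r by exact: lt_le_trans r1.
have up (x : R) : `|x - 1| <= 1 -> x <= 2 by rewrite ler_norml => /andP[_ h]; lra.
have rL : r - r' <= L by move: hL; rewrite distrC ler_norml => /andP[].
split => //.
- rewrite (saddle_area_ratio _ kap_gt0 r0 r0') -(mulrA 2); apply: ler_pM.
  + exact: powR_ge0.
  + by rewrite mulr_ge0 ?expR_ge0// ltW// saddle_area_gt0.
  + exact: up.
  + by rewrite ler_pM2r ?saddle_area_gt0// ler_expR ler_pM2l.
- rewrite (time_scale_ratio _ kap_gt0 r0 r0'); apply: ler_wpM2r; last exact: up.
  by rewrite ltW// time_scale_gt0.
- have -> : r' `^ (beta / 2) = (r' / r) `^ (beta / 2) * r `^ (beta / 2).
    by rewrite -powRM ?divfK ?gt_eqF ?divr_ge0 ?ltW.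
  by apply: ler_wpM2r; [exact: powR_ge0 | exact: up].
- by rewrite lerBlDr -mulrDr ler_pM2l//; lra.
Qed.

Let pfin D r r' t : 0 < t -> (p D r r' t < +oo)%E -> exists P, p D r r' t = P%:E.
Proof.
move=> t0 h; exists (fine (p D r r' t)); rewrite fineK// ge0_fin_numE// adde_ge0//.
  by rewrite mule_ge0 ?lee_fin ?expR_ge0// (mixture_ge0 _ _ etaP).
rewrite mule_ge0 ?lee_fin ?(ltW lam_gt0)//; apply: integral_ge0 => s /=.
by rewrite in_itv/= => /andP[s0 _]; rewrite mule_ge0 ?lee_fin ?expR_ge0// (mixture_ge0 _ _ etaP).
Qed.

Let mPhi D r t : measurable_fun (It t) (fun s => (expR (D * s))%:E * Phi r s)%E.
Proof.
have sub : It t `<=` (posR : set R) by move=> s; rewrite /= !in_itv/= andbT => /andP[].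
have h := measurable_funS (measurable_itv _) sub (measurable_mixture a kap alpha_gt0 etaP r).
by mfun.
Qed.

(** The main contribution comes from bounded times, where eta(s v0, 1) is close to C s v0, and the
    integral of s e^(-Ds) is D^(-2). [mixture_damped] controls the upper bound at all times and also
    shows that the first term is at most of order A v0 t e^(-Dt/2). Hence the limit needs no
    relation between [t] and [r]. *)
Lemma reset_subcritical D th : 0 < D -> 0 < th <= 1 ->
  exists2 X0 : R, 0 < X0 & forall r r' t, X0 <= r -> X0 <= t -> `|r' - r| <= L ->
  exists2 P, p (- D) r r' t = P%:E & close th P (lam * (A r * v0 r) * (C / D ^+ 2)).
Proof.
move=> D0 /andP[th0 th1]; have C0 := tail_constant_gt0 alpha_gt0 alpha_lt2 CE.
have [X1 X10 H1] := near_consts.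
have [e [e0 e1 eup elo]] : exists e, [/\ 0 < e, e <= 1, (1 + 3 * D) * e <= th / 2 * C
    & e * (2 * C + 1 + C * D ^+ 2) <= th * C].
  pose x := (1 + 3 * D) + (2 * C + 1 + C * D ^+ 2).
  have x0 : 0 < 1 + 3 * D by rewrite addr_gt0// mulr_gt0.
  have y0 : 0 < 2 * C + 1 + C * D ^+ 2 by rewrite !addr_gt0// mulr_gt0// exprn_gt0.
  have tc : 0 < th / 2 * C by rewrite mulr_gt0// divr_gt0.
  exists (Num.min 1 (Num.min (th / 2 * C / (1 + 3 * D)) (th / 2 * C / (2 * C + 1 + C * D ^+ 2)))); split.
  - by rewrite !lt_min ltr01 !divr_gt0.
  - by rewrite ge_min lexx.
  - by rewrite mulrC -ler_pdivlMr// !ge_min lexx !orbT.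
  - apply: (@le_trans _ _ (th / 2 * C)); last by rewrite ler_pM2r//; lra.
    by rewrite -ler_pdivlMr// !ge_min lexx !orbT.
have e01 : 0 < e <= 1 by rewrite e0.
have [X2 X20 H2] := mixture_damped alpha_gt0 alpha_lt2 etaP a_gt0 kap_gt0 CE D0 e01.
have [z0 z00 Hz] := eta_one_at0 alpha_gt0 alpha_lt2 etaP CE e0.
have Z0 : 0 < z0 / 2 by rewrite divr_gt0.
have [X3 X30 H3] := mixture_near alpha_gt0 alpha_lt2 etaP a_gt0 kap_gt0 Z0 e01.
(* [T] carries almost all of the integral of s e^(-Ds); for large [r] the range s < T satisfies s v0
   <= z0/2, where the linear approximation of [eta] is valid. *)
have [T T0 HT] := integral_id_expRN_head D0 e0.
have D2 : 0 < D / 2 by rewrite divr_gt0.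
have [K KE] : exists K, K = 4 * expR (kap * L) * (C + 3) by exists (4 * expR (kap * L) * (C + 3)).
have K0 : 0 < K by rewrite KE mulr_gt0 ?mulr_gt0 ?expR_gt0// addr_gt0.
have e20 : 0 < lam * (th / 2 * (C / D ^+ 2)) / K.
  by rewrite divr_gt0// mulr_gt0// mulr_gt0 ?divr_gt0// exprn_gt0.
have [X4 X41 H4] := expRN_powR_small ler01 D2 e20.
have [X5 X51 H5] := powRN_small beta_gt0 (divr_gt0 Z0 T0).
exists (Num.max X1 (Num.max (X2 / kap + L) (Num.max (X2 / kap) (Num.max (X3 / kap) (Num.max (2 * kap * X5) (Num.max X4 T)))))).
  by rewrite lt_max X10.
move=> r r' t; rewrite !ge_max => /and5P[r1 r2 r3 r4 /and3P[r5 _ _]].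
move=> /and5P[_ _ _ _ /and3P[_ t4 t5]] hL.
have [r0' hA hv _ hk] := H1 r r' r1 hL.
have r0 : 0 < r by exact: lt_le_trans r1.
have t1 : 1 <= t by exact: le_trans t4.
have t0 : 0 < t by exact: lt_le_trans t1.
have X2r' : X2 <= kap * r'.
  apply: le_trans hk; rewrite -mulrBr mulrC -ler_pdivrMr//; lra.
have X2r : X2 <= kap * r by rewrite mulrC -ler_pdivrMr.
have X3r : X3 <= kap * r by rewrite mulrC -ler_pdivrMr.
have v0r := time_scale_gt0 alpha kap_gt0 r0; have v0r' := time_scale_gt0 alpha kap_gt0 r0'.
have A0 := saddle_area_gt0 a kap_gt0 r0; have A0' := saddle_area_gt0 a kap_gt0 r0'.
have Av : 0 < A r * v0 r by rewrite mulr_gt0.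
have TZ : T * v0 r <= z0 / 2.
  rewrite mulrC -ler_pdivlMr//; apply: H5.
  by rewrite /saddle ler_pdivlMr ?mulr_gt0// mulrC.
have first : ((expR (- D * t))%:E * Phi r' t <= (lam * (A r * v0 r) * (th / 2 * (C / D ^+ 2)))%:E)%E.
  rewrite mulNr; apply: (le_trans (H2 r' t r0' X2r' t0)); rewrite lee_fin.
  have E0 := expR_gt0 (- (D / 2 * t)).
  have E1 : expR (- (D * t)) <= expR (- (D / 2 * t)).
    by rewrite ler_expR lerN2 ler_pM2r//; lra.
  apply: (@le_trans _ _ ((4 * expR (kap * L) * (A r * v0 r)) * ((C + 3) * (expR (- (D / 2 * t)) * t)))).
    apply: ler_pM.
    - by rewrite mulr_ge0 ?ltW.
    - rewrite addr_ge0// mulr_ge0 ?expR_ge0 ?(ltW e0)// addr_ge0 ?(ltW e0)// mulr_ge0 ?(ltW t0)//.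
      by rewrite addr_ge0 ?ltW.
    - have -> : 4 * expR (kap * L) * (A r * v0 r) = (2 * expR (kap * L) * A r) * (2 * v0 r) by ring.
      by apply: ler_pM => //; rewrite ltW.
    have -> : (C + 3) * (expR (- (D / 2 * t)) * t) = ((C + 2) * t) * expR (- (D / 2 * t)) + t * expR (- (D / 2 * t)) by ring.
    apply: lerD.
      apply: ler_pM => //.
      + by rewrite addr_ge0 ?(ltW e0)// mulr_ge0 ?(ltW t0)// addr_ge0 ?ltW.
      + have : e * t <= 1 * t by rewrite ler_pM2r.
        by rewrite mulrDl mulrDl; lra.
    by rewrite ler_pM2r//; lra.
  have := H4 t t4; rewrite powRr1 ?(ltW t0)//; set E := expR (- _) * t => hE.
  have -> : 4 * expR (kap * L) * (A r * v0 r) * ((C + 3) * E) = A r * v0 r * (K * E) by rewrite KE; ring.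
  rewrite (mulrC lam) -(mulrA _ lam) ler_pM2l//.
  by rewrite mulrC -ler_pdivlMr.
have I0 : (0 <= \int[leb]_(s in It t) ((expR (- D * s))%:E * Phi r s))%E.
  apply: integral_ge0 => s /=; rewrite in_itv/= => /andP[s0 _].
  by rewrite mule_ge0 ?lee_fin ?expR_ge0// (mixture_ge0 _ _ etaP).
have second_up : (\int[leb]_(s in It t) ((expR (- D * s))%:E * Phi r s) <=
    ((A r * v0 r) * ((1 + th / 2) * (C / D ^+ 2)))%:E)%E.
  pose f s := A r * v0 r * ((C + e) * (s * expR (- (D * s))) + (e * expR (- (D * s)) + e * expR (- (D / 2 * s)))).
  have Ce : 0 <= C + e by rewrite addr_ge0 ?ltW.
  have f0 s : 0 < s -> 0 <= f s.
    by move=> s0; rewrite mulr_ge0 ?(ltW Av)// addr_ge0 ?addr_ge0// mulr_ge0 ?expR_ge0 ?(ltW e0)// mulr_ge0 ?expR_ge0 ?(ltW s0).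
  have mf (E : set R) : measurable_fun E f by apply: measurable_funTS; rewrite /f; mfun.
  apply: (@le_trans _ _ (\int[leb]_(s in It t) (f s)%:E)%E).
    apply: ge0_le_integral => //.
    - by move=> s /=; rewrite in_itv/= => /andP[s0 _]; rewrite mule_ge0 ?lee_fin ?expR_ge0// (mixture_ge0 _ _ etaP).
    - exact: mPhi.
    - by apply/measurable_EFinP; exact: mf.
    move=> s /=; rewrite in_itv/= => /andP[s0 _]; rewrite mulNr.
    apply: (le_trans (H2 r s r0 X2r s0)); rewrite lee_fin le_eqVlt; apply/orP; left; apply/eqP.
    by rewrite /f; ring.
  apply: (@le_trans _ _ (\int[leb]_(s in posR) (f s)%:E)%E).
    apply: ge0_subset_integral => //.
    - by apply/measurable_EFinP; exact: mf.
    - by move=> s; rewrite posRE => s0; rewrite lee_fin f0.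
    - by move=> s; rewrite /= !in_itv/= andbT => /andP[].
  have mposR : measurable (posR : set R) by exact: measurable_itv.
  have ek D' s : 0 <= e * expR (- (D' * s)) by rewrite mulr_ge0 ?expR_ge0 ?ltW.
  rewrite ge0_integralZl_fun//; last 3 first.
  - exact: ltW.
  - by mfun.
  - move=> s; rewrite posRE => s0; rewrite addr_ge0 ?addr_ge0// mulr_ge0//.
    by rewrite mulr_ge0 ?expR_ge0 ?ltW.
  rewrite ge0_integralD_fun//; last 4 first.
  - by mfun.
  - by mfun.
  - by move=> s; rewrite posRE => s0; rewrite mulr_ge0// mulr_ge0 ?expR_ge0 ?ltW.
  - by move=> s _; rewrite addr_ge0.
  rewrite ge0_integralD_fun//; last 2 first.
  - by mfun.
  - by mfun.
  rewrite ge0_integralZl_fun//; last 2 first.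
  - by mfun.
  - by move=> s; rewrite posRE => s0; rewrite mulr_ge0 ?expR_ge0 ?ltW.
  rewrite (@ge0_integralZl_fun _ _ R leb posR mposR e)//; last 2 first.
  - exact: ltW.
  - by mfun.
  rewrite (@ge0_integralZl_fun _ _ R leb posR mposR e)//; last 2 first.
  - exact: ltW.
  - by mfun.
  rewrite integral_id_expRN// !integral_expRN_scale// -!EFinM lee_fin.
  rewrite ler_pM2l//.
  have -> : (C + e) * D ^- 2 + (e / D + e / (D / 2)) = (C + (1 + 3 * D) * e) / D ^+ 2.
    by field; rewrite gt_eqF.
  rewrite mulrA ler_pM2r ?invr_gt0 ?exprn_gt0//.
  by rewrite [leRHS]mulrDl mul1r lerD2l.
have second_lo : (((A r * v0 r) * ((1 - th) * (C / D ^+ 2)))%:E <=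
    \int[leb]_(s in It t) ((expR (- D * s))%:E * Phi r s))%E.
  (* If C <= e, the choice of [e] forces th >= 1, and the lower bound claimed is at most 0. *)
  have [Ce|Ce] := leP C e.
    apply: le_trans I0; rewrite lee_fin; apply: mulr_ge0_le0; first exact: ltW.
    have D20 : 0 < D ^+ 2 by rewrite exprn_gt0.
    have hh : 1 <= th.
      rewrite -(ler_pM2r C0) mul1r; apply: le_trans elo; apply: (le_trans Ce).
      by rewrite ler_peMr ?(ltW e0)// -addrA addrCA lerDl addr_ge0 ?mulr_ge0 ?(ltW C0) ?(ltW D20)//; lra.
    by apply: mulr_le0_ge0; [lra | rewrite divr_ge0 ?ltW].
  apply: (@le_trans _ _ (((A r * v0 r) * ((1 - e) * (C - e)))%:E * (D ^- 2 - e)%:E)%E).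
    rewrite -EFinM lee_fin -(mulrA (A r * v0 r) _ (D ^- 2 - e)) ler_pM2l//.
    have D20 : 0 < D ^+ 2 by rewrite exprn_gt0.
    have -> : (1 - th) * (C / D ^+ 2) = (C - th * C) / D ^+ 2 by field; rewrite gt_eqF.
    have -> : (1 - e) * (C - e) * (D ^- 2 - e) = ((1 - e) * ((C - e) * (1 - e * D ^+ 2))) / D ^+ 2.
      by field; rewrite gt_eqF.
    rewrite ler_pM2r ?invr_gt0//.
    apply: (@le_trans _ _ (C - e * (2 * C + 1 + C * D ^+ 2))); first by rewrite lerD2l lerN2.
    exact: lower_const.
  have Ce0 : 0 <= (A r * v0 r) * ((1 - e) * (C - e)).
    by rewrite mulr_ge0 ?(ltW Av)// mulr_ge0 ?subr_ge0// ltW.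
  apply: (@le_trans _ _ (((A r * v0 r) * ((1 - e) * (C - e)))%:E *
      \int[leb]_(s in It T) (s * expR (- (D * s)))%:E)%E).
    by apply: lee_wpmul2l => //.
  have subT : It T `<=` It t.
    by move=> s; rewrite /= !in_itv/= => /andP[-> h]; exact: lt_le_trans t5.
  apply: (@le_trans _ _ (\int[leb]_(s in It T) ((expR (- D * s))%:E * Phi r s))%E); last first.
    apply: ge0_subset_integral => //; first exact: mPhi.
    by move=> s /=; rewrite in_itv/= => /andP[s0 _]; rewrite mule_ge0 ?lee_fin ?expR_ge0// (mixture_ge0 _ _ etaP).
  rewrite -ge0_integralZl_fun//; last 2 first.
  - by mfun.
  - by move=> s /=; rewrite in_itv/= => /andP[s0 _]; rewrite mulr_ge0 ?expR_ge0 ?ltW.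
  apply: ge0_le_integral => //.
  - move=> s /=; rewrite in_itv/= => /andP[s0 _]; rewrite lee_fin mulr_ge0//.
    by rewrite mulr_ge0 ?expR_ge0 ?ltW.
  - by mfun.
  - exact: mPhi.
  move=> s /=; rewrite in_itv/= => /andP[s0 sT].
  have sv : s * v0 r <= z0 / 2 by apply: le_trans TZ; rewrite ler_pM2r// ltW.
  have [hlo _] := H3 r s r0 X3r s0 sv.
  apply: (@le_trans _ _ ((expR (- D * s))%:E * ((1 - e) * (A r * eta (s * v0 r) 1))%:E)%E); last first.
    by apply: lee_wpmul2l => //; rewrite lee_fin expR_ge0.
  rewrite -EFinM lee_fin mulNr.
  have : 0 < s * v0 r < z0 by rewrite mulr_gt0//=; apply: (le_lt_trans sv); lra.
  move=> /Hz; rewrite ler_norml => /andP[hz _].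
  have -> : A r * v0 r * ((1 - e) * (C - e)) * (s * expR (- (D * s))) =
    expR (- (D * s)) * ((1 - e) * (A r * ((C - e) * (s * v0 r)))) by ring.
  apply: ler_wpM2l; first exact: expR_ge0.
  apply: ler_wpM2l; first by rewrite subr_ge0.
  rewrite ler_pM2l//; lra.
have [P PE] : exists P, p (- D) r r' t = P%:E.
  apply: pfin => //; apply: lte_add_pinfty.
    by apply: le_lt_trans first _; rewrite ltry.
  by rewrite lte_mul_pinfty ?lee_fin ?(ltW lam_gt0)//; apply: le_lt_trans second_up _; rewrite ltry.
have lam0 : (0%R <= lam%:E)%E by rewrite lee_fin ltW.
exists P => //; apply/andP; split; rewrite -lee_fin -PE /reset_mixture.
  apply: (@le_trans _ _ (0%E + lam%:E * ((A r * v0 r) * ((1 - th) * (C / D ^+ 2)))%:E)%E).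
    rewrite add0e -EFinM lee_fin le_eqVlt; apply/orP; left; apply/eqP.
    by move: (A r * v0 r) (C / _) => x y; ring.
  apply: leeD; last exact: lee_wpmul2l.
  by rewrite mule_ge0 ?lee_fin ?expR_ge0// (mixture_ge0 _ _ etaP).
apply: (@le_trans _ _ ((lam * (A r * v0 r) * (th / 2 * (C / D ^+ 2)))%:E +
   lam%:E * ((A r * v0 r) * ((1 + th / 2) * (C / D ^+ 2)))%:E)%E).
  by apply: leeD => //; exact: lee_wpmul2l.
rewrite -EFinM -EFinD lee_fin le_eqVlt; apply/orP; left; apply/eqP.
by move: (A r * v0 r) (C / _) => x y; field.
Qed.

(** No restriction links [t] and [r], so two regimes are treated. For t v0 <= Z the asymptotics of
    the time integral apply. For t v0 > Z both the time integral and A H are close to Q = A G / v0,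
    because the horizon Z captures almost all of the potential [G]. In each regime the first term is
    negligible. *)
Lemma reset_critical th : 0 < th <= 1 ->
  exists2 X0 : R, 0 < X0 & forall r r' t, X0 <= r -> X0 <= t -> `|r' - r| <= L ->
  exists2 P, p 0 r r' t = P%:E & close th P (lam * (A r * H 0 r t)).
Proof.
move=> /andP[th0 th1].
have eta0 (s : R) : posR s -> (0 <= (eta s 1)%:E)%E.
  by rewrite posRE => s0; rewrite lee_fin (eta_ge0 etaP).
have mg1 := measurable_eta_one alpha_gt0 etaP.
have [G GE] : exists G, G%:E = (\int[leb]_(s in posR) (eta s 1)%:E)%E.
  exists (fine (\int[leb]_(s in posR) (eta s 1)%:E)%E); rewrite fineK// ge0_fin_numE.
    exact: (eta_potential_fin alpha_gt0 alpha_lt2 etaP).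
  exact: integral_ge0.
have G0 : 0 < G.
  rewrite lt_neqAle -lee_fin GE integral_ge0// andbT; apply/eqP => G00.
  have := eta_potential_laplace alpha_gt0 etaP GE ltr01.
  rewrite integral0_eq; last by move=> u _; rewrite -G00 !mulr0.
  by move=> /eqP; rewrite eqe eq_sym gt_eqF// powR_gt0.
have [e eE] : exists e, e = th / 100 by exists (th / 100).
have e0 : 0 < e by rewrite eE divr_gt0.
have e1 : e <= 1 / 100 by rewrite eE; lra.
have e01 : 0 < e <= 1 by rewrite e0; lra.
have he : 0 <= e <= 1 / 2 by apply/andP; split; lra.
have h13 : 0 <= 3 * e <= 1 by apply/andP; split; lra.
have e23 : 2 * e <= 3 * e by lra.
have e2th : 2 * e <= th by rewrite eE; lra.
have e9th : 3 * (3 * e) <= th by rewrite eE; lra.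
have eth : e <= th by rewrite eE; lra.
have one_e : 0 <= 1 - e by lra.
have one_p : 0 <= 1 + e by lra.
have one_2 : 1 + e <= 2 by lra.
have sq_2 : 1 - e <= 1 by lra.
have sq_e : 1 - 3 * e <= (1 - e) * (1 - e) by nra.
have [Z Z0 HZ] := eta_potential_head GE G0 e0.
have Z20 : 0 < 2 * Z by rewrite mulr_gt0.
have [X1 X10 H1] := mixture_time_integral alpha_gt0 alpha_lt2 etaP a_gt0 kap_gt0 CE (lexx 0) Z0 e01.
have [X2 X20 H2] := mixture_first_term alpha_gt0 alpha_lt2 etaP a_gt0 kap_gt0 CE Z20 e01.
have [K [X3 [K0 X30 H3]]] := mixture_uniform alpha_gt0 alpha_lt2 etaP a_gt0 kap_gt0 CE.
have [f [f0 f1 fe feG]] : exists f, [/\ 0 < f, f <= 1, f <= e & f <= e * G].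
  exists (Num.min e (e * G)); split.
  - by rewrite lt_min e0 mulr_gt0.
  - by rewrite ge_min; apply/orP; left; lra.
  - by rewrite ge_min lexx.
  - by rewrite ge_min lexx orbT.
have f01 : 0 < f <= 1 by rewrite f0.
have [X4 X40 H4] := mixture_potential alpha_gt0 alpha_lt2 etaP a_gt0 kap_gt0 GE f01.
have [X5 X50 H5] := near_consts.
have [k1 [c2 [k10 c20 Hb]]] := eta_one_bounds alpha_gt0 alpha_lt2 etaP CE Z20.
have [c1 c10 Hlow] := time_integral_lower alpha_gt0 alpha_lt2 etaP kap_gt0 CE Z0.
have el : 0 < e * lam by rewrite mulr_gt0.
have [E EE] : exists E, E = expR (kap * L) by exists (expR (kap * L)).
have E0 : 0 < E by rewrite EE expR_gt0.
have [T0 T0E] : exists T0, T0 = 32 * E * c2 / (c1 * (e * lam)) by exists (32 * E * c2 / (c1 * (e * lam))).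
have [X6 X61 H6] := powRN_small beta_gt0 (divr_gt0 Z0 X10).
(* Once r^(beta/2) >= K3, the uniform bound A r^(beta/2) of the first term is below e lam Q, as Q is
   of order A r^beta. *)
have [K3 K3E] : exists K3, K3 = 4 * K * E * (2 * kap) `^ beta / (e * lam * G) by exists (4 * K * E * (2 * kap) `^ beta / (e * lam * G)).
have k2p : 0 < (2 * kap) `^ beta by rewrite powR_gt0// mulr_gt0.
have K30 : 0 < K3 by rewrite K3E divr_gt0 ?mulr_gt0.
have T00 : 0 < T0 by rewrite T0E divr_gt0 ?mulr_gt0.
have b2 : 0 < beta / 2 by rewrite divr_gt0.
exists (Num.max (X1 + X1 / kap) (Num.max (X2 + (X2 / kap + L)) (Num.max (X3 / kap + L) (Num.max (X4 / kap) (Num.max X5 (Num.max (1 + T0) (Num.max (2 * kap * X6) (K3 `^ (beta / 2)^-1)))))))).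
  by rewrite lt_max addr_gt0// divr_gt0.
move=> r r' t; rewrite !ge_max => /and5P[r1 r2 r3 r4 /and4P[r5 _ r6 r7]].
move=> /and5P[t1 t2 _ _ /and4P[_ t6 _ _]] hL.
have [r0' hA hv hr hk] := H5 r r' r5 hL; rewrite -EE in hA.
have r0 : 0 < r by exact: lt_le_trans r5.
have dk (x : R) : 0 < x -> 0 < x / kap by move=> x0; rewrite divr_gt0.
have t1' : X1 <= t by apply: le_trans t1; rewrite lerDl ltW// dk.
have t2' : X2 <= t by apply: le_trans t2; rewrite lerDl addr_ge0 ?ltW ?dk.
have t1g : 1 <= t by apply: le_trans t6; rewrite lerDl ltW.
have tT0 : T0 <= t by apply: le_trans t6; rewrite lerDr.
have t0 : 0 < t by exact: lt_le_trans t1g.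
have toK (x y : R) : x / kap <= y -> x <= kap * y by rewrite ler_pdivrMr// mulrC.
have X1r : X1 <= kap * r by apply: toK; apply: le_trans r1; rewrite lerDr ltW.
have X4r : X4 <= kap * r by exact: toK.
have rL : r - L <= r' by move: hL; rewrite distrC ler_norml lerBlDr => /andP[_]; rewrite lerBlDl addrC.
have X2r : X2 <= kap * r'.
  by apply: toK; apply: le_trans rL; rewrite lerBrDr; apply: le_trans r2; rewrite lerDr ltW.
have X3r : X3 <= kap * r' by apply: toK; apply: le_trans rL; rewrite lerBrDr.
have v0r := time_scale_gt0 alpha kap_gt0 r0; have v0r' := time_scale_gt0 alpha kap_gt0 r0'.
have A0 := saddle_area_gt0 a kap_gt0 r0; have A0' := saddle_area_gt0 a kap_gt0 r0'.
have lam0 : (0%R <= lam%:E)%E by rewrite lee_fin ltW.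
have H0 := time_integral_ge0 etaP kap_gt0 0 r0 t0.
have Phi0 s : 0 < s -> (0 <= (expR (0 * s))%:E * Phi r s)%E.
  by move=> s0; rewrite mule_ge0 ?lee_fin ?expR_ge0// (mixture_ge0 _ _ etaP).
have AH0 : 0 <= A r * H 0 r t by rewrite mulr_ge0 ?(ltW A0).
have lAH : 0 <= lam * (A r * H 0 r t) by rewrite mulr_ge0 ?(ltW lam_gt0).
have F0 : (0 <= (expR (0 * t))%:E * Phi r' t)%E.
  by rewrite mule_ge0 ?lee_fin ?expR_ge0// (mixture_ge0 _ _ etaP).
have FE : ((expR (0 * t))%:E * Phi r' t = Phi r' t)%E by rewrite mul0r expR0 mul1e.
(* Short times: the first term is of order A v0 t, while A H is at least of order A v0 t^2; [T0] is
   the threshold on [t]. *)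
have [zZ|Zz] := leP (t * v0 r) Z.
  have [S1 S2] := H1 r t r0 X1r t1' zZ.
  have z0' : 0 < t * v0 r' by rewrite mulr_gt0.
  have z2 : t * v0 r' <= 2 * (t * v0 r) by rewrite mulrCA ler_pM2l.
  have z2' : t * v0 r' <= 2 * Z by apply: (le_trans z2); rewrite ler_pM2l.
  have [phi phiE /andP[_ cphi]] := H2 r' t r0' X2r t2' z2'.
  have /Hb/andP[_ hg] : 0 < t * v0 r' <= 2 * Z by rewrite z0'.
  have hlow := Hlow 0 r t (lexx 0) r0 t0 zZ.
  have phile : phi <= e * lam * (A r * H 0 r t).
    apply: (le_trans cphi); apply: (@le_trans _ _ (2 * ((2 * E * A r) * (c2 * (2 * (t * v0 r)))))).
      apply: ler_pM => //; first by rewrite mulr_ge0 ?(ltW A0') ?(eta_ge0 etaP).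
      apply: ler_pM => //; [exact: ltW | exact: (eta_ge0 etaP) |].
      by apply: (le_trans hg); rewrite ler_pM2l.
    apply: (@le_trans _ _ (e * lam * (A r * (c1 * (v0 r * (t ^+ 2 / 4)))))); last first.
      by rewrite ler_pM2l// ler_pM2l.
    have -> : 2 * (2 * E * A r * (c2 * (2 * (t * v0 r)))) = A r * v0 r * t * (8 * E * c2) by ring.
    have -> : e * lam * (A r * (c1 * (v0 r * (t ^+ 2 / 4)))) = A r * v0 r * t * (c1 * (e * lam) / 4 * t) by field.
    have Avt : 0 <= A r * v0 r * t by rewrite mulr_ge0 ?(ltW t0)// mulr_ge0 ?ltW.
    apply: ler_wpM2l => //; apply: (@le_trans _ _ (c1 * (e * lam) / 4 * T0)); last first.
      by rewrite ler_pM2l// divr_gt0// mulr_gt0.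
    by rewrite T0E le_eqVlt; apply/orP; left; apply/eqP; field; rewrite !gt_eqF.
  have up : (p 0 r r' t <= ((1 + 2 * e) * (lam * (A r * H 0 r t)))%:E)%E.
    apply: (@le_trans _ _ ((e * lam * (A r * H 0 r t))%:E + lam%:E * ((1 + e) * (A r * H 0 r t))%:E)%E).
      by apply: leeD; [rewrite FE phiE lee_fin | exact: lee_wpmul2l].
    by rewrite -EFinM -EFinD lee_fin le_eqVlt; apply/orP; left; apply/eqP; ring.
  have [P PE] : exists P, p 0 r r' t = P%:E.
    by apply: pfin => //; apply: le_lt_trans up _; rewrite ltry.
  exists P => //; apply: (@close_le _ (2 * e)) => //; apply/andP; split; rewrite -lee_fin -PE//.
  apply: (@le_trans _ _ (0%E + lam%:E * ((1 - e) * (A r * H 0 r t))%:E)%E).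
    rewrite add0e -EFinM lee_fin (_ : lam * ((1 - e) * (A r * H 0 r t)) = (1 - e) * (lam * (A r * H 0 r t))); last by ring.
    apply: ler_wpM2r => //.
    by rewrite lerD2l lerN2 ler_peMl ?(ltW e0)// ler1n.
  by apply: leeD => //; exact: lee_wpmul2l.
(* Long times: at the earlier time [T], with T v0 = Z, the integral has already reached almost all
   of its limit [Q], and monotonicity in [t] does the rest. *)
have [T TE] : exists T, T = Z / v0 r by exists (Z / v0 r).
have Tv : T * v0 r = Z by rewrite TE divfK// gt_eqF.
have Tt : T < t by rewrite -(ltr_pM2r v0r) Tv.
have T1 : X1 <= T.
  rewrite TE ler_pdivlMr// mulrC -ler_pdivlMr//; apply: H6.
  by rewrite /saddle ler_pdivlMr ?mulr_gt0// mulrC.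
have Tpos : 0 < T by exact: lt_le_trans T1.
have TZ : T * v0 r <= Z by rewrite Tv.
have [S1 _] := H1 r T r0 X1r T1 TZ.
have subTt : It T `<=` It t.
  by move=> s; rewrite /= !in_itv/= => /andP[-> h]; exact: lt_trans Tt.
have subtp x : It x `<=` (posR : set R) by move=> s; rewrite /= !in_itv/= andbT => /andP[].
have v0H (x : R) : 0 < x -> ((v0 r * H 0 r x)%:E = \int[leb]_(s in It (x * v0 r)%R) (eta s 1)%:E)%E.
  move=> x0; rewrite time_integral_scaleE//; apply: eq_integral => s _.
  by rewrite !mul0r expR0 mul1r.
have i : (1 - e) * G <= v0 r * H 0 r T by rewrite -lee_fin v0H// Tv.
have iii : v0 r * H 0 r t <= G.
  rewrite -lee_fin v0H// GE; apply: ge0_subset_integral => //.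
  - exact/measurable_EFinP.
have ii : v0 r * H 0 r T <= v0 r * H 0 r t.
  rewrite -lee_fin !v0H//; apply: ge0_subset_integral => //.
  - by apply/measurable_EFinP; exact: measurable_funS (subtp _) mg1.
  - by move=> s /subtp; exact: eta0.
  - by move=> s; rewrite /= !in_itv/= => /andP[-> h]; apply: lt_trans h _; rewrite ltr_pM2r.
have [Q QE] : exists Q, Q = A r * G / v0 r by exists (A r * G / v0 r).
have Q0 : 0 < Q by rewrite QE; apply: divr_gt0 => //; exact: mulr_gt0.
have QH (x : R) : A r * H 0 r x = A r / v0 r * (v0 r * H 0 r x) by field; rewrite gt_eqF.
have QG : Q = A r / v0 r * G by rewrite QE; ring.
have Av0 : 0 < A r / v0 r by rewrite divr_gt0.
have uv : u0 r `^ beta = (v0 r)^-1 by rewrite /time_scale powRN invrK.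
have Sup : (\int[leb]_(s in It t) ((expR (0 * s))%:E * Phi r s) <= ((1 + 2 * e) * Q)%:E)%E.
  have -> : (\int[leb]_(s in It t) ((expR (0 * s))%:E * Phi r s) = \int[leb]_(s in It t) Phi r s)%E.
    by apply: eq_integral => s _; rewrite mul0r expR0 mul1e.
  apply: (@le_trans _ _ (\int[leb]_(s in posR) Phi r s)%E).
    apply: ge0_subset_integral => //.
    - exact: (measurable_mixture a kap alpha_gt0 etaP r).
    - by move=> s; rewrite posRE => s0; exact: (mixture_ge0 _ _ etaP).
  apply: (le_trans (H4 r r0 X4r)); rewrite lee_fin uv QE.
  have -> : (1 + f) * (A r * ((v0 r)^-1 * G)) + f * (A r / v0 r) = ((1 + f) * G + f) * (A r / v0 r) by ring.
  have -> : (1 + 2 * e) * (A r * G / v0 r) = ((1 + 2 * e) * G) * (A r / v0 r) by ring.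
  rewrite ler_pM2r//; apply: (@le_trans _ _ (G + e * G + e * G)).
    by rewrite mulrDl mul1r; apply: lerD => //; rewrite lerD2l ler_pM2r.
  by rewrite le_eqVlt; apply/orP; left; apply/eqP; ring.
have Slo : (((1 - e) * ((1 - e) * Q))%:E <= \int[leb]_(s in It t) ((expR (0 * s))%:E * Phi r s))%E.
  apply: (@le_trans _ _ (\int[leb]_(s in It T) ((expR (0 * s))%:E * Phi r s))%E); last first.
    apply: ge0_subset_integral => //.
    - exact: mPhi.
    - by move=> s /subtp; rewrite posRE; exact: Phi0.
  apply: le_trans S1; rewrite lee_fin; apply: ler_wpM2l => //.
  by rewrite QH QG mulrCA ler_pM2l.
have Fup : (Phi r' t <= (e * (lam * Q))%:E)%E.
  apply: (le_trans (H3 r' t r0' X3r t0)); rewrite lee_fin.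
  apply: (@le_trans _ _ (K * ((2 * E * A r) * (2 * r `^ (beta / 2))))).
    rewrite ler_pM2l//; apply: ler_pM => //; [exact: ltW | exact: powR_ge0].
  have rK : K3 <= r `^ (beta / 2).
    have -> : K3 = (K3 `^ (beta / 2)^-1) `^ (beta / 2).
      by rewrite -powRrM mulVf ?gt_eqF// powRr1// ltW.
    by apply: ge0_ler_powR; rewrite ?nnegrE ?powR_ge0 ?(ltW b2) ?(ltW r0).
  have vE : (v0 r)^-1 = r `^ (beta / 2) * r `^ (beta / 2) / (2 * kap) `^ beta.
    have rE : r = u0 r * (2 * kap) by rewrite /saddle divfK// gt_eqF// mulr_gt0.
    have u0p := saddle_gt0 kap_gt0 r0.
    rewrite -uv -powRD; last by rewrite (gt_eqF r0) implybT.
    have k20 : 0 <= 2 * kap by rewrite mulr_ge0// ltW.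
    have -> : r `^ (beta / 2 + beta / 2) = u0 r `^ beta * (2 * kap) `^ beta.
      by rewrite -splitr -(powRM _ (ltW u0p) k20) -rE.
    by rewrite mulfK// gt_eqF.
  rewrite QE vE.
  have rp : 0 < r `^ (beta / 2) by rewrite powR_gt0.
  have -> : K * (2 * E * A r * (2 * r `^ (beta / 2))) = (A r * r `^ (beta / 2)) * (4 * K * E) by ring.
  have -> : e * (lam * (A r * G * (r `^ (beta / 2) * r `^ (beta / 2) / (2 * kap) `^ beta))) =
     (A r * r `^ (beta / 2)) * (e * lam * G / (2 * kap) `^ beta * r `^ (beta / 2)) by ring.
  have Arp : 0 <= A r * r `^ (beta / 2) by rewrite mulr_ge0 ?ltW.
  apply: ler_wpM2l => //; apply: (@le_trans _ _ (e * lam * G / (2 * kap) `^ beta * K3)); last first.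
    by rewrite ler_pM2l// divr_gt0// mulr_gt0.
  rewrite K3E; move: ((2 * kap) `^ beta) k2p => x x0.
  by rewrite le_eqVlt; apply/orP; left; apply/eqP; field; rewrite !gt_eqF.
have lQ : 0 < lam * Q by rewrite mulr_gt0.
have up : (p 0 r r' t <= ((1 + 3 * e) * (lam * Q))%:E)%E.
  apply: (@le_trans _ _ ((e * (lam * Q))%:E + lam%:E * ((1 + 2 * e) * Q)%:E)%E).
    by apply: leeD; [rewrite FE | exact: lee_wpmul2l].
  by rewrite -EFinM -EFinD lee_fin le_eqVlt; apply/orP; left; apply/eqP; ring.
have [P PE] : exists P, p 0 r r' t = P%:E.
  by apply: pfin => //; apply: le_lt_trans up _; rewrite ltry.
exists P => //; apply: (@close_le _ (3 * (3 * e))) => //.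
apply: (@close_trans _ _ _ (lam * Q)) => //.
  apply/andP; split; rewrite -lee_fin -PE//.
  apply: (@le_trans _ _ (0%E + lam%:E * ((1 - e) * ((1 - e) * Q))%:E)%E).
    rewrite add0e -EFinM lee_fin.
    have -> : lam * ((1 - e) * ((1 - e) * Q)) = (1 - e) * (1 - e) * (lam * Q) by ring.
    by apply: ler_wpM2r => //; exact: ltW.
  by apply: leeD => //; exact: lee_wpmul2l.
apply: (@close_le _ (2 * e)) => //; apply: close_sym => //; first exact: ltW.
apply: closeZ; first exact: ltW.
rewrite QH QG; apply: closeZ; first exact: ltW.
apply/andP; split; first exact: le_trans ii.
by apply: (le_trans iii); rewrite ler_peMl ?(ltW G0)// lerDl ltW.
Qed.

End critical_regimes.

(** * Borel sets of R^d, coordinate by coordinate *)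

Section borel_rV.
Context (R : realType) (d : nat).

(** Balls of the sup norm with rational centres and radii 1/(n + 1) form a countable base. As such a
    ball is a product of intervals, measurability can be checked on coordinates. *)
Lemma open_rV_rat_ball (O : set 'rV[R]_d) : open O ->
  O = \bigcup_(qn in [set qn : 'rV[rat]_d * nat |
        ball (map_mx ratr qn.1 : 'rV[R]_d) qn.2.+1%:R^-1 `<=` O])
      ball (map_mx ratr qn.1 : 'rV[R]_d) qn.2.+1%:R^-1.
Proof.
move=> oO; apply/seteqP; split => [x Ox|x [qn /= H]]; last exact: H.
have /nbhs_ballP[e /= e0 He] : nbhs x O by exact: open_nbhs_nbhs.
have [n nP] : exists n : nat, n.+1%:R^-1 < e / 2.
  have e2 : 0 < e / 2 by rewrite divr_gt0.
  exists (Num.truncn (e / 2)^-1); rewrite invf_plt ?posrE//.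
  exact: truncnS_gt.
have n0 : 0 < n.+1%:R^-1 :> R by rewrite invr_gt0.
have ex (i : 'I_d) : exists q : rat, `|x ord0 i - ratr q| < n.+1%:R^-1.
  have lt : x ord0 i - n.+1%:R^-1 < x ord0 i + n.+1%:R^-1.
    by rewrite ltrBlDr -addrA ltrDl addr_gt0.
  have [q] := rat_in_itvoo lt.
  by rewrite in_itv/= => qi; exists q; rewrite distrC ltr_distl.
have [q Hq] := choice ex.
have xq : ball (map_mx ratr (\row_i q i) : 'rV[R]_d) n.+1%:R^-1 x.
  split=> // i j; rewrite !mxE /ball/= (ord1 i) distrC; exact: Hq.
exists (\row_i q i, n) => //= y qy; apply: He.
rewrite (splitr e); apply: (@ball_triangle _ _ (map_mx ratr (\row_i q i) : 'rV[R]_d)).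
- by apply: ball_sym; apply: le_ball xq; exact: ltW.
- by apply: le_ball qy; exact: ltW.
Qed.

Lemma measurable_fun_rV dT (T : measurableType dT) (D : set T) (f : T -> borel_rV R d) :
  (forall i : 'I_d, measurable_fun D (fun x => (f x : 'rV[R]_d) ord0 i)) ->
  measurable_fun D f.
Proof.
move=> mf mD; apply: (@measurability _ _ _ _ D f (@open 'rV[R]_d) erefl _ mD).
move=> _ [U oU <-]; rewrite (open_rV_rat_ball oU) bigcup_mkcond preimage_bigcup setI_bigcupr.
apply: countable_bigcupT_measurable => // -[q n]; case: ifP => _; last first.
  by rewrite preimage_set0 setI0.
rewrite (_ : _ `&` _ = D `&` \bigcap_(i in [set: 'I_d])
    (D `&` (fun x => (f x : 'rV[R]_d) ord0 i) @^-1` ball (ratr (q ord0 i) : R) n.+1%:R^-1)).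
  apply: measurableI => //; apply: fin_bigcap_measurable; first exact: finite_finset.
  by move=> i _; apply: mf => //; apply: open_measurable; exact: ball_open.
apply/seteqP; split => x /= [Dx H]; split => //.
  by move=> i _; split => //=; have [_ /(_ ord0 i)] := H; rewrite !mxE.
by split=> // i j; rewrite !mxE (ord1 i); have [_] := H j I.
Qed.

Lemma measurable_coord (i : 'I_d) :
  measurable_fun [set: borel_rV R d] (fun y : borel_rV R d => (y : 'rV[R]_d) ord0 i).
Proof.
have mO (O : set R) : open O -> measurable ((fun y : borel_rV R d => (y : 'rV[R]_d) ord0 i) @^-1` O).
  move=> oO; apply: sub_sigma_algebra.
  by move: (@coord_continuous R 1 d ord0 i) => /continuousP; exact.
apply: (@measurability _ _ _ (measurableTypeR R) setT _ _ (RGenOpens.measurableE R)) => //.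
move=> _ [_ [a [b ->]] <-]; rewrite setTI; apply: mO.
exact: interval_open.
Qed.

Lemma measurable_dotp (xi : 'rV[R]_d) :
  measurable_fun [set: borel_rV R d] (fun y : borel_rV R d => dotp xi y).
Proof.
apply: (@measurable_sum _ _ R _ _ _ (fun i (y : borel_rV R d) => xi ord0 i * (y : 'rV[R]_d) ord0 i)) => i.
by apply: measurable_funM; [exact: measurable_cst | exact: measurable_coord].
Qed.

Lemma measurable_enorm : measurable_fun [set: borel_rV R d] (fun y : borel_rV R d => enorm (y : 'rV[R]_d)).
Proof.
apply: (measurableT_comp (f := @Num.sqrt R) (g := fun y : borel_rV R d => dotp (y : 'rV[R]_d) y)).
  by apply: continuous_measurable_fun; exact: sqrt_continuous.
apply: (@measurable_sum _ _ R _ _ _ (fun i (y : borel_rV R d) => (y : 'rV[R]_d) ord0 i * (y : 'rV[R]_d) ord0 i)) => i.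
by apply: measurable_funM; exact: measurable_coord.
Qed.

End borel_rV.

(** * The iterated integral as integration against a measure *)

Section lebesgue_rV.
Context (R : realType).
Local Notation leb := (@lebesgue_measure R).

Section image_sigma_finite.
Context d1 d2 (T1 : measurableType d1) (T2 : measurableType d2).
Variables (m : {measure set T1 -> \bar R}) (f : T1 -> T2) (g : T2 -> T1).
Hypothesis msf : sigma_finite setT m.
Hypotheses (mf : measurable_fun setT f) (mg : measurable_fun setT g) (fK : cancel f g).

(** The image measure along an isomorphism. The hypotheses are arguments of the constant so that its
    sigma-finite instance can be built. *)
Definition iso_measure of cancel f g & measurable_fun setT g & sigma_finite setT m :
  set T2 -> \bar R := image_measure m mf.
Local Notation im := (iso_measure fK mg msf).
HB.instance Definition _ := Measure.on im.

Let im_sf : sigma_finite setT im.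
Proof.
have [F FT Foo] := msf.
exists (fun n => g @^-1` F n); first by rewrite -preimage_bigcup -FT preimage_setT.
move=> n; have [mF Fo] := Foo n; split.
  by rewrite -[_ @^-1` _]setTI; exact: mg.
rewrite /iso_measure /image_measure /= /pushforward.
by rewrite -comp_preimage (_ : g \o f = id)//; apply/funext => x /=; rewrite fK.
Qed.
HB.instance Definition _ := @Measure_isSigmaFinite.Build _ _ _ im im_sf.

Lemma ge0_integral_iso (h : T2 -> \bar R) : measurable_fun setT h ->
  (forall y, (0 <= h y)%E) -> (\int[im]_y h y = \int[m]_x h (f x))%E.
Proof. by move=> mh h0; rewrite /iso_measure ge0_integral_image. Qed.

End image_sigma_finite.

Definition cons_rV n (uv : R * borel_rV R n) : borel_rV R n.+1 :=
  row_mx (uv.1%:M : 'M[R]_1) (uv.2 : 'rV[R]_n).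
Definition uncons_rV n (y : borel_rV R n.+1) : R * borel_rV R n :=
  ((y : 'rV[R]_n.+1) ord0 ord0, @rsubmx R 1 1 n y).

Lemma cons_rVK n : cancel (@cons_rV n) (@uncons_rV n).
Proof.
move=> [u v]; rewrite /cons_rV /uncons_rV /= row_mxKr; congr pair.
rewrite (_ : ord0 = lshift n (@ord0 0)); last exact/val_inj.
by rewrite (@row_mxEl R 1 1 n) !mxE eqxx mulr1n.
Qed.

Lemma cons_rV0 n (uv : R * borel_rV R n) : (cons_rV uv : 'rV[R]_n.+1) ord0 ord0 = uv.1.
Proof. by have := congr1 fst (cons_rVK uv). Qed.

Lemma cons_rVS n (uv : R * borel_rV R n) (i : 'I_n) :
  (cons_rV uv : 'rV[R]_n.+1) ord0 (lift ord0 i) = (uv.2 : 'rV[R]_n) ord0 i.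
Proof.
rewrite (_ : lift ord0 i = rshift 1 i); last exact/val_inj.
by rewrite /cons_rV (@row_mxEr R 1 1 n).
Qed.

Lemma measurable_cons_rV n : measurable_fun setT (@cons_rV n).
Proof.
apply: measurable_fun_rV => i; case: (unliftP ord0 i) => [j|] ->.
  under eq_fun do rewrite cons_rVS.
  by apply: (measurableT_comp (@measurable_coord R n j)); exact: measurable_snd.
by under eq_fun do rewrite cons_rV0; exact: measurable_fst.
Qed.

Lemma measurable_uncons_rV n : measurable_fun setT (@uncons_rV n).
Proof.
apply/measurable_fun_pairP; split; first exact: measurable_coord.
apply: measurable_fun_rV => i /=.
rewrite (_ : (fun x => _) = (fun y : borel_rV R n.+1 => (y : 'rV[R]_n.+1) ord0 (lift ord0 i))).
  exact: measurable_coord.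
by apply/funext => y; rewrite !mxE; congr (y _ _); exact/val_inj.
Qed.

(** Gives access to Tonelli and to uniqueness of measures for [integral_rV]. By induction, the
    measure is the image of a product under prepending a coordinate, starting from a Dirac mass in
    dimension 0. *)
Lemma lebesgue_rV_ex d : exists L : {sigma_finite_measure set (borel_rV R d) -> \bar R},
  forall f : borel_rV R d -> \bar R, measurable_fun setT f -> (forall y, (0 <= f y)%E) ->
    (integral_rV f = \int[L]_y f y)%E.
Proof.
elim: d => [|n [L HL]].
  exists (@dirac _ (borel_rV R 0) 0 R) => f mf f0 /=.
  by rewrite integral_dirac// diracT mul1e.
have [msf] :=
  lebesgue_integral_fubini.measure_function_Measure_isSigmaFinite__to__measure_function_isSigmaFinite
    (lebesgue_measure_lebesgue_measure__canonical__measure_function_SigmaFiniteMeasure R) L.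
have mc : measurable_fun [set: (measurableTypeR R * borel_rV R n)%type] (@cons_rV n).
  exact: measurable_cons_rV.
have mu : measurable_fun [set: borel_rV R n.+1]
    (@uncons_rV n : borel_rV R n.+1 -> (measurableTypeR R * borel_rV R n)%type).
  exact: measurable_uncons_rV.
exists (iso_measure mc (@cons_rVK n) mu msf).
move=> f mf f0; rewrite ge0_integral_iso//.
have mfc : measurable_fun setT (f \o @cons_rV n) by exact: measurableT_comp mf (measurable_cons_rV (n := n)).
rewrite (@fubini_tonelli1 _ _ _ _ _ leb L (f \o @cons_rV n))//=.
apply: eq_integral => u _; rewrite HL//.
by apply: (measurableT_comp (f := f \o @cons_rV n) (g := fun v : borel_rV R n => (u, v))) => //; exact: pair1_measurable.
Qed.

End lebesgue_rV.

(** * Uniqueness for characteristic functions *)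

Section characteristic_functions.
Context (R : realType) (d : nat).
Local Notation V := (borel_rV R d).

Lemma dotpDl (x y z : 'rV[R]_d) : dotp (x + y) z = dotp x z + dotp y z.
Proof. by rewrite /dotp -big_split; apply: eq_bigr => i _; rewrite !mxE mulrDl. Qed.

Lemma dotpNl (x z : 'rV[R]_d) : dotp (- x) z = - dotp x z.
Proof. by rewrite /dotp -sumrN; apply: eq_bigr => i _; rewrite !mxE mulNr. Qed.

Lemma dotpC (x y : 'rV[R]_d) : dotp x y = dotp y x.
Proof. by apply: eq_bigr => i _; rewrite mulrC. Qed.

(** The phase [c] puts sines and cosines into one real family whose products are half sums of
    members. *)
Definition cos_wave (xi : 'rV[R]_d) (c : R) (y : V) := cos (dotp xi y + c).

Lemma measurable_cos_wave xi c : measurable_fun setT (cos_wave xi c).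
Proof.
apply: (measurableT_comp (f := @cos R) (g := fun y : V => dotp xi y + c)).
  by apply: continuous_measurable_fun; exact: continuous_cos.
by apply: measurable_funD; [exact: measurable_dotp | exact: measurable_cst].
Qed.

(** By the product formula every wave is a multiplier. Low-frequency sines along a coordinate have
    the sign of y_i - a on any bounded set, so the indicators of the half-spaces y_i > a are limits
    of multipliers, and half-spaces generate the Borel sets. *)
Lemma cos_wave_eq_measure (mu nu : {measure set V -> \bar R}) :
  (mu setT < +oo)%E -> (nu setT < +oo)%E ->
  (forall xi c, (\int[mu]_y (cos_wave xi c y)%:E = \int[nu]_y (cos_wave xi c y)%:E)%E) ->
  forall A, measurable A -> mu A = nu A.
Proof.
move=> mufin nufin Heq.
pose E : set (V -> R) := [set e | exists xi c, e = cos_wave xi c].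
have bE e : E e -> bounded_measurable e.
  move=> [xi [c ->]]; split; first exact: measurable_cos_wave.
  by exists 1 => y; rewrite /cos_wave ler_norml cos_geN1 cos_le1.
have half (x y : R) : cos x * cos y = 1 / 2 * cos (x + y) + 1 / 2 * cos (x - y).
  by rewrite cosD cosB; field.
have mw xi c : multiplier mu nu E (cos_wave xi c).
  have bw : bounded_measurable (cos_wave xi c) by apply: bE; exists xi, c.
  split=> // h [bh Hh]; split; first exact: bounded_measurableM.
  move=> e [xi' [c' ->]].
  have split_int (m : {measure set V -> \bar R}) : (m setT < +oo)%E ->
     (\int[m]_y (cos_wave xi c y * h y * cos_wave xi' c' y)%:E =
      (1 / 2)%:E * \int[m]_y (h y * cos_wave (xi + xi') (c + c') y)%:E +
      (1 / 2)%:E * \int[m]_y (h y * cos_wave (xi - xi') (c - c') y)%:E)%E.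
    move=> mfin.
    have b1 : bounded_measurable (fun y => h y * cos_wave (xi + xi') (c + c') y).
      by apply: bounded_measurableM => //; apply: bE; exists (xi + xi'), (c + c').
    have b2 : bounded_measurable (fun y => h y * cos_wave (xi - xi') (c - c') y).
      by apply: bounded_measurableM => //; apply: bE; exists (xi - xi'), (c - c').
    have i1 := bounded_measurable_integrable mfin b1.
    have i2 := bounded_measurable_integrable mfin b2.
    rewrite -!integralZl//= -integralD//=; try exact: integrableZl.
    apply: eq_integral => y _; rewrite -!EFinM -EFinD; congr EFin.
    rewrite /cos_wave !dotpDl dotpNl.
    rewrite (_ : dotp xi y + dotp xi' y + (c + c') = (dotp xi y + c) + (dotp xi' y + c')); last by ring.
    rewrite (_ : dotp xi y - dotp xi' y + (c - c') = (dotp xi y + c) - (dotp xi' y + c')); last by ring.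
    rewrite mulrAC half; move: (cos (_ + _)) (cos (_ - _)) => x z; ring.
  rewrite !split_int// !Hh//; first by exists (xi - xi'), (c - c').
  by exists (xi + xi'), (c + c').
apply: (eq_measure_multiplier mufin nufin bE).
- by move=> e [xi [c ->]]; exact: Heq.
- exists 0, 0; apply/funext => y; rewrite /cos_wave (_ : dotp 0 y = 0) ?addr0 ?cos0//.
  by rewrite /dotp big1// => i _; rewrite mxE mul0r.
set Gs := [set B | _].
have ray (i : 'I_d) (a : R) : Gs [set y : V | a < (y : 'rV[R]_d) ord0 i].
  split.
    rewrite -[[set _ | _]]setTI.
    have := @measurable_coord R d i measurableT `]a, +oo[%classic (measurable_itv _).
    by congr (measurable (_ `&` _)); apply/seteqP; split => y /=; rewrite in_itv/= andbT.
  (* For fixed y the argument lies in ]-pi, pi[ as soon as [n] is large, and there the sine has the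
     sign of its argument. *)
  pose w n (y : V) := sin (n.+1%:R^-1 * ((y : 'rV[R]_d) ord0 i - a)).
  have wE n : w n = cos_wave (n.+1%:R^-1 *: delta_mx ord0 i) (- (n.+1%:R^-1 * a) - pi / 2).
    apply/funext => y; rewrite /w /cos_wave addrA cosB cos_pihalf sin_pihalf mulr0 add0r mulr1.
    congr (sin _); rewrite mulrBr; congr (_ - _).
    rewrite /dotp (bigD1 i)//= big1 ?addr0 ?mxE ?eqxx ?mulr1// => j ji.
    by rewrite !mxE (negbTE ji) mulr0 mul0r.
  have mW n : multiplier mu nu E (\1_[set y | 0 < w n y]).
    apply: multiplier_pos => //; first by rewrite wE; exact: mw.
    by move=> y; rewrite /w ler_norml sin_geN1 sin_le1.
  apply: (multiplier_lim mufin nufin bE (K := 1) mW).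
    by move=> n y; rewrite indicE; case: (_ \in _); rewrite ?normr1 ?normr0.
  move=> y; set x := (y : 'rV[R]_d) ord0 i - a.
  apply: cvg_near_cst; near=> n.
  have np : 0 < n.+1%:R^-1 :> R by rewrite invr_gt0.
  have nx : `|n.+1%:R^-1 * x| < pi.
    rewrite normrM gtr0_norm// ltr_pdivrMl//; near: n.
    exists (Num.truncn (`|x| / pi)) => // n /= nn; rewrite -ltr_pdivrMr ?pi_gt0//.
    by apply: lt_le_trans (truncnS_gt _) _; rewrite ler_nat.
  rewrite !indicE; congr ((_ : bool)%:R); apply/idP/idP; rewrite !inE /=.
    move=> ws; rewrite -subr_gt0 -/x ltNge; apply/negP => x0.
    move: ws; rewrite /w -/x ltNge => /negP; apply.
    rewrite -[_ * x]opprK sinN oppr_le0 sin_ge0_pi// -mulrN.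
    rewrite mulr_ge0 ?oppr_ge0 ?(ltW np)//=.
    by move: nx; rewrite normrM gtr0_norm// ler0_norm// => /ltW.
  move=> ax; rewrite /w -/x; apply: sin_gt0_pi.
  have x0 : 0 < x by rewrite subr_gt0.
  rewrite mulr_gt0//=; move: nx; by rewrite gtr0_norm// mulr_gt0.
move=> A mA.
have mid : measurable_fun [set: g_sigma_algebraType Gs] (fun y : g_sigma_algebraType Gs => y : V).
  apply: measurable_fun_rV => i.
  apply: (@measurability _ _ _ (measurableTypeR R) setT _ _ (RGenOInfty.measurableE R)) => //.
  move=> _ [_ [a ->] <-]; rewrite setTI; apply: sub_sigma_algebra.
  have := ray i a; congr (Gs _).
  by apply/seteqP; split => y /=; rewrite in_itv/= andbT.
by have := mid measurableT A mA; rewrite setTI.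
Unshelve. all: by end_near. Qed.

End characteristic_functions.

(** * Euclidean geometry and the joint limit *)

Section euclidean.
Context (R : realType) (d : nat).
Implicit Types x y : 'rV[R]_d.

Lemma dotp_ge0 x : 0 <= dotp x x.
Proof. by apply: sumr_ge0 => i _; rewrite -expr2 sqr_ge0. Qed.

Lemma enorm_ge0 x : 0 <= enorm x. Proof. exact: sqrtr_ge0. Qed.

Lemma enorm_sqr x : enorm x ^+ 2 = dotp x x.
Proof. by rewrite sqr_sqrtr// dotp_ge0. Qed.

Lemma dotpZl c x y : dotp (c *: x) y = c * dotp x y.
Proof. by rewrite /dotp mulr_sumr; apply: eq_bigr => i _; rewrite !mxE mulrA. Qed.

Lemma enormB_sqr y x : enorm (y - x) ^+ 2 = enorm y ^+ 2 - 2 * dotp y x + enorm x ^+ 2.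
Proof.
rewrite !enorm_sqr dotpDl dotpNl ![dotp _ (y - x)]dotpC !dotpDl !dotpNl (dotpC x y).
by ring.
Qed.

Lemma cauchy_schwarz y x : `|dotp y x| <= enorm y * enorm x.
Proof.
have [y0|y0] := eqVneq (enorm y) 0.
  have yz : y = 0.
    apply/rowP => i; rewrite mxE; have := enorm_sqr y; rewrite y0 expr0n /= => /esym/eqP.
    rewrite psumr_eq0; last by move=> j _; rewrite -expr2 sqr_ge0.
    by move=> /allP/(_ i (mem_index_enum _))/=; rewrite mulf_eq0 orbb => /eqP.
  by rewrite y0 mul0r yz /dotp big1 ?normr0// => i _; rewrite mxE mul0r.
have yp : 0 < enorm y by rewrite lt_neqAle eq_sym y0 enorm_ge0.
rewrite -(@ler_pXn2r _ 2) ?nnegrE ?normr_ge0 ?mulr_ge0 ?enorm_ge0// real_normK ?num_real// exprMn.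
have := sqr_ge0 (enorm (enorm y ^+ 2 *: x - dotp y x *: y)).
rewrite enormB_sqr ![enorm (_ *: _) ^+ 2]enorm_sqr !dotpZl ![dotp _ (_ *: _)]dotpC !dotpZl.
rewrite -!enorm_sqr (dotpC y x); set c := dotp x y; set n := enorm y; set k := enorm x => h.
have : 0 <= n ^+ 2 * (n ^+ 2 * k ^+ 2 - c ^+ 2).
  by apply: le_trans h _; rewrite le_eqVlt; apply/orP; left; apply/eqP; ring.
by rewrite pmulr_rge0 ?exprn_gt0// subr_ge0.
Qed.

Lemma enorm_shift y x : `|enorm (y - x) - enorm y| <= enorm x.
Proof.
have := cauchy_schwarz y x; rewrite ler_norml => /andP[h1 h2].
have hs := enormB_sqr y x.
have p1 := enorm_ge0 y; have p2 := enorm_ge0 x; have p3 := enorm_ge0 (y - x).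
move: hs h1 h2 p1 p2 p3; set r' := enorm (y - x); set r := enorm y; set k := enorm x; set c := dotp y x.
move=> hs h1 h2 p1 p2 p3; rewrite ler_norml; apply/andP; split.
  rewrite lerBrDr addrC; have [rk|kr] := leP r k; first by rewrite (le_trans _ p3)// subr_le0.
  rewrite -(@ler_pXn2r _ 2) ?nnegrE ?subr_ge0 ?(ltW kr)// hs.
  have -> : (r - k) ^+ 2 = r ^+ 2 - 2 * (r * k) + k ^+ 2 by ring.
  by rewrite lerD2r lerD2l lerN2 ler_pM2l.
rewrite lerBlDr -(@ler_pXn2r _ 2) ?nnegrE ?addr_ge0// hs.
have -> : (k + r) ^+ 2 = r ^+ 2 - 2 * (- (r * k)) + k ^+ 2 by ring.
by rewrite lerD2r lerD2l lerN2 ler_pM2l.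
Qed.

(** First-order expansion |y| - |y - x| = <y/|y|, x> + O(1/|y|), obtained by rationalizing the
    difference of the norms. *)
Lemma enorm_expansion y x : 0 < enorm y ->
  `|enorm y - enorm (y - x) - dotp ((enorm y)^-1 *: y) x| <= 2 * enorm x ^+ 2 / enorm y.
Proof.
move=> r0; have hc := cauchy_schwarz y x; have hn := enorm_shift y x.
have hs := enormB_sqr y x; have p3 := enorm_ge0 (y - x); have p2 := enorm_ge0 x.
rewrite dotpZl; move: r0 hs hc hn p3 p2.
set r' := enorm (y - x); set r := enorm y; set k := enorm x; set c := dotp y x.
move=> r0 hs hc hn p3 p2; have s0 : 0 < r + r' by rewrite ltr_wpDr.
have -> : r - r' - r^-1 * c = (c * (r - r') - k ^+ 2 * r) / (r * (r + r')).
  have h : (r - r') * (r + r') = 2 * c - k ^+ 2 by rewrite -subr_sqr hs; ring.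
  have rs : r * (r + r') != 0 by rewrite gt_eqF// mulr_gt0.
  apply: (mulIf rs); rewrite divfK// mulrBl.
  have -> : (r - r') * (r * (r + r')) = (2 * c - k ^+ 2) * r by rewrite -h; ring.
  have -> : r^-1 * c * (r * (r + r')) = c * (r + r') by field; rewrite gt_eqF.
  by ring.
rewrite normrM normfV [X in _ / X]gtr0_norm ?mulr_gt0//.
rewrite ler_pdivrMr ?mulr_gt0//.
apply: (@le_trans _ _ (2 * k ^+ 2 * r)).
  apply: (le_trans (ler_normB _ _)).
  rewrite normrM [X in _ + X]ger0_norm ?mulr_ge0 ?sqr_ge0 ?(ltW r0)//.
  have -> : 2 * k ^+ 2 * r = (r * k) * k + k ^+ 2 * r by ring.
  by rewrite lerD2r; apply: ler_pM => //; rewrite distrC.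
have -> : 2 * k ^+ 2 / r * (r * (r + r')) = 2 * k ^+ 2 * (r + r') by field; rewrite gt_eqF.
by rewrite ler_wpM2l ?mulr_ge0 ?sqr_ge0// lerDl.
Qed.

Lemma norm_infty_filter : Filter (@norm_infty R d).
Proof.
apply: filter_from_filter; first by exists 0.
move=> i j _ _; exists (Num.max i j) => // y /=.
by rewrite gt_max => /andP[].
Qed.

(** Reduces the filter limit to thresholds on [t] and |y|; the value must be finite there, since the
    quotient lives in the extended reals. *)
Lemma asymp_equiv_on_close (S : set (R * 'rV[R]_d)) (A : R -> 'rV[R]_d -> \bar R) (B : R -> 'rV[R]_d -> R) :
  (forall th : R, 0 < th <= 1 -> exists X0 : R, forall t y, S (t, y) -> X0 <= t -> X0 <= enorm y ->
    exists P, [/\ A t y = P%:E, close th P (B t y) & 0 < B t y]) ->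
  asymp_equiv_on S A B.
Proof.
move=> H; rewrite /asymp_equiv_on.
have F1 := norm_infty_filter.
have nearP (Q : R * 'rV[R]_d -> Prop) (X0 : R) :
    (forall t y, S (t, y) -> X0 <= t -> X0 <= enorm y -> Q (t, y)) ->
    \forall ty \near within S (filter_prod (pinfty_nbhs R) (@norm_infty R d)), Q ty.
  move=> h; exists ([set t | X0 <= t], [set y | X0 < enorm y]) => /=.
    split; last by exists X0.
    by exists X0; split; [exact: num_real | move=> t /ltW].
  by move=> [t y] /= [t0 y0] St; apply: h => //; exact: ltW.
apply/fine_cvgP; split.
  have h1 : 0 < (1 : R) <= 1 by rewrite ltr01 lexx.
  have [X0 HX] := H 1 h1; apply: (nearP _ X0) => t y St tX yX /=.
  by have [P [-> _ _]] := HX t y St tX yX.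
apply/cvgrPdist_le => e e0.
have h1 : 0 < Num.min e 1 <= 1 by rewrite lt_min e0 ltr01 ge_min lexx orbT.
have [X0 HX] := H _ h1; apply: (nearP _ X0) => t y St tX yX /=.
have [P [-> /andP[p1 p2] B0]] := HX t y St tX yX.
rewrite /= -/(P * _) distrC.
apply: (@le_trans _ _ (Num.min e 1)); last by rewrite ge_min lexx.
rewrite ler_norml lerBrDr lerBlDr ler_pdivlMr// ler_pdivrMr// addrC p1/=.
by rewrite addrC.
Qed.

End euclidean.

(** * Explicit constants *)

Section densities.
Context (R : realType) (d : nat) (alpha m : R) (eta : R -> R -> R).
Local Notation leb := (@lebesgue_measure R).
Hypotheses (d_ge1 : (1 <= d)%N) (alpha_gt0 : 0 < alpha) (alpha_lt2 : alpha < 2).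
Hypotheses (m_gt0 : 0 < m) (etaP : stable_subordinator_density alpha eta).
Local Notation beta := (alpha / 2).
Local Notation a := (d%:R / 2 : R).
Local Notation kap := (m `^ alpha^-1).
Local Notation A := (saddle_area a kap).
Local Notation v0 := (time_scale alpha kap).

Let a_gt0 : 0 < a. Proof. by rewrite divr_gt0// ltr0n. Qed.
Let kap_gt0 : 0 < kap. Proof. exact: powR_gt0. Qed.

Lemma rel_densityE t (y : 'rV[R]_d) : rel_density alpha m eta t y =
  ((expR (m * t))%:E * mixture a kap eta (enorm y) t)%E.
Proof.
rewrite /rel_density /mixture /gauss_weight; congr (_ * _)%E.
apply: eq_integral => u _; congr (_ * _ * expR (- (_ * u)) * _)%:E.
by rewrite -powR_mulrn ?powR_ge0// -powRrM mulrC.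
Qed.

Lemma reset_densityE lam t (x y : 'rV[R]_d) : 0 < lam ->
  reset_density alpha m eta lam t x y =
  reset_mixture a kap eta lam (m - lam) (enorm y) (enorm (y - x)) t.
Proof.
move=> lam0; rewrite /reset_density /reset_mixture.
have eE s : expR ((m - lam) * s) = expR (- (lam * s)) * expR (m * s).
  by rewrite -expRD; congr expR; ring.
congr (_ + _)%E; first by rewrite rel_densityE muleA -EFinM eE.
transitivity (\int[leb]_(s in `]0%R, t[) (lam%:E * ((expR ((m - lam) * s))%:E * mixture a kap eta (enorm y) s)))%E.
  apply: eq_integral => s _.
  by rewrite rel_densityE !muleA -!EFinM eE mulrA.
rewrite ge0_integralZl_EFin.
- by [].
- exact: measurable_itv.
- move=> s /=; rewrite in_itv/= => /andP[s0 _].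
  by rewrite mule_ge0 ?lee_fin ?expR_ge0// (mixture_ge0 _ _ etaP).
- have sub : (`]0%R, t[ : set R) `<=` `]0, +oo[ by move=> s; rewrite /= !in_itv/= andbT => /andP[].
  have h := measurable_funS (measurable_itv _) sub (measurable_mixture a kap alpha_gt0 etaP (enorm y)).
  by mfun.
- exact: ltW.
Qed.

Let pE (x p : R) : 0 < x -> x `^ p = expR (p * ln x).
Proof. by move=> x0; rewrite /powR gt_eqF. Qed.

Let lnkap : ln kap = alpha^-1 * ln m.
Proof. by rewrite pE// expRK. Qed.

Lemma time_scaleE r : 0 < r -> v0 r = r `^ (- beta) * Num.sqrt (2 `^ alpha * m).
Proof.
move: lnkap kap_gt0; move: kap => k lnk k0 r0.
have k2 : 0 < 2 * k by rewrite mulr_gt0.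
have p2 : 0 < 2 `^ alpha :> R by exact: powR_gt0.
have l1 : ln (r / (2 * k)) = ln r - (ln 2 + alpha^-1 * ln m).
  by rewrite lnM ?posrE ?invr_gt0// lnV ?posrE// lnM ?posrE// lnk.
have l2 : ln (2 `^ alpha * m) = alpha * ln 2 + ln m.
  by rewrite lnM ?posrE// pE// expRK.
rewrite /time_scale /saddle -powR12_sqrt ?mulr_ge0 ?(ltW p2) ?(ltW m_gt0)//.
rewrite (pE _ (divr_gt0 r0 k2)) (pE _ r0) (pE _ (mulr_gt0 p2 m_gt0)) l1 l2 -expRD.
by congr expR; move: (ln m) (ln 2) (ln r) => x y z; field; rewrite gt_eqF.
Qed.

(** The prefactor of the third case times v0; the spare v0 is the one that turns [H] into the
    rescaled time integral. The identity is checked after taking logarithms of all powers. *)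
Lemma saddle_areaE r : 0 < r ->
  A r = m `^ ((d%:R - alpha - 1) / (2 * alpha)) * expR (- (kap * r))
    / (2 `^ ((d%:R + alpha - 1) / 2) * pi `^ ((d%:R - 1) / 2) * r `^ ((d%:R - alpha + 1) / 2)) * v0 r.
Proof.
move: lnkap kap_gt0; move: kap => k lnk k0 r0.
have pi0 : 0 < pi :> R by exact: pi_gt0.
have two0 : 0 < 2 :> R by [].
have kr : 0 < k * r by rewrite mulr_gt0.
have k2 : 0 < 2 * k by rewrite mulr_gt0.
have p2 : 0 < 2 * pi :> R by rewrite mulr_gt0.
have p2r : 0 < 2 * pi * r by rewrite mulr_gt0.
have l1 : ln (r / (2 * k)) = ln r - (ln 2 + alpha^-1 * ln m).
  by rewrite lnM ?posrE ?invr_gt0// lnV ?posrE// lnM ?posrE// lnk.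
have l2 : ln (2 * pi * r / k) = ln 2 + ln pi + ln r - alpha^-1 * ln m.
  by rewrite lnM ?posrE ?invr_gt0// lnV ?posrE// lnM ?posrE// lnM ?posrE// lnk.
have l3 : ln (2 * pi / (k * r)) = ln 2 + ln pi - (alpha^-1 * ln m + ln r).
  by rewrite lnM ?posrE ?invr_gt0// lnV ?posrE// lnM ?posrE// lnM ?posrE// lnk.
rewrite /saddle_area /saddle_value -powR12_sqrt ?divr_ge0 ?(ltW p2) ?(ltW kr)//.
have -> : 4 * pi * saddle k r = 2 * pi * r / k.
  by rewrite /saddle; generalize (pi : R) => p; field; rewrite gt_eqF.
rewrite /time_scale /saddle mulrAC.
rewrite [RHS](_ : _ = m `^ ((d%:R - alpha - 1) / (2 * alpha)) / (2 `^ ((d%:R + alpha - 1) / 2) * pi `^ ((d%:R - 1) / 2) *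
   r `^ ((d%:R - alpha + 1) / 2)) * (r / (2 * k)) `^ (- beta) * expR (- (k * r))); last by ring.
congr (_ * _).
rewrite (pE _ m_gt0) (pE _ two0) (pE _ pi0) (pE _ r0) (pE _ (divr_gt0 r0 k2)).
rewrite (pE _ (divr_gt0 p2r k0)) (pE _ (divr_gt0 p2 kr)) l1 l2 l3.
rewrite -!expRD -expRN -!expRD; congr expR.
by move: (ln m) (ln 2) (ln pi) (ln r) => x1 x2 x3 x4; field; rewrite gt_eqF.
Qed.

End densities.

(** * The three asymptotic statements *)

Section asymptotics.
Context (R : realType) (d : nat) (alpha m : R) (eta : R -> R -> R).
Local Notation leb := (@lebesgue_measure R).
Hypotheses (d_ge1 : (1 <= d)%N) (alpha_gt0 : 0 < alpha) (alpha_lt2 : alpha < 2).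
Hypotheses (m_gt0 : 0 < m) (etaP : stable_subordinator_density alpha eta).
Local Notation beta := (alpha / 2).
Local Notation a := (d%:R / 2 : R).
Local Notation kap := (m `^ alpha^-1).
Local Notation A := (saddle_area a kap).
Local Notation v0 := (time_scale alpha kap).
Local Notation H := (time_integral alpha kap eta).
Local Notation gam := (Gamma (1 - beta)).
Local Notation sq := (Num.sqrt (2 `^ alpha * m)).
Local Notation Cst r := (m `^ ((d%:R - alpha - 1) / (2 * alpha)) * expR (- (kap * r))
    / (2 `^ ((d%:R + alpha - 1) / 2) * pi `^ ((d%:R - 1) / 2) * r `^ ((d%:R - alpha + 1) / 2))).

Let a_gt0 : 0 < a. Proof. by rewrite divr_gt0// ltr0n. Qed.
Let kap_gt0 : 0 < kap. Proof. exact: powR_gt0. Qed.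
Let beta_gt0 : 0 < beta. Proof. by rewrite divr_gt0. Qed.
Let beta_lt1 : beta < 1. Proof. by rewrite ltr_pdivrMr// mul1r. Qed.
Let gam_gt0 : 0 < gam. Proof. by have [_] := Gamma_integral beta_gt0 beta_lt1. Qed.

Let sq_gt0 : 0 < sq.
Proof. by rewrite sqrtr_gt0 mulr_gt0// powR_gt0. Qed.

Let zE (r t : R) : 0 < r -> t / r `^ beta * sq = t * v0 r.
Proof. by move=> r0; rewrite time_scaleE// powRN; ring. Qed.

Let pD (x p q : R) : 0 < x -> x `^ (p + q) = x `^ p * x `^ q.
Proof. by move=> x0; rewrite powRD// (gt_eqF x0) implybT. Qed.

Let int_scale D r t : 0 < r -> 0 < t ->
  (\int[leb]_(s in `]0, (t / r `^ beta * sq)[) (expR (D * (r `^ beta / sq) * s) * eta s 1))%R =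
  v0 r * H D r t.
Proof.
move=> r0 t0; rewrite zE// /Rintegral.
have -> : D * (r `^ beta / sq) = D / v0 r.
  by rewrite time_scaleE// powRN invfM invrK mulrA.
by rewrite -(time_integral_scaleE alpha_gt0 alpha_lt2 etaP kap_gt0 erefl D r0 t0).
Qed.

Let H_gt0 D r t : 0 <= D -> 0 < r -> 0 < t -> 0 < H D r t.
Proof.
move=> D0 r0 t0; have v0r := time_scale_gt0 alpha kap_gt0 r0.
have Z0 : 0 < t * v0 r by rewrite mulr_gt0.
have [c1 c10 Hl] := time_integral_lower alpha_gt0 alpha_lt2 etaP kap_gt0 erefl Z0.
apply: lt_le_trans (Hl D r t D0 r0 t0 (lexx _)).
by rewrite mulr_gt0// mulr_gt0// divr_gt0// exprn_gt0.
Qed.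

Let expR_near (e : R) : 0 < e -> exists2 dl : R, 0 < dl & forall x, `|x| <= dl -> `|expR x - 1| <= e.
Proof.
move=> e0; exists (Num.min (1 / 2) (e / 2)); first by rewrite lt_min !divr_gt0.
move=> x; rewrite le_min => /andP[x1 x2].
have h1 := expR_ge1Dx x; have h2 := expR_ge1Dx (- x).
move: x1 x2; rewrite !ler_norml => /andP[a1 a2] /andP[b1 b2].
have p1 : 0 < 1 - x by lra.
have h3 : expR x <= (1 - x)^-1.
  by rewrite -[leLHS]invrK -expRN lef_pV2 ?posrE ?expR_gt0.
have h4 : (1 - x)^-1 <= 1 + e.
  by rewrite -[leLHS]div1r ler_pdivrMr//; nra.
by apply/andP; split; lra.
Qed.

Variables (lam : R) (x : 'rV[R]_d).
Hypothesis lam_gt0 : 0 < lam.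
Local Notation L := (enorm x + 1).
Let L_gt0 : 0 < L. Proof. by rewrite ltr_wpDl// enorm_ge0. Qed.
Let hL (y : 'rV[R]_d) : `|enorm (y - x) - enorm y| <= L.
Proof. by apply: (le_trans (enorm_shift y x)); rewrite lerDl. Qed.

Lemma asymp_subcritical : m < lam ->
  asymp_equiv_on [set: R * 'rV[R]_d]
    (fun t y => reset_density alpha m eta lam t x y)
    (fun t y =>
      lam * alpha * m `^ ((d%:R + alpha - 1) / (2 * alpha))
      / (2 `^ ((d%:R - alpha + 1) / 2) * pi `^ ((d%:R - 1) / 2)
         * Gamma (1 - alpha / 2) * (lam - m) ^+ 2)
      * (expR (- (m `^ alpha^-1 * enorm y))
         / enorm y `^ ((d%:R + alpha + 1) / 2))).
Proof.
move=> mlam; have D0 : 0 < lam - m by rewrite subr_gt0.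
apply: asymp_equiv_on_close => th th1.
have [X0 X00 HX] := reset_subcritical alpha_gt0 alpha_lt2 etaP a_gt0 kap_gt0 erefl lam_gt0 L_gt0 D0 th1.
exists X0 => t y _ tX yX; have r0 : 0 < enorm y by exact: lt_le_trans yX.
have [P PE cl] := HX _ _ t yX tX (hL y).
have A0 := saddle_area_gt0 a kap_gt0 r0; have v0r := time_scale_gt0 alpha kap_gt0 r0.
set B := lam * alpha * _ / _ * _.
have BE : B = lam * (A (enorm y) * v0 (enorm y)) * (beta / gam / (lam - m) ^+ 2).
  rewrite saddle_areaE// -(mulrA _ (v0 _)).
  (* One v0 comes from [saddle_areaE], the other from eta(z,1) ~ C z; together they change the
     exponent of |y| from (d - alpha + 1)/2 to (d + alpha + 1)/2. *)
  have -> : v0 (enorm y) * v0 (enorm y) = (enorm y `^ alpha)^-1 * (2 `^ alpha * m).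
    rewrite time_scaleE// mulrACA -pD// -expr2 sqr_sqrtr; last by rewrite mulr_ge0 ?powR_ge0 ?(ltW m_gt0).
    by rewrite -powRN; congr (_ `^ _ * _); field.
  rewrite /B.
  have -> : (d%:R + alpha - 1) / (2 * alpha) = (d%:R - alpha - 1) / (2 * alpha) + 1.
    by field; rewrite gt_eqF.
  rewrite (pD _ _ m_gt0) powRr1 ?(ltW m_gt0)//.
  have -> : (d%:R + alpha + 1) / 2 = (d%:R - alpha + 1) / 2 + alpha by field.
  rewrite (pD _ _ r0).
  have -> : (d%:R + alpha - 1) / 2 = (d%:R - alpha + 1) / 2 + (alpha - 1) by field.
  have two0 : 0 < 2 :> R by [].
  rewrite (pD _ _ two0) (pD alpha (-1) two0) powR_inv1//.
  have p1 : 0 < 2 `^ ((d%:R - alpha + 1) / 2) :> R by exact: powR_gt0.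
  have p2 : 0 < 2 `^ alpha :> R by exact: powR_gt0.
  have p3 : 0 < pi `^ ((d%:R - 1) / 2) :> R by apply: powR_gt0; exact: pi_gt0.
  have p4 : 0 < enorm y `^ ((d%:R - alpha + 1) / 2) by exact: powR_gt0.
  have p5 : 0 < enorm y `^ alpha by exact: powR_gt0.
  move: p1 p2 p3 p4 p5 gam_gt0 D0; set D := lam - m.
  move: (2 `^ _) (2 `^ _) (pi `^ _) (enorm y `^ _) (enorm y `^ _) gam D (m `^ _) (expR _).
  move=> x1 x2 x3 x4 x5 x6 D x8 x9 p1 p2 p3 p4 p5 p6 D0.
  by field; rewrite !gt_eqF.
have Av : 0 < A (enorm y) * v0 (enorm y) by rewrite mulr_gt0.
exists P; rewrite BE; split; [|exact: cl|].
- by rewrite (reset_densityE m alpha_gt0 etaP _ _ _ lam_gt0) -opprB; exact: PE.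
- rewrite mulr_gt0//; first by rewrite mulr_gt0.
  by rewrite divr_gt0 ?exprn_gt0// divr_gt0.
Qed.

Lemma asymp_critical : lam = m ->
  asymp_equiv_on [set: R * 'rV[R]_d]
    (fun t y => reset_density alpha m eta lam t x y)
    (fun t y =>
      m `^ ((d%:R + alpha - 1) / (2 * alpha))
      * expR (- (m `^ alpha^-1 * enorm y))
      / (2 `^ ((d%:R + alpha - 1) / 2) * pi `^ ((d%:R - 1) / 2)
         * enorm y `^ ((d%:R - alpha + 1) / 2))
      * \int[lebesgue_measure]_(s in `]0, (t / enorm y `^ beta * sq)[) eta s 1).
Proof.
move=> lamm; apply: asymp_equiv_on_close => th th1.
have [X0 X00 HX] := reset_critical alpha_gt0 alpha_lt2 etaP a_gt0 kap_gt0 erefl lam_gt0 L_gt0 th1.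
exists X0 => t y _ tX yX; have r0 : 0 < enorm y by exact: lt_le_trans yX.
have t0 : 0 < t by exact: lt_le_trans tX.
have [P PE cl] := HX _ _ t yX tX (hL y).
have A0 := saddle_area_gt0 a kap_gt0 r0; have H0 := H_gt0 (lexx 0) r0 t0.
set B := m `^ _ * _ / _ * _.
have BE : B = lam * (A (enorm y) * H 0 (enorm y) t).
  rewrite /B; have <- : (\int[leb]_(s in `]0, (t / enorm y `^ beta * sq)[)
      (expR (0 * (enorm y `^ beta / sq) * s) * eta s 1))%R =
      (\int[leb]_(s in `]0, (t / enorm y `^ beta * sq)[) eta s 1)%R.
    by apply: eq_Rintegral => s _; rewrite !mul0r expR0 mul1r.
  rewrite int_scale// saddle_areaE// lamm.
  have -> : (d%:R + alpha - 1) / (2 * alpha) = (d%:R - alpha - 1) / (2 * alpha) + 1.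
    by field; rewrite gt_eqF.
  by rewrite (pD _ _ m_gt0) powRr1 ?(ltW m_gt0)//; ring.
exists P; rewrite BE; split; [|exact: cl|].
- rewrite (reset_densityE m alpha_gt0 etaP _ _ _ lam_gt0) (_ : m - lam = 0); first exact: PE.
  by rewrite lamm subrr.
- by rewrite mulr_gt0// mulr_gt0.
Qed.

Lemma asymp_supercritical (M : R) : lam < m -> 0 < M ->
  asymp_equiv_on
    [set ty : R * 'rV[R]_d | ty.1 / enorm ty.2 `^ beta < M]
    (fun t y => reset_density alpha m eta lam t x y)
    (fun t y =>
      (lam
       + expR (m `^ alpha^-1 * dotp ((enorm y)^-1 *: y) x)
         * (eta (t / enorm (y - x) `^ beta * sq) 1 * (m - lam) / eta (t / enorm y `^ beta * sq) 1))
      * Cst (enorm y)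
      * \int[lebesgue_measure]_(s in `]0, (t / enorm y `^ beta * sq)[)
          (expR ((m - lam) * (enorm y `^ beta / sq) * s) * eta s 1)).
Proof.
move=> lamm M0; have D0 : 0 < m - lam by rewrite subr_gt0.
apply: asymp_equiv_on_close => th th1; have /andP[th0 _] := th1.
have Z0 : 0 < M * sq by rewrite mulr_gt0.
have [X0 X00 HX] := reset_supercritical alpha_gt0 alpha_lt2 etaP a_gt0 kap_gt0 erefl lam_gt0 L_gt0 D0 Z0 th1.
have e0 : 0 < th / 100 by rewrite divr_gt0.
have [dl dl0 Hdl] := expR_near e0.
(* The second threshold keeps |y - x| positive, the third makes the remainder of [enorm_expansion]
   small enough for the exponential. *)
exists (Num.max X0 (Num.max (2 * L) (kap * (2 * enorm x ^+ 2) / dl))) => t y /= tyM.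
rewrite !ge_max => /andP[tX _] /and3P[yX y2 y3].
have r0 : 0 < enorm y by exact: lt_le_trans yX.
have t0 : 0 < t by exact: lt_le_trans tX.
have r0' : 0 < enorm (y - x).
  by have := hL y; rewrite ler_norml => /andP[h _]; have := L_gt0; lra.
have tZ : t * v0 (enorm y) <= M * sq by rewrite -zE// ler_pM2r// ltW.
have hom : `|expR (kap * (enorm y - enorm (y - x) - dotp ((enorm y)^-1 *: y) x)) - 1| <= th / 100.
  apply: Hdl; rewrite normrM (gtr0_norm kap_gt0).
  apply: (@le_trans _ _ (kap * (2 * enorm x ^+ 2 / enorm y))).
    by rewrite ler_pM2l//; exact: enorm_expansion.
  by rewrite mulrA ler_pdivrMr// (mulrC dl) -ler_pdivrMr.
have [P PE cl] := HX _ _ t _ yX tX (hL y) hom tZ.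
have A0 := saddle_area_gt0 a kap_gt0 r0; have H0 := H_gt0 (ltW D0) r0 t0.
exists P; rewrite int_scale// !zE//.
rewrite (_ : _ * Cst (enorm y) * _ = (lam + expR (kap * dotp ((enorm y)^-1 *: y) x) *
   (eta (t * v0 (enorm (y - x))) 1 * (m - lam) / eta (t * v0 (enorm y)) 1)) *
   (A (enorm y) * H (m - lam) (enorm y) t)); last first.
  by rewrite (saddle_areaE d alpha_gt0 m_gt0 r0); move: (expR _ * _) => z; ring.
split; [|exact: cl|]; first by rewrite (reset_densityE m alpha_gt0 etaP _ _ _ lam_gt0); exact: PE.
have g1 : 0 < eta (t * v0 (enorm y)) 1 by apply: (eta_gt0 etaP) => //; rewrite mulr_gt0 ?time_scale_gt0.
have g2 : 0 < eta (t * v0 (enorm (y - x))) 1 by apply: (eta_gt0 etaP) => //; rewrite mulr_gt0 ?time_scale_gt0.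
rewrite mulr_gt0//; last by rewrite mulr_gt0.
by rewrite addr_gt0// mulr_gt0 ?expR_gt0// divr_gt0// mulr_gt0.
Qed.

End asymptotics.

(** * Fourier transform of the Gaussian *)

Section gaussian.
Context (R : realType).
Local Notation leb := (@lebesgue_measure R).

Section one_dimension.
Variable u : R.
Hypothesis u_gt0 : 0 < u.
Local Notation G := (fun x : R => expR (- (x ^+ 2 / (4 * u)))).

Lemma gauss_integral0 (v : R) : 0 < v ->
  (\int[leb]_w (expR (- (w ^+ 2 / (4 * v))))%:E = (Num.sqrt (4 * pi * v))%:E)%E.
Proof.
move=> v0; have v2 : 0 < 2 * v by rewrite mulr_gt0.
have := gauss_integral1 v2; rewrite (ge0_integral_affine 1 ltr01)//; last by mfun.
rewrite mul1e (_ : 2 * pi * (2 * v) = 4 * pi * v); last by generalize (pi : R) => p; ring.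
move=> <-; rewrite (_ : [set x | setT _] = setT)//.
apply: eq_integral => w _; rewrite mul1r addrK; congr (expR (- (_ / _)))%:E.
by ring.
Qed.

Let intG (v : R) : 0 < v -> leb.-integrable setT (EFin \o (fun x : R => expR (- (x ^+ 2 / (4 * v))))).
Proof.
move=> v0; apply/integrableP; split; first by rewrite /comp; mfun.
under eq_integral do rewrite /= ger0_norm ?expR_ge0//.
by rewrite gauss_integral0// ltry.
Qed.

Let f (xi x : R) := cos (xi * x) * G x.
Let F (xi : R) := \int[leb]_x f xi x.
Let f1 (xi x : R) := - (x * sin (xi * x) * G x).

Let mcos (xi : R) : measurable_fun setT (fun x : R => cos (xi * x)).
Proof.
apply: (measurableT_comp (f := @cos R)); last by mfun.
by apply: continuous_measurable_fun; exact: continuous_cos.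
Qed.
Let msin (xi : R) : measurable_fun setT (fun x : R => sin (xi * x)).
Proof.
apply: (measurableT_comp (f := @sin R)); last by mfun.
by apply: continuous_measurable_fun; exact: continuous_sin.
Qed.

Let intf xi : leb.-integrable setT (EFin \o f xi).
Proof.
apply: (le_integrable measurableT _ _ (intG u_gt0)).
  by have h := mcos xi; rewrite /comp /f; mfun.
move=> x _ /=; rewrite lee_fin /f normrM (ger0_norm (expR_ge0 _)) ler_piMl ?expR_ge0//.
by rewrite ler_norml cos_geN1 cos_le1.
Qed.

Let df (xi x : R) : is_derive xi 1 (f ^~ x) (f1 xi x).
Proof.
rewrite /f /f1; apply: is_derive_eq.
by rewrite /GRing.scale /=; ring.
Qed.

Let K : R := 4 * u + 1.
Let dom (x : R) : `|x| * G x <= K * expR (- (x ^+ 2 / (4 * (2 * u)))).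
Proof.
have -> : G x = expR (- (x ^+ 2 / (4 * (2 * u)))) * expR (- (x ^+ 2 / (4 * (2 * u)))).
  by rewrite -expRD; congr expR; field; rewrite gt_eqF.
rewrite [leLHS]mulrA; apply: ler_wpM2r; first exact: expR_ge0.
rewrite expRN ler_pdivrMr ?expR_gt0//.
have h := expR_ge1Dx (x ^+ 2 / (4 * (2 * u))).
have K0 : 0 < K by rewrite /K addr_gt0// mulr_gt0.
apply: (@le_trans _ _ (K * (1 + x ^+ 2 / (4 * (2 * u))))); last by rewrite ler_pM2l.
have -> : x ^+ 2 = `|x| ^+ 2 by rewrite real_normK ?num_real.
move: (`|x|) (normr_ge0 x) => y y0.
have -> : K * (1 + y ^+ 2 / (4 * (2 * u))) = K + y ^+ 2 / 2 + y ^+ 2 / (8 * u).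
  by rewrite /K; field; rewrite gt_eqF.
have : 0 <= y ^+ 2 / (8 * u) by rewrite divr_ge0 ?sqr_ge0// mulr_ge0// ltW.
have := sqr_ge0 (y - 1); rewrite /K; have := u_gt0; move=> *; nra.
Qed.

Let intdom : leb.-integrable setT (EFin \o (fun x : R => K * expR (- (x ^+ 2 / (4 * (2 * u)))))).
Proof.
have v0 : 0 < 2 * u by rewrite mulr_gt0.
have h := integrableZl measurableT K (intG v0).
by apply: eq_integrable h.
Qed.

Let f1_le xi x : `|f1 xi x| <= K * expR (- (x ^+ 2 / (4 * (2 * u)))).
Proof.
apply: le_trans (dom x); rewrite /f1 normrN !normrM (ger0_norm (expR_ge0 _)).
apply: ler_wpM2r; first exact: expR_ge0.
by rewrite ler_piMr// ler_norml sin_geN1 sin_le1.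
Qed.

Let mf1 xi : measurable_fun setT (f1 xi).
Proof. by have h := msin xi; rewrite /f1; mfun. Qed.

Let dF (xi : R) : is_derive xi 1 F (\int[leb]_x f1 xi x).
Proof.
have Ia : `](xi - 1), (xi + 1)[%classic xi by rewrite /= in_itv/=; apply/andP; split; lra.
have pE (z y : R) : partial1of2 f z y = f1 z y by rewrite partial1of2E; have [_ ->] := df z y.
have G0 (y : R) : 0 <= K * expR (- (y ^+ 2 / (4 * (2 * u)))).
  by rewrite mulr_ge0 ?expR_ge0// /K addr_ge0// mulr_ge0// ltW.
have Gub z y : `](xi - 1), (xi + 1)[%classic z -> setT y ->
    `|partial1of2 f z y| <= K * expR (- (y ^+ 2 / (4 * (2 * u)))).
  by move=> _ _; rewrite pE; exact: f1_le.
have h1 := @derivable_under_integral R _ _ leb f setT measurableT xi _ _ Ia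
  (fun z _ => intf z) (fun z y _ _ => @ex_derive _ _ _ _ _ _ _ (df z y)) _ G0 intdom Gub.
have h2 := @differentiation_under_integral R _ _ leb f setT measurableT xi _ _ Ia
  (fun z _ => intf z) (fun z y _ _ => @ex_derive _ _ _ _ _ _ _ (df z y)) _ G0 intdom Gub.
apply: DeriveDef => //; rewrite -derive1E h2.
by apply: eq_Rintegral => y _; rewrite pE.
Qed.

(** Integration by parts in the form that an exact derivative of a function vanishing at both
    infinities has integral 0. *)
Let ibp (xi : R) : \int[leb]_x f1 xi x = - (2 * u * xi) * F xi.
Proof.
pose k (x : R) := f1 xi x + 2 * u * xi * f xi x.
pose P (x : R) := 2 * u * (sin (xi * x) * G x).
have dP (x : R) : is_derive x 1 P (k x).
  rewrite /P /k /f1 /f; apply: is_derive_eq.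
  by rewrite /GRing.scale /=; field; rewrite gt_eqF.
have if1 : leb.-integrable setT (EFin \o f1 xi).
  apply: (le_integrable measurableT _ _ intdom).
    by apply/measurable_EFinP; exact: mf1.
  move=> x _ /=; rewrite lee_fin; apply: (le_trans (f1_le xi x)); exact: ler_norm.
have i2 : leb.-integrable setT (EFin \o (fun x => 2 * u * xi * f xi x)).
  have h := integrableZl measurableT (2 * u * xi) (intf xi).
  by apply: eq_integrable h.
have ik : leb.-integrable setT (EFin \o k).
  have h := integrableD measurableT if1 i2.
  by apply: eq_integrable h.
suff k0 : \int[leb]_x k x = 0.
  have : \int[leb]_x k x = \int[leb]_x f1 xi x + 2 * u * xi * F xi.
    rewrite /k RintegralD// RintegralZl//.
  by rewrite k0 => /esym/eqP; rewrite addr_eq0 => /eqP ->; ring.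
have ck : continuous k.
  move=> x; rewrite /k /f1 /f; apply: differentiable_continuous; apply/derivable1_diffP.
  exact: ex_derive.
have cP : continuous P.
  by move=> x; apply: differentiable_continuous; apply/derivable1_diffP; case: (dP x).
(* On each segment the integral is P(n + 1) - P(-n - 1), which tends to 0 like 1/n; dominated
   convergence identifies the limit with the full integral. *)
pose I n := `[(- n.+1%:R : R), n.+1%:R]%classic.
have lim1 : (\int[leb]_x ((k \_ (I n)) x)%:E)%E @[n --> \oo] --> (\int[leb]_x (k x)%:E)%E.
  have [] := @dominated_convergence _ _ R leb setT measurableT
     (fun n x => ((k \_ (I n)) x)%:E) (fun x => (k x)%:E) (fun x => (`|k x|)%:E).
  - move=> n; apply/measurable_EFinP; apply/(measurable_restrictT _ _).1; first exact: measurable_itv.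
    by apply: measurable_funTS; apply/measurable_EFinP; case/integrableP: ik.
  - by apply/measurable_EFinP; case/integrableP: ik => /measurable_EFinP.
  - apply: aeW => x _; apply: cvg_near_cst; near=> n.
    rewrite patchE mem_set// /I /= in_itv/=.
    have xn : `|x| <= n.+1%:R.
      near: n; exists (Num.truncn `|x|) => // n /= hn.
      by apply: le_trans (ltW (truncnS_gt _)) _; rewrite ler_nat.
    by move: xn; rewrite ler_norml.
  - by have := integrable_abse ik; apply: eq_integrable.
  - apply: aeW => x n _ /=; rewrite lee_fin patchE; case: ifP => // _.
    by rewrite normr0.
  by move=> _ _.
have vals n : (\int[leb]_x ((k \_ (I n)) x)%:E = (P n.+1%:R - P (- n.+1%:R))%:E)%E.
  have -> : (\int[leb]_x ((k \_ (I n)) x)%:E = \int[leb]_(x in I n) (k x)%:E)%E.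
    rewrite [RHS]integral_mkcond; apply: eq_integral => x _.
    by rewrite !patchE; case: ifP.
  rewrite (continuous_FTC2 (F := P)) ?EFinB//.
  - by rewrite gtrN// ltr0n.
  - exact: continuous_subspaceT.
  - split; first by move=> x _; case: (dP x).
    + by apply: cvg_at_right_filter; exact: cP.
    + by apply: cvg_at_left_filter; exact: cP.
  - by move=> x _; rewrite derive1E; apply: derive_val.
have P0 (x : R) : 1 <= x -> `|P x| <= 8 * u ^+ 2 * x^-1 /\ `|P (- x)| <= 8 * u ^+ 2 * x^-1.
  move=> x1; have x0 : 0 < x by lra.
  have hG : G x <= 4 * u * x^-1.
    rewrite expRN -[leRHS]invrK lef_pV2 ?posrE ?expR_gt0 ?invr_gt0 ?mulr_gt0 ?invr_gt0//.
    have h := expR_ge1Dx (x ^+ 2 / (4 * u)); apply: le_trans h.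
    rewrite invfM invrK -[leLHS]add0r; apply: lerD => //.
    by rewrite mulrC ler_pM2r ?invr_gt0 ?mulr_gt0// expr2 ler_peMl ?(ltW x0).
  have hs (s : R) : `|s| <= 1 -> `|2 * u * (s * G x)| <= 8 * u ^+ 2 * x^-1.
    move=> s1; rewrite !normrM (ger0_norm (expR_ge0 _)) (gtr0_norm u_gt0) (gtr0_norm (ltr0Sn R 1)).
    have -> : 8 * u ^+ 2 * x^-1 = 2 * u * (1 * (4 * u * x^-1)) by ring.
    by rewrite ler_pM2l ?mulr_gt0//; apply: ler_pM; rewrite ?expR_ge0.
  split; first by apply: hs; rewrite ler_norml sin_geN1 sin_le1.
  rewrite /P sqrrN; apply: hs; rewrite ler_norml sin_geN1 sin_le1//.
have lim2 : (\int[leb]_x ((k \_ (I n)) x)%:E)%E @[n --> \oo] --> (0%E : \bar R).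
  under eq_cvg do rewrite vals.
  apply/fine_cvgP; split; first exact: nearW.
  apply/cvgrPdist_le => e e0; near=> n; rewrite /= sub0r normrN.
  have n1 : 1 <= n.+1%:R :> R by rewrite ler1n.
  have [h1 h2] := P0 _ n1; apply: (le_trans (ler_normB _ _)).
  apply: (@le_trans _ _ (16 * u ^+ 2 * n.+1%:R^-1)).
    by rewrite (_ : 16 * u ^+ 2 / n.+1%:R = 8 * u ^+ 2 / n.+1%:R + 8 * u ^+ 2 / n.+1%:R); [exact: lerD | ring].
  rewrite ler_pdivrMr// (mulrC e) -ler_pdivrMr//; near: n.
  exists (Num.truncn (16 * u ^+ 2 / e)) => // n /= hn.
  by apply: le_trans (ltW (truncnS_gt _)) _; rewrite ler_nat.
have h := cvg_unique _ lim1 lim2.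
by rewrite /Rintegral h.
Unshelve. all: by end_near. Qed.

(** The transform satisfies F' = -2 u xi F, so F(xi) e^(u xi^2) is constant. *)
Lemma gauss_fourier xi : \int[leb]_x (cos (xi * x) * G x) = Num.sqrt (4 * pi * u) * expR (- (u * xi ^+ 2)).
Proof.
have F0 : F 0 = Num.sqrt (4 * pi * u).
  rewrite /F /Rintegral; have -> : (\int[leb]_x (f 0 x)%:E = \int[leb]_x (G x)%:E)%E.
    by apply: eq_integral => x _; rewrite /f mul0r cos0 mul1r.
  by rewrite gauss_integral0.
pose W (z : R) := F z * expR (u * z ^+ 2).
have dW (z : R) : is_derive z 1 W 0.
  have h := dF z; rewrite ibp in h.
  rewrite /W; apply: is_derive_eq.
  by rewrite /GRing.scale /=; ring.
have := is_derive_0_is_cst xi 0 dW.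
rewrite /W expr0n /= mulr0 expR0 mulr1 F0 => h.
by rewrite -h -mulrA -expRD addrN expR0 mulr1.
Qed.

End one_dimension.
End gaussian.

(** * Heat kernel in R^d against waves *)

Section gaussian_rV.
Context (R : realType).
Local Notation leb := (@lebesgue_measure R).
Variable u : R.
Hypothesis u_gt0 : 0 < u.

Definition heat_kernel d (y : 'rV[R]_d) : R :=
  (4 * pi * u) `^ (- (d%:R / 2)) * expR (- (enorm y ^+ 2 / (4 * u))).

Lemma heat_kernel_ge0 d (y : 'rV[R]_d) : 0 <= heat_kernel y.
Proof. by rewrite mulr_ge0 ?powR_ge0 ?expR_ge0. Qed.

Let s := Num.sqrt (4 * pi * u).
Let s_gt0 : 0 < s.
Proof. by rewrite sqrtr_gt0 mulr_gt0// mulr_gt0// pi_gt0. Qed.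

Let g (x : R) := s^-1 * expR (- (x ^+ 2 / (4 * u))).

Let dotp_cons d (xi : 'rV[R]_d.+1) (w : R) (v : 'rV[R]_d) :
  dotp xi (row_mx (w%:M : 'M[R]_1) v) =
  xi ord0 ord0 * w + dotp (\row_i xi ord0 (lift ord0 i)) v.
Proof.
rewrite /dotp big_ord_recl; congr (_ * _ + _).
  exact: (cons_rV0 (w, v : borel_rV R d)).
by apply: eq_bigr => i _; rewrite mxE; congr (_ * _); exact: (cons_rVS (w, v : borel_rV R d)).
Qed.

Let enorm_cons d (w : R) (v : 'rV[R]_d) :
  enorm (row_mx (w%:M : 'M[R]_1) v : 'rV[R]_d.+1) ^+ 2 = w ^+ 2 + enorm v ^+ 2.
Proof.
have sq n (z : 'rV[R]_n) : enorm z ^+ 2 = dotp z z.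
  by rewrite sqr_sqrtr//; apply: sumr_ge0 => i _; rewrite -expr2 sqr_ge0.
rewrite !sq dotp_cons (cons_rV0 (w, v : borel_rV R d)) -expr2; congr (_ + _).
by apply: eq_bigr => i _; rewrite mxE (cons_rVS (w, v : borel_rV R d)).
Qed.

Let heat_kernel_cons d (w : R) (v : 'rV[R]_d) :
  heat_kernel (row_mx (w%:M : 'M[R]_1) v : 'rV[R]_d.+1) = g w * heat_kernel v.
Proof.
have p0 : 0 < 4 * pi * u by rewrite mulr_gt0// mulr_gt0// pi_gt0.
rewrite /heat_kernel /g enorm_cons (mulrDl (w ^+ 2)) opprD expRD.
have -> : (4 * pi * u) `^ (- (d.+1%:R / 2)) = s^-1 * (4 * pi * u) `^ (- (d%:R / 2)).
  rewrite /s -powR12_sqrt ?(ltW p0)// -powRN -powRD; last by rewrite (gt_eqF p0) implybT.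
  by congr (_ `^ _); rewrite -natr1; field.
by ring.
Qed.

Let gauss1 (rho xi c : R) : 0 <= rho <= 1 ->
  (\int[leb]_w (g w * (1 + rho * cos (xi * w + c)))%:E =
   (1 + rho * (expR (- (u * xi ^+ 2)) * cos c))%:E)%E.
Proof.
move=> /andP[r0 r1].
pose G (x : R) := expR (- (x ^+ 2 / (4 * u))).
have intG : leb.-integrable setT (EFin \o G).
  apply/integrableP; split; first by rewrite /comp /G; mfun.
  under eq_integral do rewrite /= ger0_norm ?expR_ge0//.
  by rewrite gauss_integral0// ltry.
have vG : (\int[leb]_w (G w)%:E = s%:E)%E by exact: gauss_integral0.
have ic : leb.-integrable setT (EFin \o (fun w : R => cos (xi * w) * G w)).
  apply: (le_integrable measurableT _ _ intG).
    have h : measurable_fun setT (fun w : R => cos (xi * w)).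
      apply: (measurableT_comp (f := @cos R)); last by mfun.
      by apply: continuous_measurable_fun; exact: continuous_cos.
    by rewrite /comp /G; mfun.
  move=> x _ /=; rewrite lee_fin normrM (ger0_norm (expR_ge0 _)).
  by rewrite ler_piMl ?expR_ge0// ler_norml cos_geN1 cos_le1.
have vc : (\int[leb]_w (cos (xi * w) * G w)%:E = (s * expR (- (u * xi ^+ 2)))%:E)%E.
  by rewrite -(gauss_fourier u_gt0) /Rintegral fineK//; exact: integrable_fin_num ic.
pose f (c' w : R) := g w * (1 + rho * cos (xi * w + c')).
have f0 c' w : 0 <= f c' w.
  rewrite mulr_ge0//; first by rewrite mulr_ge0 ?expR_ge0 ?invr_ge0 ?(ltW s_gt0).
  have h1 := cos_geN1 (xi * w + c').
  have : rho * -1 <= rho * cos (xi * w + c') by apply: ler_wpM2l.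
  by lra.
have mf c' : measurable_fun setT (f c').
  have h : measurable_fun setT (fun w : R => cos (xi * w + c')).
    apply: (measurableT_comp (f := @cos R)); last by mfun.
    by apply: continuous_measurable_fun; exact: continuous_cos.
  by rewrite /f /g; mfun.
(* Reflection exchanges the phases c and -c; adding the two integrals leaves 2 cos(xi w) cos c, so
   the sine transform never appears. *)
have sym : (\int[leb]_w (f c w)%:E = \int[leb]_w (f (- c) w)%:E)%E.
  rewrite (ge0_integral_reflect 0)//; last 2 first.
  - by apply/measurable_EFinP; exact: mf.
  - by move=> w _; rewrite lee_fin.
  rewrite (_ : [set x | setT _] = setT)//; apply: eq_integral => w _.
  rewrite /f /g sub0r sqrrN; congr (_ * (1 + rho * _))%:E.
  by rewrite -cosN; congr cos; ring.
have dbl : (\int[leb]_w (f c w)%:E + \int[leb]_w (f (- c) w)%:E =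
   (2 * (1 + rho * (expR (- (u * xi ^+ 2)) * cos c)))%:E)%E.
  rewrite -ge0_integralD_fun//; last 2 first.
  - exact: mf.
  - exact: mf.
  transitivity (\int[leb]_w ((2 / s)%:E * (G w)%:E + (2 / s * rho * cos c)%:E * (cos (xi * w) * G w)%:E))%E.
    apply: eq_integral => w _; rewrite -!EFinM -EFinD; congr EFin.
    by rewrite /f /g -/(G w) cosD cosB; ring.
  rewrite integralD//=; [|exact: integrableZl|exact: integrableZl].
  rewrite !integralZl//= vG vc -!EFinM; congr EFin.
  by move: s_gt0; move: s => s' s0; field; rewrite gt_eqF.
move: dbl; rewrite -sym.
have fin : (\int[leb]_w (f c w)%:E)%E \is a fin_num -> (\int[leb]_w (f c w)%:E)%E = (1 + rho * (expR (- (u * xi ^+ 2)) * cos c))%:E ->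
  (\int[leb]_w (g w * (1 + rho * cos (xi * w + c)))%:E)%E = (1 + rho * (expR (- (u * xi ^+ 2)) * cos c))%:E by [].
have I0 : (0 <= \int[leb]_w (f c w)%:E)%E by apply: integral_ge0 => w _; rewrite lee_fin.
move: I0; rewrite -/(f c).
case: (\int[leb]_w (f c w)%:E)%E => [I| |] //= _ [] h.
congr EFin; have : 2 * I = 2 * (1 + rho * (expR (- (u * xi ^+ 2)) * cos c)) by rewrite -h; ring.
by apply: mulfI; rewrite gt_eqF.
Qed.

Let shift_cons d (x : 'rV[R]_d.+1) (w : R) (v : 'rV[R]_d) :
  row_mx (w%:M : 'M[R]_1) v - x =
  row_mx ((w - x ord0 ord0)%:M : 'M[R]_1) (v - \row_i x ord0 (lift ord0 i)) :> 'rV[R]_d.+1.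
Proof.
apply/rowP => i; rewrite mxE; case: (unliftP ord0 i) => [j|] ->.
  rewrite (cons_rVS (w, v : borel_rV R d)) mxE.
  by rewrite (cons_rVS (w - x ord0 ord0, v - \row_i x ord0 (lift ord0 i) : borel_rV R d)) /= !mxE.
rewrite (cons_rV0 (w, v : borel_rV R d)) mxE.
by rewrite (cons_rV0 (w - x ord0 ord0, v - \row_i x ord0 (lift ord0 i) : borel_rV R d)).
Qed.

(** Adding 1 to the wave makes the integrand nonnegative, as [integral_rV] demands. The induction on
    [d] needs [k] and [c] general: the first coordinate enters the inner integral as a Gaussian
    factor and as a phase. *)
Lemma heat_kernel_fourier d (xi x : 'rV[R]_d) (k c : R) : 0 <= k ->
  integral_rV (fun y => (k * (heat_kernel (y - x) * (1 + cos (dotp xi y + c))))%:E) =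
  (k * (1 + expR (- (u * enorm xi ^+ 2)) * cos (dotp xi x + c)))%:E.
Proof.
elim: d xi x k c => [|d IH] xi x k c k0.
  have e0 (z : 'rV[R]_0) : enorm z = 0 by rewrite /enorm /dotp big_ord0 sqrtr0.
  rewrite /= /heat_kernel !e0 /dotp !big_ord0 expr0n /= !mul0r !mulr0 oppr0 powRr0 expR0 add0r.
  by rewrite !mul1r.
rewrite /=; pose xi' := \row_i xi ord0 (lift ord0 i) : 'rV[R]_d.
pose x' := \row_i x ord0 (lift ord0 i) : 'rV[R]_d.
have dE : dotp xi x = xi ord0 ord0 * x ord0 ord0 + dotp xi' x'.
  by rewrite /dotp big_ord_recl; congr (_ + _); apply: eq_bigr => i _; rewrite !mxE.
have xiE : enorm xi ^+ 2 = xi ord0 ord0 ^+ 2 + enorm xi' ^+ 2.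
  have sq n (z : 'rV[R]_n) : enorm z ^+ 2 = dotp z z.
    by rewrite sqr_sqrtr//; apply: sumr_ge0 => i _; rewrite -expr2 sqr_ge0.
  rewrite !sq /dotp big_ord_recl -expr2; congr (_ + _).
  by apply: eq_bigr => i _; rewrite !mxE.
have g0 w : 0 <= g w by rewrite mulr_ge0 ?expR_ge0 ?invr_ge0 ?(ltW s_gt0).
pose c' := dotp xi' x' + c.
pose rho := expR (- (u * enorm xi' ^+ 2)).
transitivity (\int[leb]_w (k * (g (w - x ord0 ord0) * (1 + rho * cos (xi ord0 ord0 * w + c'))))%:E)%E.
  apply: eq_integral => w _.
  rewrite [RHS](_ : _ = ((k * g (w - x ord0 ord0)) * (1 + rho * cos (dotp xi' x' + (xi ord0 ord0 * w + c))))%:E); last first.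
    by rewrite mulrA; congr (_ * (1 + _ * cos _))%:E; rewrite /c'; ring.
  rewrite -(IH xi' x' (k * g (w - x ord0 ord0)) (xi ord0 ord0 * w + c) (mulr_ge0 k0 (g0 _))).
  suff -> : (fun v : 'rV[R]_d => (k * (heat_kernel ((row_mx (w%:M : 'M[R]_1) v : 'rV[R]_d.+1) - x) *
      (1 + cos (dotp xi (row_mx (w%:M : 'M[R]_1) v) + c))))%:E) =
      (fun y => (k * g (w - x ord0 ord0) * (heat_kernel (y - x') * (1 + cos (dotp xi' y + (xi ord0 ord0 * w + c)))))%:E) by [].
  apply/funext => v; congr EFin.
  rewrite shift_cons heat_kernel_cons dotp_cons -/xi' -/x'.
  rewrite (_ : xi ord0 ord0 * w + dotp xi' v + c = dotp xi' v + (xi ord0 ord0 * w + c)); last by ring.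
  by ring.
have r01 : 0 <= rho <= 1.
  rewrite expR_ge0 -[leRHS]expR0 ler_expR oppr_le0 mulr_ge0 ?sqr_ge0//; exact: ltW.
have gc0 w : 0 <= 1 + rho * cos (xi ord0 ord0 * w + c').
  have /andP[r0 r1] := r01; have h1 := cos_geN1 (xi ord0 ord0 * w + c').
  have : rho * -1 <= rho * cos (xi ord0 ord0 * w + c') by exact: ler_wpM2l.
  by lra.
have mint (e : R -> R) : measurable_fun setT e -> measurable_fun setT (fun w : R => e w * (1 + rho * cos (xi ord0 ord0 * w + c'))).
  have h : measurable_fun setT (fun w : R => cos (xi ord0 ord0 * w + c')).
    apply: (measurableT_comp (f := @cos R)); last by mfun.
    by apply: continuous_measurable_fun; exact: continuous_cos.
  by move=> me; mfun.
rewrite ge0_integralZl_fun//; last 2 first.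
- by apply: mint; rewrite /g; mfun.
- by move=> w _; rewrite mulr_ge0.
rewrite (ge0_integral_affine (x ord0 ord0) ltr01)//; last 2 first.
- by apply/measurable_EFinP; apply: mint; rewrite /g; mfun.
- by move=> w _; rewrite lee_fin mulr_ge0.
rewrite mul1e (_ : [set w | setT _] = setT)//.
have -> : (\int[leb]_w (g (1 * w + x ord0 ord0 - x ord0 ord0) * (1 + rho * cos (xi ord0 ord0 * (1 * w + x ord0 ord0) + c')))%:E =
   \int[leb]_w (g w * (1 + rho * cos (xi ord0 ord0 * w + (dotp xi x + c))))%:E)%E.
  apply: eq_integral => w _; rewrite mul1r addrK; congr (_ * (1 + _ * cos _))%:E.
  by rewrite dE /c'; ring.
rewrite gauss1// -EFinM; congr (_ * (1 + _))%:E.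
by rewrite mulrA -expRD xiE; congr (expR _ * _); ring.
Qed.

End gaussian_rV.

(** * Last arrival before a given time *)

Section last_arrival.
Context (R : realType) (M : R -> nat) (t : R).
Hypotheses (t_ge0 : 0 <= t).
Hypothesis M_homo : forall s s' : R, 0 <= s -> s <= s' -> (M s <= M s')%N.
Hypothesis M_right_cont : forall s : R, 0 <= s -> \forall s' \near s^'+, M s' = M s.
Local Notation hit n := (ereal_inf [set s%:E | s in [set s : R | 0 <= s /\ (n <= M s)%N]]).

Let right_nbhs (s : R) : 0 <= s -> exists2 dl : R, 0 < dl & forall s', s < s' < s + dl -> M s' = M s.
Proof.
move=> s0; have := M_right_cont s0; rewrite /at_right /within /= => /nbhs_ballP[dl /= dl0 H].
exists dl => // s' /andP[h1 h2]; apply: H => //.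
by rewrite /ball /= ltr_norml; apply/andP; split; lra.
Qed.

Lemma hit_succ_gt : (t%:E < hit (M t).+1)%E.
Proof.
have [dl dl0 Hdl] := right_nbhs t_ge0.
apply: (@lt_le_trans _ _ (t + dl)%:E); first by rewrite lte_fin ltrDl.
apply: le_ereal_inf_tmp => _ [s [s0 Ms] <-]; rewrite lee_fin leNgt; apply/negP => sd.
move: Ms; apply/negP; rewrite -leqNgt; have [st|ts] := leP s t; first exact: M_homo.
by rewrite Hdl// ts.
Qed.

(** Right-continuity makes the infimum attained, so the path has its final value exactly from that
    time on. *)
Lemma hit_last : (0 < M t)%N -> exists S : R, [/\ hit (M t) = S%:E, 0 <= S <= t &
  forall s, 0 <= s <= t -> (M s == M t) = (S <= s)].
Proof.
move=> Mt; pose A := [set s : R | 0 <= s /\ (M t <= M s)%N].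
have At : A t by split.
have Alb : has_lbound A by exists 0 => s [].
have Ainf : has_inf A by split => //; exists t.
have S0 : 0 <= inf A by apply: lb_le_inf; [exists t | move=> s []].
have St : inf A <= t by exact: ge_inf.
exists (inf A); split; first by rewrite ereal_inf_EFin//; exists t.
  by rewrite S0.
have AS : (M t <= M (inf A))%N.
  have [dl dl0 Hdl] := right_nbhs S0.
  have [s As sd] : exists2 s, A s & s < inf A + dl by apply: inf_adherent.
  have Ss : inf A <= s by exact: ge_inf.
  have [<-|neq] := eqVneq s (inf A); first by case: As.
  rewrite -(Hdl s); first by case: As.
  by rewrite sd andbT lt_neqAle eq_sym neq.
move=> s /andP[s0 st]; apply/idP/idP => [/eqP Ms|Ss].
  by apply: ge_inf => //; split => //; rewrite Ms.
by rewrite eqn_leq M_homo//= (leq_trans AS)// M_homo.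
Qed.

End last_arrival.

(** * Discretization of the last arrival *)

Section discretization.
Context (R : realType) (M : R -> nat) (t : R) (f : R -> R) (e0 : R).
Hypothesis t_gt0 : 0 < t.
Hypothesis M_homo : forall s s' : R, 0 <= s -> s <= s' -> (M s <= M s')%N.
Hypothesis M_right_cont : forall s : R, 0 <= s -> \forall s' \near s^'+, M s' = M s.
Hypothesis M0 : M 0 = 0%N.
Hypothesis f_right_cont : forall s : R, 0 <= s -> f s' @[s' --> s^'+] --> f s.

Definition grid (k j : nat) : R := t * (j%:R / k.+1%:R).

(** For 0 <= s <= t, the indicator that no arrival falls in ]s, t]; it jumps from 0 to 1 at the last
    arrival. *)
Definition same (s : R) : R := (M s == M t)%:R.

(* Evaluates [f] at the first grid point after the last jump before [t], and
   is [e0] if there is none. *)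
Definition grid_sum (k : nat) : R :=
  same 0 * e0 + \sum_(j < k.+1) (same (grid k j.+1) - same (grid k j)) * f (grid k j.+1).

Lemma grid_ge0 k j : 0 <= grid k j.
Proof. by rewrite mulr_ge0 ?(ltW t_gt0)// divr_ge0. Qed.

Lemma grid_le k j : (j <= k.+1)%N -> grid k j <= t.
Proof. by move=> jk; rewrite ler_piMr ?(ltW t_gt0)// ler_pdivrMr// mul1r ler_nat. Qed.

Lemma grid_max k : grid k k.+1 = t.
Proof. by rewrite /grid mulfV ?mulr1// pnatr_eq0. Qed.

Lemma gridS k j : grid k j.+1 = grid k j + t / k.+1%:R.
Proof. by rewrite /grid -natr1 mulrDl mulrDr mul1r. Qed.

Lemma grid_sum_no_jump k : M t = 0%N -> grid_sum k = e0.
Proof.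
move=> Mt; have one s : 0 <= s <= t -> same s = 1.
  move=> /andP[s0 st]; rewrite /same Mt eqn_leq leq0n andbT.
  by have := M_homo s0 st; rewrite Mt => ->.
rewrite /grid_sum one ?lexx ?(ltW t_gt0)// mul1r big1 ?addr0// => j _.
by rewrite !one ?subrr ?mul0r// grid_ge0/= grid_le// ltnW.
Qed.

Lemma grid_sum_jump k (S : R) : 0 <= S <= t ->
  (forall s, 0 <= s <= t -> (M s == M t) = (S <= s)) -> (0 < M t)%N ->
  exists2 s : R, S <= s < S + t / k.+1%:R + t / k.+1%:R & grid_sum k = f s.
Proof.
move=> /andP[S0 St] HS Mt.
have ex : exists j, S <= grid k j by exists k.+1; rewrite grid_max.
pose j0 := ex_minn ex; have [j Hj jmin] : exists2 j, S <= grid k j & forall i, S <= grid k i -> (j <= i)%N.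
  by case: (ex_minnP ex) => j h1 h2; exists j.
have jk : (j <= k.+1)%N by apply: jmin; rewrite grid_max.
have sE i : (i <= k.+1)%N -> same (grid k i) = (j <= i)%N%:R.
  move=> ik; rewrite /same HS ?grid_ge0/= ?grid_le//; congr (nat_of_bool _)%:R.
  apply/idP/idP; first exact: jmin.
  move=> ji; apply: (le_trans Hj); rewrite /grid ler_pM2l// ler_pM2r ?invr_gt0//.
  by rewrite ler_nat.
have s0 : same 0 = 0.
  by rewrite /same M0; case: (M t) Mt.
have jpos : (0 < j)%N.
  rewrite lt0n; apply/eqP => j_0; have := sE 0%N isT.
  by rewrite j_0 /grid mul0r mulr0 s0 => /eqP; rewrite eq_sym oner_eq0.
exists (grid k j).
  rewrite Hj /=; case: j Hj jmin jk sE jpos => // i Hi imin ik _ _.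
  rewrite gridS ltrD2r; have : grid k i < S.
    by rewrite ltNge; apply/negP => /imin; rewrite ltnn.
  by move=> h; apply: (lt_le_trans h); rewrite lerDl divr_ge0// ltW.
rewrite /grid_sum s0 mul0r add0r.
have jk' : (j.-1 < k.+1)%N by rewrite prednK.
rewrite (bigD1 (Ordinal jk'))//= big1 => [|i ij].
  rewrite (prednK jpos) (sE _ jk) (sE j.-1 (ltnW jk')) leqnn addr0.
  have -> : (j <= j.-1)%N = false by apply/negbTE; rewrite -ltnNge (prednK jpos).
  by rewrite subr0 mul1r.
rewrite (sE i.+1 (ltn_ord i)) (sE i (ltnW (ltn_ord i))); have [ji|ij'] := leqP j i; first by rewrite leqW// subrr mul0r.
have : (j <= i.+1)%N = false.
  apply/negbTE; rewrite -ltnNge ltn_neqAle ij' andbT; apply/eqP => ji.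
  by move/eqP: ij; apply; apply: val_inj; rewrite /= -ji.
by move=> ->; rewrite subrr mul0r.
Qed.

(** The selected grid point approaches [S] from the right, which is where [f] is continuous. *)
Lemma cvg_grid_sum (S : R) : 0 <= S <= t ->
  (forall s, 0 <= s <= t -> (M s == M t) = (S <= s)) -> (0 < M t)%N ->
  grid_sum k @[k --> \oo] --> f S.
Proof.
move=> Sb HS Mt; have /andP[S0 St] := Sb.
apply/cvgrPdist_le => e e_gt0.
have [dl dl0 Hdl] : exists2 dl : R, 0 < dl & forall s, S <= s < S + dl -> `|f S - f s| <= e.
  have /cvgrPdist_le/(_ e e_gt0) := f_right_cont S0.
  rewrite /at_right near_withinE => /nbhs_ballP[dl /= dl0 H]; exists dl => // s /andP[h1 h2].
  have [->|neq] := eqVneq s S; first by rewrite subrr normr0 ltW.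
  apply: H; last by rewrite lt_neqAle eq_sym neq.
  by rewrite /ball /= ltr_norml; apply/andP; split; lra.
near=> k; have [s /andP[s1 s2] ->] := grid_sum_jump k Sb HS Mt; apply: Hdl; rewrite s1 (lt_le_trans s2)// -addrA lerD2l.
rewrite -mulrDl ler_pdivrMr// mulrC -ler_pdivrMr//.
near: k; exists (Num.truncn ((t + t) / dl)) => // k /= hk.
by apply: le_trans (ltW (truncnS_gt _)) _; rewrite ler_nat.
Unshelve. all: by end_near. Qed.

End discretization.

(** * Limit of the discretized mean *)

Section grid_limit.
Context (R : realType) (lam psi t : R).
Hypotheses (lam_gt0 : 0 < lam) (psi_ge0 : 0 <= psi) (t_gt0 : 0 < t).
Let mu := lam + psi.
Let mu_gt0 : 0 < mu. Proof. by rewrite ltr_wpDr. Qed.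

Let exp_bounds (a : R) : 0 < a -> a / (1 + a) <= 1 - expR (- a) <= a.
Proof.
move=> a0; have h1 := expR_ge1Dx (- a); have h2 := expR_ge1Dx a.
apply/andP; split; last by lra.
have p : 0 < 1 + a by rewrite addr_gt0.
rewrite expRN ler_pdivrMr// mulrBl mul1r.
suff : (expR a)^-1 * (1 + a) <= 1 by lra.
by rewrite mulrC ler_pdivrMr ?expR_gt0// mul1r.
Qed.

Lemma exp_ratio (h : R) : 0 < h ->
  `|(1 - expR (- (lam * h))) / (1 - expR (- (mu * h))) - lam / mu| <= lam * h.
Proof.
move=> h0; have lh : 0 < lam * h by rewrite mulr_gt0.
have mh : 0 < mu * h by rewrite mulr_gt0.
have /andP[a1 a2] := exp_bounds lh; have /andP[b1 b2] := exp_bounds mh.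
move: a1 a2 b1 b2; set A := 1 - _; set B := 1 - _ => a1 a2 b1 b2.
have b0 : 0 < B by apply: lt_le_trans b1; rewrite divr_gt0// addr_gt0.
have lm : lam / mu <= 1 by rewrite ler_pdivrMr// mul1r lerDl.
have lm0 : 0 <= lam / mu by rewrite divr_ge0// ltW.
have up : A / B <= lam / mu + lam * h.
  rewrite ler_pdivrMr//; apply: (le_trans a2).
  apply: (@le_trans _ _ ((lam / mu + lam * h) * (mu * h / (1 + mu * h)))).
    rewrite le_eqVlt; apply/orP; left; apply/eqP; field.
    by rewrite !gt_eqF// addr_gt0.
  by rewrite ler_wpM2l// addr_ge0// ltW.
have lo : lam / mu - lam * h <= A / B.
  apply: (@le_trans _ _ ((lam * h / (1 + lam * h)) / (mu * h))).
    have -> : lam * h / (1 + lam * h) / (mu * h) = lam / mu / (1 + lam * h).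
      by field; rewrite !gt_eqF// addr_gt0.
    rewrite ler_pdivlMr ?addr_gt0// mulrBl mulrDr mulr1.
    have p1 : lam / mu * (lam * h) <= lam * h by rewrite ler_piMl// ltW.
    have p2 : 0 <= lam * h * (1 + lam * h) - lam * h.
      by rewrite mulrDr mulr1 addrC addKr mulr_ge0// ltW.
    by lra.
  have A0 : 0 <= A by apply: le_trans a1; rewrite divr_ge0 ?addr_ge0// ltW.
  apply: ler_pM => //; first by rewrite divr_ge0 ?addr_ge0// ltW.
    by rewrite invr_ge0 ltW.
  by rewrite lef_pV2// posrE.
by rewrite ler_norml; apply/andP; split; lra.
Qed.

Let G p := expR (- (lam * (t - p))).

(** On the uniform grid the constant part telescopes and the rest is a geometric sum of ratio e^(-mu
    h), with h the step; [exp_ratio] then gives the limit lam/mu of the step factor. *)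
Lemma grid_sum_expR k C :
  \sum_(j < k.+1) (G (grid t k j.+1) - G (grid t k j)) * (1 + expR (- ((t - grid t k j.+1) * psi)) * C) =
  1 - expR (- (lam * t)) + C * ((1 - expR (- (lam * (t / k.+1%:R)))) / (1 - expR (- (mu * (t / k.+1%:R))))
     * (1 - expR (- (mu * t)))).
Proof.
have k0 : k.+1%:R != 0 :> R by rewrite pnatr_eq0.
set h := t / k.+1%:R; have h0 : 0 < h by rewrite divr_gt0.
set q := expR (- (mu * h)).
have q1 : 1 - q != 0.
  by rewrite gt_eqF// subr_gt0 -expR0 ltr_expR oppr_lt0 mulr_gt0.
have pw a n : expR (- (a * h)) ^+ n = expR (- (a * (n%:R * h))).
  by rewrite -expRM_natl; congr expR; ring.
have tE j : (j < k.+1)%N -> t - grid t k j.+1 = (k.+1 - j.+1)%N%:R * h.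
  by move=> jk; rewrite natrB// /grid /h; field.
have gE j : grid t k j.+1 = grid t k j + h by exact: gridS.
transitivity (\sum_(j < k.+1) ((G (grid t k j.+1) - G (grid t k j)) +
    C * ((1 - expR (- (lam * h))) * q ^+ (k.+1 - j.+1)))).
  apply: eq_bigr => j _; rewrite mulrDr mulr1; congr (_ + _).
  have -> : G (grid t k j) = expR (- (lam * h)) * G (grid t k j.+1).
    by rewrite /G -expRD gE; congr expR; ring.
  have -> : q ^+ (k.+1 - j.+1) = G (grid t k j.+1) * expR (- ((t - grid t k j.+1) * psi)).
    by rewrite /G pw -expRD tE// /mu; congr expR; ring.
  by ring.
rewrite big_split/= -mulr_sumr -mulr_sumr; congr (_ + _ * _).
  rewrite -(big_mkord xpredT (fun j => G (grid t k j.+1) - G (grid t k j))) telescope_sumr//.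
  have -> : grid t k k.+1 = t by exact: grid_max.
  by rewrite /G subrr mulr0 oppr0 expR0 /grid mul0r mulr0 subr0.
rewrite -mulrA; congr (_ * _).
have -> : \sum_(j < k.+1) q ^+ (k.+1 - j.+1) = \sum_(j < k.+1) q ^+ j.
  by rewrite [RHS](reindex_inj rev_ord_inj).
have := subrX1 q k.+1; rewrite pw.
have -> : k.+1%:R * h = t by rewrite /h; field.
move=> e; apply: (mulfI q1); rewrite mulrA mulfV// mul1r.
by rewrite -opprB mulNr -e opprB.
Qed.

Lemma cvg_grid_sum_expR C :
  (\sum_(j < k.+1) (G (grid t k j.+1) - G (grid t k j)) * (1 + expR (- ((t - grid t k j.+1) * psi)) * C))
  @[k --> \oo] --> 1 - expR (- (lam * t)) + C * (lam / mu * (1 - expR (- (mu * t)))).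
Proof.
under eq_fun do rewrite grid_sum_expR.
apply: cvgD; first exact: cvg_cst.
apply: cvgM; first exact: cvg_cst.
apply: cvgM; last exact: cvg_cst.
apply/cvgrPdist_le => e e0; near=> k.
rewrite distrC; apply: (le_trans (exp_ratio _)); first by rewrite divr_gt0.
rewrite mulrA ler_pdivrMr// -ler_pdivrMl//.
near: k; exists (Num.truncn (e^-1 * (lam * t))) => // k /= hk.
by apply: le_trans (ltW (truncnS_gt _)) _; rewrite ler_nat.
Unshelve. all: by end_near. Qed.

End grid_limit.

(** * Means of bounded functions, and independence *)

Section mean.
Context disp (T : measurableType disp) (R : realType) (P : probability T R).

Definition has_mean (f : T -> R) (v : R) :=
  bounded_measurable f /\ (\int[P]_w (f w)%:E = v%:E)%E.

Let Pfin : (P setT < +oo)%E. Proof. by rewrite probability_setT ltry. Qed.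

Lemma has_meanD f g v u : has_mean f v -> has_mean g u ->
  has_mean (fun w => f w + g w) (v + u).
Proof.
move=> [bf fv] [bg gu]; split; first exact: bounded_measurableD.
have If := bounded_measurable_integrable Pfin bf.
have Ig := bounded_measurable_integrable Pfin bg.
rewrite EFinD -fv -gu; exact: (integralD_EFin measurableT If Ig).
Qed.

Lemma has_meanZ c f v : has_mean f v -> has_mean (fun w => c * f w) (c * v).
Proof.
move=> [bf fv]; split.
  by apply: bounded_measurableM => //; exact: bounded_measurable_cst.
have If := bounded_measurable_integrable Pfin bf.
rewrite EFinM -fv; exact: (integralZl measurableT If).
Qed.

Lemma has_mean_ext f g v u : f =1 g -> v = u -> has_mean f v -> has_mean g u.
Proof. by move=> /funext -> ->. Qed.

Lemma has_mean_cst c : has_mean (fun=> c) c.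
Proof.
split; first exact: bounded_measurable_cst.
by rewrite integral_cst//= probability_setT mule1.
Qed.

Lemma has_mean_sum n (f : nat -> T -> R) (v : nat -> R) :
  (forall i, (i < n)%N -> has_mean (f i) (v i)) ->
  has_mean (fun w => \sum_(i < n) f i w) (\sum_(i < n) v i).
Proof.
elim: n => [|n IH] H.
  by apply: has_mean_ext (has_mean_cst 0) => [w|]; rewrite big_ord0.
apply: has_mean_ext (has_meanD (IH _) (H n (ltnSn n))) => [w||i il].
- by rewrite big_ord_recr.
- by rewrite big_ord_recr.
- by apply: H; rewrite ltnW.
Qed.

Lemma has_mean_fine f v : bounded_measurable f -> fine ('E_P[f]) = v -> has_mean f v.
Proof.
move=> bf; rewrite unlock => <-; split => //.
rewrite fineK//; apply: (integrable_fin_num measurableT).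
exact: bounded_measurable_integrable.
Qed.

(** Independence says that the image under [Z] of [P] restricted to [D] is [p] times the law of [Z];
    integrating [g] against both measures gives the product. *)
Lemma has_mean_indep dV (V : measurableType dV) (D : set T) (Z : T -> V) (g : V -> R) (p v : R) :
  measurable D -> measurable_fun setT Z -> measurable_fun setT g -> (forall y, 0 <= g y <= 2) ->
  (forall A, measurable A -> (P (Z @^-1` A `&` D) = P (Z @^-1` A) * P D)%E) ->
  P D = p%:E -> has_mean (fun w => g (Z w)) v ->
  has_mean (fun w => \1_D w * g (Z w)) (p * v).
Proof.
move=> mD mZ mg gb ind Dp [bgZ gv].
have p0 : 0 <= p by rewrite -lee_fin -Dp.
have mgE : measurable_fun setT (fun y => (g y)%:E) by exact/measurable_EFinP.
have g0 y : (0 <= (g y)%:E)%E by rewrite lee_fin; case/andP: (gb y).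
have m1 : measurable_fun setT (fun w => (\1_D w : R)) by exact: measurable_indic.
split.
  apply: bounded_measurableM => //; split => //; exists 1 => w.
  by rewrite indicE; case: (_ \in _); rewrite ?normr1 ?normr0.
have m1E : measurable_fun setT (fun w => (\1_D w : R)%:E) by exact/measurable_EFinP.
have p1 w : (0 <= (\1_D w : R)%:E)%E by rewrite lee_fin indicE.
transitivity (\int[image_measure (density_measure P m1E p1) mZ]_y (g y)%:E)%E.
  rewrite ge0_integral_image// preimage_setT integral_density_measure//.
  - by apply: eq_integral => w _; rewrite EFinM muleC.
  - exact: (measurableT_comp (f := fun y => (g y)%:E) (g := Z)).
transitivity (\int[mscale (NngNum p0) (image_measure P mZ)]_y (g y)%:E)%E.
  apply: eq_measure_integral => A mA _.
  have mZA : measurable (Z @^-1` A) by rewrite -[X in measurable X]setTI; exact: mZ.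
  transitivity (P (Z @^-1` A `&` D)).
    by rewrite setIC -(integral_indic P mZA mD).
  by rewrite ind// Dp muleC.
rewrite ge0_integral_mscale//= ge0_integral_image// preimage_setT.
by rewrite gv.
Qed.

End mean.

(** * The law of the process with resetting *)

Section resetting_law.
Context (R : realType) (d : nat) disp (Omega : measurableType disp).
Variable P : probability Omega R.
Local Notation V := (borel_rV R d).
Variables (lam t : R) (x : 'rV[R]_d) (psi : 'rV[R]_d -> R).
Variables (Y X : R -> Omega -> V) (N : R -> Omega -> nat).
Hypotheses (lam_gt0 : 0 < lam) (t_gt0 : 0 < t) (psi_ge0 : forall xi, 0 <= psi xi).
Hypotheses (levyY : levy_process P x Y) (psiY : has_char_exponent P x Y psi).
Hypotheses (poissonN : poisson_process P lam N) (indepYN : indep_processes P Y N).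
Hypothesis resetX : resetting_process Y N X.
Let t_ge0 : 0 <= t. Proof. exact: ltW. Qed.

Lemma measurable_fun_subV dT (T : measurableType dT) (f g : T -> V) :
  measurable_fun setT f -> measurable_fun setT g ->
  measurable_fun setT (fun w => (f w : 'rV[R]_d) - g w : V).
Proof.
move=> mf mg; apply: measurable_fun_rV => i.
rewrite [X in measurable_fun _ X](_ : _ = fun w => f w ord0 i - g w ord0 i).
  by apply: measurable_funB;
    [apply: (measurableT_comp (f := fun y : V => y ord0 i) (g := f))
    |apply: (measurableT_comp (f := fun y : V => y ord0 i) (g := g))] => //;
    exact: measurable_coord.
by apply/funext => w; rewrite !mxE.
Qed.

Lemma measurable_eq_nat dT (T : measurableType dT) (f g : T -> nat) :
  measurable_fun setT f -> measurable_fun setT g -> measurable [set w | f w = g w].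
Proof.
move=> mf mg; have := measurable_fun_eqn mf mg; move=> /(_ measurableT [set true] I).
rewrite setTI; congr measurable; apply/seteqP; split => w /=; first by move=> /eqP.
by move=> ->; rewrite eqxx.
Qed.

Definition path_events dV (W : measurableType dV) (Z : R -> Omega -> W) : set (set Omega) :=
  [set B | exists s A, [/\ 0 <= s, measurable A & B = Z s @^-1` A]].

Lemma measurable_path dV (W : measurableType dV) (Z : R -> Omega -> W) s : 0 <= s ->
  measurable_fun [set: g_sigma_algebraType (path_events Z)] (Z s : g_sigma_algebraType (path_events Z) -> W).
Proof.
by move=> s0 _ A mA; rewrite setTI; apply: sub_gen_smallest; exists s, A.
Qed.

(** No arrival in ]p, t]; the event depends on [N] alone and is therefore independent of functionals
    of [Y]. *)
Let D p := [set w | N p w = N t w].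

Let mD p : 0 <= p -> measurable (D p).
Proof. by move=> p0; apply: measurable_eq_nat; exact: (poisson_meas poissonN). Qed.

Let indepD p (Z : Omega -> V) : 0 <= p ->
  measurable_fun [set: g_sigma_algebraType (path_events Y)] (Z : g_sigma_algebraType (path_events Y) -> V) ->
  forall A, measurable A -> (P (Z @^-1` A `&` D p) = P (Z @^-1` A) * P (D p))%E.
Proof.
move=> p0 mZ A mA; apply: indepYN.
  by have := mZ measurableT A mA; rewrite setTI.
have := measurable_eq_nat (measurable_path (Z := N) p0) (measurable_path (Z := N) t_ge0); exact.
Qed.

Let P_D p : 0 <= p <= t -> P (D p) = (expR (- (lam * (t - p))))%:E.
Proof.
move=> /andP[p0 pt]; have [->|neq] := eqVneq p t.
  by rewrite (_ : D t = setT) ?probability_setT ?subrr ?mulr0 ?oppr0 ?expR0//; apply/seteqP.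
have lt : p < t by rewrite lt_neqAle neq.
rewrite (_ : D p = [set w | (N t w - N p w)%N = 0%N]).
  rewrite (poisson_incr poissonN)// /poisson_pmf mulr_gt0 ?subr_gt0//.
  by rewrite expr0 fact0 divr1 mul1r.
apply/seteqP; split => w /=; rewrite /D/=; first by move=> ->; rewrite subnn.
move/eqP; rewrite subn_eq0 => h; apply/eqP.
by rewrite eqn_leq h (poisson_homo poissonN).
Qed.

Let same_indic p w : same (N^~ w) t p = \1_(D p) w.
Proof.
rewrite /same indicE; congr (nat_of_bool _)%:R; apply/idP/idP => [/eqP h|/set_mem h].
  exact: mem_set.
exact/eqP.
Qed.

Section wave.
Variables (xi : 'rV[R]_d) (c : R).
Let W (y : V) : R := 1 + cos_wave xi c y.

Let mW : measurable_fun setT W.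
Proof. by apply: measurable_funD => //; exact: measurable_cos_wave. Qed.

Let W_bound y : 0 <= W y <= 2.
Proof.
rewrite /W /cos_wave; have := cos_geN1 (dotp xi y + c); have := cos_le1 (dotp xi y + c).
by move=> h1 h2; apply/andP; split; lra.
Qed.

Let bW (Z : Omega -> V) : measurable_fun setT Z -> bounded_measurable (fun w => W (Z w)).
Proof.
move=> mZ; split; first exact: (measurableT_comp (f := W) (g := Z)).
by exists 2 => w; rewrite ger0_norm; case/andP: (W_bound (Z w)).
Qed.

Let mY s : 0 <= s -> measurable_fun setT (Y s).
Proof. exact: (levy_meas levyY). Qed.

(** The sine of the increment has mean 0 because the characteristic exponent is real; the addition
    formula brings in the phase. *)
Let mean_shift s c' : 0 <= s ->
  has_mean P (fun w => 1 + cos (dotp xi ((Y s w : 'rV[R]_d) - x) + c')) (1 + expR (- (s * psi xi)) * cos c').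
Proof.
move=> s0; have [h1 h2] : fine ('E_P[fun w => cos (dotp xi ((Y s w : 'rV[R]_d) - x))]) = expR (- (s * psi xi)) /\
    fine ('E_P[fun w => sin (dotp xi ((Y s w : 'rV[R]_d) - x))]) = 0.
  by have := psiY xi s0; rewrite /char_fun => -[-> ->].
have mZ : measurable_fun setT (fun w => dotp xi ((Y s w : 'rV[R]_d) - x)).
  apply: (measurableT_comp (f := fun y : V => dotp xi y) (g := fun w => (Y s w : 'rV[R]_d) - x : V)).
    exact: measurable_dotp.
  by apply: measurable_fun_subV => //; exact: mY.
have mc : has_mean P (fun w => cos (dotp xi ((Y s w : 'rV[R]_d) - x))) (expR (- (s * psi xi))).
  apply: has_mean_fine => //; split; last by exists 1 => w; rewrite ler_norml cos_geN1 cos_le1.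
  by apply: (measurableT_comp (f := @cos R)) => //; apply: continuous_measurable_fun; exact: continuous_cos.
have ms : has_mean P (fun w => sin (dotp xi ((Y s w : 'rV[R]_d) - x))) 0.
  apply: has_mean_fine => //; split; last by exists 1 => w; rewrite ler_norml sin_geN1 sin_le1.
  by apply: (measurableT_comp (f := @sin R)) => //; apply: continuous_measurable_fun; exact: continuous_sin.
apply: has_mean_ext (has_meanD (has_mean_cst P 1) (has_meanD (has_meanZ (cos c') mc) (has_meanZ (- sin c') ms))).
- by move=> w /=; rewrite cosD; ring.
- by ring.
Qed.

Let mean_Yt : has_mean P (fun w => W (Y t w)) (1 + expR (- (t * psi xi)) * cos (dotp xi x + c)).
Proof.
apply: has_mean_ext (mean_shift (dotp xi x + c) t_ge0) => // w.
rewrite /W /cos_wave; congr (1 + cos _).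
by rewrite dotpC dotpDl dotpNl dotpC (dotpC x); ring.
Qed.

Let mean_inc q : 0 <= q <= t ->
  has_mean P (fun w => W ((Y t w : 'rV[R]_d) - Y q w)) (1 + expR (- ((t - q) * psi xi)) * cos c).
Proof.
move=> /andP[q0 qt]; have tq : 0 <= t - q by rewrite subr_ge0.
have mi a b : 0 <= a -> 0 <= b -> measurable_fun setT (fun w => (Y a w : 'rV[R]_d) - Y b w : V).
  by move=> a0 b0; apply: measurable_fun_subV; exact: mY.
have mWE : measurable_fun setT (fun y => (W y)%:E) by exact/measurable_EFinP.
have W0 y : (0 <= (W y)%:E)%E by rewrite lee_fin; case/andP: (W_bound y).
split; first by apply: bW; exact: mi.
have [_ <-] := mean_shift c tq.
transitivity (\int[P]_w (W ((Y (t - q) w : 'rV[R]_d) - Y 0 w))%:E)%E.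
  transitivity (\int[image_measure P (mi _ _ t_ge0 q0)]_y (W y)%:E)%E.
    by rewrite ge0_integral_image// preimage_setT.
  transitivity (\int[image_measure P (mi _ _ tq (lexx 0))]_y (W y)%:E)%E.
    apply: eq_measure_integral => A mA _.
    have := levy_stat levyY q0 tq mA; rewrite (_ : q + (t - q) = t); last by ring.
    exact.
  by rewrite ge0_integral_image// preimage_setT.
apply: ge0_ae_eq_integral => //.
- apply: (measurableT_comp (f := fun y => (W y)%:E) (g := fun w => (Y (t - q) w : 'rV[R]_d) - Y 0 w : V)) => //.
  exact: mi.
- apply: (measurableT_comp (f := fun y => (W y)%:E) (g := fun w => (Y (t - q) w : 'rV[R]_d) - x : V)) => //.
  by apply: measurable_fun_subV => //; exact: mY.
- by apply: filterS (levy_init levyY) => w h _ /=; rewrite h.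
Qed.

Let approx k w := grid_sum (N^~ w) t (fun s => W ((Y t w : 'rV[R]_d) - Y s w)) (W (Y t w)) k.

Let grid01 k j : (j <= k.+1)%N -> 0 <= grid t k j <= t.
Proof. by move=> jk; rewrite grid_ge0//= grid_le. Qed.

(** At a deterministic grid point each summand is a factor in [N] times a factor in an increment of
    [Y], so independence and stationarity give its mean. *)
Lemma mean_grid_sum k : has_mean P (approx k)
  (expR (- (lam * t)) * (1 + expR (- (t * psi xi)) * cos (dotp xi x + c)) +
   \sum_(j < k.+1) (expR (- (lam * (t - grid t k j.+1))) - expR (- (lam * (t - grid t k j)))) *
     (1 + expR (- ((t - grid t k j.+1) * psi xi)) * cos c)).
Proof.
have mYp s : 0 <= s -> measurable_fun [set: g_sigma_algebraType (path_events Y)] (Y s : g_sigma_algebraType (path_events Y) -> V).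
  exact: measurable_path.
have inc p q : 0 <= p <= t -> 0 <= q <= t ->
    has_mean P (fun w => same (N^~ w) t p * W ((Y t w : 'rV[R]_d) - Y q w))
      (expR (- (lam * (t - p))) * (1 + expR (- ((t - q) * psi xi)) * cos c)).
  move=> pt qt; have /andP[p0 _] := pt; have /andP[q0 _] := qt.
  apply: has_mean_ext (has_mean_indep (Z := fun w => (Y t w : 'rV[R]_d) - Y q w : V) (mD p0) _ mW W_bound _ (P_D pt) (mean_inc qt)).
  - by move=> w; rewrite same_indic.
  - by [].
  - by apply: measurable_fun_subV; exact: mY.
  - by apply: indepD => //; apply: measurable_fun_subV; exact: mYp.
apply: has_meanD.
  have p00 : 0 <= (0 : R) <= t by rewrite lexx.
  apply: has_mean_ext (has_mean_indep (mD (lexx 0)) (mY t_ge0) mW W_bound _ (P_D p00) mean_Yt).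
  - by move=> w; rewrite same_indic.
  - by rewrite subr0.
  - by apply: indepD => //; exact: mYp.
apply: (has_mean_sum (f := fun j w => (same (N^~ w) t (grid t k j.+1) - same (N^~ w) t (grid t k j)) * W ((Y t w : 'rV[R]_d) - Y (grid t k j.+1) w))
   (v := fun j => (expR (- (lam * (t - grid t k j.+1))) - expR (- (lam * (t - grid t k j)))) *
     (1 + expR (- ((t - grid t k j.+1) * psi xi)) * cos c))) => j jk.
have g1 := grid01 jk; have g0 := grid01 (ltnW jk).
apply: has_mean_ext (has_meanD (inc _ _ g1 g1) (has_meanZ (-1) (inc _ _ g0 g1))).
- by move=> w; ring.
- by ring.
Qed.

End wave.

Let N_homo w (s s' : R) : 0 <= s -> s <= s' -> (N s w <= N s' w)%N.
Proof. exact: (poisson_homo poissonN). Qed.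

Let N_right w (s : R) : 0 <= s -> \forall s' \near s^'+, N s' w = N s w.
Proof. exact: (poisson_right_cont poissonN). Qed.

Let approx_cvg (phi : 'rV[R]_d -> R) w : continuous phi ->
  grid_sum (N^~ w) t (fun s => phi ((Y t w : 'rV[R]_d) - Y s w)) (phi (Y t w)) k
    @[k --> \oo] --> phi (X t w).
Proof.
move=> cphi; have [H1 H2] := resetX w t_ge0.
have hs := hit_succ_gt t_ge0 (@N_homo w) (@N_right w).
have [Nt|Nt] := posnP (N t w).
  rewrite H1; last by move: hs; rewrite Nt.
  have E k : grid_sum (N^~ w) t (fun s => phi ((Y t w : 'rV[R]_d) - Y s w)) (phi (Y t w)) k = phi (Y t w).
    exact: (grid_sum_no_jump _ _ t_gt0 (@N_homo w) k Nt).
  by under eq_fun do rewrite E; exact: cvg_cst.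
have [S [SE St HS]] := hit_last t_ge0 (@N_homo w) (@N_right w) Nt.
rewrite (H2 (N t w) Nt); last 2 first.
- by rewrite /arrival SE lee_fin; case/andP: St.
- exact: hs.
rewrite /arrival SE /=.
apply: (cvg_grid_sum (M := N^~ w) (f := fun s => phi ((Y t w : 'rV[R]_d) - Y s w))) => //.
- exact: (poisson_init poissonN).
- move=> s s0.
  have h : (fun s' => (Y t w : 'rV[R]_d) - Y s' w) @ s^'+ --> (Y t w : 'rV[R]_d) - Y s w.
    by apply: cvgB; [exact: cvg_cst | exact: (levy_right_cont levyY)].
  exact: (cvg_comp _ _ h (cphi _)).
Qed.

(** Coordinates of X_t are pointwise limits of grid sums, each measurable since it involves [Y] and
    [N] at finitely many fixed times. *)
Lemma measurable_resetting : measurable_fun setT (X t).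
Proof.
apply: measurable_fun_rV => i.
have mY s : 0 <= s -> measurable_fun setT (Y s) by exact: (levy_meas levyY).
have mYi s : 0 <= s -> measurable_fun setT (fun w => Y s w ord0 i).
  by move=> s0; apply: (measurableT_comp (f := fun y : V => y ord0 i) (g := Y s)) => //;
    [exact: measurable_coord | exact: mY].
have msame p : 0 <= p -> measurable_fun setT (fun w => same (N^~ w) t p).
  move=> p0; rewrite (_ : (fun w => _) = \1_(D p)); last by apply/funext => w; rewrite same_indic.
  exact/measurable_indic/mD.
apply: (measurable_fun_cvg (h := fun k w => grid_sum (N^~ w) t
    (fun s => (fun z : 'rV[R]_d => z ord0 i) ((Y t w : 'rV[R]_d) - Y s w)) ((fun z : 'rV[R]_d => z ord0 i) (Y t w)) k)).
  move=> k; apply: measurable_funD.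
    by apply: measurable_funM; [exact: msame | exact: mYi].
  apply: measurable_sum => j; apply: measurable_funM.
    by apply: measurable_funB; apply: msame; exact: grid_ge0.
  under eq_fun do rewrite !mxE.
  by apply: measurable_funB; apply: mYi => //; exact: grid_ge0.
by move=> w _; apply: (approx_cvg (phi := fun z : 'rV[R]_d => z ord0 i)); exact: coord_continuous.
Qed.

(** The grid sums are bounded by 2 and converge pointwise to the wave at X_t, so the explicit means
    converge to its mean. *)
Lemma resetting_mean (xi : 'rV[R]_d) (c : R) :
  (\int[P]_w (1 + cos_wave xi c (X t w))%:E =
   (expR (- (lam * t)) * (1 + expR (- (t * psi xi)) * cos (dotp xi x + c))
    + ((1 - expR (- (lam * t))) + lam / (lam + psi xi) * (1 - expR (- ((lam + psi xi) * t))) * cos c))%:E)%E.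
Proof.
pose W (y : V) : R := 1 + cos_wave xi c y.
have W_bound y : `|W y| <= 2.
  rewrite /W /cos_wave; have h1 := cos_geN1 (dotp xi y + c); have h2 := cos_le1 (dotp xi y + c).
  by rewrite ler_norml; apply/andP; split; lra.
pose phi k w := grid_sum (N^~ w) t (fun s => W ((Y t w : 'rV[R]_d) - Y s w)) (W (Y t w)) k.
have Hphi := mean_grid_sum xi c.
have cW : continuous (fun z : 'rV[R]_d => 1 + cos (dotp xi z + c)).
  have gc : continuous (fun r : R => 1 + cos (r + c)).
    move=> r; apply: cvgD; first exact: cvg_cst.
    have ac : (fun r' : R => r' + c) @ r --> r + c.
      by apply: cvgD; [exact: cvg_id | exact: cvg_cst].
    exact: (cvg_comp _ _ ac (@continuous_cos R _)).
  have h0 : continuous (fun z : 'rV[R]_d => dotp xi z).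
    have ca : continuous (fun z : R * R => z.1 + z.2) by move=> z; exact: add_continuous.
    apply: (continuous_big ca (F := fun i (z : 'rV[R]_d) => xi ord0 i * z ord0 i)).
    move=> i _ z.
    have h : (fun z' : 'rV[R]_d => z' ord0 i) @ z --> z ord0 i by exact: coord_continuous.
    have g : (fun r : R => xi ord0 i * r) @ z ord0 i --> xi ord0 i * z ord0 i.
      by apply: cvgM; [exact: cvg_cst | exact: cvg_id].
    exact: (cvg_comp _ _ h g).
  by move=> y; exact: (cvg_comp _ _ (h0 y) (gc _)).
have lim1 : (\int[P]_w (phi k w)%:E @[k --> \oo] --> \int[P]_w (W (X t w))%:E)%E.
  apply: (integral_bounded_lim (K := 2)).
  - by apply: (@le_lt_trans _ _ 1%E); [exact: probability_le1 | exact: ltry].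
  - by move=> k; case: (Hphi k) => -[].
  - apply: (measurableT_comp (f := W) (g := X t)); last exact: measurable_resetting.
    by apply: measurable_funD => //; exact: measurable_cos_wave.
  - move=> k w; have [Nt|Nt] := posnP (N t w).
      by rewrite /phi (grid_sum_no_jump _ _ t_gt0 (@N_homo w) k Nt).
    have [S [_ St HS]] := hit_last t_ge0 (@N_homo w) (@N_right w) Nt.
    by have [s _] := grid_sum_jump (M := N^~ w) (fun s => W ((Y t w : 'rV[R]_d) - Y s w)) (W (Y t w)) t_gt0 (poisson_init poissonN w) k St HS Nt; rewrite /phi => ->.
  - by move=> w; move: (@approx_cvg (fun z : 'rV[R]_d => 1 + cos (dotp xi z + c)) w cW).
apply: (cvg_unique _ lim1); first exact: ereal_hausdorff.
have -> : (fun k => \int[P]_w (phi k w)%:E)%E = (fun k =>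
  (expR (- (lam * t)) * (1 + expR (- (t * psi xi)) * cos (dotp xi x + c)) +
   \sum_(j < k.+1) (expR (- (lam * (t - grid t k j.+1))) - expR (- (lam * (t - grid t k j)))) *
     (1 + expR (- ((t - grid t k j.+1) * psi xi)) * cos c))%:E).
  by apply/funext => k; exact: (Hphi k).2.
apply: cvg_EFin; first exact: nearW.
apply: cvgD; first exact: cvg_cst.
have h := @cvg_grid_sum_expR R lam (psi xi) t lam_gt0 (psi_ge0 xi) t_gt0 (cos c).
by rewrite [cos c * _]mulrC in h; exact: h.
Qed.

End resetting_law.

(** * Fourier transform of the proposed density *)

Section dominated_combination.
Context d (T : measurableType d) (R : realType).
Variables (mu : {measure set T -> \bar R}) (D : set T).
Hypothesis mD : measurable D.

(* Both [f - g] and [(1 + c) * g] are nonnegative. *)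
Lemma integral_dominated_combination (f g : T -> R) (a b c : R) :
  measurable_fun D f -> measurable_fun D g ->
  (forall x, D x -> 0 <= g x <= f x) ->
  (\int[mu]_(x in D) (f x)%:E = a%:E)%E -> (\int[mu]_(x in D) (g x)%:E = b%:E)%E ->
  -1 <= c -> (\int[mu]_(x in D) (f x + c * g x)%:E = (a + c * b)%:E)%E.
Proof.
move=> mf mg gf fa gb c1.
have mfg : measurable_fun D (fun x => f x - g x) by exact: measurable_funB.
have g0 x : D x -> 0 <= g x by move=> /gf/andP[].
have fg0 x : D x -> 0 <= f x - g x by move=> /gf/andP[_]; rewrite subr_ge0.
have c10 : 0 <= 1 + c by lra.
have : (\int[mu]_(x in D) (f x - g x)%:E + b%:E = a%:E)%E.
  rewrite -gb -fa -ge0_integralD_fun//.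
  by apply: eq_integral => x _; rewrite subrK.
case fgE : (\int[mu]_(x in D) (f x - g x)%:E)%E => [r| |] // -[rb].
rewrite (eq_integral (fun x => (f x - g x + (1 + c) * g x)%:E)); last first.
  by move=> x _; congr EFin; ring.
rewrite ge0_integralD_fun//.
- rewrite fgE ge0_integralZl_fun// gb -EFinM -EFinD -rb; congr EFin; ring.
- exact: measurable_funM.
- by move=> x Dx; rewrite mulr_ge0// g0.
Qed.

End dominated_combination.

Section density_fourier.
Context (R : realType) (d : nat) (alpha m : R) (eta : R -> R -> R).
Local Notation leb := (@lebesgue_measure R).
Local Notation V := (borel_rV R d).
Hypotheses (alpha_gt0 : 0 < alpha).
Hypotheses (m_gt0 : 0 < m) (etaP : stable_subordinator_density alpha eta).
Local Notation beta := (alpha / 2).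
Local Notation rel := (rel_density alpha m eta).
Local Notation psi := (rel_exponent alpha m).
Let K := m `^ (2 / alpha).
Let K_gt0 : 0 < K. Proof. exact: powR_gt0. Qed.
Let Kbeta : K `^ beta = m.
Proof.
rewrite /K -powRrM (_ : 2 / alpha * (alpha / 2) = 1) ?powRr1 ?(ltW m_gt0)//.
by field; rewrite gt_eqF.
Qed.

Lemma rel_exponent_ge0 (xi : 'rV[R]_d) : 0 <= psi xi.
Proof.
rewrite /rel_exponent subr_ge0 -[leLHS]Kbeta ge0_ler_powR ?nnegrE ?addr_ge0 ?sqr_ge0 ?(ltW K_gt0)//.
  by rewrite divr_ge0 ?(ltW alpha_gt0).
by rewrite lerDl sqr_ge0.
Qed.

(** Density at time [s] of the tempered stable subordinator, a probability density because K^beta =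
    m. The density of the relativistic process is the mixture of heat kernels at times [u] with
    these weights. *)
Let ker (s u : R) : R := expR (m * s) * (expR (- (K * u)) * eta s u).

Let ker_ge0 s u : 0 < s -> 0 < u -> 0 <= ker s u.
Proof. by move=> s0 u0; rewrite !mulr_ge0 ?expR_ge0 ?(eta_ge0 etaP). Qed.

Let mker s : 0 < s -> measurable_fun (posR : set R) (ker s).
Proof.
move=> s0; have := measurable_eta etaP s0 => h; rewrite /ker.
by apply: measurable_funM => //; apply: measurable_funM => //; mfun.
Qed.

Let ker_laplace s b : 0 < s -> 0 <= b ->
  (\int[leb]_(u in posR) (ker s u * expR (- (u * b)))%:E =
   (expR (- (s * ((K + b) `^ beta - m))))%:E)%E.
Proof.
move=> s0 b0; have Kb : 0 < K + b by rewrite ltr_wpDr.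
have h := eta_laplace etaP s0 Kb.
transitivity (\int[leb]_(u in posR) (expR (m * s) * (expR (- ((K + b) * u)) * eta s u))%:E)%E.
  apply: eq_integral => u _; congr EFin; rewrite /ker (_ : - ((K + b) * u) = - (K * u) + - (u * b)); last by ring.
  by rewrite expRD; ring.
rewrite ge0_integralZl_fun ?expR_ge0//.
- under eq_integral do rewrite EFinM.
  by rewrite h -EFinM -expRD; congr (expR _)%:E; ring.
- by apply: measurable_funM; [mfun | exact: (measurable_eta etaP s0)].
- by move=> u; rewrite /= in_itv/= andbT => u0; rewrite mulr_ge0 ?expR_ge0 ?(eta_ge0 etaP).
Qed.

Let ker_fourier s b c : 0 < s -> 0 <= b -> -1 <= c ->
  (\int[leb]_(u in posR) (ker s u * (1 + expR (- (u * b)) * c))%:E =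
   (1 + expR (- (s * ((K + b) `^ beta - m))) * c)%:E)%E.
Proof.
move=> s0 b0 c1; have h0 := ker_laplace s0 (lexx 0); have hb := ker_laplace s0 b0.
have mexp : measurable_fun (posR : set R) (fun u => expR (- (u * b))) by mfun.
have mk := mker s0.
transitivity (\int[leb]_(u in posR) (ker s u + c * (ker s u * expR (- (u * b))))%:E)%E.
  by apply: eq_integral => u _; congr EFin; ring.
rewrite (@integral_dominated_combination _ _ _ leb _ _ _ _ 1 _ _ _ _ _ _ hb c1).
- by congr EFin; ring.
- exact: measurable_itv.
- exact: mk.
- exact: measurable_funM.
- move=> u; rewrite /= in_itv/= andbT => u0; have k0 := ker_ge0 s0 u0.
  rewrite mulr_ge0 ?expR_ge0//= ler_piMr// -expR0 ler_expR oppr_le0.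
  by rewrite mulr_ge0// ltW.
- move: h0; rewrite addr0 Kbeta subrr mulr0 oppr0 expR0 => <-.
  by apply: eq_integral => u _; rewrite mulr0 oppr0 expR0 mulr1.
Qed.

Let F (ysu : (V * R) * R) : R := ker ysu.1.2 ysu.2 * heat_kernel ysu.2 (ysu.1.1 : 'rV[R]_d).

Let mDR : measurable (([set: V] `*` (posR : set R)) `*` (posR : set R)).
Proof. by repeat apply: measurableX => //. Qed.

Let mF : measurable_fun (([set: V] `*` (posR : set R)) `*` (posR : set R)) F.
Proof.
rewrite /F /ker /heat_kernel; apply: measurable_funM.
  apply: measurable_funM; first by apply: measurable_funTS; mfun.
  apply: measurable_funM; first by apply: measurable_funTS; mfun.
  apply: (measurable_comp (F := (posR : set R) `*` (posR : set R)) (f := fun tu : R * R => eta tu.1 tu.2)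
    (g := fun ysu : (V * R) * R => (ysu.1.2, ysu.2))).
  - exact: measurableX.
  - by move=> _ [[[y s] u] [[_ s0] u0] <-].
  - exact: measurable_eta2 alpha_gt0 etaP.
  - by apply: measurable_funTS; apply: measurable_fun_pair; mfun.
apply: measurable_funTS; apply: measurable_funM; first by mfun.
have me : measurable_fun setT (fun ysu : (V * R) * R => enorm (ysu.1.1 : 'rV[R]_d)).
  apply: (measurableT_comp (f := fun y : V => enorm (y : 'rV[R]_d)) (g := fun ysu : (V * R) * R => ysu.1.1)).
    exact: measurable_enorm.
  by mfun.
by mfun.
Qed.

Let F_ge0 ys u : ([set: V] `*` (posR : set R)) ys -> (posR : set R) u -> 0 <= F (ys, u).
Proof.
move=> [_]; rewrite /= !in_itv/= !andbT => s0 u0.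
by rewrite mulr_ge0 ?heat_kernel_ge0// ker_ge0.
Qed.

Lemma rel_density_kernel s (y : V) : 0 < s ->
  rel s y = (\int[leb]_(u in posR) (ker s u * heat_kernel u (y : 'rV[R]_d))%:E)%E.
Proof.
move=> s0; transitivity (\int[leb]_(u in posR) (expR (m * s) * (heat_kernel u (y : 'rV[R]_d) * expR (- (K * u)) * eta s u))%:E)%E.
  rewrite ge0_integralZl_fun ?expR_ge0//.
  - apply: measurable_funM; last exact: (measurable_eta etaP s0).
    by apply: measurable_funM; [rewrite /heat_kernel|]; mfun.
  - move=> u; rewrite /= in_itv/= andbT => u0.
    apply: mulr_ge0; last exact: (eta_ge0 etaP).
    by apply: mulr_ge0; [exact: heat_kernel_ge0 | exact: expR_ge0].
by apply: eq_integral => u _; rewrite /ker; congr EFin; ring.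
Qed.

Lemma rel_density_ge0 s (y : V) : 0 < s -> (0 <= rel s y)%E.
Proof.
move=> s0; rewrite rel_density_kernel//; apply: integral_ge0 => u.
rewrite /= in_itv/= andbT => u0.
by rewrite lee_fin mulr_ge0 ?heat_kernel_ge0// ker_ge0.
Qed.

Lemma measurable_rel_density2 :
  measurable_fun ([set: V] `*` (posR : set R)) (fun ys => rel ys.2 ys.1).
Proof.
apply: (eq_measurable_fun (fun ys : V * R => (\int[leb]_(u in posR) (F (ys, u))%:E)%E)).
  move=> [y s]; rewrite inE => -[_]; rewrite /= in_itv/= andbT => s0.
  by rewrite rel_density_kernel.
apply: (measurable_tonelli_on leb (f := fun z => (F z)%:E)).
- exact: measurableX.
- exact: measurable_itv.
- exact/measurable_EFinP.
- by move=> ys u h1 h2; rewrite lee_fin F_ge0.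
Qed.

Lemma measurable_rel_density s (z : 'rV[R]_d) : 0 < s ->
  measurable_fun [set: V] (fun y : V => rel s ((y : 'rV[R]_d) - z)).
Proof.
move=> s0.
apply: (measurable_comp (F := [set: V] `*` (posR : set R)) (f := fun ys : V * R => rel ys.2 ys.1)
    (g := fun y : V => (((y : 'rV[R]_d) - z : V), s))).
- exact: measurableX.
- by move=> _ [y _ <-]; split => //=; rewrite in_itv/= andbT.
- exact: measurable_rel_density2.
apply: measurable_fun_pair => //; apply: measurable_fun_rV => i.
rewrite [X in measurable_fun _ X](_ : _ = fun y : V => y ord0 i - z ord0 i).
  by apply: measurable_funB => //; exact: measurable_coord.
by apply/funext => y; rewrite !mxE.
Qed.

Variables (lam t : R) (x : 'rV[R]_d).
Hypotheses (lam_gt0 : 0 < lam) (t_gt0 : 0 < t).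
Local Notation f := (reset_density alpha m eta lam t x).

Let sub_pos s : `]0%R, t[%classic s -> 0 < s.
Proof. by rewrite /= in_itv/= => /andP[]. Qed.

Let G (ys : V * R) : \bar R := ((lam * expR (- (lam * ys.2)))%:E * rel ys.2 ys.1)%E.

Let mG : measurable_fun ([set: V] `*` `]0%R, t[%classic) G.
Proof.
apply: emeasurable_funM; first by apply: measurable_funTS; mfun.
apply: (measurable_funS _ _ measurable_rel_density2); first exact: measurableX.
by move=> ys [_ /sub_pos s0]; split => //=; rewrite in_itv/= andbT.
Qed.

Let G_ge0 y s : [set: V] y -> `]0%R, t[%classic s -> (0 <= G (y, s))%E.
Proof.
move=> _ /sub_pos s0; rewrite mule_ge0 ?rel_density_ge0// lee_fin.
by rewrite mulr_ge0 ?expR_ge0 ?(ltW lam_gt0).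
Qed.

Lemma measurable_reset_density : measurable_fun [set: V] (f : V -> \bar R).
Proof.
apply: emeasurable_funD.
  by apply: emeasurable_funM => //; exact: measurable_rel_density.
exact: (measurable_tonelli_on leb _ _ mG G_ge0).
Qed.

Lemma reset_density_ge0 y : (0 <= f y)%E.
Proof.
apply: adde_ge0; first by rewrite mule_ge0 ?rel_density_ge0 ?lee_fin ?expR_ge0.
by apply: integral_ge0 => s Ds; exact: G_ge0.
Qed.

Variable L : {sigma_finite_measure set V -> \bar R}.
Hypothesis LE : forall h : V -> \bar R, measurable_fun setT h ->
  (forall y, 0 <= h y)%E -> (integral_rV h = \int[L]_y h y)%E.

Variables (xi : 'rV[R]_d) (c : R).
Let W (y : V) : R := 1 + cos_wave xi c y.

Let W_ge0 y : 0 <= W y.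
Proof. by rewrite /W /cos_wave -lerBlDl sub0r cos_geN1. Qed.

Let mW : measurable_fun setT W.
Proof. by apply: measurable_funD => //; exact: measurable_cos_wave. Qed.

(** Tonelli brings the heat kernel integral inside, where it yields e^(-u |xi|^2); the Laplace
    transform of [ker] then gives e^(-s psi). *)
Lemma rel_density_fourier s (z : 'rV[R]_d) : 0 < s ->
  (\int[L]_y (rel s ((y : 'rV[R]_d) - z) * (W y)%:E) =
   (1 + expR (- (s * psi xi)) * cos (dotp xi z + c))%:E)%E.
Proof.
move=> s0.
pose H (yu : V * R) := ker s yu.2 * (heat_kernel yu.2 ((yu.1 : 'rV[R]_d) - z) * W yu.1).
have mwy : measurable_fun setT (fun y : V => (y : 'rV[R]_d) - z : V).
  apply: measurable_fun_rV => i.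
  rewrite [X in measurable_fun _ X](_ : _ = fun y : V => y ord0 i - z ord0 i).
    by apply: measurable_funB => //; exact: measurable_coord.
  by apply/funext => y; rewrite !mxE.
have mH : measurable_fun ([set: V] `*` (posR : set R)) (fun yu => (H yu)%:E).
  apply/measurable_EFinP; apply: measurable_funM.
    apply: (measurable_comp (F := (posR : set R)) (f := ker s) (g := snd)).
    - exact: measurable_itv.
    - by move=> _ [[y u] [_ u0] <-].
    - exact: mker.
    - by apply: measurable_funTS; exact: measurable_snd.
  apply: measurable_funTS; apply: measurable_funM; last first.
    by apply: (measurableT_comp (f := W) (g := fst)) => //; exact: measurable_fst.
  rewrite /heat_kernel; apply: measurable_funM; first by mfun.
  have me : measurable_fun setT (fun yu : V * R => enorm ((yu.1 : 'rV[R]_d) - z)).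
    apply: (measurableT_comp (f := fun y : V => enorm (y : 'rV[R]_d)) (g := fun yu : V * R => (yu.1 : 'rV[R]_d) - z : V)).
      exact: measurable_enorm.
    apply: (measurableT_comp (f := fun y : V => (y : 'rV[R]_d) - z : V) (g := fst)) => //.
  by mfun.
have H_ge0 y u : [set: V] y -> (posR : set R) u -> (0 <= (H (y, u))%:E)%E.
  move=> _; rewrite /= in_itv/= andbT => u0.
  rewrite lee_fin; apply: mulr_ge0; first exact: ker_ge0.
  by apply: mulr_ge0; [exact: heat_kernel_ge0 | exact: W_ge0].
transitivity (\int[L]_y \int[leb]_(u in posR) (H (y, u))%:E)%E.
  apply: eq_integral => y _; rewrite rel_density_kernel// -ge0_integralZr ?lee_fin//.
  - by apply: eq_integral => u _; rewrite -EFinM /H mulrA.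
  - apply/measurable_EFinP; apply: measurable_funM; first exact: mker.
    by rewrite /heat_kernel; mfun.
  - move=> u; rewrite /= in_itv/= andbT => u0.
    by rewrite lee_fin mulr_ge0 ?heat_kernel_ge0// ker_ge0.
have mpos : measurable (posR : set R) by exact: measurable_itv.
rewrite (tonelli_on L leb measurableT mpos mH H_ge0).
rewrite -(ker_fourier (c := cos (dotp xi z + c)) s0 (sqr_ge0 (enorm xi)) (cos_geN1 _)).
apply: eq_integral => u; rewrite inE /= in_itv/= andbT => u0.
rewrite -(heat_kernel_fourier u0 xi z c (ker_ge0 s0 u0)) LE.
- by [].
- have := mH; rewrite -/H => mH'.
  apply/measurable_EFinP; apply: measurable_funM => //; apply: measurable_funM => //.
  rewrite /heat_kernel; apply: measurable_funM => //.
  have me : measurable_fun setT (fun y : V => enorm ((y : 'rV[R]_d) - z)).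
    apply: (measurableT_comp (f := fun y : V => enorm (y : 'rV[R]_d)) (g := fun y : V => (y : 'rV[R]_d) - z : V)) => //.
    exact: measurable_enorm.
  by mfun.
- by move=> y; rewrite lee_fin mulr_ge0 ?ker_ge0// mulr_ge0 ?heat_kernel_ge0// W_ge0.
Qed.

Lemma integral_expRN_itv (b : R) : 0 < b ->
  (\int[leb]_(s in `]0%R, t[) (expR (- (b * s)))%:E = ((1 - expR (- (b * t))) / b)%:E)%E.
Proof.
move=> b0; rewrite (ge0_integral_reflect t).
- rewrite (_ : [set s | _] = `]0%R, t[%classic); last first.
    by apply/seteqP; split => s; rewrite /= !in_itv/= => /andP[h1 h2]; apply/andP; split; lra.
  transitivity (\int[leb]_(s in `]0%R, t[) (expR (- (b * t)) * expR (b * s))%:E)%E.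
    by apply: eq_integral => s _; rewrite -expRD; congr (expR _)%:E; ring.
  rewrite ge0_integralZl_fun ?expR_ge0//; last by mfun.
  rewrite integral_expR_itv// -EFinM; congr EFin.
  rewrite mulrA mulrBr mulr1 -expRD addrC.
  by rewrite addNr expR0 addrC.
- exact: measurable_itv.
- by mfun.
- by move=> s _; rewrite lee_fin expR_ge0.
Qed.

(** The right-hand side is literally that of [resetting_mean]. *)
Lemma reset_density_fourier :
  (\int[L]_y (f y * (W y)%:E) =
   (expR (- (lam * t)) * (1 + expR (- (t * psi xi)) * cos (dotp xi x + c))
    + ((1 - expR (- (lam * t))) + lam / (lam + psi xi) * (1 - expR (- ((lam + psi xi) * t))) * cos c))%:E)%E.
Proof.
have psi0 := rel_exponent_ge0 xi.
have mI : measurable `]0%R, t[%classic by exact: measurable_itv.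
have mrelx := measurable_rel_density x t_gt0.
have mWE : measurable_fun setT (fun y => (W y)%:E) by exact/measurable_EFinP.
have m1 : measurable_fun setT (fun y : V => (expR (- (lam * t)))%:E * rel t ((y : 'rV[R]_d) - x))%E.
  exact: emeasurable_funM.
have m2 : measurable_fun setT (fun y : V => \int[leb]_(s in `]0%R, t[) G (y, s))%E.
  exact: (measurable_tonelli_on leb _ _ mG G_ge0).
have i0 y : (0 <= \int[leb]_(s in `]0%R, t[) G (y, s))%E.
  by apply: integral_ge0 => s Ds; exact: G_ge0.
have r0 y : (0 <= rel t ((y : 'rV[R]_d) - x))%E by exact: rel_density_ge0.
have e0 : (0 <= (expR (- (lam * t)))%:E :> \bar R)%E by rewrite lee_fin expR_ge0.
have W0 y : (0 <= (W y)%:E)%E by rewrite lee_fin W_ge0.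
transitivity (\int[L]_y ((expR (- (lam * t)))%:E * (rel t ((y : 'rV[R]_d) - x) * (W y)%:E)
  + (\int[leb]_(s in `]0%R, t[) G (y, s)) * (W y)%:E))%E.
  apply: eq_integral => y _; rewrite muleA -ge0_muleDl; [by [] | exact: (mule_ge0 e0 (r0 y)) | exact: i0].
rewrite ge0_integralD//; last 4 first.
- by move=> y _; exact: (mule_ge0 e0 (mule_ge0 (r0 y) (W0 y))).
- by apply: emeasurable_funM => //; exact: emeasurable_funM.
- by move=> y _; exact: (mule_ge0 (i0 y) (W0 y)).
- exact: emeasurable_funM.
rewrite ge0_integralZl//; last 2 first.
- exact: emeasurable_funM.
- by move=> y _; exact: (mule_ge0 (r0 y) (W0 y)).
rewrite rel_density_fourier// -EFinM [RHS]EFinD; congr (_ + _)%E.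
pose G2 (ys : V * R) := (G ys * (W ys.1)%:E)%E.
have mG2 : measurable_fun ([set: V] `*` `]0%R, t[%classic) G2.
  apply: emeasurable_funM => //; apply: measurable_funTS.
  by apply: (measurableT_comp (f := fun y => (W y)%:E) (g := fst)) => //; exact: measurable_fst.
have G20 y s : [set: V] y -> `]0%R, t[%classic s -> (0 <= G2 (y, s))%E.
  by move=> h1 h2; rewrite mule_ge0 ?lee_fin ?W_ge0// G_ge0.
transitivity (\int[L]_y \int[leb]_(s in `]0%R, t[) G2 (y, s))%E.
  apply: eq_integral => y _; rewrite -ge0_integralZr ?lee_fin ?W_ge0//.
  - apply: (measurable_comp (F := [set: V] `*` `]0%R, t[%classic) (f := G) (g := fun s : R => (y, s))) => //.
    + exact: measurableX.
    + by move=> _ [s Ds <-].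
    + by apply: measurable_funTS; exact: measurable_fun_pair.
  - by move=> s Ds; exact: G_ge0.
rewrite (tonelli_on L leb measurableT mI mG2 G20).
transitivity (\int[leb]_(s in `]0%R, t[)
   (lam * expR (- (lam * s)) + cos c * (lam * expR (- ((lam + psi xi) * s))))%:E)%E.
  apply: eq_integral => s; rewrite inE => /sub_pos s0.
  (* After a reset the process restarts from the origin, hence the centre 0. *)
  have := rel_density_fourier 0 s0; rewrite /dotp big1 ?add0r; last by move=> i _; rewrite mxE mulr0.
  move=> h; transitivity ((lam * expR (- (lam * s)))%:E * \int[L]_y (rel s ((y : 'rV[R]_d) - 0) * (W y)%:E))%E.
    rewrite -ge0_integralZl//.
    - apply: eq_integral => y _; have -> : (y : 'rV[R]_d) - 0 = y by exact: subr0.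
      exact/esym/muleA.
    - by apply: emeasurable_funM => //; exact: measurable_rel_density.
    - by move=> y _; rewrite mule_ge0 ?rel_density_ge0// lee_fin W_ge0.
    - by rewrite lee_fin mulr_ge0 ?expR_ge0 ?(ltW lam_gt0).
  rewrite h -EFinM; congr EFin.
  rewrite (_ : - ((lam + psi xi) * s) = - (lam * s) + - (s * psi xi)) ?expRD; last by ring.
  by ring.
have lp : 0 < lam + psi xi by rewrite ltr_wpDr.
rewrite (@integral_dominated_combination _ _ _ leb _ _ _ _ (1 - expR (- (lam * t)))
   (lam / (lam + psi xi) * (1 - expR (- ((lam + psi xi) * t)))) (cos c)).
- by congr EFin; ring.
- exact: mI.
- by mfun.
- by mfun.
- move=> s /sub_pos s0; rewrite mulr_ge0 ?expR_ge0 ?(ltW lam_gt0)//=.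
  by rewrite ler_wpM2l ?(ltW lam_gt0)// ler_expR lerN2 ler_wpM2r ?(ltW s0)// lerDl.
- rewrite ge0_integralZl_fun ?(ltW lam_gt0)//; last by mfun.
  rewrite integral_expRN_itv// -EFinM; congr EFin; field; exact: lt0r_neq0.
- rewrite ge0_integralZl_fun ?(ltW lam_gt0)//; last by mfun.
  rewrite integral_expRN_itv// -EFinM; congr EFin; field; exact: lt0r_neq0.
- exact: cos_geN1.
Qed.

End density_fourier.

(** * Existence of the density *)

Section existence.
Context (R : realType) (d : nat) (alpha m : R) (eta : R -> R -> R).
Hypotheses (alpha_gt0 : 0 < alpha).
Hypotheses (m_gt0 : 0 < m) (etaP : stable_subordinator_density alpha eta).
Local Notation V := (borel_rV R d).

Let integral_one_wave (mu : {measure set V -> \bar R}) (xi : 'rV[R]_d) c : mu setT = 1%E ->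
  (\int[mu]_y (1 + cos_wave xi c y)%:E = 1%:E + \int[mu]_y (cos_wave xi c y)%:E)%E.
Proof.
move=> mu1; have mufin : (mu setT < +oo)%E by rewrite mu1 ltry.
have b1 : bounded_measurable (fun _ : V => 1 : R) by exact: bounded_measurable_cst.
have i1 := bounded_measurable_integrable mufin b1.
have bw : bounded_measurable (cos_wave xi c).
  split; first exact: measurable_cos_wave.
  by exists 1 => y; rewrite /cos_wave ler_norml cos_geN1 cos_le1.
have i2 := bounded_measurable_integrable mufin bw.
have := integralD_EFin measurableT i1 i2.
rewrite /= => ->; congr (_ + _)%E.
by rewrite integral_cst//= mu1 mule1.
Qed.

Lemma resetting_has_density lam (x : 'rV[R]_d) disp (Omega : measurableType disp)
    (P : probability Omega R) (Y X : R -> Omega -> V) (N : R -> Omega -> nat) t :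
  0 < lam -> rel_stable_process P alpha m x Y -> poisson_process P lam N ->
  indep_processes P Y N -> resetting_process Y N X -> 0 < t ->
  has_density P (X t) (reset_density alpha m eta lam t x).
Proof.
move=> lam0 [levyY psiY] pN iYN rX t0.
have psi0 (xi : 'rV[R]_d) := rel_exponent_ge0 alpha_gt0 m_gt0 xi.
have mX := measurable_resetting t0 levyY pN rX.
have mf : measurable_fun [set: V] (reset_density alpha m eta lam t x : V -> \bar R) by exact: measurable_reset_density.
have f0 (y : V) : (0 <= reset_density alpha m eta lam t x y)%E by exact: reset_density_ge0.
have [L LE] := @lebesgue_rV_ex R d.
split => //= A mA.
pose mu := image_measure P mX; pose nu := density_measure L mf f0.
have cancel1 (p q : \bar R) : (1%:E + p = 1%:E + q)%E -> p = q.
  by case: p q => [p| |] [q| |] //= -[/addrI ->].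
have eqW xi c : (\int[mu]_y (1 + cos_wave xi c y)%:E = \int[nu]_y (1 + cos_wave xi c y)%:E)%E.
  have mW : measurable_fun setT (fun y : V => (1 + cos_wave xi c y)%:E).
    by apply/measurable_EFinP; apply: measurable_funD => //; exact: measurable_cos_wave.
  have W0 (y : V) : (0 <= (1 + cos_wave xi c y)%:E)%E.
    by rewrite lee_fin /cos_wave -lerBlDl sub0r cos_geN1.
  rewrite /mu ge0_integral_image// preimage_setT.
  rewrite (resetting_mean lam0 t0 psi0 levyY psiY pN iYN rX).
  rewrite integral_density_measure//.
  transitivity (\int[L]_y (reset_density alpha m eta lam t x y * (1 + cos_wave xi c y)%:E))%E.
    by apply: esym; apply: reset_density_fourier.
  by apply: eq_integral => y _; rewrite muleC.
have mu1 : mu setT = 1%E.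
  by rewrite /mu /image_measure /= /pushforward preimage_setT probability_setT.
(* The wave with zero frequency and zero phase makes the test function the constant 2, so equality
   of its integrals gives the total mass; only then can the added constant 1 be cancelled. *)
have nu1 : nu setT = 1%E.
  have c2 y : 1 + cos_wave (0 : 'rV[R]_d) 0 y = 2.
    rewrite /cos_wave /dotp big1; last by move=> i _; rewrite mxE mul0r.
    by rewrite addr0 cos0.
  have := eqW 0 0; under eq_integral do rewrite c2.
  under [in X in _ = X -> _]eq_integral do rewrite c2.
  rewrite !integral_cst//= mu1 mule1 => h.
  have half (q : \bar R) : (2%:E = 2%:E * q)%E -> (0 <= q)%E -> q = 1%E.
    case: q => [r| |] //; first by move=> -[e] _; congr EFin; move: e; lra.
    by rewrite gt0_muley ?lte_fin.
  exact: (half _ h (measure_ge0 nu setT)).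
have mufin : (mu setT < +oo)%E by rewrite mu1 ltry.
have nufin : (nu setT < +oo)%E by rewrite nu1 ltry.
have -> : P (X t @^-1` A) = mu A by [].
have -> : mu A = nu A.
  apply: (cos_wave_eq_measure mufin nufin) => // xi c.
  have := eqW xi c; rewrite (integral_one_wave xi c mu1) (integral_one_wave xi c nu1).
  by apply: cancel1.
rewrite LE.
- rewrite /nu /density_measure integral_mkcond; apply: eq_integral => y _.
  by rewrite epatch_indic.
- by apply: emeasurable_funM => //; apply/measurable_EFinP; exact: measurable_indic.
- by move=> y; rewrite mule_ge0.
Qed.

End existence.

Theorem theorem1p4 (R : realType) (d : nat) (alpha m : R) (eta : R -> R -> R)
    (d_ge1 : (1 <= d)%N) (alpha_gt0 : 0 < alpha) (alpha_lt2 : alpha < 2)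
    (m_gt0 : 0 < m) (eta_density : stable_subordinator_density alpha eta) :
  (forall (lambda : R) (x : 'rV[R]_d) (disp : measure_display)
      (Omega : measurableType disp) (P : probability Omega R)
      (Y X : R -> Omega -> borel_rV R d) (N : R -> Omega -> nat),
    0 < lambda ->
    rel_stable_process P alpha m x Y ->
    poisson_process P lambda N ->
    indep_processes P Y N ->
    resetting_process Y N X ->
    forall t : R, 0 < t ->
      has_density P (X t) (reset_density alpha m eta lambda t x))
  /\
  (forall (lambda : R) (x : 'rV[R]_d), 0 < lambda ->
    let z (t : R) (y : 'rV[R]_d) :=
      t / enorm y `^ (alpha / 2) * Num.sqrt (2 `^ alpha * m) in
    [/\ m < lambda ->
        asymp_equiv_on [set: R * 'rV[R]_d]
          (fun t y => reset_density alpha m eta lambda t x y)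
          (fun t y =>
            lambda * alpha * m `^ ((d%:R + alpha - 1) / (2 * alpha))
            / (2 `^ ((d%:R - alpha + 1) / 2) * pi `^ ((d%:R - 1) / 2)
               * Gamma (1 - alpha / 2) * (lambda - m) ^+ 2)
            * (expR (- (m `^ alpha^-1 * enorm y))
               / enorm y `^ ((d%:R + alpha + 1) / 2))),
        lambda = m ->
        asymp_equiv_on [set: R * 'rV[R]_d]
          (fun t y => reset_density alpha m eta lambda t x y)
          (fun t y =>
            m `^ ((d%:R + alpha - 1) / (2 * alpha))
            * expR (- (m `^ alpha^-1 * enorm y))
            / (2 `^ ((d%:R + alpha - 1) / 2) * pi `^ ((d%:R - 1) / 2)
               * enorm y `^ ((d%:R - alpha + 1) / 2))
            * \int[lebesgue_measure]_(s in `]0, z t y[) eta s 1) &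
        lambda < m ->
        forall M : R, 0 < M ->
        asymp_equiv_on
          [set ty : R * 'rV[R]_d | ty.1 / enorm ty.2 `^ (alpha / 2) < M]
          (fun t y => reset_density alpha m eta lambda t x y)
          (fun t y =>
            (lambda
             + expR (m `^ alpha^-1 * dotp ((enorm y)^-1 *: y) x)
               * (eta (z t (y - x)) 1 * (m - lambda) / eta (z t y) 1))
            * (m `^ ((d%:R - alpha - 1) / (2 * alpha))
               * expR (- (m `^ alpha^-1 * enorm y))
               / (2 `^ ((d%:R + alpha - 1) / 2) * pi `^ ((d%:R - 1) / 2)
                  * enorm y `^ ((d%:R - alpha + 1) / 2)))
            * \int[lebesgue_measure]_(s in `]0, z t y[)
                (expR ((m - lambda)
                       * (enorm y `^ (alpha / 2) / Num.sqrt (2 `^ alpha * m))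
                       * s) * eta s 1))]).
Proof.
split.
  move=> lam x disp Omega P Y X N lam_gt0 stableY poissonN indepYN resetX t t_gt0.
  exact: (resetting_has_density alpha_gt0 m_gt0 eta_density lam_gt0 stableY poissonN indepYN resetX t_gt0).
move=> lam x lam_gt0 z; split.
- exact: asymp_subcritical.
- exact: asymp_critical.
- by move=> lt_lam_m M M_gt0; apply: asymp_supercritical.
Qed.
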